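(* Let $a\in\mathbb{R}$, let $n\geq 1$ be an integer, $1<q<\infty$, $1\leq r<\infty$, $\beta>0$, and let $\gamma$ satisfy $$0<\gamma<\min\bigl(2,\,n,\,n-(n-2)(\beta+1)\bigr).$$ Let $\kappa\geq q(\beta+1)$ be such that $$\frac1\kappa>\max\Bigl(\frac{n-\gamma}{n(\beta+1)}+\frac1q-1,\ \frac{n-\gamma}{n(\beta+1)}+\frac1q+\frac{\gamma-2}{n\beta},\ \frac1q-\frac{2}{n(\beta+1)}\Bigr)$$ and $$\frac1\kappa<\min\Bigl(\frac{n-\gamma}{n(\beta+1)}+\frac1q,\ \frac1\beta-\frac{n-\gamma}{n\beta(\beta+1)}\Bigr).$$ Then the integral equation $$u(t)=e^{t\Delta}u_0+a\int_0^t e^{(t-\tau)\Delta}\bigl(|\cdot|^{-\gamma}|u(\tau)|^{\beta}u(\tau)\bigr)\,d\tau \qquad (\ast)$$ is locally well posed in $\dot K_q^{\frac{n-\gamma}{\beta+1}-\frac n\kappa,1}$ in the following sense: for every $u_0\in\dot K_q^{\frac{n-\gamma}{\beta+1}-\frac n\kappa,1}$ there exist $T>0$ and a solution $u\in C\bigl([0,T],\dot K_q^{\frac{n-\gamma}{\beta+1}-\frac n\kappa,1}\bigr)$ of $(\ast)$, which is unique in the class of continuous functions $u$ satisfying $$t^{\frac{n}{2q}-\frac{n}{2\kappa}}\|u(t)\|_{\dot K_\kappa^{\frac{n-\gamma}{\beta+1}-\frac n\kappa,1}}\in L^\infty(0,T].$$ Moreover, the solution $u$ can be extended to a maximal interval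 $[0,T_{\max})$ such that either $T_{\max}=\infty$, or $T_{\max}<\infty$ and $$\lim_{t\to T_{\max}}\|u(t)\|_{\dot K_q^{\frac{n-\gamma}{\beta+1}-\frac n\kappa,1}}=\infty.$$ Furthermore, the minimal existence time $T$ depends only on $\|u_0\|_{\dot K_q^{\frac{n-\gamma}{\beta+1}-\frac n\kappa,1}}$.
   Context: For $k\in\mathbb{Z}$ let $B_k=B(0,2^k)\subset\mathbb{R}^n$, $R_k=B_k\setminus B_{k-1}$, and let $\chi_k$ be the characteristic function of $R_k$. For $\alpha\in\mathbb{R}$ and $1\leq p,q\leq\infty$, the homogeneous Herz space $\dot K_p^{\alpha,q}$ is the set of all $f\in L^p_{\mathrm{loc}}(\mathbb{R}^n\setminus\{0\})$ with $$\|f\|_{\dot K_p^{\alpha,q}}=\Bigl(\sum_{k=-\infty}^{\infty}2^{k\alpha q}\|f\chi_k\|_{L^p(\mathbb{R}^n)}^q\Bigr)^{1/q}<\infty,$$ with the usual modifications when $p=\infty$ and/or $q=\infty$. Here $e^{t\Delta}$ denotes the heat semigroup on $\mathbb{R}^n$ (convolution with the Gaussian heat kernel). Equation $(\ast)$ is the mild formulation of the Hardy--Hénon equation $\partial_t u=\Delta u+a|x|^{-\gamma}|u|^{\beta}u$, $u(0)=u_0$; a solution is a function $u$ satisfying $(\ast)$ on the relevant time interval. *)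

(* Defs.v *)
(* MathComp-Analysis, over an arbitrary realType R; R^n is 'rV[R]_n. *)
From HB Require Import structures.
From mathcomp Require Import all_boot all_order all_algebra.
From mathcomp Require Import all_classical all_reals all_analysis.
From mathcomp Require Import measurable_realfun.

Set Implicit Arguments.
Unset Strict Implicit.
Unset Printing Implicit Defensive.
Import Order.TTheory GRing.Theory Num.Theory.
Import numFieldNormedType.Exports.

Local Open Scope classical_set_scope.
Local Open Scope ring_scope.

Definition rV_display : measure_display.
Proof. exact: default_measure_display. Qed.

Section measurable_rV.
Context {R : realType} {n : nat}.

(* The sigma-algebra generated by the coordinates, as the library does for
   n.-tuple T; on R^n it is the Borel sigma-algebra. *)
Let coord (i : 'I_n) (x : 'rV[R]_n) : measurableTypeR R := x ord0 i.

Let rV_set0 : g_sigma_preimage coord set0.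
Proof. exact: sigma_algebra0. Qed.

Let rV_setC A : g_sigma_preimage coord A -> g_sigma_preimage coord (~` A).
Proof. exact: sigma_algebraC. Qed.

Let rV_bigcup (F : (set 'rV[R]_n)^nat) :
  (forall i, g_sigma_preimage coord (F i)) ->
  g_sigma_preimage coord (\bigcup_i (F i)).
Proof. exact: sigma_algebra_bigcup. Qed.

HB.instance Definition _ := @isMeasurable.Build rV_display
  'rV[R]_n (g_sigma_preimage coord) rV_set0 rV_setC rV_bigcup.

Lemma measurable_coord (i : 'I_n) :
  measurable_fun [set: 'rV[R]_n] (fun x => x ord0 i : measurableTypeR R).
Proof.
move=> _ Y mY; rewrite setTI; apply: sub_sigma_algebra => /=.
rewrite -bigcup_seq/=; exists i => /=; first by rewrite mem_index_enum.
by exists Y => //; rewrite setTI.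
Qed.

Lemma measurable_fun_rV d (T : measurableType d) (f : T -> 'rV[R]_n) :
  (forall i, measurable_fun setT (fun t => f t ord0 i : measurableTypeR R)) ->
  measurable_fun setT f.
Proof.
move=> mf _ A mA; rewrite setTI.
suff : g_sigma_preimage coord `<=` [set B | measurable (f @^-1` B)] by apply.
apply: smallest_sub.
  split => [|B mB|F mF] /=; first by rewrite preimage_set0.
  - by rewrite setTD preimage_setC; exact: measurableC.
  - by rewrite preimage_bigcup; exact: bigcupT_measurable.
move=> B; rewrite -bigcup_seq/= => -[i _ [Y mY <-]] /=.
by rewrite setTI; have := mf i measurableT _ mY; rewrite setTI.
Qed.

End measurable_rV.

Section lebesgue_rV.
Context {R : realType}.

Definition rV_cons n (p : measurableTypeR R * 'rV[R]_n) : 'rV[R]_n.+1 :=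
  row_mx (\row_(_ < 1) p.1) p.2.

Definition rV_uncons n (x : 'rV[R]_n.+1) : measurableTypeR R * 'rV[R]_n :=
  (x ord0 ord0, rsubmx (x : 'rV[R]_(1 + n))).

Lemma rV_cons0 n t (x : 'rV[R]_n) : rV_cons (t, x) ord0 ord0 = t.
Proof.
rewrite (_ : ord0 = @lshift 1 n ord0); last exact: val_inj.
by rewrite (@row_mxEl _ 1 1 n) mxE.
Qed.

Lemma rV_consS n t (x : 'rV[R]_n) i :
  rV_cons (t, x) ord0 (lift ord0 i) = x ord0 i.
Proof.
rewrite (_ : lift ord0 i = rshift 1 i); last exact: val_inj.
by rewrite (@row_mxEr _ 1 1 n).
Qed.

Lemma rV_consK n : cancel (@rV_cons n) (@rV_uncons n).
Proof.
by move=> [t x]; rewrite /rV_uncons rV_cons0 /rV_cons row_mxKr.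
Qed.

Lemma rV_unconsK n : cancel (@rV_uncons n) (@rV_cons n).
Proof.
move=> x; rewrite /rV_uncons /rV_cons /= -[RHS](@hsubmxK _ _ 1 n x).
rewrite (_ : \row__ _ = @lsubmx _ 1 1 n x)//; apply/rowP => i; rewrite !mxE; congr (x _ _).
by apply: val_inj; rewrite /= ord1.
Qed.

Lemma measurable_rV_cons n : measurable_fun setT (@rV_cons n).
Proof.
apply: measurable_fun_rV => i.
case: (unliftP ord0 i) => [j|] ->.
  rewrite [X in measurable_fun _ X](_ : _ =
      (fun x : 'rV[R]_n => x ord0 j : measurableTypeR R) \o snd); last first.
    by apply/funext => -[t x]; rewrite rV_consS.
  by apply: measurableT_comp => //; exact: measurable_coord.
rewrite [X in measurable_fun _ X](_ : _ = fst) //.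
by apply/funext => -[t x]; rewrite rV_cons0.
Qed.

Lemma measurable_rV_uncons n : measurable_fun setT (@rV_uncons n).
Proof.
apply: measurable_fun_pair => /=; first exact: measurable_coord.
apply: measurable_fun_rV => i.
rewrite [X in measurable_fun _ X](_ : _ =
    (fun x : 'rV[R]_n.+1 => x ord0 (rshift 1 i) : measurableTypeR R)).
  exact: measurable_coord.
by apply/funext => x; rewrite mxE.
Qed.

Section cons.
Variables (n : nat) (m : {sigma_finite_measure set 'rV[R]_n -> \bar R}).

Let mu : {measure set (measurableTypeR R * 'rV[R]_n)%type -> \bar R} :=
  (lebesgue_measure \x m)%E.

Definition cons_measure : set 'rV[R]_n.+1 -> \bar R :=
  pushforward mu (@rV_cons n).

Let mcons A : measurable A -> measurable (@rV_cons n @^-1` A).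
Proof.
by move=> mA; rewrite -[X in measurable X]setTI; exact: measurable_rV_cons.
Qed.

Let cons_measure0 : cons_measure set0 = 0%E.
Proof. by rewrite /cons_measure /pushforward preimage_set0 (measure0 mu). Qed.

Let cons_measure_ge0 A : (0 <= cons_measure A)%E.
Proof. exact: (measure_ge0 mu). Qed.

Let cons_measure_sigma_additive : semi_sigma_additive cons_measure.
Proof.
move=> F mF tF mUF; rewrite /cons_measure /pushforward preimage_bigcup.
apply: (@measure_semi_sigma_additive _ _ _ mu) => [k||]; first exact: mcons.
- apply/trivIsetP => /= i j _ _ ij; rewrite -preimage_setI.
  by move/trivIsetP : tF => /(_ _ _ _ _ ij) ->//; rewrite preimage_set0.
- by rewrite -preimage_bigcup; exact: mcons.
Qed.

HB.instance Definition _ := isMeasure.Build _ _ _ cons_measure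
  cons_measure0 cons_measure_ge0 cons_measure_sigma_additive.

Let cons_measure_sigma_finite : sigma_finite setT cons_measure.
Proof.
have /sigma_finiteP[F [TF ndF Foo]] := sigma_finiteT (@lebesgue_measure R).
have /sigma_finiteP[G [TG ndG Goo]] := sigma_finiteT m.
exists (fun k => @rV_uncons n @^-1` (F k `*` G k)) => [|k].
  rewrite -preimage_bigcup (_ : \bigcup_i _ = setT) ?preimage_setT//.
  rewrite -setXTT TF TG predeqE => -[x y]; split.
    by move=> [k _ []/= ? ?]; split; exists k.
  move=> [/= [k _ Fkx] [l _ Gly]]; exists (maxn k l) => //; split.
  - by move: x Fkx; exact/subsetPset/ndF/leq_maxl.
  - by move: y Gly; exact/subsetPset/ndG/leq_maxr.
have [mF Fk] := Foo k; have [mG Gk] := Goo k; split.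
  rewrite -[X in measurable X]setTI; apply: measurable_rV_uncons => //.
  exact: measurableX.
rewrite /cons_measure /pushforward -comp_preimage (_ : _ \o _ = id); last first.
  by apply/funext => p /=; rewrite rV_consK.
by rewrite preimage_id /= product_measure1E// lte_mul_pinfty// ge0_fin_numE.
Qed.

HB.instance Definition _ := @Measure_isSigmaFinite.Build _ _ _ cons_measure
  cons_measure_sigma_finite.

End cons.

Fixpoint lebesgue_rV n : {sigma_finite_measure set 'rV[R]_n -> \bar R} :=
  match n with
  | 0 => \d_ (0 : 'rV[R]_0)
  | n'.+1 => cons_measure (lebesgue_rV n')
  end.

Lemma lebesgue_rV_box n (A : 'I_n -> set (measurableTypeR R)) :
  (forall i, measurable (A i)) ->
  lebesgue_rV n [set x | forall i, A i (x ord0 i)] =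
    (\prod_(i < n) lebesgue_measure (A i))%E.
Proof.
elim: n A => [|n IHn] A mA.
  by rewrite big_ord0 /= diracE mem_set//= => -[].
rewrite big_ord_recl -(IHn (fun i => A (lift ord0 i)))// -product_measure1E//.
  congr ((_ \x _)%E _); apply/seteqP; split => -[t x] /= h.
    split => [|i]; first by have := h ord0; rewrite rV_cons0.
    by have := h (lift ord0 i); rewrite rV_consS.
  case: h => At Ax i; case: (unliftP ord0 i) => [j|] ->.
    by rewrite rV_consS; exact: Ax.
  by rewrite rV_cons0.
rewrite [X in measurable X](_ : _ = \bigcap_(i in [set: 'I_n])
    ((fun x : 'rV[R]_n => x ord0 i : measurableTypeR R) @^-1` A (lift ord0 i))).
  apply: fin_bigcap_measurable => // i _.
  by rewrite -[X in measurable X]setTI; exact: measurable_coord.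
by apply/seteqP; split => x /= h i; [move=> _|]; exact: h.
Qed.

End lebesgue_rV.

Section herz.
Context {R : realType} {n : nat}.
Implicit Types (f v : 'rV[R]_n -> R) (x y : 'rV[R]_n) (alpha t : R)
  (p q : \bar R) (k : int).

Local Notation mu := (@lebesgue_rV R n).

(* The norm `|x| of the library on 'rV[R]_n is the sup norm. *)
Definition enorm x : R := Num.sqrt (\sum_(i < n) x ord0 i ^+ 2).

Definition eball (d : R) : set 'rV[R]_n := [set x | enorm x < d].

Definition annulus k : set 'rV[R]_n := eball (2 ^ k) `\` eball (2 ^ (k - 1)).

(* Elements of function spaces are Borel representatives; equality of such
   elements is stated almost everywhere. *)
Definition Lloc_punctured p : set ('rV[R]_n -> R) :=
  [set f : 'rV[R]_n -> R | measurable_fun setT f /\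
    forall K : set 'rV[R]_n, compact K -> ~ K 0 ->
      (Lnorm mu p (EFin \o (f \* \1_K)%R) < +oo)%E].

Definition herz_norm alpha p q f : \bar R :=
  let N k := Lnorm mu p (EFin \o (f \* \1_(annulus k))%R) in
  match q with
  | q%:E => (\esum_(k in [set: int])
      ((2 `^ (k%:~R * alpha * q))%:E * N k `^ q)) `^ q^-1
  | +oo%E => ereal_sup [set (2 `^ (k%:~R * alpha))%:E * N k | k in [set: int]]
  | -oo%E => 0 (* irrelevant: only 1 <= q <= +oo is meaningful *)
  end%E.

Definition herz_space alpha p q : set ('rV[R]_n -> R) :=
  [set f : 'rV[R]_n -> R | Lloc_punctured p f /\ (herz_norm alpha p q f < +oo)%E].

(* u belongs to C(I, K) with K the Herz space of parameters alpha, p, q *)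
Definition herz_continuous alpha p q (I : set R) (u : R -> 'rV[R]_n -> R) :=
  (forall t, I t -> herz_space alpha p q (u t)) /\
  (forall t, I t ->
    herz_norm alpha p q (u s \- u t) @[s --> within I (nbhs t)] --> 0%E).

(* t ^ sigma * ||u(t)|| is in L^oo(0, T] *)
Definition herz_weighted_bounded (sigma alpha : R) p q (T : R)
    (u : R -> 'rV[R]_n -> R) :=
  let w t := ((t `^ sigma)%:E * herz_norm alpha p q (u t))%E in
  measurable_fun (`]0, T] : set R) w /\
  exists M : R, {ae lebesgue_measure, forall t : R,
    0 < t <= T -> (w t <= M%:E)%E}.

Definition heat_kernel t x : R :=
  (4 * pi * t) `^ (- (n%:R / 2)) * expR (- (enorm x ^+ 2) / (4 * t)).

Definition heat t f x : R :=
  if t == 0 then f x else \int[mu]_y (heat_kernel t (x - y) * f y).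

(* Rintegral is 0 on functions that are not integrable, so the convergence of
   the integral defining heat is recorded separately. *)
Definition heat_defined t f x : Prop :=
  t != 0 -> mu.-integrable setT (fun y => (heat_kernel t (x - y) * f y)%:E).

Definition henon_term (gamma beta : R) v x : R :=
  enorm x `^ (- gamma) * `|v x| `^ beta * v x.

Definition mild_eq (a gamma beta : R) u0 (u : R -> 'rV[R]_n -> R) t : Prop :=
  let g tau x := heat (t - tau) (henon_term gamma beta (u tau)) x in
  {ae mu, forall x,
    [/\ heat_defined t u0 x,
        {ae lebesgue_measure, forall tau : R, 0 < tau < t ->
          heat_defined (t - tau) (henon_term gamma beta (u tau)) x},
        lebesgue_measure.-integrable (`]0, t[ : set R)
          (fun tau => (g tau x)%:E) &
        u t x = heat t u0 x +
          a * \int[lebesgue_measure]_(tau in (`]0, t[ : set R)) g tau x]}.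

(* Solutions on [0, T] in the class where uniqueness is claimed. *)
Definition mild_solution (a gamma beta q kappa : R) u0 (T : R)
    (u : R -> 'rV[R]_n -> R) : Prop :=
  let s := (n%:R - gamma) / (beta + 1) - n%:R / kappa in
  [/\ herz_continuous s q%:E 1%E `[0, T] u,
      herz_weighted_bounded (n%:R / (2 * q) - n%:R / (2 * kappa))
        s kappa%:E 1%E T u &
      forall t, 0 <= t <= T -> mild_eq a gamma beta u0 u t].

End herz.

(* Main.v *)
(* Let X and Y be the Herz spaces with weight s = (n-gamma)/(beta+1) - n/kappa,
   summation exponent 1 and integrability q and kappa. Cutting functions along
   the dyadic annuli shows that the heat flow maps the space with parameters
   (al, p) into the one with (s, r) with norm O(t^(-th)), where
   th = (n/p - n/r + al - s)/2, as soon as 1 <= p <= r and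
   -n/r < s <= al <= n(1-1/p): between distant annuli the Gaussian beats every
   power of the radii, and between adjacent ones the L^p-L^r smoothing or the
   sup bound of the kernel suffices. The endpoint al = n(1-1/p) is allowed, and
   it is where the nonlinearity lands: by Hoelder, |x|^(-gamma)|f|^beta f is
   locally Lipschitz from Y to the space with p = kappa/(beta+1) and
   al = s(beta+1) + gamma = n(1-1/p).

   The Duhamel term is therefore singular of order t^(-delta) in Y and
   t^(-(delta-sigma)) in X, with sigma = n/(2q) - n/(2kappa) and
   delta = (n beta + gamma)/(2(beta+1)); the bounds on kappa say that 0 < sigma < delta < 1, sigma(beta+1) < 1 and
   delta + sigma beta < 1. Hence Picard iteration converges for the norm
   sup t^sigma |u(t)|_Y on an interval that depends only on |u_0|_X; an
   exponential weight in time gives uniqueness on any interval. Continuity in X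
   reduces to the strong continuity of the heat flow, checked on indicator
   functions and extended by dominated convergence. Since the existence time
   depends only on the norm, a solution whose X-norm is bounded along times
   tending to T can be continued past T, whence the blow-up alternative. *)
From HB Require Import structures.
Require Import Defs.
From mathcomp Require Import all_boot all_order all_algebra.
From mathcomp Require Import all_classical all_reals all_analysis.
From mathcomp Require Import measurable_realfun ring lra zify.

Set Implicit Arguments.
Unset Strict Implicit.
Unset Printing Implicit Defensive.
Import Order.TTheory GRing.Theory Num.Theory.
Import numFieldNormedType.Exports.

Local Open Scope classical_set_scope.
Local Open Scope ring_scope.

(** * Minkowski's integral inequality *)

(** Between annuli the heat flow acts as a matrix indexed by [(k, j)]. At the endpoint weight its
    entries have no decay in [j], but on [l^1] it is enough to bound the column sums over [k]
    uniformly in [j]: this is where summation exponent 1 enters. The nonlinearity lands in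
    integrability [kappa / (beta + 1)], and [kappa >= q (beta + 1)] makes this at least [q], so that
    a second Hoelder inequality on each annulus brings it into the range needed for X. Estimates are
    proved for functions with values in [[0, +oo]], where heat flow and Duhamel integral always make
    sense and Tonelli applies; real functions enter through their absolute values. The obstacle is
    time. A mild solution is a family of Borel slices, continuous in norm, with a weighted bound at
    almost every time only. The analysis uses jointly measurable curves bounded at every time; a
    mild solution is brought to this form by a measurable version and by inserting its bound into
    the Duhamel formula. Conversely continuity is derived: restarting slightly before a given time
    reduces it to strong continuity of the heat flow at a single state. *)

Lemma powRD_gt0 (R : realType) (x r s : R) : 0 < x ->
  x `^ (r + s) = x `^ r * x `^ s.
Proof. by move=> x0; rewrite powRD// (gt_eqF x0) implybT. Qed.

Lemma powRB1_mul (R : realType) (x r : R) : 0 < x -> x `^ (r - 1) * x = x `^ r.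
Proof.
by move=> x0; rewrite -{2}(powRr1 (ltW x0)) -powRD_gt0// subrK.
Qed.

Section power_means.
Context d (T : measurableType d) (R : realType).
Variable mu : {measure set T -> \bar R}.
Local Open Scope ereal_scope.

Lemma le_poweR (r : R) (x y : \bar R) : (0 <= r)%R -> 0 <= x -> x <= y ->
  x `^ r <= y `^ r.
Proof.
move=> r0 x0 xy; apply: gt0_ler_poweR => //; rewrite in_itv/= ?leey ?andbT//.
exact: le_trans xy.
Qed.

(** Young's inequality for the product of [h w^(1/p - 1)] and [l^(p - 1) w^(1 - 1/p)]. The free
    scale [l] is optimised after integration. *)
Lemma young_weight (p l w : R) (h : \bar R) : (1 < p)%R -> (0 < l)%R ->
  (0 < w)%R -> 0 <= h ->
  (l `^ (p - 1))%:E * h <=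
    p^-1%:E * (h `^ p * (w `^ (1 - p))%:E) + (l `^ p * (1 - p^-1) * w)%:E.
Proof.
move=> p1 l0 w0; have p0 : (0 < p)%R by exact: lt_trans p1.
have pV1 : (p^-1 < 1)%R by rewrite invf_lt1.
have q0 : (0 < (1 - p^-1)^-1)%R by rewrite invr_gt0 subr_gt0.
case: h => [h| _|//].
  rewrite lee_fin => h0; rewrite poweR_EFin -!EFinM -EFinD lee_fin.
  have := @conjugate_powR R (h * w `^ (p^-1 - 1))%R (l `^ (p - 1) * w `^ (1 - p^-1))%R
    p (1 - p^-1)^-1%R.
  rewrite invrK subrKC => /(_ _ _ p0 q0 erefl).
  rewrite !mulr_ge0 ?powR_ge0// => /(_ isT isT).
  rewrite mulrACA -powRD_gt0//.
  rewrite subrKA subrr powRr0 mulr1 !powRM ?powR_ge0// -!powRrM.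
  have -> : ((p^-1 - 1) * p = 1 - p)%R by field; rewrite gt_eqF.
  have -> : ((p - 1) * (1 - p^-1)^-1 = p)%R.
    by field; rewrite subr_eq0 !gt_eqF.
  rewrite divff ?(powRr1 (ltW w0)); last by rewrite subr_eq0 gt_eqF// .
  move=> H; rewrite [leLHS]mulrC (le_trans H)// le_eqVlt; apply/orP; left.
  by apply/eqP; ring.
rewrite poweRyr ?gt_eqF// (@gt0_mulye _ (w `^ (1 - p))%:E) ?lte_fin ?powR_gt0//.
by rewrite (@gt0_muley _ p^-1%:E) ?lte_fin ?invr_gt0// addye ?leey// ltNye.
Qed.

(** Weighted Hoelder inequality, obtained by integrating [young_weight]. It is used with three
    weights: a perturbed section norm for Minkowski, the constant 1 on an annulus, and the heat
    kernel, where it is Jensen's inequality. *)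
Lemma power_mean_ineq (D : set T) (w : T -> R) (h : T -> \bar R) (p : R) :
  (1 <= p)%R -> measurable D -> measurable_fun D w -> measurable_fun D h ->
  (forall x, D x -> (0 < w x)%R) -> (forall x, D x -> 0 <= h x) ->
  \int[mu]_(x in D) (w x)%:E < +oo ->
  (\int[mu]_(x in D) h x) `^ p <=
    (\int[mu]_(x in D) (w x)%:E) `^ (p - 1) *
    \int[mu]_(x in D) (h x `^ p * (w x `^ (1 - p))%:E).
Proof.
move=> p1 mD mw mh w0 h0 Aoo.
have h_ge0 : 0 <= \int[mu]_(x in D) h x by exact: integral_ge0.
move: p1; rewrite le_eqVlt => /predU1P[<-|p1].
  rewrite subrr poweRe0 mul1e poweRe1//.
  rewrite (_ : \int[mu]_(x in D) _ = \int[mu]_(x in D) h x)//.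
  by apply: eq_integral => x /[!inE] Dx; rewrite powRr0 mule1 poweRe1// h0.
have p0 : (0 < p)%R by exact: lt_trans p1.
set C := \int[mu]_(x in D) (h x `^ p * _).
have mw1 : measurable_fun D (fun x => (w x `^ (1 - p))%:E).
  apply/measurable_EFinP.
  exact: (measurableT_comp (measurable_powR (1 - p))).
have mhp : measurable_fun D (fun x => h x `^ p).
  exact: (measurableT_comp (measurable_poweR p)).
have C0 : 0 <= C.
  by apply: integral_ge0 => x Dx; rewrite mule_ge0 ?poweR_ge0// lee_fin powR_ge0.
set A := \int[mu]_(x in D) (w x)%:E.
have A0 : 0 <= A by apply: integral_ge0 => x Dx; rewrite lee_fin ltW// w0.
have key l : (0 < l)%R -> (l `^ (p - 1))%:E * \int[mu]_(x in D) h x <=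
    p^-1%:E * C + (l `^ p * (1 - p^-1))%:E * A.
  move=> l0; have k0 : (0 <= l `^ p * (1 - p^-1))%R.
    by rewrite mulr_ge0 ?powR_ge0// subr_ge0 invf_le1 ?(ltW p1).
  have p'0 : (0 <= p^-1)%R by rewrite invr_ge0 ltW.
  rewrite /C /A -ge0_integralZl_EFin//; last exact: powR_ge0.
  rewrite -ge0_integralZl_EFin//; last 2 first.
  - by move=> x Dx; rewrite mule_ge0 ?poweR_ge0// lee_fin powR_ge0.
  - exact: emeasurable_funM.
  rewrite -ge0_integralZl_EFin//; last 2 first.
  - by move=> x Dx; rewrite lee_fin ltW// w0.
  - exact/measurable_EFinP.
  have i1 x : D x -> 0 <= p^-1%:E * (h x `^ p * (w x `^ (1 - p))%:E).
    by move=> Dx; rewrite mule_ge0 ?lee_fin// mule_ge0 ?poweR_ge0// lee_fin powR_ge0.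
  have i2 x : D x -> 0 <= (l `^ p * (1 - p^-1))%:E * (w x)%:E.
    by move=> Dx; rewrite mule_ge0 ?lee_fin// ltW// w0.
  have m1 : measurable_fun D (fun x => p^-1%:E * (h x `^ p * (w x `^ (1 - p))%:E)).
    by apply: emeasurable_funM => //; exact: emeasurable_funM.
  have m2 : measurable_fun D (fun x => (l `^ p * (1 - p^-1))%:E * (w x)%:E).
    by apply: emeasurable_funM => //; exact/measurable_EFinP.
  rewrite -ge0_integralD//.
  apply: ge0_le_integral => //.
  - by move=> x Dx; rewrite mule_ge0 ?h0// lee_fin powR_ge0.
  - exact: emeasurable_funM.
  - exact: emeasurable_funD.
  by move=> x Dx; rewrite -EFinM young_weight// ?w0 ?h0.
(* A positive weight with zero integral forces [D] to be null. *)
have [A_eq0|A_gt0] := eqVneq A 0.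
  suff -> : \int[mu]_(x in D) h x = 0.
    by rewrite poweR0r ?gt_eqF// mule_ge0// poweR_ge0.
  have : ae_eq mu D (EFin \o w) (cst 0).
    apply/ae_eq_integral_abs => //; first exact/measurable_EFinP.
    rewrite -A_eq0; apply: eq_integral => x /[!inE] Dx.
    by rewrite gee0_abs// lee_fin ltW// w0.
  move=> ww; transitivity (\int[mu]_(x in D) (cst 0 x : \bar R)); last exact: integral0.
  apply: ge0_ae_eq_integral => //.
  apply: filterS ww => x /= wx Dx; have := w0 _ Dx.
  by have [->] := wx Dx; rewrite ltxx.
have {}A_gt0 : 0 < A by rewrite lt0e A_gt0.
have [->|Coo] := eqVneq C +oo.
  by rewrite gt0_muley ?leey// poweR_gt0.
have {}Coo : C < +oo by rewrite ltey.
set B := \int[mu]_(x in D) h x in h_ge0 key *.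
have Boo : B < +oo.
  have := key 1%R ltr01; rewrite !powR1 mul1e mul1r => /le_lt_trans; apply.
  rewrite lte_add_pinfty// ?lte_mul_pinfty// ?lee_fin ?invr_ge0 ?ltW//.
  by rewrite subr_gt0 invf_lt1.
have [a aE] : exists a, A = a%:E by exists (fine A); rewrite fineK// ge0_fin_numE.
have [b bE] : exists b, B = b%:E by exists (fine B); rewrite fineK// ge0_fin_numE.
have [c cE] : exists c, C = c%:E by exists (fine C); rewrite fineK// ge0_fin_numE.
move: key A_gt0 h_ge0 C0; rewrite aE bE cE !lte_fin !lee_fin => key a0 b0 c0.
move: b0; rewrite le_eqVlt => /predU1P[<-|b0].
  by rewrite powR0 ?gt_eqF// mulr_ge0// powR_ge0.
(* The optimal scale: for [l = b / a] the left side is [l^p a], and the term with factor [1 - 1/p]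
   is absorbed. *)
have := key (b / a)%R (divr_gt0 b0 a0).
rewrite -!EFinM -EFinD lee_fin.
have ba0 : (0 < b / a)%R by rewrite divr_gt0.
have -> : ((b / a) `^ (p - 1) * b = (b / a) `^ p * a)%R.
  by rewrite -(powRB1_mul p ba0) -mulrA divfK// gt_eqF.
move=> H; have {}H : ((b / a) `^ p * a <= c)%R.
  have : (p^-1 * ((b / a) `^ p * a) <= p^-1 * c)%R.
    by move: H; rewrite -lerBlDr; apply: le_trans; lra.
  by rewrite ler_pM2l// invr_gt0.
rewrite (_ : b `^ p = a `^ (p - 1) * ((b / a) `^ p * a))%R; last first.
  rewrite mulrCA (powRB1_mul p a0) -powRM ?(ltW a0) ?(ltW ba0)//.
  by rewrite divfK// gt_eqF.
by rewrite ler_pM2l// powR_gt0.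
Qed.

End power_means.

Section tonelli_in.
Context d1 d2 (X : measurableType d1) (Y : measurableType d2) (R : realType).
Variables (m1 : {sigma_finite_measure set X -> \bar R})
  (m2 : {sigma_finite_measure set Y -> \bar R}).
Local Open Scope ereal_scope.

Lemma measurable_patch_prod (A : set X) (B : set Y) (f : X * Y -> \bar R) :
  measurable A -> measurable B -> measurable_fun setT f ->
  measurable_fun setT (f \_ (A `*` B)).
Proof.
move=> mA mB mf; apply/(measurable_restrictT _ _).1; first exact: measurableX.
exact: measurable_funTS.
Qed.

Lemma patch_prodE (A : set X) (B : set Y) (f : X * Y -> \bar R) x :
  (fun y => (f \_ (A `*` B)) (x, y)) =
  if x \in A then (fun y => f (x, y)) \_ B else cst 0.
Proof.
apply/funext => y; rewrite /patch in_setX /=.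
by case: (x \in A); case: (y \in B).
Qed.

Lemma patch_prodE' (A : set X) (B : set Y) (f : X * Y -> \bar R) y :
  (fun x => (f \_ (A `*` B)) (x, y)) =
  if y \in B then (fun x => f (x, y)) \_ A else cst 0.
Proof.
apply/funext => x; rewrite /patch in_setX /=.
by case: (y \in B); rewrite ?andbT ?andbF.
Qed.

Lemma tonelli_in (A : set X) (B : set Y) (f : X * Y -> \bar R) :
  measurable A -> measurable B -> measurable_fun setT f ->
  (forall z, 0 <= f z) ->
  \int[m1]_(x in A) \int[m2]_(y in B) f (x, y) =
  \int[m2]_(y in B) \int[m1]_(x in A) f (x, y).
Proof.
move=> mA mB mf f0; rewrite [LHS]integral_mkcond [RHS]integral_mkcond.
have H := @fubini_tonelli _ _ _ _ _ m1 m2 _ (measurable_patch_prod mA mB mf).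
transitivity (\int[m1]_x \int[m2]_y (f \_ (A `*` B)) (x, y)).
  apply: eq_integral => x _; rewrite patch_prodE /patch; case: ifPn => // _.
    by rewrite [LHS]integral_mkcond.
  by rewrite integral0.
rewrite H; last by move=> z; rewrite /patch; case: ifPn.
apply: eq_integral => y _; rewrite patch_prodE' /patch; case: ifPn => // _.
  by rewrite [RHS]integral_mkcond.
by rewrite integral0.
Qed.

Lemma measurable_integral_in2 (B : set Y) (f : X * Y -> \bar R) :
  measurable B -> measurable_fun setT f -> (forall z, 0 <= f z) ->
  measurable_fun setT (fun x => \int[m2]_(y in B) f (x, y)).
Proof.
move=> mB mf f0; have mT := @measurableT _ X.
have := @measurable_fun_fubini_tonelli_F _ _ _ _ _ m2 _
  (measurable_patch_prod mT mB mf).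
rewrite (_ : fubini_F _ _ = (fun x => \int[m2]_(y in B) f (x, y))).
  by apply=> z; rewrite /patch; case: ifPn.
apply/funext => x; rewrite /fubini_F; rewrite patch_prodE in_setT.
by rewrite -integral_mkcond.
Qed.

Lemma measurable_integral_in1 (A : set X) (f : X * Y -> \bar R) :
  measurable A -> measurable_fun setT f -> (forall z, 0 <= f z) ->
  measurable_fun setT (fun y => \int[m1]_(x in A) f (x, y)).
Proof.
move=> mA mf f0; have mT := @measurableT _ Y.
have := @measurable_fun_fubini_tonelli_G _ _ _ _ _ m1 _
  (measurable_patch_prod mA mT mf).
rewrite (_ : fubini_G _ _ = (fun y => \int[m1]_(x in A) f (x, y))).
  by apply=> z; rewrite /patch; case: ifPn.
apply/funext => y; rewrite /fubini_G; rewrite patch_prodE' in_setT.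
by rewrite -integral_mkcond.
Qed.

(* Hoelder with the weight [N + e * w], where N is the L^r norm of the
   sections; [w] only serves to make the weight positive. *)
Lemma minkowski_integral (A : set X) (B : set Y) (f : X * Y -> \bar R)
    (w : X -> R) (r : R) :
  (1 <= r)%R -> measurable A -> measurable B -> measurable_fun setT f ->
  (forall z, 0 <= f z) ->
  measurable_fun A w -> (forall x, A x -> (0 < w x)%R) ->
  \int[m1]_(x in A) (w x)%:E < +oo ->
  (\int[m2]_(y in B) (\int[m1]_(x in A) f (x, y)) `^ r) `^ r^-1 <=
  \int[m1]_(x in A) (\int[m2]_(y in B) f (x, y) `^ r) `^ r^-1.
Proof.
move=> r1 mA mB mf f0 mw w0 woo; have r0 : (0 < r)%R by exact: lt_le_trans r1.
have mfr : measurable_fun setT (fun z => f z `^ r).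
  exact: (measurableT_comp (measurable_poweR r)).
set N := fun x => (\int[m2]_(y in B) f (x, y) `^ r) `^ r^-1.
have mN : measurable_fun setT N.
  apply: (measurableT_comp (measurable_poweR r^-1)).
  apply: (@measurable_integral_in2 B (fun z => f z `^ r)) => // z.
  exact: poweR_ge0.
have [->|Noo] := eqVneq (\int[m1]_(x in A) N x) +oo; first by rewrite leey.
have {}Noo : \int[m1]_(x in A) N x < +oo by rewrite ltey.
have N0 x : 0 <= N x by exact: poweR_ge0.
have iN : m1.-integrable A N.
  apply/integrableP; split; first exact: measurable_funTS.
  by under eq_integral => x _ do rewrite gee0_abs//.
have aN := integrable_ae mA iN.
(* The weight must be finite; since the right side is finite, the sections of infinite norm form a
   null set. *)
set A' := A `&` [set x | N x < +oo].
have mA' : measurable A'.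
  by apply: emeasurable_fun_infty_o => //; exact: measurable_funTS.
have A'A : A' `<=` A by move=> x [].
have mAA' : measurable (A `\` A') by exact: measurableD.
have AA'0 : m1 (A `\` A') = 0.
  case: aN => Z [mZ Z0 sZ]; apply/eqP; rewrite eq_le measure_ge0 andbT -Z0.
  rewrite le_measure ?inE//; move=> x [Ax nA'x]; apply: sZ => /= /(_ Ax).
  by rewrite ge0_fin_numE// => h; apply: nA'x; split.
have restr (g : X -> \bar R) : measurable_fun setT g -> (forall x, 0 <= g x) ->
    \int[m1]_(x in A) g x = \int[m1]_(x in A') g x.
  move=> mg g0; rewrite (@ge0_negligible_integral _ _ _ m1 A (A `\` A') g)//.
    by congr (integral _ _ _); rewrite setDD; apply/seteqP; split=> x [].
  exact: measurable_funTS.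
apply/lee_addgt0Pr => e e0.
set wi := \int[m1]_(x in A) (w x)%:E in woo *.
have wi0 : 0 <= wi by apply: integral_ge0 => x Ax; rewrite lee_fin ltW// w0.
(* Chosen so that [c] times the integral of [w] is at most [e]. *)
set c := (e / (1 + fine wi))%R.
have c0 : (0 < c)%R by rewrite divr_gt0// ltr_pwDl// fine_ge0.
set M := fun x => (fine (N x) + c * w x)%R.
have M0 x : A' x -> (0 < M x)%R.
  by move=> A'x; rewrite ltr_wpDl ?fine_ge0// mulr_gt0// w0//; exact: A'A.
have mM : measurable_fun A' M.
  apply: measurable_funD.
    by apply: measurableT_comp => //; exact: measurable_funTS.
  by apply: measurable_funM => //; exact: measurable_funS mw.
have ME x : A' x -> (M x)%:E = N x + c%:E * (w x)%:E.
  by move=> [Ax Nx]; rewrite EFinD fineK// ge0_fin_numE.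
have HM : \int[m1]_(x in A') (M x)%:E <= \int[m1]_(x in A) N x + e%:E.
  have -> : \int[m1]_(x in A') (M x)%:E =
      \int[m1]_(x in A') N x + c%:E * \int[m1]_(x in A') (w x)%:E.
    rewrite -ge0_integralZl_EFin//; last 3 first.
    - by move=> x /A'A Ax; rewrite lee_fin ltW// w0.
    - by apply/measurable_EFinP; exact: measurable_funS mw.
    - exact: ltW.
    rewrite -ge0_integralD//; last 3 first.
    - exact: measurable_funTS.
    - by move=> x /A'A Ax; rewrite mule_ge0// lee_fin ltW// w0.
    - apply: emeasurable_funM => //.
      by apply/measurable_EFinP; exact: measurable_funS mw.
    by apply: eq_integral => x /[!inE] A'x; rewrite ME.
  rewrite -restr//; apply: leeD => //.
  apply: (@le_trans _ _ (c%:E * wi)).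
    apply: lee_pmul => //; first by rewrite lee_fin ltW.
      by apply: integral_ge0 => x /A'A Ax; rewrite lee_fin ltW// w0.
    apply: ge0_subset_integral => //; first exact/measurable_EFinP.
    by move=> x Ax; rewrite lee_fin ltW// w0.
  rewrite -(@fineK _ wi) ?ge0_fin_numE// -EFinM lee_fin /c mulrAC.
  rewrite ler_pdivrMr ?ltr_pwDl ?fine_ge0// ler_pM2l//.
  by rewrite lerDr.
apply: le_trans HM.
set H := \int[m1]_(x in A') (M x)%:E.
have H0 : 0 <= H by apply: integral_ge0 => x A'x; rewrite lee_fin ltW// M0.
have [->|Hoo] := eqVneq H +oo; first by rewrite leey.
have {}Hoo : H < +oo by rewrite ltey.
suff : \int[m2]_(y in B) (\int[m1]_(x in A) f (x, y)) `^ r <= H `^ r.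
  move=> /(le_poweR (r := r^-1)); rewrite invr_ge0 ltW// => /(_ isT).
  rewrite -(poweRrM H) divff ?gt_eqF// poweRe1//; apply.
  by apply: integral_ge0 => y _; exact: poweR_ge0.
set Mw := fun x => (M x `^ (1 - r))%:E.
have mMw : measurable_fun A' Mw.
  apply/measurable_EFinP; exact: (measurableT_comp (measurable_powR _)).
have Mw0 x : 0 <= Mw x by rewrite lee_fin powR_ge0.
pose Mp := Mw \_ A'.
have mMp : measurable_fun setT Mp by apply/(measurable_restrictT _ _).1.
have Mp0 x : 0 <= Mp x by rewrite /Mp /patch; case: ifPn.
have MpE x : A' x -> Mp x = Mw x by move=> A'x; rewrite /Mp /patch mem_set.
have mF : measurable_fun setT (fun z : X * Y => f z `^ r * Mp z.1).
  by apply: emeasurable_funM => //; exact: measurableT_comp.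
have F0 z : 0 <= f z `^ r * Mp z.1 by rewrite mule_ge0// poweR_ge0.
(* Weighted Hoelder with weight [M] for each [y]. After Tonelli the integral over [y] is
   [N^r M^(1-r) <= M], which gives [H^(r-1) H] in total. *)
apply: (@le_trans _ _ (\int[m2]_(y in B) (H `^ (r - 1) *
    \int[m1]_(x in A') (f (x, y) `^ r * Mp x)))).
  apply: ge0_le_integral => //.
  - by move=> y _; exact: poweR_ge0.
  - apply: (measurableT_comp (measurable_poweR _)).
    by apply: measurable_funTS; exact: measurable_integral_in1.
  - apply: emeasurable_funM => //; apply: measurable_funTS.
    exact: (@measurable_integral_in1 A' (fun z => f z `^ r * Mp z.1)).
  move=> y By; rewrite restr//; last exact: (measurableT_comp mf).
  apply: le_trans (@power_mean_ineq _ _ _ m1 A' M (fun x => f (x, y)) r r1 mA' mM _ M0 _ Hoo) _ => //.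
    apply: measurable_funTS; exact: (measurableT_comp mf).
  rewrite le_eqVlt; apply/orP; left; apply/eqP; congr (_ * _).
  by apply: eq_integral => x /[!inE] A'x; rewrite MpE.
rewrite ge0_integralZl//; last 3 first.
- apply: measurable_funTS.
  exact: (@measurable_integral_in1 A' (fun z => f z `^ r * Mp z.1)).
- by move=> y _; apply: integral_ge0 => x _; exact: (F0 (x, y)).
- exact: poweR_ge0.
rewrite -(tonelli_in mA' mB mF F0).
apply: (@le_trans _ _ (H `^ (r - 1) * H)); last first.
  rewrite -(@fineK _ H) ?ge0_fin_numE// !poweR_EFin -EFinM lee_fin.
  have := fine_ge0 H0; rewrite le_eqVlt => /predU1P[<-|Hp].
    by rewrite mulr0 powR_ge0.
  by rewrite powRB1_mul.
apply: lee_pmul => //; first exact: poweR_ge0.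
  by apply: integral_ge0 => x _; apply: integral_ge0 => y _; exact: (F0 (x, y)).
apply: ge0_le_integral => //.
- by move=> x _; apply: integral_ge0 => y _; exact: (F0 (x, y)).
- apply: measurable_funTS.
  exact: (@measurable_integral_in2 B (fun z => f z `^ r * Mp z.1)).
- exact/measurable_EFinP.
move=> x A'x /=; rewrite ge0_integralZr//; last 2 first.
- by apply: measurable_funTS; exact: (measurableT_comp mfr).
- by move=> y _; exact: poweR_ge0.
have NrE : \int[m2]_(y in B) f (x, y) `^ r = N x `^ r.
  rewrite /N -poweRrM mulVf ?gt_eqF// poweRe1//.
  by apply: integral_ge0 => y _; exact: poweR_ge0.
rewrite NrE MpE//; case: A'x (M0 _ A'x) => Ax Nx Mx0.
rewrite -(@fineK _ (N x)) ?ge0_fin_numE// poweR_EFin -EFinM lee_fin.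
apply: (@le_trans _ _ (M x `^ r * M x `^ (1 - r))%R).
  rewrite ler_wpM2r ?powR_ge0// ge0_ler_powR ?nnegrE ?fine_ge0 ?(ltW r0) ?(ltW Mx0)//.
  by rewrite /M lerDl mulr_ge0// ltW// w0.
by rewrite -powRD_gt0// subrKC powRr1// ltW.
Qed.

End tonelli_in.

(** * The Gaussian kernel on R^n *)

Section enorm.
Context {R : realType} {n : nat}.
Implicit Types x y : 'rV[R]_n.

Lemma enorm_ge0 x : 0 <= enorm x. Proof. exact: sqrtr_ge0. Qed.

Lemma enorm_sqr x : enorm x ^+ 2 = \sum_(i < n) x ord0 i ^+ 2.
Proof. by rewrite sqr_sqrtr// sumr_ge0// => i _; exact: sqr_ge0. Qed.

Lemma enormN x : enorm (- x) = enorm x.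
Proof. by congr Num.sqrt; apply: eq_bigr => i _; rewrite mxE sqrrN. Qed.

Lemma enorm_subC x y : enorm (x - y) = enorm (y - x).
Proof. by rewrite -enormN opprB. Qed.

Lemma enorm_coord x i : `|x ord0 i| <= enorm x.
Proof.
rewrite -(ler_pXn2r (n := 2)) ?nnegrE ?enorm_ge0// enorm_sqr -normrX.
rewrite ger0_norm ?sqr_ge0// (bigD1 i)//= lerDl.
by rewrite sumr_ge0// => j _; exact: sqr_ge0.
Qed.

(** Coordinatewise this is [(u - 2 v)^2 >= 0]. It plays the part of a triangle inequality for
    squared norms. *)
Lemma enorm_quasi x y : enorm x ^+ 2 <= 2 * enorm (x - y) ^+ 2 + 2 * enorm y ^+ 2.
Proof.
rewrite !enorm_sqr !mulr_sumr -big_split/=; apply: ler_sum => i _.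
by rewrite !mxE; have := sqr_ge0 (x ord0 i - 2 * y ord0 i); nra.
Qed.

Lemma enorm_eq0 x : enorm x = 0 -> x = 0.
Proof.
move=> x0; apply/rowP => i; rewrite mxE; apply/eqP.
by rewrite -normr_le0 -x0 enorm_coord.
Qed.

Lemma enorm0 : enorm (0 : 'rV[R]_n) = 0.
Proof. by rewrite /enorm big1 ?sqrtr0// => i _; rewrite mxE expr0n. Qed.

Lemma measurable_enorm : measurable_fun setT (@enorm R n).
Proof.
rewrite (_ : @enorm R n = (fun u => u `^ 2^-1) \o
    (fun x => \sum_(i < n) x ord0 i ^+ 2)); last first.
  by apply/funext => x /=; rewrite powR12_sqrt// sumr_ge0// => i _; exact: sqr_ge0.
apply: measurableT_comp; first exact: measurable_powR.
apply: measurable_sum => i; apply: measurable_funX; exact: measurable_coord.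
Qed.

Lemma measurable_eball d : measurable (@eball R n d).
Proof.
rewrite (_ : eball d = setT `&` @enorm R n @^-1` `]-oo, d[%classic).
  by apply: measurable_enorm => //; exact: measurable_itv.
by rewrite setTI; apply/seteqP; split => x /=; rewrite in_itv.
Qed.

Lemma measurable_annulus k : measurable (@annulus R n k).
Proof. by apply: measurableD; exact: measurable_eball. Qed.

Lemma annulusP k x : annulus k x <-> 2 ^ (k - 1) <= enorm x < 2 ^ k.
Proof.
rewrite /annulus /eball; split => [[/= -> /negP]|/andP[h1 h2]].
  by rewrite -leNgt => ->.
by split => //=; apply/negP; rewrite -leNgt.
Qed.

Lemma measurable_rV_sub : measurable_fun setT
  (fun z : 'rV[R]_n * 'rV[R]_n => z.1 - z.2).
Proof.
apply: measurable_fun_rV => i; under eq_fun do rewrite !mxE.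
apply: measurable_funB.
  exact: (measurableT_comp (measurable_coord i) measurable_fst).
exact: (measurableT_comp (measurable_coord i) measurable_snd).
Qed.

End enorm.

(** * Lebesgue measure on ['rV[R]_n], mass and semigroup law of the Gaussian *)

Section lebesgue_rV_facts.
Context {R : realType}.
Local Open Scope ereal_scope.

Lemma integral_rV_cons n (f : 'rV[R]_n.+1 -> \bar R) :
  measurable_fun setT f -> (forall x, 0 <= f x) ->
  \int[lebesgue_rV n.+1]_x f x =
  \int[lebesgue_measure]_t \int[lebesgue_rV n]_x f (rV_cons (t, x)).
Proof.
move=> mf f0.
rewrite (_ : \int[lebesgue_rV n.+1]_x f x =
    \int[pushforward (lebesgue_measure \x lebesgue_rV n) (@rV_cons R n)]_x f x)//.
rewrite (ge0_integral_pushforward (@measurable_rV_cons R n))// preimage_setT.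
rewrite (@fubini_tonelli1 _ _ _ _ _ lebesgue_measure (lebesgue_rV n))//; last by move=> ? /=.
by apply: measurableT_comp => //; exact: measurable_rV_cons.
Qed.

Lemma lebesgue_rV_eball n (d : R) : (0 <= d)%R ->
  lebesgue_rV n (eball d) <= ((2 * d) ^+ n)%:E.
Proof.
move=> d0; pose A (i : 'I_n) : set (measurableTypeR R) := `](- d)%R, d[%classic.
apply: (@le_trans _ _ (lebesgue_rV n [set x | forall i, A i (x ord0 i)])).
  rewrite le_measure// ?inE; first exact: measurable_eball.
    rewrite [X in measurable X](_ : _ = \bigcap_(i in [set: 'I_n])
        ((fun x : 'rV[R]_n => x ord0 i : measurableTypeR R) @^-1` A i)).
      apply: fin_bigcap_measurable => // i _.
      rewrite -[X in measurable X]setTI; apply: measurable_coord => //.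
      exact: measurable_itv.
    by apply/seteqP; split => x /= h i; [move=> _|]; exact: h.
  move=> x xd i; rewrite /A /= in_itv/= -ltr_norml.
  exact: le_lt_trans (enorm_coord x i) xd.
rewrite lebesgue_rV_box => [|i]; last exact: measurable_itv.
rewrite (eq_bigr (fun=> (2 * d)%:E)) => [|i _].
  by rewrite prodEFin big_const_ord iter_mulr_1.
rewrite /A lebesgue_measure_itv/= lte_fin; case: ltP => dd.
  by rewrite -EFinB opprK mulr_natl.
by rewrite (_ : d = 0%R) ?mulr0//; lra.
Qed.

Lemma lebesgue_rV_set0 n : (0 < n)%N -> lebesgue_rV n [set 0%R : 'rV[R]_n] = 0.
Proof.
case: n => // n _; pose A (i : 'I_n.+1) : set (measurableTypeR R) := [set 0%R].
rewrite (_ : [set 0%R : 'rV[R]_n.+1] = [set x | forall i, A i (x ord0 i)]); last first.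
  apply/seteqP; split => x /= => [-> i|h]; first by rewrite /A /= mxE.
  by apply/rowP => i; rewrite (h i) mxE.
rewrite lebesgue_rV_box => [|i]; last exact: measurable_set1.
by rewrite big_ord_recl lebesgue_measure_set1 mul0e.
Qed.

Definition heat_kernel1 (t u : R) : R :=
  ((4 * pi * t) `^ (- 2^-1) * expR (- u ^+ 2 / (4 * t)))%R.

(** The variance is [2 t]; the unit mass of the kernel is then that of a normal density. *)
Lemma heat_kernel1E t u m : (0 < t)%R ->
  heat_kernel1 t (m - u) = normal_pdf m (Num.sqrt (2 * t)) u.
Proof.
move=> t0; have t20 : (0 < 2 * t)%R by rewrite mulr_gt0.
rewrite normal_pdfE ?gt_eqF ?sqrtr_gt0// /heat_kernel1 /normal_peak /normal_fun.
rewrite sqr_sqrtr ?(ltW t20)//; congr (_ * expR _)%R.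
  rewrite powRN powR12_sqrt ?mulr_ge0 ?pi_ge0 ?ltW//.
  by congr (Num.sqrt _)^-1%R; rewrite -mulr_natr; ring.
have -> : ((u - m) ^+ 2 = (m - u) ^+ 2)%R by ring.
by congr (_ / _)%R; ring.
Qed.

Lemma heat_kernel1_int t m : (0 < t)%R ->
  \int[lebesgue_measure]_u (heat_kernel1 t (m - u))%:E = 1.
Proof.
move=> t0; under eq_integral do rewrite heat_kernel1E//.
exact: integral_normal_pdf.
Qed.

Lemma measurable_heat_kernel1 t : measurable_fun setT (heat_kernel1 t).
Proof.
apply: measurable_funM => //; apply: measurableT_comp => //.
by apply: measurable_funM => //; apply: measurableT_comp.
Qed.

(** Completing the square in [u]: the product is the kernel of time [s + t] at [x - y] times the
    kernel of time [s t / (s + t)] centred at [(t x + s y) / (s + t)], and the latter has mass 1. *)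
Lemma heat_kernel1_conv s t x y : (0 < s)%R -> (0 < t)%R ->
  \int[lebesgue_measure]_u (heat_kernel1 s (x - u) * heat_kernel1 t (u - y))%:E =
  (heat_kernel1 (s + t) (x - y))%:E.
Proof.
move=> s0 t0; have st0 : (0 < s + t)%R by rewrite addr_gt0.
have r0 : (0 < s * t / (s + t))%R by rewrite divr_gt0 ?mulr_gt0.
have pi4 : (0 < 4 * pi :> R)%R by rewrite mulr_gt0 ?pi_gt0.
transitivity (\int[lebesgue_measure]_u ((heat_kernel1 (s + t) (x - y))%:E *
   (heat_kernel1 (s * t / (s + t)) ((t * x + s * y) / (s + t) - u))%:E)).
  apply: eq_integral => u _; rewrite -EFinM /heat_kernel1; congr (_%:E).
  rewrite mulrACA [RHS]mulrACA -!expRD -!powRM ?mulr_ge0 ?invr_ge0 ?pi_ge0 ?(ltW s0) ?(ltW t0) ?(ltW st0) ?(ltW r0)//.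
  congr (_ `^ _ * expR _)%R; first by field; rewrite gt_eqF.
  by field; rewrite !gt_eqF.
rewrite ge0_integralZl//.
- by rewrite heat_kernel1_int// mule1.
- apply/measurable_EFinP; apply: measurableT_comp; first exact: measurable_heat_kernel1.
  exact: measurable_funB.
- by move=> u _; rewrite lee_fin mulr_ge0 ?powR_ge0 ?expR_ge0.
by rewrite lee_fin mulr_ge0 ?powR_ge0 ?expR_ge0.
Qed.

Lemma heat_kernel_ge0 n t (x : 'rV[R]_n) : (0 <= heat_kernel t x)%R.
Proof. by rewrite mulr_ge0 ?powR_ge0 ?expR_ge0. Qed.

Lemma heat_kernel_gt0 n t (x : 'rV[R]_n) : (0 < t)%R -> (0 < heat_kernel t x)%R.
Proof.
by move=> t0; rewrite mulr_gt0 ?expR_gt0// powR_gt0// !mulr_gt0 ?pi_gt0.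
Qed.

Lemma rV_consB n (p r : R * 'rV[R]_n) :
  (rV_cons p - rV_cons r = rV_cons (p.1 - r.1, p.2 - r.2))%R.
Proof.
case: p r => [u x] [v y] /=; apply/rowP => i; rewrite [LHS]mxE [X in (_ + X)%R]mxE.
by case: (unliftP ord0 i) => [j|] ->; rewrite ?rV_consS ?rV_cons0 ?mxE.
Qed.

(** Gaussians factor over the coordinates; semigroup law and unit mass follow from dimension one by
    induction along [rV_cons]. *)
Lemma heat_kernel_cons n t u (x : 'rV[R]_n) : (0 < t)%R ->
  heat_kernel t (rV_cons (u, x)) = (heat_kernel1 t u * heat_kernel t x)%R.
Proof.
move=> t0; rewrite /heat_kernel /heat_kernel1 mulrACA -expRD.
rewrite -powRD_gt0 ?mulr_gt0 ?pi_gt0//; congr (_ `^ _ * expR _)%R.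
  by rewrite -natr1; field.
rewrite !enorm_sqr big_ord_recl rV_cons0.
under eq_bigr => i _ do rewrite rV_consS.
by field; rewrite gt_eqF.
Qed.

Lemma measurable_heat_kernel n t : measurable_fun setT (@heat_kernel R n t).
Proof.
apply: measurable_funM => //; apply: measurableT_comp => //.
apply: measurable_funM => //; apply: measurableT_comp => //.
by apply: measurable_funX; exact: measurable_enorm.
Qed.

Lemma heat_kernel_subC n t (x y : 'rV[R]_n) :
  heat_kernel t (x - y) = heat_kernel t (y - x).
Proof. by rewrite /heat_kernel enorm_subC. Qed.

Lemma measurable_heat_kernel_sub n t (x : 'rV[R]_n) :
  measurable_fun setT (fun y : 'rV[R]_n => heat_kernel t (x - y)).
Proof.
apply: measurableT_comp; first exact: measurable_heat_kernel.
exact: (measurableT_comp measurable_rV_sub (pair1_measurable x)).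
Qed.

Lemma integral_rV0 (f : 'rV[R]_0 -> \bar R) : measurable_fun setT f ->
  \int[lebesgue_rV 0]_x f x = f 0%R.
Proof. by move=> mf; rewrite [LHS]integral_dirac//= diracT mul1e. Qed.

Lemma heat_kernel_rV0 t (x : 'rV[R]_0) : heat_kernel t x = 1%R.
Proof.
rewrite /heat_kernel /enorm big_ord0 sqrtr0 expr0n mul0r oppr0 powRr0.
by rewrite mul0r expR0 mulr1.
Qed.

Lemma heat_kernel_conv n s t (x y : 'rV[R]_n) : (0 < s)%R -> (0 < t)%R ->
  \int[lebesgue_rV n]_z (heat_kernel s (x - z) * heat_kernel t (z - y))%:E =
  (heat_kernel (s + t) (x - y))%:E.
Proof.
move=> s0 t0; elim: n x y => [|n IHn] x y.
  rewrite integral_rV0; last first.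
    apply/measurable_EFinP; apply: measurable_funM.
      exact: measurable_heat_kernel_sub.
    by under eq_fun do rewrite heat_kernel_subC; exact: measurable_heat_kernel_sub.
  by rewrite !heat_kernel_rV0 ?mul1r.
rewrite -(rV_unconsK x) -(rV_unconsK y).
case: (rV_uncons x) (rV_uncons y) => [u {}x] [v {}y].
rewrite integral_rV_cons; last 2 first.
- apply/measurable_EFinP; apply: measurable_funM.
    exact: measurable_heat_kernel_sub.
  by under eq_fun do rewrite heat_kernel_subC; exact: measurable_heat_kernel_sub.
- by move=> z; rewrite lee_fin mulr_ge0// heat_kernel_ge0.
under eq_integral => w _.
  under eq_integral => z _ do
    rewrite !rV_consB/= !heat_kernel_cons// mulrACA EFinM.
  rewrite ge0_integralZl//; last 3 first.
  - apply/measurable_EFinP; apply: measurable_funM.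
      exact: measurable_heat_kernel_sub.
    by under eq_fun do rewrite heat_kernel_subC; exact: measurable_heat_kernel_sub.
  - by move=> z _; rewrite lee_fin mulr_ge0// heat_kernel_ge0.
  - by rewrite lee_fin !mulr_ge0 ?powR_ge0 ?expR_ge0.
  rewrite IHn.
  over.
rewrite ge0_integralZr//; last 3 first.
- apply/measurable_EFinP; apply: measurable_funM;
    (apply: measurableT_comp; [exact: measurable_heat_kernel1|exact: measurable_funB]).
- by move=> w _; rewrite lee_fin !mulr_ge0 ?powR_ge0 ?expR_ge0.
- by rewrite lee_fin heat_kernel_ge0.
by rewrite heat_kernel1_conv// -EFinM -heat_kernel_cons ?addr_gt0// rV_consB.
Qed.

Lemma heat_kernel_int n t (x : 'rV[R]_n) : (0 < t)%R ->
  \int[lebesgue_rV n]_z (heat_kernel t (x - z))%:E = 1.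
Proof.
move=> t0; elim: n x => [|n IHn] x.
  rewrite integral_rV0; last first.
    by apply/measurable_EFinP; exact: measurable_heat_kernel_sub.
  by rewrite !heat_kernel_rV0 ?mul1r.
rewrite -(rV_unconsK x); case: (rV_uncons x) => [u {}x].
rewrite integral_rV_cons; last 2 first.
- by apply/measurable_EFinP; exact: measurable_heat_kernel_sub.
- by move=> z; rewrite lee_fin heat_kernel_ge0.
under eq_integral => w _.
  under eq_integral => z _ do
    rewrite !rV_consB/= !heat_kernel_cons// EFinM.
  rewrite ge0_integralZl//; last 3 first.
  - by apply/measurable_EFinP; exact: measurable_heat_kernel_sub.
  - by move=> z _; rewrite lee_fin heat_kernel_ge0.
  - by rewrite lee_fin !mulr_ge0 ?powR_ge0 ?expR_ge0.
  rewrite IHn mule1.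
  over.
exact: heat_kernel1_int.
Qed.

End lebesgue_rV_facts.

(** * Herz norms of nonnegative functions *)

Section esum_int.
Context {R : realType}.
Local Open Scope ereal_scope.

(** The enumeration [0, -1, 1, -2, 2, ...], which turns sums over the integers into series. The term
    of index [i] has absolute value at least [i / 2]. *)
Definition int_of_index (i : nat) : int :=
  if odd i then Negz i./2 else Posz i./2.

Lemma int_of_index_bij : set_bij [set: nat] [set: int] int_of_index.
Proof.
pose g (k : int) := match k with Posz m => m.*2 | Negz m => m.*2.+1 end.
have gK : cancel g int_of_index.
  by case=> m; rewrite /int_of_index/= ?odd_double ?uphalf_double ?doubleK.
have fK : cancel int_of_index g.
  move=> i; rewrite /int_of_index -[RHS]odd_double_half.
  by case: (odd i).
split => //; first by move=> i j _ _; exact: (can_inj fK).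
by move=> k _; exists (g k).
Qed.

Lemma esum_int_series (a : int -> \bar R) : (forall k, 0 <= a k) ->
  \esum_(k in [set: int]) a k = \sum_(i <oo) a (int_of_index i).
Proof.
move=> a0; rewrite (@reindex_esum R _ _ setT setT int_of_index a int_of_index_bij).
by rewrite nneseries_esumT.
Qed.

Lemma esum_intZl (c : R) (a : int -> \bar R) : (0 <= c)%R -> (forall k, 0 <= a k) ->
  \esum_(k in [set: int]) (c%:E * a k) = c%:E * \esum_(k in [set: int]) a k.
Proof.
move=> c0 a0; rewrite !esum_int_series//; last by move=> k; exact: mule_ge0.
by rewrite nneseriesZl.
Qed.

Lemma esum_int_ge (a : int -> \bar R) k : (forall k, 0 <= a k) ->
  a k <= \esum_(k in [set: int]) a k.
Proof.
move=> a0; apply: esum_ge; exists [set k]; first by split.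
by rewrite fsbig_set1.
Qed.

Lemma integral_esum_int d (T : measurableType d) (mu : {measure set T -> \bar R})
    (D : set T) (f : int -> T -> \bar R) : measurable D ->
  (forall k, measurable_fun D (f k)) -> (forall k x, D x -> 0 <= f k x) ->
  \int[mu]_(x in D) (\esum_(k in [set: int]) f k x) =
  \esum_(k in [set: int]) \int[mu]_(x in D) f k x.
Proof.
move=> mD mf f0; rewrite esum_int_series => [|k]; last by apply: integral_ge0 => x; exact: f0.
rewrite -integral_nneseries//; last by move=> i x; exact: f0.
by apply: eq_integral => x /[!inE] Dx; rewrite esum_int_series// => k; exact: f0.
Qed.

Lemma esum_int_swap (a : int -> int -> \bar R) : (forall i j, 0 <= a i j) ->
  \esum_(i in [set: int]) (\esum_(j in [set: int]) a i j) =
  \esum_(j in [set: int]) (\esum_(i in [set: int]) a i j).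
Proof.
move=> a0; rewrite !esum_int_series => [|j|i]; try by apply: esum_ge0.
under eq_eseriesr => i _ do rewrite esum_int_series//.
rewrite nneseries_interchange//.
by apply: eq_eseriesr => j _; rewrite esum_int_series.
Qed.

Lemma measurable_esum_int d (T : measurableType d) (D : set T)
    (f : int -> T -> \bar R) :
  (forall k, measurable_fun D (f k)) -> (forall k x, 0 <= f k x) ->
  measurable_fun D (fun x => \esum_(k in [set: int]) f k x).
Proof.
move=> mf f0; under eq_fun => x do rewrite esum_int_series//.
by apply: ge0_emeasurable_sum => // k x _ _; exact: f0.
Qed.

End esum_int.

(** Series become integrals against a sigma-finite measure, so that Minkowski's integral inequality
    also gives countable subadditivity. *)
HB.instance Definition _ (R : realType) := @Measure_isSigmaFinite.Build _ _ _
  (@counting nat R) (sigma_finite_counting R).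

Local Open Scope ereal_scope.

Definition ring_norm {R : realType} {n : nat} (p : R) (k : int)
    (f : 'rV[R]_n -> \bar R) : \bar R :=
  (\int[@lebesgue_rV R n]_(x in annulus k) f x `^ p) `^ p^-1.

(* The Herz norm with summation exponent 1, for [0, +oo]-valued functions;
   locked to keep conversion from unfolding it. *)
HB.lock Definition eherz {R : realType} {n : nat} (s p : R)
    (f : 'rV[R]_n -> \bar R) : \bar R :=
  \esum_(k in [set: int]) ((2 `^ (k%:~R * s))%:E * ring_norm p k f).
Canonical locked_eherz := Unlockable eherz.unlock.

Local Close Scope ereal_scope.

Section eherz.
Context {R : realType} {n : nat}.
Local Open Scope ereal_scope.
Local Notation mu := (@lebesgue_rV R n).
Implicit Types (f g : 'rV[R]_n -> \bar R) (s p r : R) (k : int).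

Lemma eherzE s p f :
  eherz s p f = \esum_(k in [set: int]) ((2 `^ (k%:~R * s))%:E * ring_norm p k f).
Proof. by rewrite unlock. Qed.

Lemma ring_norm_ge0 p k f : 0 <= ring_norm p k f.
Proof. exact: poweR_ge0. Qed.

Lemma eherz_term_ge0 s p f k : 0 <= (2 `^ (k%:~R * s))%:E * ring_norm p k f.
Proof. by rewrite mule_ge0 ?ring_norm_ge0// lee_fin powR_ge0. Qed.
Hint Resolve eherz_term_ge0 : core.

Lemma eherz_ge0 s p f : 0 <= eherz s p f.
Proof. by rewrite eherzE; apply: esum_ge0 => k _. Qed.

Lemma le_ring_norm p k f g : (0 < p)%R ->
  measurable_fun setT f -> measurable_fun setT g ->
  (forall x, 0 <= f x) -> (forall x, 0 <= g x) ->
  {ae mu, forall x, annulus k x -> f x <= g x} -> ring_norm p k f <= ring_norm p k g.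
Proof.
move=> p0 mf mg f0 g0 fg; apply: le_poweR; first by rewrite invr_ge0 ltW.
  by apply: integral_ge0 => x _; exact: poweR_ge0.
have mp h : measurable_fun setT h -> measurable_fun (annulus k) (fun x => h x `^ p).
  by move=> mh; apply: measurable_funTS; exact: (measurableT_comp (measurable_poweR p)).
apply: ae_ge0_le_integral => //; [exact: measurable_annulus| | exact: mp | | exact: mp |].
- by move=> x _; exact: poweR_ge0.
- by move=> x _; exact: poweR_ge0.
by apply: filterS fg => x /= H Ax; apply: le_poweR => //; [exact: ltW|exact: H].
Qed.

Lemma le_eherz s p f g : (0 < p)%R ->
  measurable_fun setT f -> measurable_fun setT g ->
  (forall x, 0 <= f x) -> (forall x, 0 <= g x) ->
  {ae mu, forall x, f x <= g x} -> eherz s p f <= eherz s p g.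
Proof.
move=> p0 mf mg f0 g0 fg; rewrite !eherzE; apply: le_esum => k _.
apply: lee_wpmul2l; first by rewrite lee_fin powR_ge0.
by apply: le_ring_norm => //; apply: filterS fg.
Qed.

Lemma eq_eherz s p f g : (0 < p)%R ->
  measurable_fun setT f -> measurable_fun setT g ->
  (forall x, 0 <= f x) -> (forall x, 0 <= g x) ->
  {ae mu, forall x, f x = g x} -> eherz s p f = eherz s p g.
Proof.
move=> p0 mf mg f0 g0 fg; apply/eqP; rewrite eq_le.
by apply/andP; split; apply: le_eherz => //; apply: filterS fg => x ->.
Qed.

Lemma ring_normZ p k (c : R) f : (0 < p)%R -> (0 <= c)%R ->
  measurable_fun setT f -> (forall x, 0 <= f x) ->
  ring_norm p k (fun x => c%:E * f x) = c%:E * ring_norm p k f.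
Proof.
move=> p0 c0 mf f0; rewrite /ring_norm.
under eq_integral => x _ do rewrite poweRM// poweR_EFin.
rewrite ge0_integralZl_EFin//; first last.
- exact: powR_ge0.
- by apply: measurable_funTS; exact: (measurableT_comp (measurable_poweR p)).
- by move=> x _; exact: poweR_ge0.
- exact: measurable_annulus.
rewrite poweRM ?lee_fin ?powR_ge0//; last first.
  by apply: integral_ge0 => x _; exact: poweR_ge0.
by rewrite poweR_EFin -powRrM divff ?gt_eqF// powRr1.
Qed.

Lemma eherzZ s p (c : R) f : (0 < p)%R -> (0 <= c)%R ->
  measurable_fun setT f -> (forall x, 0 <= f x) ->
  eherz s p (fun x => c%:E * f x) = c%:E * eherz s p f.
Proof.
move=> p0 c0 mf f0; rewrite !eherzE -esum_intZl//.
by apply: eq_esum => k _; rewrite ring_normZ// muleCA.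
Qed.

Lemma eherz0 s p : (0 < p)%R -> eherz s p (cst 0 : 'rV[R]_n -> \bar R) = 0.
Proof.
move=> p0; rewrite eherzE esum1// => k _; rewrite /ring_norm.
under eq_integral => x _ do rewrite poweR0r ?gt_eqF//.
by rewrite integral0 poweR0r ?mule0// invr_neq0 ?gt_eqF.
Qed.

Section minkowski.
Context d (T : measurableType d) (nu : {sigma_finite_measure set T -> \bar R}).
Variables (A : set T) (w : T -> R).
Hypotheses (mA : measurable A) (mw : measurable_fun A w)
  (w0 : forall x, A x -> (0 < w x)%R) (woo : \int[nu]_(x in A) (w x)%:E < +oo).
Variables (F : T * 'rV[R]_n -> \bar R).
Hypotheses (mF : measurable_fun setT F) (F0 : forall z, 0 <= F z).

(** The weight [w] is the auxiliary one of [minkowski_integral]; it is taken to be 1 on bounded time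
    intervals and [2^-i] on the naturals. *)
Lemma ring_norm_int p k : (1 <= p)%R ->
  ring_norm p k (fun x => \int[nu]_(t in A) F (t, x)) <=
  \int[nu]_(t in A) ring_norm p k (fun x => F (t, x)).
Proof.
move=> p1; rewrite /ring_norm.
apply: (@minkowski_integral _ _ _ _ _ nu mu A (annulus k) F w p) => //.
exact: measurable_annulus.
Qed.

Lemma measurable_ring_norm p k :
  measurable_fun setT (fun t => ring_norm p k (fun x => F (t, x))).
Proof.
apply: (measurableT_comp (measurable_poweR p^-1)).
apply: (@measurable_integral_in2 _ _ _ _ _ mu (annulus k) (fun z => F z `^ p)).
- exact: measurable_annulus.
- exact: (measurableT_comp (measurable_poweR p)).
- by move=> z; exact: poweR_ge0.
Qed.

Lemma measurable_eherz s p :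
  measurable_fun setT (fun t => eherz s p (fun x => F (t, x))).
Proof.
under eq_fun => t do rewrite eherzE.
apply: measurable_esum_int => [k|k t]; last by [].
by apply: emeasurable_funM => //; exact: measurable_ring_norm.
Qed.

Lemma eherz_int s p : (1 <= p)%R ->
  eherz s p (fun x => \int[nu]_(t in A) F (t, x)) <=
  \int[nu]_(t in A) eherz s p (fun x => F (t, x)).
Proof.
move=> p1; under eq_integral => t _ do rewrite eherzE.
rewrite eherzE integral_esum_int//; last first.
  by move=> k; apply: emeasurable_funM => //; apply: measurable_funTS; exact: measurable_ring_norm.
apply: le_esum => k _; rewrite ge0_integralZl_EFin//; first last.
- by apply: measurable_funTS; exact: measurable_ring_norm.
- by move=> t _; exact: ring_norm_ge0.
by apply: lee_wpmul2l; [rewrite lee_fin powR_ge0|exact: ring_norm_int].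
Qed.

End minkowski.

Lemma measurable_fun_nat_prod d (T : measurableType d) (f : nat -> T -> \bar R) :
  (forall i, measurable_fun setT (f i)) ->
  measurable_fun setT (fun z : nat * T => f z.1 z.2).
Proof.
move=> mf _ Y mY; rewrite setTI.
rewrite (_ : _ @^-1` Y = \bigcup_i ([set i] `*` (f i @^-1` Y))).
  apply: bigcupT_measurable => i; apply: measurableX => //.
  by have := mf i measurableT _ mY; rewrite setTI.
apply/seteqP; split => [[i x]/= Yx|[i x]/= [j _ [/= -> //]]].
by exists i.
Qed.

Lemma counting_weight_lty :
  \int[@counting nat R]_i (2^-1 ^+ i)%:E < +oo.
Proof.
rewrite (@ge0_integral_count R (fun i => (2^-1 ^+ i)%:E)); last first.
  by move=> i; rewrite lee_fin exprn_ge0.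
apply: (@le_lt_trans _ _ 2%:E); last by rewrite ltry.
apply: lime_le; first by apply: is_cvg_nneseries => i _ _; rewrite lee_fin exprn_ge0.
apply: nearW => N; rewrite sumEFin lee_fin.
elim: N => [|N IH]; first by rewrite big_nil.
have : (\sum_(0 <= i < N) (2^-1 ^+ i) = 2 - 2 * 2^-1 ^+ N :> R)%R.
  elim: N {IH} => [|N IH]; first by rewrite big_nil expr0 mulr1 subrr.
  by rewrite big_nat_recr//= IH exprS; field.
rewrite big_nat_recr//= => ->.
have : (0 <= (2^-1 : R) ^+ N)%R by rewrite exprn_ge0.
by lra.
Qed.

Lemma ring_norm_series p k (f : nat -> 'rV[R]_n -> \bar R) : (1 <= p)%R ->
  (forall i, measurable_fun setT (f i)) -> (forall i x, 0 <= f i x) ->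
  ring_norm p k (fun x => \sum_(i <oo) f i x) <= \sum_(i <oo) ring_norm p k (f i).
Proof.
move=> p1 mf f0.
rewrite -(@ge0_integral_count R (fun i => ring_norm p k (f i))); last first.
  by move=> i; exact: ring_norm_ge0.
rewrite (_ : (fun x => _) = (fun x => \int[counting]_(i in setT) f i x)); last first.
  by apply/funext => x; rewrite (@ge0_integral_count R (f^~ x)).
have := @ring_norm_int _ _ (@counting nat R) setT (fun i => (2^-1 ^+ i)%R) measurableT _ _ _
  (fun z => f z.1 z.2) _ _ p k p1.
apply => //; first exact: counting_weight_lty.
exact: measurable_fun_nat_prod.
Qed.

Lemma ring_norm_esum p k (f : int -> 'rV[R]_n -> \bar R) : (1 <= p)%R ->
  (forall i, measurable_fun setT (f i)) -> (forall i x, 0 <= f i x) ->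
  ring_norm p k (fun x => \esum_(i in [set: int]) f i x) <=
  \esum_(i in [set: int]) ring_norm p k (f i).
Proof.
move=> p1 mf f0; rewrite esum_int_series => [|j]; last exact: ring_norm_ge0.
rewrite (_ : (fun x => _) = (fun x => \sum_(i <oo) f (int_of_index i) x)); last first.
  by apply/funext => x; rewrite esum_int_series.
exact: ring_norm_series.
Qed.

Lemma eherz_series s p (f : nat -> 'rV[R]_n -> \bar R) : (1 <= p)%R ->
  (forall i, measurable_fun setT (f i)) -> (forall i x, 0 <= f i x) ->
  eherz s p (fun x => \sum_(i <oo) f i x) <= \sum_(i <oo) eherz s p (f i).
Proof.
move=> p1 mf f0.
rewrite -(@ge0_integral_count R (fun i => eherz s p (f i))); last first.
  by move=> i; exact: eherz_ge0.
rewrite (_ : (fun x => _) = (fun x => \int[counting]_(i in setT) f i x)); last first.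
  by apply/funext => x; rewrite (@ge0_integral_count R (f^~ x)).
have := @eherz_int _ _ (@counting nat R) setT (fun i => (2^-1 ^+ i)%R) measurableT _ _ _
  (fun z => f z.1 z.2) _ _ s p p1.
apply => //.
- exact: counting_weight_lty.
exact: measurable_fun_nat_prod.
Qed.

Lemma nneseries2 (a : nat -> \bar R) : (forall i, 0 <= a i) ->
  (forall i, (1 < i)%N -> a i = 0) -> \sum_(i <oo) a i = a 0%N + a 1%N.
Proof.
move=> a0 a2; rewrite (nneseries_split 0 2)//.
rewrite eseries0 ?adde0; last by move=> i i2 _; rewrite a2.
by rewrite add0n !big_nat_recr//= big_nil add0e.
Qed.

(** Countable subadditivity for the sequence [f, g, 0, 0, ...]. *)
Lemma eherzD s p f g : (1 <= p)%R -> measurable_fun setT f ->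
  measurable_fun setT g -> (forall x, 0 <= f x) -> (forall x, 0 <= g x) ->
  eherz s p (fun x => f x + g x) <= eherz s p f + eherz s p g.
Proof.
move=> p1 mf mg f0 g0; have p0 : (0 < p)%R by exact: lt_le_trans p1.
pose h i := if i is 0%N then f else if i is 1%N then g else cst 0.
have h0 i x : 0 <= h i x by case: i => [|[|i]] /=.
rewrite (_ : (fun x => f x + g x) = (fun x => \sum_(i <oo) h i x)).
  apply: le_trans (eherz_series _ p1 _ h0) _ => [[|[|i]]//|].
  rewrite nneseries2// => [i|[|[|i]]//]; first exact: eherz_ge0.
  by rewrite eherz0.
by apply/funext => x; rewrite nneseries2//; case=> [|[|i]].
Qed.

End eherz.

Section eherz_facts.
Context {R : realType} {n : nat}.
Local Open Scope ereal_scope.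
Local Notation mu := (@lebesgue_rV R n).
Implicit Types (f g : 'rV[R]_n -> \bar R) (s p q r t : R) (k : int).

Lemma pow2_exprz k : ((2 : R) ^ k = 2 `^ k%:~R)%R.
Proof. by rewrite powR_intmul. Qed.

Lemma annulus_cover (x : 'rV[R]_n) : x != 0%R -> exists k, annulus k x.
Proof.
move=> x0; have ex0 : (0 < enorm x)%R.
  rewrite lt_neqAle enorm_ge0 andbT eq_sym; apply: contra x0 => /eqP/enorm_eq0 ->.
  exact: eqxx.
have ln20 : (0 < ln (2 : R))%R by rewrite ln_gt0// ltr1n.
(* The annulus of index [k] starts at radius [2^(k-1)], whence the shift by one. *)
pose k : int := (Num.floor (ln (enorm x) / ln 2) + 1)%R.
exists k; apply/annulusP; rewrite /k addrK !pow2_exprz.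
have h1 : (2 `^ (ln (enorm x) / ln 2) = enorm x)%R.
  by rewrite /powR pnatr_eq0/= divfK ?gt_eqF// lnK ?posrE.
rewrite -[in X in (_ <= X)%R]h1 -[in X in (X < _)%R]h1.
apply/andP; split; first by rewrite ler_powR ?ler1n// floor_le_tmp.
by rewrite /powR pnatr_eq0/= ltr_expR ltr_pM2r// floorD1_gt.
Qed.

(** The annuli miss only the origin, a null set for positive [n]; in dimension 0 it would carry all
    the mass. *)
Lemma ae_annuli (P : 'rV[R]_n -> Prop) : (0 < n)%N ->
  (forall k, {ae mu, forall x, annulus k x -> P x}) -> {ae mu, forall x, P x}.
Proof.
move=> n0 aP.
have /ae_foralln aP' i : {ae mu, forall x, annulus (int_of_index i) x -> P x}.
  exact: aP.
have a0 : {ae mu, forall x, x != 0%R}.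
  exists [set 0%R]; split; last by move=> x /= /negP/negPn/eqP.
    rewrite (_ : [set 0%R] = [set x : 'rV[R]_n | forall i, [set 0%R] (x ord0 i)]).
      rewrite [X in measurable X](_ : _ = \bigcap_(i in [set: 'I_n])
          ((fun x : 'rV[R]_n => x ord0 i : measurableTypeR R) @^-1` [set 0%R])).
        apply: fin_bigcap_measurable => // i _.
        by rewrite -[X in measurable X]setTI; apply: measurable_coord.
      by apply/seteqP; split => x /= h i; [move=> _|]; exact: h.
    apply/seteqP; split => x /= => [-> i|h]; first by rewrite mxE.
    by apply/rowP => i; rewrite (h i) mxE.
  exact: lebesgue_rV_set0.
apply: filterS2 aP' a0 => x H x0; have [k Ak] := annulus_cover x0.
have [_ _ /(_ k I)[i _ ik]] := int_of_index_bij.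
by apply: (H i); rewrite ik.
Qed.

Lemma ring_norm_lty s p f k : eherz s p f < +oo -> ring_norm p k f < +oo.
Proof.
rewrite eherzE => foo; have := esum_int_ge k (eherz_term_ge0 s p f).
move=> /le_lt_trans/(_ foo) H; rewrite ltey; apply/eqP => E; move: H.
by rewrite E gt0_muley ?ltxx// lte_fin powR_gt0.
Qed.

Lemma eherz_lty_ae s p f : (0 < n)%N -> (0 < p)%R -> measurable_fun setT f ->
  (forall x, 0 <= f x) -> eherz s p f < +oo -> {ae mu, forall x, f x < +oo}.
Proof.
move=> n0 p0 mf f0 foo; apply: ae_annuli => // k.
have mA := @measurable_annulus R n k.
have : \int[mu]_(x in annulus k) f x `^ p < +oo.
  have := ring_norm_lty k foo; rewrite /ring_norm.
  by apply: lty_poweRy; rewrite invr_neq0// gt_eqF.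
have mfp : measurable_fun (annulus k) (fun x => f x `^ p).
  by apply: measurable_funTS; exact: (measurableT_comp (measurable_poweR p)).
move=> H; have iF : mu.-integrable (annulus k) (fun x => f x `^ p).
  apply/integrableP; split => //; under eq_integral => x _ do rewrite gee0_abs ?poweR_ge0//.
  exact: H.
have := integrable_ae mA iF; apply: filterS => x /= H1 Ax.
have := H1 Ax; rewrite ge0_fin_numE ?poweR_ge0//.
by apply: lty_poweRy; rewrite gt_eqF.
Qed.

Lemma eherz_eq0_ae s p f : (0 < n)%N -> (0 < p)%R -> measurable_fun setT f ->
  (forall x, 0 <= f x) -> eherz s p f = 0 -> {ae mu, forall x, f x = 0}.
Proof.
move=> n0 p0 mf f0 foo; apply: ae_annuli => // k.
have mA := @measurable_annulus R n k.
have mfp : measurable_fun (annulus k) (fun x => f x `^ p).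
  by apply: measurable_funTS; exact: (measurableT_comp (measurable_poweR p)).
have : \int[mu]_(x in annulus k) f x `^ p = 0.
  have := esum_int_ge k (eherz_term_ge0 s p f); rewrite -eherzE foo => H.
  have /eqP : (2 `^ (k%:~R * s))%:E * ring_norm p k f = 0.
    by apply/eqP; rewrite eq_le H eherz_term_ge0.
  rewrite mule_eq0 gt_eqF ?lte_fin ?powR_gt0//= => /eqP.
  apply: poweR_eq0_eq0; apply: integral_ge0 => x _; exact: poweR_ge0.
move=> H; have : ae_eq mu (annulus k) (fun x => f x `^ p) (cst 0).
  apply/ae_eq_integral_abs => //; rewrite -[RHS]H; apply: eq_integral => x _.
  by rewrite gee0_abs ?poweR_ge0.
apply: filterS => x /= H1 Ax; have := H1 Ax.
by apply: poweR_eq0_eq0.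
Qed.

(** The annulus lies in a cube of side [2^(k+1)]. This crude volume is the origin of the factors
    [2^((k+1) n ...)] in the block estimates. *)
Lemma lebesgue_annulus k : mu (annulus k) <= (2 `^ ((k%:~R + 1) * n%:R))%:E.
Proof.
have k0 : (0 <= (2 : R) ^ k)%R by rewrite exprz_ge0.
apply: (@le_trans _ _ (mu (eball (2 ^ k)))).
  rewrite le_measure ?inE//; [exact: measurable_annulus|exact: measurable_eball|].
  by move=> x [].
apply: le_trans (lebesgue_rV_eball n k0) _.
rewrite lee_fin pow2_exprz powRrM powRD_gt0// powRr1//.
by rewrite powR_mulrn ?mulr_ge0 ?powR_ge0// mulrC.
Qed.

(** [power_mean_ineq] for [f^q], with weight 1 and exponent [p / q], combined with the volume of the
    annulus. *)
Lemma ring_norm_hoelder p q k f : (1 <= q)%R -> (q <= p)%R ->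
  measurable_fun setT f -> (forall x, 0 <= f x) ->
  ring_norm q k f <=
    (2 `^ ((k%:~R + 1) * n%:R * (q^-1 - p^-1)))%:E * ring_norm p k f.
Proof.
move=> q1 qp mf f0; have q0 : (0 < q)%R by exact: lt_le_trans q1.
have p0 : (0 < p)%R by exact: lt_le_trans qp.
have mA := @measurable_annulus R n k.
have vE : \int[mu]_(x in annulus k) (cst 1%R x)%:E = mu (annulus k).
  by rewrite -[RHS]mul1e -integral_cst.
have voo : \int[mu]_(x in annulus k) (cst 1%R x)%:E < +oo.
  by rewrite vE (le_lt_trans (lebesgue_annulus k))// ltry.
have pq1 : (1 <= p / q)%R by rewrite ler_pdivlMr// mul1r.
have := @power_mean_ineq _ _ _ mu _ (cst 1%R) (fun x => f x `^ q) (p / q)%R pq1 mA _ _ _ _ voo.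
move=> /(_ _)/(_ _)/(_ _)/(_ _).
have mfq : measurable_fun (annulus k) (fun x => f x `^ q).
  by apply: measurable_funTS; exact: (measurableT_comp (measurable_poweR q)).
move=> /(_ (measurable_cst _) mfq (fun _ _ => ltr01) (fun _ _ => poweR_ge0 _ _)).
under [X in _ <= _ * X -> _]eq_integral => x _.
  rewrite powR1 mule1 -poweRrM mulrCA divff ?gt_eqF// mulr1.
  over.
rewrite vE => H.
have I0 (a : R) : 0 <= \int[mu]_(x in annulus k) f x `^ a.
  by apply: integral_ge0 => x _; exact: poweR_ge0.
have p'0 : (0 <= p^-1)%R by rewrite invr_ge0 ltW.
have := le_poweR p'0 (poweR_ge0 _ _) H.
rewrite -poweRrM (_ : p / q * p^-1 = q^-1)%R; last by field; rewrite !gt_eqF.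
rewrite poweRM ?poweR_ge0// -/(ring_norm q k f) -/(ring_norm p k f).
move=> /le_trans; apply; apply: lee_wpmul2r; first exact: ring_norm_ge0.
rewrite -poweRrM (_ : (p / q - 1) * p^-1 = q^-1 - p^-1)%R; last first.
  by field; rewrite !gt_eqF.
rewrite (powRrM _ (_ * _)) -poweR_EFin; apply: le_poweR => //.
  by rewrite subr_ge0 lef_pV2.
exact: lebesgue_annulus.
Qed.

End eherz_facts.

(** * The heat flow on functions with values in [[0, +oo]] *)

Local Open Scope ereal_scope.

HB.lock Definition eheat {R : realType} {n : nat} (t : R)
    (f : 'rV[R]_n -> \bar R) (x : 'rV[R]_n) : \bar R :=
  \int[@lebesgue_rV R n]_y ((heat_kernel t (x - y))%:E * f y).
Canonical locked_eheat := Unlockable eheat.unlock.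

Local Close Scope ereal_scope.

Section eheat.
Context {R : realType} {n : nat}.
Local Open Scope ereal_scope.
Local Notation mu := (@lebesgue_rV R n).
Implicit Types (f g : 'rV[R]_n -> \bar R) (s p q r t : R) (k : int).

Lemma eheatE t f x :
  eheat t f x = \int[mu]_y ((heat_kernel t (x - y))%:E * f y).
Proof. by rewrite unlock. Qed.

Lemma measurable_invr : measurable_fun [set: R] (fun x => x^-1 : R)%R.
Proof.
rewrite (_ : (fun x : R => x^-1)%R = (fun x : R =>
    if (0 <= x)%R then x `^ (-1) else - (- x) `^ (-1))%R); last first.
  apply/funext => x; case: ifPn => [x0|]; first by rewrite powR_inv1.
  by rewrite -ltNge => x0; rewrite powR_inv1 ?oppr_ge0 ?(ltW x0)// invrN opprK.
apply: measurable_fun_ifT => //=.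
- exact: measurable_fun_ler.
- by apply: measurableT_comp => //; apply: (measurableT_comp (measurable_powR _)).
Qed.

Lemma measurable_heat_kernel2 : measurable_fun setT
  (fun z : R * 'rV[R]_n => heat_kernel z.1 z.2).
Proof.
rewrite /heat_kernel; apply: measurable_funM.
  apply: (measurableT_comp (measurable_powR _)).
  by apply: measurable_funM.
apply: measurableT_comp => //; apply: measurable_funM.
  apply: measurableT_comp => //; apply: measurable_funX.
  by apply: measurableT_comp => //; exact: measurable_enorm.
apply: (measurableT_comp measurable_invr).
by apply: measurable_funM.
Qed.

Lemma measurable_heat_kernel3 d (T : measurableType d) (h : T -> R)
    (a b : T -> 'rV[R]_n) : measurable_fun setT h -> measurable_fun setT a ->
  measurable_fun setT b ->
  measurable_fun setT (fun z => heat_kernel (h z) (a z - b z)).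
Proof.
move=> mh ma mb.
apply: (measurableT_comp measurable_heat_kernel2 (_ : measurable_fun setT (fun z => (h z, a z - b z)%R))).
apply: measurable_fun_pair => //.
exact: (measurableT_comp measurable_rV_sub (measurable_fun_pair ma mb)).
Qed.

Lemma eheat_ge0 t f x : (forall x, 0 <= f x) -> 0 <= eheat t f x.
Proof.
rewrite eheatE => f0; apply: integral_ge0 => y _.
by rewrite mule_ge0// lee_fin heat_kernel_ge0.
Qed.

Lemma measurable_eheat_integrand t f x : measurable_fun setT f ->
  measurable_fun setT (fun y : 'rV[R]_n => (heat_kernel t (x - y))%:E * f y).
Proof.
move=> mf; apply: emeasurable_funM => //; apply/measurable_EFinP.
exact: measurable_heat_kernel_sub.
Qed.

(** Time and datum may both depend on the parameter, as they do in the Duhamel integrand. *)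
Lemma measurable_eheat2 d (T : measurableType d) (h : T -> R)
    (F : T * 'rV[R]_n -> \bar R) : measurable_fun setT h -> measurable_fun setT F ->
  (forall z, 0 <= F z) ->
  measurable_fun setT (fun z : T * 'rV[R]_n => eheat (h z.1) (fun y => F (z.1, y)) z.2).
Proof.
move=> mh mF F0; under eq_fun => z do rewrite eheatE.
apply: (@measurable_integral_in2 _ _ _ _ _ mu setT (fun w : (T * 'rV[R]_n) * 'rV[R]_n =>
  (heat_kernel (h w.1.1) (w.1.2 - w.2))%:E * F (w.1.1, w.2))) => //.
  apply: emeasurable_funM.
    apply/measurable_EFinP; apply: measurable_heat_kernel3 => //.
    - by apply: measurableT_comp => //; apply: measurableT_comp.
    - by apply: measurableT_comp.
  apply: (measurableT_comp mF).
  by apply: measurable_fun_pair => //; apply: measurableT_comp.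
by move=> w; rewrite mule_ge0// lee_fin heat_kernel_ge0.
Qed.

Lemma measurable_eheat t f : measurable_fun setT f -> (forall x, 0 <= f x) ->
  measurable_fun setT (eheat t f).
Proof.
move=> mf f0.
have := @measurable_eheat2 _ unit (cst t) (fun z => f z.2) (measurable_cst _) _ _.
move=> /(_ _)/(_ _) => /(_ (measurableT_comp mf measurable_snd) (fun z => f0 _)) H.
exact: (measurableT_comp H (pair1_measurable tt)).
Qed.

Lemma le_eheat t f g x : measurable_fun setT f -> measurable_fun setT g ->
  (forall x, 0 <= f x) -> (forall x, 0 <= g x) ->
  {ae mu, forall x, f x <= g x} -> eheat t f x <= eheat t g x.
Proof.
move=> mf mg f0 g0 fg; rewrite !eheatE; apply: ae_ge0_le_integral => //.
- by move=> y _; rewrite mule_ge0// lee_fin heat_kernel_ge0.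
- exact: measurable_eheat_integrand.
- by move=> y _; rewrite mule_ge0// lee_fin heat_kernel_ge0.
- exact: measurable_eheat_integrand.
apply: filterS fg => y fgy _; apply: lee_wpmul2l => //.
by rewrite lee_fin heat_kernel_ge0.
Qed.

Lemma eheatZ t (c : R) f x : (0 <= c)%R -> measurable_fun setT f ->
  (forall x, 0 <= f x) ->
  eheat t (fun y => c%:E * f y) x = c%:E * eheat t f x.
Proof.
move=> c0 mf f0; rewrite !eheatE -ge0_integralZl_EFin//.
- by apply: eq_integral => y _; rewrite muleCA.
- by move=> y _; rewrite mule_ge0// lee_fin heat_kernel_ge0.
- exact: measurable_eheat_integrand.
Qed.

Lemma eheat_int d (T : measurableType d) (nu : {sigma_finite_measure set T -> \bar R})
    (A : set T) (F : T * 'rV[R]_n -> \bar R) t x : measurable A ->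
  measurable_fun setT F -> (forall z, 0 <= F z) ->
  eheat t (fun y => \int[nu]_(u in A) F (u, y)) x =
  \int[nu]_(u in A) eheat t (fun y => F (u, y)) x.
Proof.
move=> mA mF F0; rewrite eheatE; under [RHS]eq_integral => u _ do rewrite eheatE.
have m1 : measurable_fun setT (fun z : T * 'rV[R]_n =>
    (heat_kernel t (x - z.2))%:E * F z).
  apply: emeasurable_funM => //; apply/measurable_EFinP.
  exact: measurable_heat_kernel3.
rewrite (tonelli_in nu mu mA measurableT m1); last first.
  by move=> z; rewrite mule_ge0// lee_fin heat_kernel_ge0.
apply: eq_integral => y _; rewrite /= ge0_integralZl_EFin//.
- by apply: measurable_funTS; exact: (measurableT_comp mF).
- exact: heat_kernel_ge0.
Qed.

Lemma eheat_semigroup s t f x : (0 < s)%R -> (0 < t)%R -> measurable_fun setT f ->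
  (forall x, 0 <= f x) -> eheat s (eheat t f) x = eheat (s + t) f x.
Proof.
move=> s0 t0 mf f0.
have m1 : measurable_fun setT (fun z : 'rV[R]_n * 'rV[R]_n =>
    (heat_kernel t (z.2 - z.1))%:E * f z.1).
  apply: emeasurable_funM; last exact: measurableT_comp.
  by apply/measurable_EFinP; exact: measurable_heat_kernel3.
rewrite (_ : eheat t f = fun z => \int[mu]_(y in setT) ((heat_kernel t (z - y))%:E * f y)); last first.
  by apply/funext => z; rewrite eheatE.
rewrite [LHS](@eheat_int _ _ mu setT (fun z => (heat_kernel t (z.2 - z.1))%:E * f z.1))//; last first.
  by move=> z; rewrite mule_ge0// lee_fin heat_kernel_ge0.
rewrite eheatE; apply: eq_integral => y _; rewrite eheatE.
under eq_integral => z _ do rewrite muleA -EFinM /=.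
rewrite ge0_integralZr//.
- by rewrite heat_kernel_conv.
- apply/measurable_EFinP; apply: measurable_funM.
    exact: measurable_heat_kernel_sub.
  by under eq_fun do rewrite heat_kernel_subC; exact: measurable_heat_kernel_sub.
- by move=> z _; rewrite lee_fin mulr_ge0// heat_kernel_ge0.
Qed.

(** The prefactor is estimated through [4 pi >= 1], the exponential by 1. *)
Lemma heat_kernel_le t (x : 'rV[R]_n) : (0 < t)%R ->
  (heat_kernel t x <= t `^ (- (n%:R / 2)))%R.
Proof.
move=> t0; rewrite /heat_kernel -[leRHS]mulr1; apply: ler_pM; rewrite ?powR_ge0 ?expR_ge0//.
  rewrite !powRN lef_pV2 ?posrE ?powR_gt0 ?mulr_gt0 ?pi_gt0//.
  apply: ge0_ler_powR; rewrite ?nnegrE ?divr_ge0 ?mulr_ge0 ?pi_ge0 ?(ltW t0)//.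
  by rewrite ler_peMl ?(ltW t0)//; have := pi_ge2 R; lra.
by rewrite -expR0 ler_expR mulNr oppr_le0 divr_ge0 ?sqr_ge0// mulr_ge0// ltW.
Qed.

(** Jensen's inequality for the probability density [heat_kernel t (x - y)]. *)
Lemma eheat_pow t f p x : (0 < t)%R -> (1 <= p)%R -> measurable_fun setT f ->
  (forall x, 0 <= f x) -> eheat t f x `^ p <= eheat t (fun y => f y `^ p) x.
Proof.
move=> t0 p1 mf f0; have p0 : (0 < p)%R by exact: lt_le_trans p1.
have Koo : \int[mu]_y (heat_kernel t (x - y))%:E < +oo.
  by rewrite heat_kernel_int// ltry.
have := power_mean_ineq (w := fun y : 'rV[R]_n => heat_kernel t (x - y))
  (h := fun y : 'rV[R]_n => (heat_kernel t (x - y))%:E * f y) p1 measurableT _ _ _ _ Koo.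
rewrite heat_kernel_int// poweR1r mul1e !eheatE; move=> /(_ _)/(_ _)/(_ _)/(_ _).
move=> /(_ (measurable_heat_kernel_sub _ _) (measurable_eheat_integrand _ _ mf)).
move=> /(_ (fun _ _ => heat_kernel_gt0 _ t0)) H.
apply: le_trans (H _) _ => [y _|]; first by rewrite mule_ge0// lee_fin heat_kernel_ge0.
rewrite le_eqVlt; apply/orP; left; apply/eqP; apply: eq_integral => y _.
rewrite poweRM// ?lee_fin ?heat_kernel_ge0// muleAC; congr (_ * _).
rewrite poweR_EFin -EFinM -powRD_gt0 ?heat_kernel_gt0// subrKC.
by rewrite powRr1 ?heat_kernel_ge0.
Qed.

Lemma eheat_sup t f p x : (0 < t)%R -> (1 <= p)%R -> measurable_fun setT f ->
  (forall x, 0 <= f x) ->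
  eheat t f x `^ p <= (t `^ (- (n%:R / 2)))%:E * \int[mu]_y f y `^ p.
Proof.
move=> t0 p1 mf f0; apply: le_trans (eheat_pow x t0 p1 mf f0) _.
have mfp : measurable_fun setT (fun y => f y `^ p).
  exact: (measurableT_comp (measurable_poweR p)).
rewrite eheatE -ge0_integralZl_EFin//; last 2 first.
- by move=> y _; exact: poweR_ge0.
- exact: powR_ge0.
apply: ge0_le_integral => //.
- by move=> y _; rewrite mule_ge0 ?poweR_ge0// lee_fin heat_kernel_ge0.
- exact: measurable_eheat_integrand.
- by apply: emeasurable_funM.
by move=> y _; apply: lee_wpmul2r; rewrite ?poweR_ge0// lee_fin heat_kernel_le.
Qed.

(** Integrate [eheat_pow] and exchange the integrals: by symmetry the kernel has mass 1 in the other
    variable too. *)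
Lemma eheat_contract t f p : (0 < t)%R -> (1 <= p)%R -> measurable_fun setT f ->
  (forall x, 0 <= f x) ->
  \int[mu]_x eheat t f x `^ p <= \int[mu]_y f y `^ p.
Proof.
move=> t0 p1 mf f0.
have mfp : measurable_fun setT (fun y => f y `^ p).
  exact: (measurableT_comp (measurable_poweR p)).
apply: (@le_trans _ _ (\int[mu]_x eheat t (fun y => f y `^ p) x)).
  apply: ge0_le_integral => //.
  - by move=> x _; exact: poweR_ge0.
  - by apply: (measurableT_comp (measurable_poweR p)); exact: measurable_eheat.
  - by apply: measurable_eheat => // x; exact: poweR_ge0.
  - by move=> x _; exact: eheat_pow.
have m1 : measurable_fun setT (fun z : 'rV[R]_n * 'rV[R]_n =>
    (heat_kernel t (z.1 - z.2))%:E * f z.2 `^ p).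
  apply: emeasurable_funM; last exact: (measurableT_comp mfp).
  by apply/measurable_EFinP; exact: measurable_heat_kernel3.
under eq_integral => x _ do rewrite eheatE.
rewrite (tonelli_in mu mu measurableT measurableT m1); last first.
  by move=> z; rewrite mule_ge0 ?poweR_ge0// lee_fin heat_kernel_ge0.
rewrite le_eqVlt; apply/orP; left; apply/eqP; apply: eq_integral => y _.
rewrite /= ge0_integralZr//.
- under eq_integral => x _ do rewrite heat_kernel_subC.
  by rewrite heat_kernel_int// mul1e.
- apply/measurable_EFinP.
  by under eq_fun do rewrite heat_kernel_subC; exact: measurable_heat_kernel_sub.
- by move=> x _; rewrite lee_fin heat_kernel_ge0.
- exact: poweR_ge0.
Qed.

(** Interpolation between the sup bound [eheat_sup] and the L^p contraction. *)
Lemma eheat_smoothing t f p r : (0 < t)%R -> (1 <= p)%R -> (p <= r)%R ->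
  measurable_fun setT f -> (forall x, 0 <= f x) ->
  (\int[mu]_x eheat t f x `^ r) `^ r^-1 <=
  (t `^ (- (n%:R / 2 * (p^-1 - r^-1))))%:E * (\int[mu]_y f y `^ p) `^ p^-1.
Proof.
move=> t0 p1 pr mf f0; have p0 : (0 < p)%R by exact: lt_le_trans p1.
have r0 : (0 < r)%R by exact: lt_le_trans pr.
set I := \int[mu]_y f y `^ p.
have I0 : 0 <= I by apply: integral_ge0 => y _; exact: poweR_ge0.
have [->|Ioo] := eqVneq I +oo.
  rewrite (@poweRyr _ p^-1) ?invr_neq0 ?gt_eqF// gt0_muley ?leey//.
  by rewrite lte_fin powR_gt0.
set S := (t `^ (- (n%:R / 2)))%:E * I.
have S0 : 0 <= S by rewrite mule_ge0// lee_fin powR_ge0.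
have rp0 : (0 <= r / p - 1)%R by rewrite subr_ge0 ler_pdivlMr// mul1r.
have H : \int[mu]_x eheat t f x `^ r <= S `^ (r / p - 1) * I.
  apply: (@le_trans _ _ (\int[mu]_x (S `^ (r / p - 1) * eheat t f x `^ p))).
    apply: ge0_le_integral => //.
    - by move=> x _; exact: poweR_ge0.
    - by apply: (measurableT_comp (measurable_poweR _)); exact: measurable_eheat.
    - apply: emeasurable_funM => //.
      by apply: (measurableT_comp (measurable_poweR _)); exact: measurable_eheat.
    - move=> x _; have e0 := eheat_ge0 t x f0.
      (* The splitting [g^r = (g^p)^(r/p - 1) g^p] also holds for infinite values, except that
         [r = p] needs a separate look because [+oo^0 = 1]. *)
      have -> : eheat t f x `^ r = (eheat t f x `^ p) `^ (r / p - 1) * eheat t f x `^ p.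
        rewrite -poweRrM -[X in _ * X `^ _]poweRe1//.
        rewrite -poweRrM mul1r mulrBr mulr1 mulrCA divff ?gt_eqF// mulr1.
        move: e0; case: (eheat t f x) => [u u0|_|//].
          rewrite !poweR_EFin -EFinM.
          move: u0; rewrite lee_fin le_eqVlt => /predU1P[<-|u0].
            by rewrite !(@powR0 _ r) ?(@powR0 _ p) ?mulr0// gt_eqF.
          by rewrite -powRD_gt0// subrK.
        rewrite (@poweRyr _ r) ?gt_eqF// (@poweRyr _ p) ?gt_eqF//.
        have [->|rp] := eqVneq (r - p)%R 0%R; first by rewrite poweRe0 mul1e.
        by rewrite poweRyr// mulyy.
      apply: lee_wpmul2r; first exact: poweR_ge0.
      by apply: le_poweR; [|exact: poweR_ge0|exact: eheat_sup].
  rewrite ge0_integralZl//; last 3 first.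
  - by apply: (measurableT_comp (measurable_poweR _)); exact: measurable_eheat.
  - by move=> x _; exact: poweR_ge0.
  - exact: poweR_ge0.
  by apply: lee_wpmul2l; [exact: poweR_ge0|exact: eheat_contract].
have r'0 : (0 <= r^-1)%R by rewrite invr_ge0 ltW.
apply: le_trans (le_poweR r'0 _ H) _.
  by apply: integral_ge0 => x _; exact: poweR_ge0.
move: I0 Ioo @S S0 H; case: I => [i|//|//]; rewrite lee_fin => i0 _ S _ _.
rewrite /S -EFinM !poweR_EFin -!EFinM lee_fin.
move: i0; rewrite le_eqVlt => /predU1P[<-|i0].
  rewrite !mulr0 powR0 ?invr_neq0 ?gt_eqF// powR0 ?invr_neq0 ?gt_eqF//.
rewrite (@powRM _ (t `^ _)%R i) ?powR_ge0 ?(ltW i0)// -[((_ * _) * i)%R]mulrA (powRB1_mul (r / p) i0).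
rewrite powRM ?powR_ge0// -!powRrM le_eqVlt; apply/orP; left; apply/eqP.
by congr (_ `^ _ * _ `^ _)%R; field; rewrite !gt_eqF.
Qed.

End eheat.

(** * The heat flow between Herz spaces *)

Section real_bounds.
Context {R : realType}.
Implicit Types (a b t x y z : R) (k j : int).

Lemma powR_expR x a : 0 < x -> x `^ a = expR (a * ln x).
Proof. by move=> x0; rewrite /powR gt_eqF. Qed.

Lemma ln_le_sub1 x : 0 < x -> ln x <= x - 1.
Proof.
move=> x0; rewrite -ler_expR lnK ?posrE//.
by have := expR_ge1Dx (x - 1); rewrite subrKC.
Qed.

(** A Gaussian beats every power, in logarithmic variables. The number 128 is the one in
    [heat_kernel_far]. *)
Lemma gaussian_power a : 0 <= a -> exists2 C : R, 1 <= C &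
  forall y, expR (a * y) * expR (- expR (2 * y) / 128) <= C.
Proof.
rewrite le_eqVlt => /predU1P[<-|a0].
  exists 1 => // y; rewrite mul0r expR0 mul1r -[leRHS]expR0 ler_expR.
  by rewrite mulNr oppr_le0 divr_ge0// expR_ge0.
(* The exponent is largest at [e^(2y) = 64 a], and [ln x <= x - 1] compares [y] with this point; the
   summand 1 provides [1 <= C]. *)
exists (expR (a / 2 * ln (64 * a)) + 1); first by rewrite lerDr expR_ge0.
move=> y; rewrite -expRD ler_wpDr// ler_expR.
have a64 : 0 < 64 * a by rewrite mulr_gt0.
have := @ln_le_sub1 (expR (2 * y) / (64 * a)) _.
rewrite divr_gt0 ?expR_gt0// => /(_ isT).
rewrite ln_div ?posrE ?expR_gt0// expRK => H.
have {}H : a / 2 * (2 * y - ln (64 * a)) <= a / 2 * (expR (2 * y) / (64 * a)).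
  by rewrite ler_pM2l ?divr_gt0//; apply: le_trans H _; rewrite gerBl.
move: H; rewrite (_ : a / 2 * (expR (2 * y) / (64 * a)) = expR (2 * y) / 128).
  by rewrite mulrBr; lra.
by field; rewrite gt_eqF.
Qed.

(** After translation by [k0] the integer of index [i] has absolute value at least [i / 2], so the
    sum is dominated by a geometric series of ratio [e^(-c/2)], whatever [k0]. *)
Lemma esum_geometric c : 0 < c -> exists2 G : R, 0 < G &
  forall k0 : int, (\esum_(k in [set: int])
    (expR (- (c * `|k%:~R - k0%:~R|)))%:E <= G%:E)%E.
Proof.
move=> c0; set z := expR (- (c / 2)).
have z0 : 0 < z by exact: expR_gt0.
have z1 : z < 1 by rewrite -[ltRHS]expR0 ltr_expR oppr_lt0 divr_gt0.
exists (1 - z)^-1; first by rewrite invr_gt0 subr_gt0.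
move=> k0.
have bij : set_bij [set: int] [set: int] (fun k => k + k0).
  split => //; first by move=> i j _ _ /addIr.
  by move=> k _; exists (k - k0) => //; rewrite subrK.
rewrite (@reindex_esum R _ _ setT setT (fun k => k + k0) _ bij).
under eq_esum => k _ do rewrite intrD addrK.
rewrite esum_int_series => [|k]; last by rewrite lee_fin expR_ge0.
apply: lime_le; first by apply: is_cvg_nneseries => i _ _; rewrite lee_fin expR_ge0.
apply: nearW => N; rewrite sumEFin lee_fin.
have H (i : nat) : expR (- (c * `|(int_of_index i)%:~R|)) <= z ^+ i.
  rewrite /z -expRM_natl ler_expR.
  have -> : i%:R * - (c / 2) = - (c * (i%:R / 2)) by ring.
  rewrite lerN2 ler_pM2l// /int_of_index.
  have := odd_double_half i; set h := i./2; case: (odd i) => /= E.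
    have -> : i%:R = 1 + h%:R * 2 :> R by rewrite -E natrD -muln2 natrM.
    rewrite NegzE mulrNz normrN -pmulrn ger0_norm ?ler0n// -[h.+1%:R]natr1.
    by lra.
  have -> : i%:R = h%:R * 2 :> R by rewrite -E add0n -muln2 natrM.
  by rewrite mulfK// -pmulrn ger0_norm.
apply: (@le_trans _ _ (\sum_(0 <= i < N) z ^+ i)); first exact: ler_sum.
elim: N => [|N _]; first by rewrite big_nil invr_ge0 subr_ge0 ltW.
have -> : \sum_(0 <= i < N.+1) z ^+ i = (1 - z ^+ N.+1) / (1 - z).
  elim: N => [|N IH].
    by rewrite big_nat1 expr0 expr1 divff// subr_eq0 gt_eqF.
  rewrite big_nat_recr//= IH [in RHS]exprS; field.
  by rewrite subr_eq0 gt_eqF.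
rewrite -[leRHS]mul1r ler_pM2r ?invr_gt0 ?subr_gt0//.
by rewrite gerBl exprn_ge0// ltW.
Qed.

End real_bounds.

(** * Coefficients of the heat flow between two annuli *)

Section block_coefficients.
Context {R : realType}.
Variables (m p r s al : R).
Hypotheses (m0 : 0 <= m) (p1 : 1 <= p) (pr : p <= r) (s_gt : - (m / r) < s)
  (s_le : s <= al) (al_le : al <= m * (1 - p^-1)).

Let th := (m / p - m / r + al - s) / 2.

(** Relative to the scale [sqrt t], with [y = ln (2^k / sqrt t)] and [z = ln (2^j / sqrt t)], the
    powers on the left amount to [e^(sg y) e^(mm z)] with [sg = s + m/r > 0] and
    [mm = m(1 - 1/p) - al >= 0]. The Gaussians turn the first factor into decay in [|y|] and keep
    the second bounded; for [mm = 0] no decay in [j] is left. The index [k0] is that of the scale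
    [sqrt t]. *)
Lemma far_coeff : exists2 C : R, 0 < C & forall t (k j k0 : int), 0 < t ->
  k0%:~R * ln 2 <= ln t / 2 < (k0%:~R + 1) * ln 2 ->
  2 `^ (k%:~R * s) * 2 `^ ((k%:~R + 1) * m / r) * t `^ (- (m / 2)) *
  expR (- (2 `^ k%:~R) ^+ 2 / (128 * t)) *
  expR (- (2 `^ j%:~R) ^+ 2 / (128 * t)) *
  2 `^ ((j%:~R + 1) * m * (1 - p^-1)) <=
  C * t `^ (- th) * 2 `^ (j%:~R * al) *
    expR (- ((s + m / r) * ln 2 * `|k%:~R - k0%:~R|)).
Proof.
set L : R := ln 2; have L0 : 0 < L by rewrite ln_gt0// ltr1n.
set sg := s + m / r; have sg0 : 0 < sg by rewrite /sg -[m / r]opprK subr_gt0.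
set mm := m * (1 - p^-1) - al; have mm0 : 0 <= mm by rewrite subr_ge0.
(* Twice the exponent [sg]: one half cancels the growth for [y >= 0], the other becomes decay. For
   negative [y] the power decays by itself. *)
have [C1 C1_ge1 HC1] := gaussian_power (mulr_ge0 (ler0n R 2) (ltW sg0)).
have [C2 C2_ge1 HC2] := gaussian_power mm0.
have C10 : 0 < C1 by exact: lt_le_trans C1_ge1.
have C20 : 0 < C2 by exact: lt_le_trans C2_ge1.
exists (C1 * C2 * expR (sg * L + L * m / r + L * m * (1 - p^-1))).
  by rewrite !mulr_gt0 ?expR_gt0.
move=> t k j k0 t0 /andP[k0t tk0].
set u : R := ln t / 2 in k0t tk0 *.
have tE : ln t = 2 * u by rewrite /u mulrC divfK.
have gE (i : int) : - (2 `^ i%:~R) ^+ 2 / (128 * t) = - expR (2 * (i%:~R * L - u)) / 128.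
  rewrite powR_expR// -expRM_natl mulrBr expRB -tE lnK ?posrE//.
  by field; rewrite gt_eqF.
rewrite !gE; set y := k%:~R * L - u; set z := j%:~R * L - u.
have Ey : expR (sg * y) * expR (- expR (2 * y) / 128) <= C1 * expR (- (sg * `|y|)).
  have [y0|y0] := leP 0 y.
    rewrite ger0_norm// expRN ler_pdivlMr ?expR_gt0// mulrAC -expRD.
    by have := HC1 y; rewrite (_ : 2 * sg * y = sg * y + sg * y)//; ring.
  rewrite ltr0_norm// mulrN opprK mulrC; apply: ler_pM => //; rewrite ?expR_ge0//.
  apply: le_trans C1_ge1; rewrite -[leRHS]expR0 ler_expR.
  by rewrite mulNr oppr_le0 divr_ge0// expR_ge0.
have Ez := HC2 z.
have yk : - (sg * `|y|) <= sg * L - sg * L * `|k%:~R - k0%:~R|.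
  rewrite -mulrA -mulrBr -mulrN ler_pM2l// lerNl opprB.
  have -> : L * `|k%:~R - k0%:~R| = `|(k%:~R - k0%:~R) * L|.
    by rewrite normrM (gtr0_norm L0) mulrC.
  rewrite lerBlDr.
  have -> : (k%:~R - k0%:~R) * L = y + (u - k0%:~R * L) by rewrite /y; ring.
  apply: le_trans (ler_normD _ _) _; rewrite lerD2l ger0_norm ?subr_ge0//.
  by rewrite lerBlDr; apply: ltW; apply: lt_le_trans tk0 _; lra.
(* Homogeneity: after factoring out [t^(-th) 2^(j al)], only the scaled variables [y] and [z] and a
   constant remain. *)
have E1 : 2 `^ (k%:~R * s) * 2 `^ ((k%:~R + 1) * m / r) * t `^ (- (m / 2)) *
    2 `^ ((j%:~R + 1) * m * (1 - p^-1)) =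
    t `^ (- th) * 2 `^ (j%:~R * al) * expR (sg * y) * expR (mm * z) *
    expR (L * m / r + L * m * (1 - p^-1)).
  rewrite !powR_expR// tE -/L -!expRD; congr expR.
  rewrite /th /sg /mm /y /z; lra.
apply: (@le_trans _ _ (t `^ (- th) * 2 `^ (j%:~R * al) *
    expR (L * m / r + L * m * (1 - p^-1)) *
    ((expR (sg * y) * expR (- expR (2 * y) / 128)) *
     (expR (mm * z) * expR (- expR (2 * z) / 128))))).
  rewrite le_eqVlt; apply/orP; left; apply/eqP.
  move: E1; set A := 2 `^ (_ * s); set B := 2 `^ (_ * m / r); set D := t `^ (- (m / 2)).
  set E := 2 `^ (_ * (1 - p^-1)) => E1.
  transitivity ((A * B * D * E) * (expR (- expR (2 * y) / 128) * expR (- expR (2 * z) / 128))).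
    by ring.
  by rewrite E1; ring.
apply: (@le_trans _ _ (t `^ (- th) * 2 `^ (j%:~R * al) *
    expR (L * m / r + L * m * (1 - p^-1)) *
    (C1 * expR (- (sg * `|y|)) * C2))).
  apply: ler_wpM2l; first by rewrite !mulr_ge0 ?powR_ge0 ?expR_ge0.
  by apply: ler_pM => //; rewrite mulr_ge0 ?expR_ge0.
have yk' : expR (- (sg * `|y|)) <= expR (sg * L) * expR (- (sg * L * `|k%:~R - k0%:~R|)).
  by rewrite -expRD ler_expR.
rewrite (_ : sg * L + L * m / r + L * m * (1 - p^-1) =
  sg * L + (L * m / r + L * m * (1 - p^-1))); last by ring.
rewrite (expRD (sg * L)).
set X := t `^ _; set Y := 2 `^ _; set Z := expR (_ + _).
rewrite [leRHS](_ : _ = X * Y * Z * (C1 * (expR (sg * L) * expR (- (sg * L * `|k%:~R - k0%:~R|))) * C2)).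
  apply: ler_wpM2l; first by rewrite !mulr_ge0 ?powR_ge0 ?expR_ge0.
  by rewrite ler_pM2r// ler_pM2l.
by ring.
Qed.

(** The first entry of the minimum is L^p-L^r smoothing, the second the sup bound of the kernel. If
    [2^j >= sqrt t] smoothing suffices because [s <= al]; if [2^j] is smaller, the sup bound does
    because [s + m/r + m(1 - 1/p) - al] is positive. *)
Lemma near_coeff : exists2 C : R, 0 < C & forall t (k j : int), 0 < t ->
  `|k%:~R - j%:~R| <= 1 :> R ->
  Num.min (2 `^ (k%:~R * s) * t `^ (- (m / 2 * (p^-1 - r^-1))))
   (2 `^ (k%:~R * s) * 2 `^ ((k%:~R + 1) * m / r) * t `^ (- (m / 2)) *
    2 `^ ((j%:~R + 1) * m * (1 - p^-1))) <=
  C * t `^ (- th) * 2 `^ (j%:~R * al).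
Proof.
set L : R := ln 2; have L0 : 0 < L by rewrite ln_gt0// ltr1n.
set sg := s + m / r; have sg0 : 0 < sg by rewrite /sg -[m / r]opprK subr_gt0.
set mm := m * (1 - p^-1) - al; have mm0 : 0 <= mm by rewrite subr_ge0.
exists (expR (`|s| * L + sg * L + L * m / r + L * m * (1 - p^-1))).
  exact: expR_gt0.
move=> t k j t0 kj; set u : R := ln t / 2.
have tE : ln t = 2 * u by rewrite /u mulrC divfK.
have p0 : 0 < p by exact: lt_le_trans p1.
have r0 : 0 < r by exact: lt_le_trans pr.
have q1 : 0 <= L * m / r by rewrite divr_ge0 ?mulr_ge0 ?(ltW L0) ?(ltW r0).
have q2 : 0 <= L * m * (1 - p^-1).
  by rewrite mulr_ge0 ?mulr_ge0 ?(ltW L0)// subr_ge0 invf_le1.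
have q3 : 0 <= sg * L by rewrite mulr_ge0 ?ltW.
have q4 : 0 <= `|s| * L by rewrite mulr_ge0 ?normr_ge0 ?(ltW L0).
rewrite ge_min; set z := j%:~R * L - u; apply/orP.
rewrite !powR_expR// tE -/L -!expRD !ler_expR.
have [z0|z0] := leP 0 z; [left|right].
  have h1 : (k%:~R - j%:~R) * s * L <= `|s| * L.
    rewrite ler_pM2r//; apply: le_trans (ler_norm _) _; rewrite normrM.
    by rewrite ler_piMl.
  have h2 : 0 <= (al - s) * z by rewrite mulr_ge0// subr_ge0.
  by move: h2; rewrite /z /th; lra.
have h1 : (k%:~R - j%:~R) * sg * L <= sg * L.
  rewrite ler_pM2r//; rewrite -[leRHS]mul1r ler_pM2r//.
  by apply: le_trans kj; exact: ler_norm.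
have h2 : (sg + mm) * z <= 0.
  by apply: mulr_ge0_le0; [rewrite addr_ge0// ltW|exact: ltW].
move: h1 h2; rewrite /z /th /sg /mm; lra.
Qed.

End block_coefficients.

(** * Restriction to annuli and estimates of single blocks *)

Section rpart.
Context {R : realType} {n : nat}.
Local Open Scope ereal_scope.
Local Notation mu := (@lebesgue_rV R n).
Implicit Types (f g : 'rV[R]_n -> \bar R) (s p q r t : R) (k j : int).

Definition rpart j f (y : 'rV[R]_n) : \bar R := f y * (\1_(annulus j) y)%:E.

Lemma rpart_ge0 j f y : (forall x, 0 <= f x) -> 0 <= rpart j f y.
Proof. by move=> f0; rewrite mule_ge0// lee_fin indicE; case: (_ \in _). Qed.

Lemma measurable_rpart j f : measurable_fun setT f -> measurable_fun setT (rpart j f).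
Proof.
move=> mf; apply: emeasurable_funM => //; apply/measurable_EFinP.
by apply: measurable_indic; exact: measurable_annulus.
Qed.

Lemma rpartE j f y : rpart j f y = if y \in annulus j then f y else 0.
Proof. by rewrite /rpart indicE; case: (_ \in _); rewrite ?mule1 ?mule0. Qed.

Lemma annulus_inj j k (y : 'rV[R]_n) : annulus j y -> annulus k y -> j = k.
Proof.
have two1 : (1 < 2 :> R)%R by rewrite ltr1n.
move=> /annulusP/andP[j1 j2] /annulusP/andP[k1 k2].
have := le_lt_trans j1 k2; have := le_lt_trans k1 j2.
rewrite !ltr_eXz2l// => h1 h2; apply/eqP; rewrite eq_le; lia.
Qed.

Lemma esum_rpart f y : (0 < n)%N -> (forall x, 0 <= f x) -> y != 0%R ->
  \esum_(j in [set: int]) rpart j f y = f y.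
Proof.
move=> n0 f0 y0; have [k Ak] := annulus_cover y0.
transitivity (\esum_(j in [set k]) f y); last exact: esum_set1.
rewrite [RHS]esum_mkcond; apply: eq_esum => j _; rewrite rpartE.
have [jk|jk] := eqVneq j k; first by rewrite jk !mem_set.
rewrite !memNset//=; first exact/eqP.
by move=> Aj; move/eqP : jk; apply; exact: annulus_inj Ak.
Qed.

Lemma ae_neq0 : (0 < n)%N -> {ae mu, forall x, x != 0%R}.
Proof.
move=> n0; apply: ae_annuli => // k; apply: nearW => x /annulusP/andP[xk _].
by apply/eqP => x0; move: xk; rewrite x0 enorm0 leNgt exprz_gt0.
Qed.

Lemma integral_rpart j f (h : 'rV[R]_n -> \bar R) :
  \int[mu]_y (h y * rpart j f y) = \int[mu]_(y in annulus j) (h y * f y).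
Proof.
rewrite [RHS]integral_mkcond; apply: eq_integral => y _.
by rewrite rpartE /patch; case: ifPn; rewrite ?mule0.
Qed.

Lemma integral_rpart_pow j f p : (0 < p)%R ->
  \int[mu]_y (rpart j f y `^ p) = \int[mu]_(y in annulus j) f y `^ p.
Proof.
move=> p0; rewrite [RHS]integral_mkcond; apply: eq_integral => y _.
by rewrite rpartE /patch; case: ifPn => // _; rewrite poweR0r ?gt_eqF.
Qed.

Lemma eheat_esum t f x : (0 < n)%N -> measurable_fun setT f -> (forall x, 0 <= f x) ->
  eheat t f x = \esum_(j in [set: int]) eheat t (rpart j f) x.
Proof.
move=> n0 mf f0; rewrite eheatE; under eq_esum => j _ do rewrite eheatE.
rewrite -integral_esum_int//; last 2 first.
- by move=> j; apply: measurable_eheat_integrand; exact: measurable_rpart.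
- by move=> j y _; rewrite mule_ge0 ?lee_fin ?heat_kernel_ge0 ?rpart_ge0.
apply: ge0_ae_eq_integral => //.
- exact: measurable_eheat_integrand.
- apply: measurable_esum_int => j.
    by apply: measurable_eheat_integrand; exact: measurable_rpart.
  by move=> y; rewrite mule_ge0 ?lee_fin ?heat_kernel_ge0 ?rpart_ge0.
- by move=> y _; rewrite mule_ge0 ?lee_fin ?heat_kernel_ge0.
- move=> y _; apply: esum_ge0 => j _.
  by rewrite mule_ge0 ?lee_fin ?heat_kernel_ge0 ?rpart_ge0.
apply: filterS (ae_neq0 n0) => y y0 _.
rewrite esum_intZl ?heat_kernel_ge0//; last by move=> j; exact: rpart_ge0.
by rewrite esum_rpart.
Qed.

Lemma ring_norm_sup r k g (c : \bar R) : (0 < r)%R -> measurable_fun setT g ->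
  (forall x, 0 <= g x) -> 0 <= c -> (forall x, annulus k x -> g x <= c) ->
  ring_norm r k g <= (2 `^ ((k%:~R + 1) * n%:R / r))%:E * c.
Proof.
move=> r0 mg g0 c0 gc; have r'0 : (0 <= r^-1)%R by rewrite invr_ge0 ltW.
have mA := @measurable_annulus R n k.
apply: (@le_trans _ _ ((c `^ r * mu (annulus k)) `^ r^-1)).
  apply: le_poweR => //; first by apply: integral_ge0 => x _; exact: poweR_ge0.
  rewrite -integral_cst//; apply: ge0_le_integral => //.
  - by move=> x _; exact: poweR_ge0.
  - by apply: measurable_funTS; exact: (measurableT_comp (measurable_poweR r)).
  - by move=> x Ax; apply: le_poweR => //; [exact: ltW|exact: gc].
rewrite poweRM ?poweR_ge0// -poweRrM divff ?gt_eqF// poweRe1// muleC.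
apply: lee_wpmul2r => //; rewrite powRrM -poweR_EFin.
by apply: le_poweR => //; exact: lebesgue_annulus.
Qed.

Lemma eheat_rpart_le t j f x (c : R) : measurable_fun setT f ->
  (forall x, 0 <= f x) -> (0 <= c)%R ->
  (forall y, annulus j y -> (heat_kernel t (x - y) <= c)%R) ->
  eheat t (rpart j f) x <= c%:E * ring_norm 1 j f.
Proof.
move=> mf f0 c0 Kc; rewrite eheatE integral_rpart /ring_norm invr1.
have mA := @measurable_annulus R n j.
rewrite poweRe1; last by apply: integral_ge0 => y _; exact: poweR_ge0.
under [X in _ * X]eq_integral => y _ do rewrite poweRe1//.
rewrite -ge0_integralZl_EFin//; last exact: measurable_funTS.
apply: ge0_le_integral => //.
- by move=> y _; rewrite mule_ge0// lee_fin heat_kernel_ge0.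
- by apply: measurable_funTS; exact: measurable_eheat_integrand.
- by apply: emeasurable_funM => //; exact: measurable_funTS.
by move=> y Ay; apply: lee_wpmul2r => //; rewrite lee_fin Kc.
Qed.

(** Hoelder from L^p to L^1 on the source annulus, the kernel bound from L^1 to L^oo, and the volume
    of the target annulus from L^oo to L^r. *)
Lemma block_sup t k j f p r (c : R) : (1 <= p)%R -> (0 < r)%R ->
  measurable_fun setT f -> (forall x, 0 <= f x) -> (0 <= c)%R ->
  (forall x y : 'rV[R]_n, annulus k x -> annulus j y ->
    (heat_kernel t (x - y) <= c)%R) ->
  ring_norm r k (eheat t (rpart j f)) <=
  (2 `^ ((k%:~R + 1) * n%:R / r) * c * 2 `^ ((j%:~R + 1) * n%:R * (1 - p^-1)))%:E *
  ring_norm p j f.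
Proof.
move=> p1 r0 mf f0 c0 Kc.
apply: (@le_trans _ _ ((2 `^ ((k%:~R + 1) * n%:R / r))%:E * (c%:E * ring_norm 1 j f))).
  apply: ring_norm_sup => //.
  - by apply: measurable_eheat; [exact: measurable_rpart|move=> y; exact: rpart_ge0].
  - by move=> x; apply: eheat_ge0 => y; exact: rpart_ge0.
  - by rewrite mule_ge0 ?lee_fin ?ring_norm_ge0.
  - by move=> x Ax; apply: eheat_rpart_le => // y Ay; exact: Kc.
rewrite muleA -EFinM [leRHS](_ : _ = (2 `^ ((k%:~R + 1) * n%:R / r) * c)%:E *
  ((2 `^ ((j%:~R + 1) * n%:R * (1 - p^-1)))%:E * ring_norm p j f)); last first.
  by rewrite muleA -EFinM.
apply: lee_wpmul2l; first by rewrite lee_fin mulr_ge0 ?powR_ge0.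
by have := @ring_norm_hoelder R n p 1 j f (lexx 1%R) p1 mf f0; rewrite invr1.
Qed.

Lemma block_smoothing t k j f p r : (0 < t)%R -> (1 <= p)%R -> (p <= r)%R ->
  measurable_fun setT f -> (forall x, 0 <= f x) ->
  ring_norm r k (eheat t (rpart j f)) <=
  (t `^ (- (n%:R / 2 * (p^-1 - r^-1))))%:E * ring_norm p j f.
Proof.
move=> t0 p1 pr mf f0; have p0 : (0 < p)%R by exact: lt_le_trans p1.
have r0 : (0 < r)%R by exact: lt_le_trans pr.
have mrf := measurable_rpart j mf; have rf0 y := rpart_ge0 j y f0.
have := eheat_smoothing t0 p1 pr mrf rf0; rewrite integral_rpart_pow//.
apply: le_trans; apply: le_poweR; first by rewrite invr_ge0 ltW.
  by apply: integral_ge0 => x _; exact: poweR_ge0.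
apply: ge0_subset_integral => //; first exact: measurable_annulus.
  by apply: (measurableT_comp (measurable_poweR r)); exact: measurable_eheat.
by move=> x _; exact: poweR_ge0.
Qed.

(* [|x - y|] is at least a quarter of the larger radius; this Gaussian factor is
   shared between the two radii. *)
Lemma heat_kernel_far t k j (x y : 'rV[R]_n) : (0 < t)%R ->
  annulus k x -> annulus j y -> (1 < `|k%:~R - j%:~R : R|)%R ->
  (heat_kernel t (x - y) <= t `^ (- (n%:R / 2)) *
    expR (- (2 `^ k%:~R) ^+ 2 / (128 * t)) *
    expR (- (2 `^ j%:~R) ^+ 2 / (128 * t)))%R.
Proof.
move=> t0.
wlog kj : k j x y / (k%:~R - j%:~R <= 0 :> R)%R => [H Ax Ay kj|].
  have [kj0|kj0] := leP (k%:~R - j%:~R : R)%R 0%R; first exact: H.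
  rewrite heat_kernel_subC mulrAC; apply: H => //.
    by rewrite -opprB oppr_le0 ltW.
  by rewrite distrC.
move=> /annulusP/andP[_ xk] /annulusP/andP[yj _]; rewrite ler0_norm// opprB.
rewrite -intrB -[X in (X < _)%R](_ : 1%:~R = 1%R :> R)%R// ltr_int => jk.
have t4 : (0 < 4 * t)%R by rewrite mulr_gt0.
rewrite !pow2_exprz in xk yj.
set a := (2 `^ k%:~R : R)%R in xk *; set b := (2 `^ j%:~R : R)%R.
have a0 : (0 < a)%R by rewrite powR_gt0.
have b0 : (0 < b)%R by rewrite powR_gt0.
have yb : (b / 2 <= enorm y)%R.
  apply: le_trans yj; rewrite intrB powRD_gt0// -/b.
  by rewrite (_ : - 1%:~R = -1)%R// powR_inv1.
(* The indices differ by at least 2. *)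
have ab : (4 * a <= b)%R.
  have -> : (4 * a = 2 `^ (k%:~R + 2) :> R)%R.
    by rewrite powRD_gt0// -/a (@powR_mulrn R 2 2)//; ring.
  rewrite /b ler_powR ?ler1n// (_ : k%:~R + 2 = (k + 2)%:~R)%R ?ler_int//; last by rewrite intrD.
  by lia.
have q := enorm_quasi y x; rewrite enorm_subC in q.
(* From [b^2/4 <= |y|^2 <= 2 |x - y|^2 + 2 |x|^2] and [|x| <= b/4]. *)
have d2 : (b ^+ 2 / 16 <= enorm (x - y) ^+ 2)%R.
  have h1 : ((b / 2) ^+ 2 <= enorm y ^+ 2)%R.
    by rewrite ler_pXn2r// nnegrE ?enorm_ge0// divr_ge0// ltW.
  have h2 : (enorm x ^+ 2 <= (b / 4) ^+ 2)%R.
    rewrite ler_pXn2r// ?nnegrE ?enorm_ge0 ?divr_ge0 ?(ltW b0)//.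
    by apply: ltW; apply: lt_le_trans xk _; lra.
  by move: q h1 h2; rewrite !expr_div_n; lra.
rewrite /heat_kernel -[leRHS]mulrA -expRD; apply: ler_pM; rewrite ?powR_ge0 ?expR_ge0//.
  rewrite !powRN lef_pV2 ?posrE ?powR_gt0 ?mulr_gt0 ?pi_gt0//.
  apply: ge0_ler_powR; rewrite ?nnegrE ?divr_ge0 ?mulr_ge0 ?pi_ge0 ?(ltW t0)//.
  by rewrite ler_peMl ?(ltW t0)//; have := pi_ge2 R; lra.
(* Here [|x - y|^2 / (4t) >= b^2 / (64t) >= (a^2 + b^2) / (128t)], the origin of 128. *)
rewrite ler_expR !mulNr -opprD lerN2 -mulrDl.
rewrite ler_pdivlMr// (_ : _ / (128 * t) * (4 * t) = (a ^+ 2 + b ^+ 2) / 32)%R; last first.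
  by field; rewrite gt_eqF.
have : (a ^+ 2 <= b ^+ 2)%R.
  by rewrite ler_pXn2r ?nnegrE ?(ltW a0) ?(ltW b0)//; lra.
by lra.
Qed.

End rpart.

(** * The heat flow from one Herz space to another *)

Section heat_herz.
Context {R : realType} {n : nat}.
Hypothesis n0 : (0 < n)%N.
Local Open Scope ereal_scope.
Local Notation mu := (@lebesgue_rV R n).
Local Notation N := (n%:R : R).

(** An [l^1] matrix estimate: entries dominated by profiles whose sums over the target index [k] are
    bounded uniformly in the source index [j]. *)
Lemma heat_herz (p r s al : R) : (1 <= p)%R -> (p <= r)%R ->
  (- (N / r) < s)%R -> (s <= al)%R -> (al <= N * (1 - p^-1))%R ->
  exists2 C : R, (0 < C)%R & forall t (f : 'rV[R]_n -> \bar R), (0 < t)%R ->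
    measurable_fun setT f -> (forall x, 0 <= f x) ->
    eherz s r (eheat t f) <=
      (C * t `^ (- ((N / p - N / r + al - s) / 2)))%:E * eherz al p f.
Proof.
move=> p1 pr sr sal alp; have N0 : (0 <= N)%R by rewrite ler0n.
have r0 : (0 < r)%R by apply: lt_le_trans (le_trans p1 pr).
have r1 : (1 <= r)%R by exact: le_trans pr.
set th := ((N / p - N / r + al - s) / 2)%R.
have [C1 C10 far] := far_coeff sr alp.
have [C2 C20 near] := near_coeff N0 p1 pr sr sal alp.
have ln20 : (0 < ln (2 : R))%R by rewrite ln_gt0// ltr1n.
have sg0 : (0 < (s + N / r) * ln 2)%R.
  by rewrite mulr_gt0//; lra.
have [G1 G10 HG1] := esum_geometric sg0.
have [G2 G20 HG2] := esum_geometric (@ltr01 R).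
exists (C1 * G1 + C2 * expR 1 * G2)%R; first by rewrite addr_gt0 ?mulr_gt0 ?expR_gt0.
move=> t f t0 mf f0.
(* Defined by [2^k0 <= sqrt t < 2^(k0 + 1)]. *)
set k0 : int := Num.floor (ln t / 2 / ln 2).
have k0P : (k0%:~R * ln 2 <= ln t / 2 < (k0%:~R + 1) * ln 2)%R.
  rewrite -ler_pdivlMr// -ltr_pdivrMr//.
  by have := floor_itv (ln t / 2 / ln 2)%R; rewrite intrD.
set D := (t `^ (- th))%R; have D0 : (0 <= D)%R by rewrite powR_ge0.
pose w k := expR (- ((s + N / r) * ln 2 * `|k%:~R - k0%:~R|))%R.
pose w' (k j : int) := expR (- (1 * `|k%:~R - j%:~R : R|))%R.
have mr j := measurable_rpart j mf; have rf0 j y := rpart_ge0 j y f0.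
(* Two profiles: [w], concentrated at the scale [sqrt t], dominates distant pairs of annuli, and
   [w'], concentrated on the diagonal, adjacent ones. Their sum dominates every entry. *)
have block (k j : int) :
    (2 `^ (k%:~R * s))%:E * ring_norm r k (eheat t (rpart j f)) <=
    (D * (C1 * w k + C2 * expR 1 * w' k j))%:E * ((2 `^ (j%:~R * al))%:E * ring_norm p j f).
  have w0 : (0 <= w k)%R by exact: expR_ge0.
  have w'0 : (0 <= w' k j)%R by exact: expR_ge0.
  have rn0 : 0 <= ring_norm p j f by exact: ring_norm_ge0.
  have sup c : (0 <= c)%R -> (forall x y : 'rV[R]_n, annulus k x -> annulus j y ->
      (heat_kernel t (x - y) <= c)%R) ->
      (2 `^ (k%:~R * s))%:E * ring_norm r k (eheat t (rpart j f)) <=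
      (2 `^ (k%:~R * s) * (2 `^ ((k%:~R + 1) * n%:R / r) * c *
         2 `^ ((j%:~R + 1) * n%:R * (1 - p^-1))))%:E * ring_norm p j f.
    move=> c0 Kc; rewrite EFinM -muleA; apply: lee_wpmul2l.
      by rewrite lee_fin powR_ge0.
    exact: block_sup.
  have [kj|kj] := ltP 1%R (`|k%:~R - j%:~R : R|)%R.
    apply: le_trans (sup _ _ (fun x y Ax Ay => heat_kernel_far t0 Ax Ay kj)) _.
      by rewrite !mulr_ge0 ?powR_ge0 ?expR_ge0.
    rewrite muleA -EFinM; apply: lee_wpmul2r => //; rewrite lee_fin.
    have := far t k j k0 t0 k0P; rewrite -/th -/D -/(w k) => H.
    apply: (@le_trans _ _ (C1 * D * 2 `^ (j%:~R * al) * w k)%R).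
      by apply: le_trans H; rewrite !mulrA.
    have : (0 <= D * (C2 * expR 1 * w' k j) * 2 `^ (j%:~R * al))%R.
      by rewrite !mulr_ge0 ?powR_ge0 ?expR_ge0// ltW.
    by rewrite mulrDr mulrDl; lra.
  have := near t k j t0 kj; rewrite -/th -/D => H.
  apply: (@le_trans _ _ ((C2 * D * 2 `^ (j%:~R * al))%:E * ring_norm p j f)); last first.
    rewrite muleA -EFinM; apply: lee_wpmul2r => //; rewrite lee_fin.
    (* Adjacency means [|k - j| <= 1]; the factor [e] compensates the value of the profile there. *)
    have h1 : (1 <= expR 1 * w' k j)%R.
      by rewrite -expRD -[leLHS]expR0 ler_expR mul1r subr_ge0.
    have h2 : (0 <= C2 * D * 2 `^ (j%:~R * al))%R by rewrite !mulr_ge0 ?powR_ge0// ltW.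
    have h3 : (0 <= D * (C1 * w k) * 2 `^ (j%:~R * al))%R by rewrite !mulr_ge0 ?powR_ge0// ltW.
    have := ler_wpM2l h2 h1; rewrite mulr1 => /le_trans; apply.
    by rewrite mulrDr mulrDl; lra.
  move: H; rewrite ge_min => /orP[|] H.
    apply: (@le_trans _ _ ((2 `^ (k%:~R * s) * t `^ (- (N / 2 * (p^-1 - r^-1))))%:E * ring_norm p j f)).
      rewrite EFinM -muleA; apply: lee_wpmul2l; first by rewrite lee_fin powR_ge0.
      exact: block_smoothing.
    by apply: lee_wpmul2r.
  apply: le_trans (sup _ (powR_ge0 _ _) (fun x y _ _ => heat_kernel_le (x - y) t0)) _.
  by apply: lee_wpmul2r => //; rewrite lee_fin; apply: le_trans H; rewrite !mulrA.
rewrite !eherzE.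
apply: (@le_trans _ _ (\esum_(k in [set: int]) \esum_(j in [set: int])
    ((2 `^ (k%:~R * s))%:E * ring_norm r k (eheat t (rpart j f))))).
  apply: le_esum => k _; rewrite esum_intZl ?powR_ge0//; last first.
    by move=> j; exact: ring_norm_ge0.
  apply: lee_wpmul2l; first by rewrite lee_fin powR_ge0.
  rewrite (_ : eheat t f = fun x => \esum_(j in [set: int]) eheat t (rpart j f) x).
    apply: ring_norm_esum => // j; first exact: measurable_eheat.
    by move=> x; exact: eheat_ge0.
  by apply/funext => x; rewrite eheat_esum.
(* With the sum over [k] inside, each term of the norm of [f] is multiplied by a bounded column
   sum. *)
rewrite esum_int_swap; last first.
  by move=> k j; rewrite mule_ge0 ?ring_norm_ge0// lee_fin powR_ge0.
rewrite -esum_intZl; last 2 first.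
- by rewrite !mulr_ge0// addr_ge0// !mulr_ge0 ?expR_ge0// ltW.
- by move=> j; rewrite mule_ge0 ?ring_norm_ge0// lee_fin powR_ge0.
apply: le_esum => j _.
apply: (@le_trans _ _ (\esum_(k in [set: int]) ((D * (C1 * w k + C2 * expR 1 * w' k j))%:E *
    ((2 `^ (j%:~R * al))%:E * ring_norm p j f)))).
  exact: le_esum.
set Q := (2 `^ (j%:~R * al))%:E * ring_norm p j f.
have Q0 : 0 <= Q by rewrite mule_ge0 ?ring_norm_ge0// lee_fin powR_ge0.
have a0 k : (0 <= D * (C1 * w k + C2 * expR 1 * w' k j))%R.
  by rewrite mulr_ge0// addr_ge0// !mulr_ge0 ?expR_ge0// ltW.
have S : \esum_(k in [set: int]) (D * (C1 * w k + C2 * expR 1 * w' k j))%:E <=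
    (D * (C1 * G1 + C2 * expR 1 * G2))%:E.
  under eq_esum => k _ do rewrite EFinM.
  rewrite esum_intZl//; last first.
    by move=> k; rewrite lee_fin addr_ge0// !mulr_ge0 ?expR_ge0// ltW.
  rewrite EFinM; apply: lee_wpmul2l => //.
  under eq_esum => k _ do rewrite EFinD.
  rewrite esumD; last 2 first.
  - by move=> k _; rewrite lee_fin !mulr_ge0 ?expR_ge0// ltW.
  - by move=> k _; rewrite lee_fin !mulr_ge0 ?expR_ge0// ltW.
  rewrite EFinD; apply: leeD.
    under eq_esum => k _ do rewrite EFinM.
    rewrite esum_intZl ?(ltW C10)//; last by move=> k; rewrite lee_fin expR_ge0.
    by rewrite EFinM; apply: lee_wpmul2l; [rewrite lee_fin ltW|exact: HG1].
  have e0 : (0 <= C2 * expR 1)%R by rewrite mulr_ge0 ?expR_ge0// ltW.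
  under eq_esum => k _ do rewrite EFinM.
  rewrite esum_intZl//; last by move=> k; rewrite lee_fin expR_ge0.
  by rewrite [leRHS]EFinM; apply: lee_wpmul2l => //; exact: HG2.
have [->|Qoo] := eqVneq Q +oo.
  rewrite gt0_muley ?leey// lte_fin mulr_gt0 ?powR_gt0//.
  by rewrite addr_gt0 ?mulr_gt0 ?expR_gt0.
move: Q Q0 Qoo => [q q0 _|//|//].
under eq_esum => k _ do rewrite muleC.
rewrite esum_intZl// muleC.
by apply: lee_wpmul2r => //; apply: le_trans S _; rewrite mulrC.
Qed.

End heat_herz.

(** * The heat flow on real functions *)

Section Rintegral_facts.
Context d1 d2 (X : measurableType d1) (Y : measurableType d2) (R : realType).
Variables (m2 : {sigma_finite_measure set Y -> \bar R}).

Lemma measurable_Rintegral2 (B : set Y) (F : X * Y -> R) : measurable B ->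
  measurable_fun setT F ->
  measurable_fun setT (fun x => \int[m2]_(y in B) F (x, y)).
Proof.
move=> mB mF; rewrite /Rintegral; apply: measurableT_comp => //.
under eq_fun => x do rewrite integralE.
have mE : measurable_fun setT (EFin \o F) by exact/measurable_EFinP.
apply: emeasurable_funB.
  rewrite (_ : (fun x => _) = fun x => (\int[m2]_(y in B) (EFin \o F)^\+ (x, y))%E).
    by apply: measurable_integral_in2 => //; exact: measurable_funepos.
  by apply/funext => x; apply: eq_integral => y _; rewrite !funeposE.
rewrite (_ : (fun x => _) = fun x => (\int[m2]_(y in B) (EFin \o F)^\- (x, y))%E).
  by apply: measurable_integral_in2 => //; exact: measurable_funeneg.
by apply/funext => x; apply: eq_integral => y _; rewrite !funenegE.
Qed.

End Rintegral_facts.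

Lemma abs_fine_le (R : realType) (z : \bar R) : (`|fine z|%:E <= `|z|)%E.
Proof. by case: z => //=; rewrite normr0 leey. Qed.

Lemma abs_Rintegral_le d (T : measurableType d) (R : realType)
    (mu : {measure set T -> \bar R}) (D : set T) (f : T -> R) :
  measurable D -> measurable_fun D f ->
  (`|\int[mu]_(x in D) f x|%:E <= \int[mu]_(x in D) `|f x|%:E)%E.
Proof.
move=> mD mf; apply: le_trans (abs_fine_le _) _.
by apply: le_abse_integral => //; exact/measurable_EFinP.
Qed.

Section heat_real.
Context {R : realType} {n : nat}.
Local Notation V := 'rV[R]_n.
Local Notation mu := (@lebesgue_rV R n).
Implicit Types (f g : V -> R) (t : R) (x : V).

Definition absE f : V -> \bar R := fun x => `|f x|%:E.

Lemma absE_ge0 f x : (0 <= absE f x)%E. Proof. by rewrite lee_fin. Qed.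

Lemma measurable_absE f : measurable_fun setT f -> measurable_fun setT (absE f).
Proof. by move=> mf; apply/measurable_EFinP; exact: measurableT_comp. Qed.

Lemma heatE t f x : t != 0 -> heat t f x = \int[mu]_y (heat_kernel t (x - y) * f y).
Proof. by move=> /negbTE t0; rewrite /heat t0. Qed.

Lemma heat0 f x : heat 0 f x = f x. Proof. by rewrite /heat eqxx. Qed.

Lemma measurable_heat_integrand t f x : measurable_fun setT f ->
  measurable_fun setT (fun y : V => heat_kernel t (x - y) * f y).
Proof. by move=> mf; apply: measurable_funM => //; exact: measurable_heat_kernel_sub. Qed.

Lemma measurable_heat2 d (T : measurableType d) (h : T -> R) (F : T * V -> R) :
  measurable_fun setT h -> measurable_fun setT F ->
  measurable_fun setT (fun z : T * V => heat (h z.1) (fun y => F (z.1, y)) z.2).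
Proof.
move=> mh mF; rewrite /heat; apply: measurable_fun_ifT => /=.
- apply: measurable_fun_eqr => //.
  exact: (measurableT_comp mh measurable_fst).
- by under eq_fun => z do rewrite -surjective_pairing.
apply: (@measurable_Rintegral2 _ _ _ _ _ mu setT (fun w : (T * V) * V =>
  heat_kernel (h w.1.1) (w.1.2 - w.2) * F (w.1.1, w.2))) => //.
apply: measurable_funM.
  apply: measurable_heat_kernel3 => //.
  - by apply: measurableT_comp => //; apply: measurableT_comp.
  - by apply: measurableT_comp.
apply: (measurableT_comp mF).
by apply: measurable_fun_pair => //; apply: measurableT_comp.
Qed.

Lemma measurable_heat t f : measurable_fun setT f -> measurable_fun setT (heat t f).
Proof.
move=> mf; have := @measurable_heat2 _ unit (cst t) (fun z => f z.2) (measurable_cst _).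
move=> /(_ (measurableT_comp mf measurable_snd)) H.
exact: (measurableT_comp H (pair1_measurable tt)).
Qed.

Lemma abs_heat_le t f x : t != 0 -> measurable_fun setT f ->
  (absE (heat t f) x <= eheat t (absE f) x)%E.
Proof.
move=> t0 mf; rewrite /absE heatE// eheatE.
apply: le_trans (abs_Rintegral_le _ _ _) _ => //.
  exact: measurable_heat_integrand.
apply: ge0_le_integral => //.
- apply/measurable_EFinP; apply: measurableT_comp => //.
  exact: measurable_heat_integrand.
- by apply: measurable_eheat_integrand; exact: measurable_absE.
by move=> y _; rewrite -EFinM lee_fin normrM ger0_norm ?heat_kernel_ge0.
Qed.

Lemma heat_integrable t f x : measurable_fun setT f ->
  (eheat t (absE f) x < +oo)%E ->
  mu.-integrable setT (fun y : V => (heat_kernel t (x - y) * f y)%:E).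
Proof.
move=> mf foo; apply/integrableP; split.
  by apply/measurable_EFinP; exact: measurable_heat_integrand.
apply: le_lt_trans foo; rewrite eheatE le_eqVlt; apply/orP; left; apply/eqP.
apply: eq_integral => y _.
by rewrite /absE -EFinM /= normrM ger0_norm ?heat_kernel_ge0.
Qed.

Lemma heatD t f g x : t != 0 -> measurable_fun setT f -> measurable_fun setT g ->
  (eheat t (absE f) x < +oo)%E -> (eheat t (absE g) x < +oo)%E ->
  heat t (fun y => f y + g y) x = heat t f x + heat t g x.
Proof.
move=> t0 mf mg foo goo; rewrite !heatE// -RintegralD//; last 2 first.
- exact: heat_integrable.
- exact: heat_integrable.
by congr Rintegral; apply/funext => y; rewrite mulrDr.
Qed.

Lemma heatZ t c f x : t != 0 -> measurable_fun setT f ->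
  (eheat t (absE f) x < +oo)%E ->
  heat t (fun y => c * f y) x = c * heat t f x.
Proof.
move=> t0 mf foo; rewrite !heatE// -RintegralZl//; last exact: heat_integrable.
by congr Rintegral; apply/funext => y; rewrite mulrCA.
Qed.

Lemma heatB t f g x : t != 0 -> measurable_fun setT f -> measurable_fun setT g ->
  (eheat t (absE f) x < +oo)%E -> (eheat t (absE g) x < +oo)%E ->
  heat t (fun y => f y - g y) x = heat t f x - heat t g x.
Proof.
move=> t0 mf mg foo goo; rewrite !heatE// -RintegralB//; last 2 first.
- exact: heat_integrable.
- exact: heat_integrable.
by congr Rintegral; apply/funext => y; rewrite mulrBr.
Qed.

Lemma heat_ae t f g x : t != 0 -> measurable_fun setT f -> measurable_fun setT g ->
  {ae mu, forall x, f x = g x} -> heat t f x = heat t g x.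
Proof.
move=> t0 mf mg fg; rewrite !heatE// /Rintegral; congr fine.
apply: ae_eq_integral => //.
- by apply/measurable_EFinP; exact: measurable_heat_integrand.
- by apply/measurable_EFinP; exact: measurable_heat_integrand.
by apply: filterS fg => y /= -> _.
Qed.

Lemma heat_nneg t f x : t != 0 -> measurable_fun setT f -> (forall x, 0 <= f x) ->
  (eheat t (EFin \o f) x < +oo)%E -> (heat t f x)%:E = eheat t (EFin \o f) x.
Proof.
move=> t0 mf f0 foo; rewrite heatE// /Rintegral fineK.
  by rewrite eheatE; apply: eq_integral => y _; rewrite EFinM.
rewrite ge0_fin_numE.
  by rewrite (_ : (\int[mu]_y _)%E = eheat t (EFin \o f) x)// eheatE; apply: eq_integral => y _; rewrite EFinM.
by apply: integral_ge0 => y _; rewrite lee_fin mulr_ge0 ?heat_kernel_ge0.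
Qed.

(** Fubini; the absolute convergence of the double integral is [eheat_semigroup] applied to the
    absolute value of [f]. *)
Lemma heat_semigroup s t f x : 0 < s -> 0 < t -> measurable_fun setT f ->
  (eheat (s + t) (absE f) x < +oo)%E ->
  heat s (heat t f) x = heat (s + t) f x.
Proof.
move=> s0 t0 mf foo; have st0 : 0 < s + t by rewrite addr_gt0.
rewrite !(@heatE s) ?(@heatE (s + t)) ?gt_eqF//.
pose F (z : V * V) := heat_kernel s (x - z.1) * (heat_kernel t (z.1 - z.2) * f z.2).
have mF : measurable_fun setT F.
  apply: measurable_funM.
    by apply: measurable_heat_kernel3.
  apply: measurable_funM; first exact: measurable_heat_kernel3.
  exact: measurableT_comp.
have iF : (mu \x mu)%E.-integrable setT (EFin \o F).
  apply/integrable12ltyP; first exact/measurable_EFinP.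
  apply: le_lt_trans foo; rewrite -(eheat_semigroup x s0 t0) //; last 2 first.
  - exact: measurable_absE.
  - by move=> y; exact: absE_ge0.
  rewrite eheatE; apply: ge0_le_integral => //=.
  - by move=> y _; apply: integral_ge0.
  - have : measurable_fun setT (fun z => `|F z|%:E).
      by apply/measurable_EFinP; exact: measurableT_comp.
    by move/(measurable_integral_in2 mu measurableT); apply.
  - apply: measurable_eheat_integrand; apply: measurable_eheat.
      exact: measurable_absE.
    by move=> y; exact: absE_ge0.
  move=> y _; rewrite eheatE -ge0_integralZl_EFin//; last 3 first.
  - by move=> z _; rewrite mule_ge0 ?absE_ge0// lee_fin heat_kernel_ge0.
  - by apply: measurable_eheat_integrand; exact: measurable_absE.
  - exact: heat_kernel_ge0.
  rewrite le_eqVlt; apply/orP; left; apply/eqP; apply: eq_integral => z _.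
  rewrite /F /absE -!EFinM /= normrM (ger0_norm (heat_kernel_ge0 _ _)) normrM.
  by rewrite (ger0_norm (heat_kernel_ge0 _ _)).
have FE := Fubini iF.
transitivity (fine (\int[mu]_y \int[mu]_z (F (y, z))%:E)%E).
  rewrite /Rintegral; congr fine; apply: ae_eq_integral => //.
  - apply/measurable_EFinP; apply: measurable_heat_integrand; exact: measurable_heat.
  - exact: (measurable_int _ (integrable_fubini_F iF)).
  have := ae_integrable1 iF; apply: filterS => y iy _.
  rewrite heatE ?gt_eqF// -RintegralZl//; last first.
    have [k0|k0] := eqVneq (heat_kernel s (x - y)) 0.
      by move: (heat_kernel_gt0 (x - y) s0); rewrite k0 ltxx.
    have := integrableZl measurableT (heat_kernel s (x - y))^-1 iy.
    by apply: eq_integrable => // z _ /=; rewrite /F /= -EFinM mulKf.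
  by rewrite fineK//; apply: integral_fune_fin_num.
rewrite FE /Rintegral; congr fine; apply: eq_integral => z _.
rewrite /F /=; under eq_integral => y _ do rewrite mulrA EFinM.
rewrite integralZr//; last first.
  apply/integrableP; split.
    apply/measurable_EFinP; apply: measurable_funM; exact: measurable_heat_kernel3.
  rewrite (_ : (\int[mu]_y _)%E = (heat_kernel (s + t) (x - z))%:E) ?ltry//.
  rewrite -heat_kernel_conv//; apply: eq_integral => y _.
  by rewrite gee0_abs// lee_fin mulr_ge0 ?heat_kernel_ge0.
by rewrite heat_kernel_conv.
Qed.

End heat_real.

(** * Strong continuity of the heat flow *)

Lemma integral_poweR1 d (T : measurableType d) (R : realType)
    (mu : {measure set T -> \bar R}) (D : set T) (f : T -> \bar R) :
  (forall x, 0 <= f x)%E ->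
  (\int[mu]_(x in D) f x `^ 1 = \int[mu]_(x in D) f x)%E.
Proof. by move=> f0; apply: eq_integral => x _; rewrite poweRe1. Qed.

Section evsmall.
Context {R : realType}.
Local Open Scope ereal_scope.
Implicit Types X Y : nat -> \bar R.

(** Convergence to 0 of nonnegative sequences, in a form that tolerates infinite initial terms and
    avoids [fine]. *)
Definition evsmall X := forall e : R, (0 < e)%R -> \forall i \near \oo, X i <= e%:E.

Lemma evsmall_le X Y : (forall i, X i <= Y i) -> evsmall Y -> evsmall X.
Proof. by move=> XY Y0 e e0; apply: filterS (Y0 e e0) => i; exact: le_trans. Qed.

Lemma evsmallD X Y : evsmall X -> evsmall Y -> evsmall (fun i => X i + Y i).
Proof.
move=> X0 Y0 e e0; have e2 : (0 < e / 2)%R by rewrite divr_gt0.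
apply: filterS2 (X0 _ e2) (Y0 _ e2) => i Xi Yi.
by rewrite [e]splitr EFinD; exact: leeD.
Qed.

Lemma evsmallZ (c : R) X : (0 <= c)%R -> evsmall X -> evsmall (fun i => c%:E * X i).
Proof.
move=> c0 X0 e e0; have ec : (0 < e / (c + 1))%R by rewrite divr_gt0// ltr_wpDl.
apply: filterS (X0 _ ec) => i Xi.
apply: le_trans (lee_wpmul2l _ Xi) _; first by rewrite lee_fin.
rewrite -EFinM lee_fin mulrCA ger_pMr// ler_pdivrMr ?mul1r ?lerDl//.
by rewrite ltr_wpDl.
Qed.

Lemma evsmall_pow (a : R) X : (0 < a)%R -> (forall i, 0 <= X i) ->
  evsmall X -> evsmall (fun i => X i `^ a).
Proof.
move=> a0 Xge X0 e e0; have ec : (0 < e `^ a^-1)%R by rewrite powR_gt0.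
apply: filterS (X0 _ ec) => i Xi.
apply: le_trans (le_poweR (ltW a0) (Xge i) Xi) _.
by rewrite poweR_EFin -powRrM mulVf ?gt_eqF// powRr1// ltW.
Qed.

Lemma evsmall_cvg X : X @ \oo --> 0 -> evsmall X.
Proof.
move=> /fine_cvgP[fX cX] e e0.
have H : \forall i \near \oo, (fine (X i) < e)%R by exact: (cvgr_lt _ cX).
near=> i.
have fi : X i \is a fin_num by near: i.
by rewrite -(fineK fi) lee_fin ltW//; near: i.
Unshelve. all: by end_near. Qed.

Lemma evsmall_sum (I : Type) (r : seq I) (X : I -> nat -> \bar R) :
  (forall j, evsmall (X j)) -> evsmall (fun i => \sum_(j <- r) X j i).
Proof.
move=> X0; elim: r => [|j r IH] e e0.
  by apply: nearW => i; rewrite big_nil lee_fin ltW.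
have := evsmallD (X0 j) IH e0; apply: filterS => i.
by rewrite big_cons.
Qed.

(** The usual approximation argument: the error [Z j] is small uniformly in [i], and for fixed [j]
    the main part tends to 0. *)
Lemma evsmall_approx X (Y Z : nat -> nat -> \bar R) :
  (forall j i, X i <= Y j i + Z j i) -> (forall j, evsmall (Y j)) ->
  (forall e : R, (0 < e)%R -> exists j, forall i, Z j i <= e%:E) -> evsmall X.
Proof.
move=> XYZ Y0 Z0 e e0; have e2 : (0 < e / 2)%R by rewrite divr_gt0.
have [j Zj] := Z0 _ e2; apply: filterS (Y0 j _ e2) => i Yi.
by apply: le_trans (XYZ j i) _; rewrite [e]splitr EFinD; exact: leeD.
Qed.

End evsmall.

(** * Strong continuity in L^1 on indicator functions *)

Section strong_continuity.
Context {R : realType} {n : nat}.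
Local Notation V := 'rV[R]_n.
Local Notation mu := (@lebesgue_rV R n).
Variable (t_ : nat -> R).
Hypotheses (t_gt0 : forall i, 0 < t_ i) (t_cvg : t_ @ \oo --> 0).
Implicit Types (f g : V -> R) (A B U : set V) (x y : V).

Let t_neq0 i : t_ i != 0. Proof. by rewrite gt_eqF. Qed.

Definition heat_gap f i : V -> \bar R := absE (fun x => heat (t_ i) f x - f x).

Lemma measurable_heat_gap f i : measurable_fun setT f ->
  measurable_fun setT (heat_gap f i).
Proof.
move=> mf; apply: measurable_absE; apply: measurable_funB => //.
exact: measurable_heat.
Qed.

Lemma eheat_bounded t f x (M : R) : 0 < t -> measurable_fun setT f ->
  (forall x, `|f x| <= M) -> (eheat t (absE f) x <= M%:E)%E.
Proof.
move=> t0 mf fM; have M0 : 0 <= M by exact: le_trans (normr_ge0 _) (fM 0).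
rewrite eheatE -[leRHS]mule1 -(heat_kernel_int x t0) -ge0_integralZl_EFin//; last 2 first.
- by move=> y _; rewrite lee_fin heat_kernel_ge0.
- by apply/measurable_EFinP; exact: measurable_heat_kernel_sub.
apply: ge0_le_integral => //.
- by move=> y _; rewrite mule_ge0 ?absE_ge0// lee_fin heat_kernel_ge0.
- by apply: measurable_eheat_integrand; exact: measurable_absE.
- apply: emeasurable_funM => //.
  by apply/measurable_EFinP; exact: measurable_heat_kernel_sub.
move=> y _; rewrite muleC; apply: lee_wpmul2r; first by rewrite lee_fin heat_kernel_ge0.
by rewrite lee_fin.
Qed.

Lemma heat_gapD f g i x : measurable_fun setT f -> measurable_fun setT g ->
  (eheat (t_ i) (absE f) x < +oo)%E -> (eheat (t_ i) (absE g) x < +oo)%E ->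
  (heat_gap (fun y => f y + g y)%R i x <= heat_gap f i x + heat_gap g i x)%E.
Proof.
move=> mf mg foo goo; rewrite /heat_gap /absE heatD// -EFinD lee_fin.
by rewrite opprD addrACA ler_normD.
Qed.

Lemma heat_gap_le f i x : measurable_fun setT f ->
  (heat_gap f i x <= eheat (t_ i) (absE f) x + absE f x)%E.
Proof.
move=> mf; apply: (@le_trans _ _ (absE (heat (t_ i) f) x + absE f x)%E).
  by rewrite /heat_gap /absE -EFinD lee_fin ler_normB.
by apply: leeD => //; exact: abs_heat_le.
Qed.

Lemma int_heat_gap_le f i : measurable_fun setT f ->
  (\int[mu]_x heat_gap f i x <= 2%:E * \int[mu]_x absE f x)%E.
Proof.
move=> mf; have maf := measurable_absE mf.
have mef : measurable_fun setT (eheat (t_ i) (absE f)).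
  by apply: measurable_eheat => // x; exact: absE_ge0.
apply: (@le_trans _ _ (\int[mu]_x (eheat (t_ i) (absE f) x + absE f x))%E).
  apply: ge0_le_integral => //.
  - by move=> x _; exact: absE_ge0.
  - exact: measurable_heat_gap.
  - exact: emeasurable_funD.
  - by move=> x _; exact: heat_gap_le.
have e0 x : (0 <= eheat (t_ i) (absE f) x)%E.
  by apply: eheat_ge0 => y; exact: absE_ge0.
rewrite ge0_integralD//; last by move=> x _; exact: absE_ge0.
rewrite (_ : 2%:E = 1 + 1)%E; last by rewrite -EFinD.
rewrite ge0_muleDl// mul1e; apply: leeD => //.
have := eheat_contract (t_gt0 i) (lexx 1) maf (absE_ge0 f).
by rewrite !integral_poweR1 => // x; exact: absE_ge0.
Qed.

Definition set_continuous A := evsmall (fun i => \int[mu]_x heat_gap (\1_A : V -> R) i x)%E.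

Lemma indic_le1 A x : `|\1_A x : R| <= 1.
Proof. by rewrite indicE; case: (_ \in _); rewrite ?normr0 ?normr1. Qed.

Lemma eheat_indic_lty A i x : measurable A -> (eheat (t_ i) (absE (\1_A)) x < +oo)%E.
Proof.
move=> mA; apply: le_lt_trans (eheat_bounded x (t_gt0 i) (measurable_indic mA) (indic_le1 A)) _.
exact: ltry.
Qed.

Lemma int_indic A : measurable A -> (\int[mu]_x absE (\1_A) x = mu A)%E.
Proof.
move=> mA; rewrite -[in RHS](setIT A) -integral_indic//; apply: eq_integral => x _.
by rewrite /absE ger0_norm.
Qed.

(** Half of the Gaussian exponent gives the small factor; the other half is a kernel of time [2 t],
    still of mass 1. *)
Lemma kernel_outside t d (x y : V) : 0 < t -> 0 <= d -> d <= enorm (x - y) ->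
  heat_kernel t (x - y) <= 2 `^ (n%:R / 2) * expR (- (d ^+ 2) / (8 * t)) *
    heat_kernel (2 * t) (x - y).
Proof.
move=> t0 d0 dxy; rewrite /heat_kernel mulrACA -expRD.
have -> : 2 `^ (n%:R / 2) * (4 * pi * (2 * t)) `^ (- (n%:R / 2)) =
    (4 * pi * t) `^ (- (n%:R / 2)) :> R.
  rewrite (_ : 4 * pi * (2 * t) = 2 * (4 * pi * t)); last by ring.
  rewrite powRM ?mulr_ge0 ?pi_ge0 ?(ltW t0)// mulrA -powRD_gt0// subrr powRr0.
  by rewrite mul1r.
apply: ler_wpM2l; first exact: powR_ge0.
rewrite ler_expR; set e := enorm _ in dxy *.
have : d ^+ 2 <= e ^+ 2 by rewrite ler_pXn2r// nnegrE enorm_ge0.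
move=> de; rewrite -subr_ge0.
have -> : - d ^+ 2 / (8 * t) + - e ^+ 2 / (4 * (2 * t)) - - e ^+ 2 / (4 * t) =
  (e ^+ 2 - d ^+ 2) / (8 * t) by field; rewrite gt_eqF.
by rewrite divr_ge0 ?subr_ge0// mulr_ge0// ltW.
Qed.

(** Openness for the Euclidean norm is spelled out, the ambient norm on matrices being the sup
    norm. *)
Definition enorm_open U := forall x, U x -> exists2 d : R, 0 < d &
  forall y, enorm (x - y) < d -> U y.

(** The mass that leaves [U] from [x] sits at distance at least [d]; by [kernel_outside] it is at
    most a constant times [e^(-d^2/(8t)) <= 8t/d^2]. *)
Lemma open_escape U x : measurable U -> enorm_open U -> U x ->
  exists2 c : R, 0 <= c & forall i, 1 - heat (t_ i) \1_U x <= c * t_ i.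
Proof.
move=> mU oU Ux; have [d d0 dU] := oU x Ux.
exists (2 `^ (n%:R / 2) * (8 / d ^+ 2)).
  by rewrite mulr_ge0 ?powR_ge0// divr_ge0// sqr_ge0.
move=> i; set t := t_ i; have t0 : 0 < t by exact: t_gt0.
have mCU : measurable (~` U) by exact: measurableC.
have E1 : 1 - heat t \1_U x = heat t (\1_(~` U)) x.
  have H1 : heat t (cst 1) x = 1.
    rewrite heatE ?gt_eqF//; apply: EFin_inj; rewrite -[RHS](heat_kernel_int x t0).
    rewrite /Rintegral fineK; first by apply: eq_integral => y _; rewrite mulr1.
    under eq_integral do rewrite mulr1.
    by rewrite heat_kernel_int.
  rewrite -[in LHS]H1 -heatB ?gt_eqF//; last 2 first.
  - apply: le_lt_trans (eheat_bounded x t0 _ (_ : forall x, `|cst 1 x| <= 1)) (ltry _) => //.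
    by move=> y /=; rewrite normr1.
  - exact: eheat_indic_lty.
  congr heat; apply/funext => y; rewrite !indicE in_setC.
  by case: (y \in U); rewrite ?subrr ?subr0.
rewrite E1 -lee_fin.
apply: (@le_trans _ _ (eheat t (absE (\1_(~` U))) x)).
  apply: (@le_trans _ _ (absE (heat t (\1_(~` U))) x)).
    by rewrite lee_fin ler_norm.
  by apply: abs_heat_le; [rewrite gt_eqF|exact: measurable_indic].
set D := 2 `^ (n%:R / 2) * expR (- (d ^+ 2) / (8 * t)).
have D0 : 0 <= D by rewrite mulr_ge0 ?powR_ge0 ?expR_ge0.
have t20 : 0 < 2 * t by rewrite mulr_gt0.
apply: (@le_trans _ _ D%:E).
  rewrite eheatE -[leRHS]mule1 -(heat_kernel_int x t20) -ge0_integralZl_EFin//; last 2 first.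
  - by move=> y _; rewrite lee_fin heat_kernel_ge0.
  - by apply/measurable_EFinP; exact: measurable_heat_kernel_sub.
  apply: ge0_le_integral => //.
  - by move=> y _; rewrite mule_ge0 ?absE_ge0// lee_fin heat_kernel_ge0.
  - by apply: measurable_eheat_integrand; apply: measurable_absE; exact: measurable_indic.
  - apply: emeasurable_funM => //.
    by apply/measurable_EFinP; exact: measurable_heat_kernel_sub.
  move=> y _; rewrite /absE -!EFinM lee_fin indicE in_setC.
  have [yU|yU] := boolP (y \in U); rewrite ?normr0 ?normr1 ?mulr0 ?mulr1.
    by rewrite mulr_ge0 ?heat_kernel_ge0.
  apply: kernel_outside => //; first exact: ltW.
  by rewrite leNgt; apply: contra yU => /dU Uy; rewrite inE.
rewrite lee_fin /D -mulrA; apply: ler_wpM2l; first exact: powR_ge0.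
rewrite mulNr expRN invf_ple ?posrE ?expR_gt0 ?mulr_gt0 ?invr_gt0 ?exprn_gt0//.
have -> : (8 / d ^+ 2 * t)^-1 = d ^+ 2 / (8 * t) by field; rewrite !gt_eqF// sqrf_eq0 gt_eqF.
by apply: le_trans (expR_ge1Dx _); rewrite lerDr.
Qed.

(** The gap is [1 - P] on [U] and [P] off [U]. The first part tends to 0 by [open_escape] and
    dominated convergence. The second is no larger, since the total mass of [P] is at most [mu U]:
    what is found outside has left [U]. *)
Lemma open_set_continuous U : measurable U -> enorm_open U -> (mu U < +oo)%E ->
  set_continuous U.
Proof.
move=> mU oU Uoo; have mI := measurable_indic (D := setT) mU : measurable_fun setT (\1_U : V -> R).
pose P i x : R := heat (t_ i) \1_U x.
have mP i : measurable_fun setT (P i) by exact: measurable_heat.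
have PE i x : (P i x)%:E = eheat (t_ i) (EFin \o \1_U) x.
  apply: heat_nneg => //.
  rewrite (_ : EFin \o _ = absE (\1_U : V -> R)); first exact: eheat_indic_lty.
  by apply/funext => y; rewrite /absE ger0_norm.
have P0 i x : 0 <= P i x.
  by rewrite -lee_fin PE; apply: eheat_ge0 => y; rewrite lee_fin.
have P1 i x : P i x <= 1.
  rewrite -lee_fin PE (_ : EFin \o _ = absE (\1_U : V -> R)).
    exact: eheat_bounded (t_gt0 i) mI (indic_le1 U).
  by apply/funext => y; rewrite /absE ger0_norm.
have small : evsmall (fun i => \int[mu]_(x in U) (1 - P i x)%:E)%E.
  apply: evsmall_cvg.
  have := @dominated_convergence _ _ _ mu U mU (fun i x => (1 - P i x)%:E) (cst 0%E) (cst 1%E).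
  case=> //.
  - move=> i; apply: measurable_funTS; apply/measurable_EFinP.
    exact: measurable_funB.
  - apply: nearW => x Ux.
    have [c c0 Hc] := open_escape mU oU Ux.
    apply: cvg_EFin; first by apply: nearW.
    apply: (@squeeze_cvgr _ _ _ _ (cst 0) (fun i => c * t_ i)).
    + by apply: nearW => i /=; rewrite subr_ge0 P1 Hc.
    + exact: cvg_cst.
    + by rewrite -[X in _ --> X](mulr0 c); apply: cvgMr.
  - apply/integrableP; split; first exact: measurable_cst.
    by rewrite /= normr1 integral_cst// mul1e.
  - by apply: nearW => x i Ux; rewrite /= lee_fin ger0_norm ?subr_ge0// gerBl.
  by rewrite integral0 => _ _ H; exact: H.
have mC : measurable (~` U) by exact: measurableC.
apply: evsmall_le (evsmallZ (ler0n R 2) small) => i.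
have gapE x : heat_gap \1_U i x = if x \in U then (1 - P i x)%:E else (P i x)%:E.
  rewrite /heat_gap /absE -/(P i x) indicE; case: (x \in U) => /=.
    by rewrite distrC ger0_norm// subr_ge0.
  by rewrite subr0 ger0_norm.
have -> : (\int[mu]_x heat_gap \1_U i x =
    \int[mu]_(x in U) (1 - P i x)%:E + \int[mu]_(x in ~` U) (P i x)%:E)%E.
  rewrite -(setUv U) ge0_integral_setU//; last 3 first.
  - by rewrite setUv; exact: measurable_heat_gap.
  - by move=> x _; exact: absE_ge0.
  - by apply/disj_setPS => x [].
  congr (_ + _)%E; apply: eq_integral => x; rewrite gapE.
    by move=> ->.
  by rewrite in_setC => /negbTE ->.
rewrite (_ : 2%:E = 1 + 1)%E; last by rewrite -EFinD.
set I1 := (\int[mu]_(x in U) (1 - P i x)%:E)%E.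
have I10 : (0 <= I1)%E by apply: integral_ge0 => x _; rewrite lee_fin subr_ge0.
rewrite ge0_muleDl// mul1e leeD2l//.
set J := (\int[mu]_(x in U) (P i x)%:E)%E; set K := (\int[mu]_(x in ~` U) _)%E.
have J0 : (0 <= J)%E by apply: integral_ge0 => x _; rewrite lee_fin.
have K0 : (0 <= K)%E by apply: integral_ge0 => x _; rewrite lee_fin.
have IJ : (I1 + J = mu U)%E.
  rewrite -ge0_integralD//.
  - transitivity (\int[mu]_(x in U) (cst 1%E x))%E; last by rewrite integral_cst// mul1e.
    by apply: eq_integral => x _; rewrite -EFinD subrK.
  - by move=> x _; rewrite lee_fin subr_ge0.
  - by apply: measurable_funTS; apply/measurable_EFinP; exact: measurable_funB.
  - by move=> x _; rewrite lee_fin.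
  - by apply: measurable_funTS; apply/measurable_EFinP.
have JK : (J + K <= mu U)%E.
  rewrite -ge0_integral_setU//; last 3 first.
  - by rewrite setUv; apply/measurable_EFinP.
  - by move=> x _; rewrite lee_fin.
  - by apply/disj_setPS => x [].
  rewrite setUv.
  have mE : measurable_fun setT (EFin \o (\1_U : V -> R)) by exact/measurable_EFinP.
  have := eheat_contract (t_gt0 i) (lexx 1) mE (fun x => _).
  have i0 x : (0 <= (EFin \o (\1_U : V -> R)) x)%E by rewrite lee_fin.
  rewrite !integral_poweR1//; last by move=> x; exact: eheat_ge0.
  rewrite integral_indic// setIT => H; apply: le_trans (H _) => //.
  by apply: ge0_le_integral => // [x _|||x _]; rewrite ?lee_fin ?PE//; [exact/measurable_EFinP|apply: measurable_eheat].
have Joo : (J < +oo)%E by apply: le_lt_trans Uoo; rewrite -IJ leeDr.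
have JF : J \is a fin_num by rewrite ge0_fin_numE.
by move: JK; rewrite -IJ [(I1 + J)%E]addeC leeD2lE.
Qed.

Lemma enorm_open_eball M : enorm_open (@eball R n M).
Proof.
move=> x xM; have M0 : 0 < M by apply: le_lt_trans xM; exact: enorm_ge0.
set a := enorm x ^+ 2; have a0 : 0 <= a by exact: sqr_ge0.
have aM : a < M ^+ 2 by rewrite ltr_pXn2r// nnegrE ?enorm_ge0// ltW.
set c := M ^+ 2 - a; have c0 : 0 < c by rewrite subr_gt0.
(* The squared norm of [y] is at most [(1 + e) |x|^2 + (1 + 1/e) |x - y|^2]. Of the margin [c], one
   half pays for [e |x|^2] and the other, through the radius chosen next, for [|x - y|]. *)
set e := c / (2 * (a + 1)); have e0 : 0 < e by rewrite divr_gt0// mulr_gt0// ltr_wpDl.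
have e'0 : 0 < 1 + e^-1 by rewrite addr_gt0// invr_gt0.
exists (Num.sqrt (c / (2 * (1 + e^-1)))).
  by rewrite sqrtr_gt0 divr_gt0// mulr_gt0.
move=> y xy; rewrite /eball/= -(ltr_pXn2r (n := 2)) ?nnegrE ?enorm_ge0 ?(ltW M0)//.
have h : enorm y ^+ 2 <= (1 + e) * a + (1 + e^-1) * enorm (x - y) ^+ 2.
  rewrite /a !enorm_sqr !mulr_sumr -big_split/=; apply: ler_sum => i _.
  rewrite !mxE; set u := x _ _; set v := y _ _.
  have -> : (1 + e) * u ^+ 2 + (1 + e^-1) * (u - v) ^+ 2 =
    v ^+ 2 + e^-1 * (e * u + (u - v)) ^+ 2 by field; rewrite gt_eqF.
  by rewrite lerDl mulr_ge0 ?sqr_ge0// invr_ge0 ltW.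
have xy2 : enorm (x - y) ^+ 2 < c / (2 * (1 + e^-1)).
  rewrite -[ltRHS]sqr_sqrtr; last by rewrite divr_ge0 ?mulr_ge0 ?(ltW c0) ?(ltW e'0).
  by rewrite ltr_pXn2r// nnegrE ?enorm_ge0 ?sqrtr_ge0.
apply: le_lt_trans h _.
have h2 : (1 + e^-1) * enorm (x - y) ^+ 2 < c / 2.
  by rewrite -ltr_pdivlMl// mulrC -[X in _ < X]mulrA -invfM.
have h3 : e * a <= c / 2.
  rewrite /e mulrAC ler_pdivrMr ?mulr_gt0 ?ltr_wpDl//.
  rewrite (_ : c / 2 * (2 * (a + 1)) = c * (a + 1)); last by field.
  by rewrite ler_pM2l// lerDl.
by rewrite mulrDl mul1r; rewrite /c in h2 h3; lra.
Qed.

(** The sigma-algebra is generated by the preimages of the half lines []z, +oo[] under the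
    coordinates, and these preimages are open. *)
Lemma sigma_enorm_open A : measurable A ->
  <<s [set U : set V | measurable U /\ enorm_open U] >> A.
Proof.
move: A; apply: smallest_sub; first exact: smallest_sigma_algebra.
move=> B; rewrite -bigcup_seq/= => -[i _ [Y mY <-]]; rewrite setTI.
set G := [set U | _]; set H := [set Z | <<s G >> ((fun x : V => x ord0 i : measurableTypeR R) @^-1` Z)].
move: mY; rewrite RGenOInfty.measurableE => mY.
move: Y mY; change (<<s @RGenOInfty.G R >> `<=` H); apply: smallest_sub.
  split; rewrite /H /=.
  - by rewrite preimage_set0; exact: sigma_algebra0.
  - by move=> Z HZ; rewrite setTD preimage_setC -setTD; exact: sigma_algebraCD.
  - by move=> F HF; rewrite preimage_bigcup; exact: sigma_algebra_bigcup.
move=> _ [z ->] /=; apply: sub_sigma_algebra; split.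
  by rewrite -[X in measurable X]setTI; apply: measurable_coord.
move=> x /=; rewrite in_itv/= andbT => zx; exists (x ord0 i - z).
  by rewrite subr_gt0.
move=> y xy; rewrite in_itv/= andbT.
have := le_lt_trans (enorm_coord (x - y) i) xy; rewrite !mxE => h.
by have := le_lt_trans (ler_norm _) h; lra.
Qed.

(** For the closure of the lambda-system under proper differences. *)
Lemma int_gap_indicD A B i : measurable A -> measurable B -> B `<=` A ->
  (\int[mu]_x heat_gap (\1_(A `\` B)) i x <=
   \int[mu]_x heat_gap (\1_A : V -> R) i x + \int[mu]_x heat_gap (\1_B) i x)%E.
Proof.
move=> mA mB BA; have mAB : measurable (A `\` B) by exact: measurableD.
rewrite -ge0_integralD//; last 4 first.
- by move=> x _; exact: absE_ge0.
- by apply: measurable_heat_gap; exact: measurable_indic.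
- by move=> x _; exact: absE_ge0.
- by apply: measurable_heat_gap; exact: measurable_indic.
have IE : (\1_(A `\` B) : V -> R) = fun x => \1_A x - \1_B x.
  apply/funext => x; rewrite !indicE in_setD.
  have [xB|xB] := boolP (x \in B); last by rewrite andbT subr0.
  by rewrite andbF (mem_set (BA _ (set_mem xB))) subrr.
apply: ge0_le_integral => //.
- by move=> x _; exact: absE_ge0.
- by apply: measurable_heat_gap; exact: measurable_indic.
- apply: emeasurable_funD; apply: measurable_heat_gap; exact: measurable_indic.
move=> x _; rewrite IE /heat_gap /absE heatB//; last 2 first.
- exact: eheat_indic_lty.
- exact: eheat_indic_lty.
rewrite -EFinD lee_fin; set a := heat _ _ _; set b := heat _ _ _.
by rewrite (_ : a - b - _ = (a - \1_A x) - (b - \1_B x)) ?ler_normB//; ring.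
Qed.

(** For the closure under increasing unions: the missing part costs at most twice its measure,
    uniformly in [i]. *)
Lemma int_gap_indicU A B i : measurable A -> measurable B -> B `<=` A ->
  (\int[mu]_x heat_gap (\1_A : V -> R) i x <=
   \int[mu]_x heat_gap (\1_B) i x + 2%:E * mu (A `\` B))%E.
Proof.
move=> mA mB BA; have mAB : measurable (A `\` B) by exact: measurableD.
apply: (@le_trans _ _ (\int[mu]_x heat_gap (\1_B : V -> R) i x +
    \int[mu]_x heat_gap (\1_(A `\` B)) i x)%E); last first.
  apply: leeD => //; apply: le_trans (int_heat_gap_le _ _) _.
    exact: measurable_indic.
  by rewrite int_indic.
have IE : (\1_A : V -> R) = fun x => \1_B x + \1_(A `\` B) x.
  apply/funext => x; rewrite !indicE in_setD.
  have [xB|xB] := boolP (x \in B); last by rewrite andbT add0r.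
  by rewrite andbF addr0 (mem_set (BA _ (set_mem xB))).
rewrite -ge0_integralD//; last 4 first.
- by move=> x _; exact: absE_ge0.
- by apply: measurable_heat_gap; exact: measurable_indic.
- by move=> x _; exact: absE_ge0.
- by apply: measurable_heat_gap; exact: measurable_indic.
apply: ge0_le_integral => //.
- by move=> x _; exact: absE_ge0.
- by apply: measurable_heat_gap; exact: measurable_indic.
- apply: emeasurable_funD; apply: measurable_heat_gap; exact: measurable_indic.
move=> x _; rewrite {1}IE; apply: heat_gapD.
- exact: measurable_indic.
- exact: measurable_indic.
- exact: eheat_indic_lty.
- exact: eheat_indic_lty.
Qed.

Lemma eball_lty M : 0 <= M -> (mu (eball M) < +oo)%E.
Proof. by move=> M0; apply: le_lt_trans (lebesgue_rV_eball n M0) _; exact: ltry. Qed.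

(* The pi-lambda theorem extends the case of open sets. *)
Lemma measurable_set_continuous M A : 0 <= M -> measurable A ->
  set_continuous (A `&` eball M).
Proof.
move=> M0 mA; have mQ := @measurable_eball R n M.
have Qoo := eball_lty M0.
pose G := [set U : set V | measurable U /\ enorm_open U].
pose H := [set A : set V | measurable A /\ set_continuous (A `&` eball M)].
have IQoo B : measurable B -> (mu (B `&` eball M) < +oo)%E.
  move=> mB; apply: le_lt_trans Qoo; rewrite le_measure ?inE//.
  exact: measurableI.
have IG : setI_closed G.
  move=> U1 U2 [mU1 oU1] [mU2 oU2]; split; first exact: measurableI.
  move=> x [/oU1[d1 d10 h1] /oU2[d2 d20 h2]]; exists (Num.min d1 d2).
    by rewrite lt_min d10.
  by move=> y; rewrite lt_min => /andP[/h1 ? /h2].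
have GH : G `<=` H.
  move=> U [mU oU]; split => //; apply: open_set_continuous.
  - exact: measurableI.
  - by have [] := IG U (eball M) (conj mU oU) (conj mQ (@enorm_open_eball M)).
  - exact: IQoo.
suff DH : lambda_system setT H.
  have := lambda_system_subset IG DH GH (fun _ _ => subsetT _).
  by move=> /(_ A (sigma_enorm_open mA))[].
split=> //.
- split => //; rewrite setTI; apply: open_set_continuous => //.
  exact: enorm_open_eball.
- move=> B C CB [mB HB] [mC HC]; split; first exact: measurableD.
  apply: evsmall_le (evsmallD HB HC) => i.
  rewrite (_ : (B `\` C) `&` eball M = (B `&` eball M) `\` (C `&` eball M)).
    apply: int_gap_indicD; [exact: measurableI|exact: measurableI|].
    by move=> x [Cx Mx]; split => //; exact: CB.
  apply/seteqP; split => x /=.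
    by move=> [[Bx nCx] Mx]; split => // -[].
  by move=> [[Bx Mx] h]; split => //; split => // Cx; apply: h.
- move=> F ndF HF; have mF i : measurable (F i) by case: (HF i).
  have mU : measurable (\bigcup_i F i) by exact: bigcupT_measurable.
  split => //; set E := _ `&` _.
  have mE : measurable E by exact: measurableI.
  pose D j := E `\` (F j `&` eball M).
  have mD j : measurable (D j) by apply: measurableD => //; exact: measurableI.
  have D0 : mu (D j) @[j --> \oo] --> (0 : \bar R)%E.
    rewrite -(measure0 mu) (_ : set0 = \bigcap_j D j); last first.
      apply/seteqP; split => // x Dx; have [[[j _ Fjx] Mx] _] := Dx 0%N I.
      by have [_] := Dx j I; apply.
    apply: nonincreasing_cvg_mu => //.
    - apply: le_lt_trans (IQoo _ mU); rewrite le_measure ?inE//.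
      exact: subDsetl.
    - by apply: bigcapT_measurable.
    - move=> i j ij; apply/subsetPset; apply: setDS.
      by apply: setSI; exact/subsetPset/ndF.
  apply: (@evsmall_approx _ _ (fun j i => \int[mu]_x heat_gap (\1_(F j `&` eball M) : V -> R) i x)%E
    (fun j i => 2%:E * mu (D j))%E).
  + move=> j i; apply: int_gap_indicU => //; first exact: measurableI.
    by apply: setSI; exact: bigcup_sup.
  + by move=> j; case: (HF j).
  + move=> e e0; have [j _ Hj] := evsmallZ (ler0n R 2) (evsmall_cvg D0) e0.
    by exists j => i; apply: Hj => /=.
Qed.

End strong_continuity.

(** * Strong continuity in Herz spaces *)

Import HBSimple HBNNSimple.

Section herz_continuity.
Context {R : realType} {n : nat}.
Hypothesis n0 : (0 < n)%N.
Local Notation V := 'rV[R]_n.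
Local Notation mu := (@lebesgue_rV R n).
Local Notation N := (n%:R : R).
Implicit Types (f g : V -> R) (A : set V).

(** The shells exhaust the punctured space, and each meets only finitely many annuli. *)
Definition shell (m : nat) : set V := eball (2 ^+ m) `\` eball (2 ^- m).

Lemma measurable_shell m : measurable (shell m).
Proof. by apply: measurableD; exact: measurable_eball. Qed.

Lemma shell_annulus m k x : shell m x -> annulus k x -> `|k%:~R| <= m%:R + 1 :> R.
Proof.
move=> [xm /negP]; rewrite /eball/= -leNgt => mx.
move=> /annulusP/andP[k1 k2]; rewrite /eball/= in xm.
have two1 : 1 < 2 :> R by rewrite ltr1n.
have h1 := le_lt_trans k1 xm; have h2 := le_lt_trans mx k2.
rewrite -[2 ^+ m]/(2 ^ (m : int)) ltr_eXz2l// in h1.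
rewrite exprnN ltr_eXz2l// in h2.
rewrite -intr_norm -(_ : (m%:Z + 1)%:~R = m%:R + 1 :> R); last by rewrite intrD.
rewrite ler_int; lia.
Qed.

Lemma eherz_shell s p A m : 0 < p -> measurable A -> A `<=` shell m ->
  (eherz s p (absE (\1_A)) < +oo)%E.
Proof.
move=> p0 mA Am; have [G G0 HG] := esum_geometric (@ltr01 R).
have mI : measurable_fun setT (absE (\1_A : V -> R)).
  by apply: measurable_absE; exact: measurable_indic.
set M : R := m%:R + 1.
(* On the annuli met by the shell [e^(M - |k|) >= 1]; the factor [expR M] thus turns a finite sum
   into a geometric series. *)
set C : R := 2 `^ (M * `|s|) * 2 `^ ((M + 1) * N / p) * expR M.
apply: (@le_lt_trans _ _ (\esum_(k in [set: int]) (C%:E * (expR (- (1 * `|k%:~R - 0%:~R : R|)))%:E))%E).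
  rewrite eherzE; apply: le_esum => k _.
  have [kM|kM] := leP (`|k%:~R : R|) M; last first.
    rewrite (_ : ring_norm p k _ = 0%E); last first.
      apply/eqP; rewrite eq_le ring_norm_ge0 andbT.
      rewrite -[leRHS](mule0 (2 `^ ((k%:~R + 1) * N / p))%:E).
      apply: ring_norm_sup => // [x|x Akx]; first exact: absE_ge0.
      rewrite /absE indicE; have [xA|xA] := boolP (x \in A); last by rewrite normr0.
      by have := shell_annulus (Am _ (set_mem xA)) Akx; rewrite leNgt kM.
    by rewrite mule0 mule_ge0// lee_fin ?expR_ge0// !mulr_ge0 ?powR_ge0 ?expR_ge0.
  apply: (@le_trans _ _ ((2 `^ (k%:~R * s))%:E * ((2 `^ ((k%:~R + 1) * N / p))%:E * 1))%E).
    apply: lee_wpmul2l; first by rewrite lee_fin powR_ge0.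
    apply: ring_norm_sup => // [x|x _]; first exact: absE_ge0.
    by rewrite /absE lee_fin indic_le1.
  rewrite mule1 -!EFinM lee_fin /C -2![leRHS]mulrA; apply: ler_pM; rewrite ?powR_ge0//.
    rewrite ler_powR ?ler1n//; apply: le_trans (ler_norm _) _.
    by rewrite normrM ler_wpM2r.
  rewrite -[leLHS]mulr1; apply: ler_pM; rewrite ?powR_ge0//.
    rewrite ler_powR ?ler1n// ler_wpM2r ?invr_ge0 ?(ltW p0)// ler_wpM2r//.
    by rewrite lerD2r; apply: le_trans kM; exact: ler_norm.
  by rewrite -expRD -[leLHS]expR0 ler_expR mul1r subr0 subr_ge0.
rewrite esum_intZl; last 2 first.
- by rewrite !mulr_ge0 ?powR_ge0 ?expR_ge0.
- by move=> k; rewrite lee_fin expR_ge0.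
apply: (@le_lt_trans _ _ (C%:E * G%:E)%E); last by rewrite -EFinM ltry.
by apply: lee_wpmul2l => //; rewrite lee_fin !mulr_ge0 ?powR_ge0 ?expR_ge0.
Qed.

Section fixed_parameters.
Variables (s q : R).
Hypotheses (q1 : 1 <= q) (s_gt : - (N / q) < s) (s_lt : s < N * (1 - q^-1)).
Variable (t_ : nat -> R).
Hypotheses (t_gt0 : forall i, 0 < t_ i) (t_cvg : t_ @ \oo --> 0).

Let q0 : 0 < q. Proof. exact: lt_le_trans q1. Qed.

(** With equal parameters on both sides the power of [t] in [heat_herz] is 0, so the flow is bounded
    uniformly in time. The weight [s'] is free because [s + eta] and [s - eta] are needed besides
    [s]. *)
Lemma eherz_gap_le s' : - (N / q) < s' -> s' < N * (1 - q^-1) ->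
  exists2 C : R, 0 < C & forall f i, measurable_fun setT f ->
    (eherz s' q (heat_gap t_ f i) <= C%:E * eherz s' q (absE f))%E.
Proof.
move=> s1 s2; have [C C0 HC] := heat_herz n0 q1 (lexx q) s1 (lexx s') (ltW s2).
exists (C + 1); first by rewrite addr_gt0.
move=> f i mf; have maf := measurable_absE mf.
have mef : measurable_fun setT (eheat (t_ i) (absE f)).
  by apply: measurable_eheat => // x; exact: absE_ge0.
have ef0 x : (0 <= eheat (t_ i) (absE f) x)%E by apply: eheat_ge0 => y; exact: absE_ge0.
apply: (@le_trans _ _ (eherz s' q (fun x => eheat (t_ i) (absE f) x + absE f x)%E)).
  apply: le_eherz => //.
  - exact: measurable_heat_gap.
  - exact: emeasurable_funD.
  - by move=> x; exact: absE_ge0.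
  - by move=> x; rewrite adde_ge0// absE_ge0.
  - by apply: nearW => x; exact: heat_gap_le.
apply: le_trans (eherzD _ q1 mef maf ef0 (absE_ge0 f)) _.
rewrite EFinD ge0_muleDl ?mul1e ?lee_fin ?(ltW C0)//; apply: leeD => //.
have := HC (t_ i) (absE f) (t_gt0 i) maf (absE_ge0 f).
by rewrite (_ : (N / q - N / q + s' - s') / 2 = 0) ?oppr0 ?powRr0 ?mulr1//; lra.
Qed.

Definition herz_strong f := [/\ measurable_fun setT f,
  (eherz s q (absE f) < +oo)%E & evsmall (fun i => eherz s q (heat_gap t_ f i))].

Lemma herz_eheat_ae f t : 0 < t -> measurable_fun setT f ->
  (eherz s q (absE f) < +oo)%E -> {ae mu, forall x, (eheat t (absE f) x < +oo)%E}.
Proof.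
move=> t0 mf foo; have [C C0 HC] := heat_herz n0 q1 (lexx q) s_gt (lexx s) (ltW s_lt).
have maf := measurable_absE mf.
apply: (eherz_lty_ae (s := s) n0 q0).
- by apply: measurable_eheat => // x; exact: absE_ge0.
- by move=> x; apply: eheat_ge0 => y; exact: absE_ge0.
apply: le_lt_trans (HC _ _ t0 maf (absE_ge0 f)) _.
by rewrite lte_mul_pinfty// lee_fin mulr_ge0 ?powR_ge0// ltW.
Qed.

Lemma eherz_gapD f g i : measurable_fun setT f -> measurable_fun setT g ->
  (eherz s q (absE f) < +oo)%E -> (eherz s q (absE g) < +oo)%E ->
  (eherz s q (heat_gap t_ (fun x => f x + g x)%R i) <=
   eherz s q (heat_gap t_ f i) + eherz s q (heat_gap t_ g i))%E.
Proof.
move=> mf mg foo goo.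
have mgap h : measurable_fun setT h -> measurable_fun setT (heat_gap t_ h i).
  exact: measurable_heat_gap.
apply: (@le_trans _ _ (eherz s q (fun x => heat_gap t_ f i x + heat_gap t_ g i x)%E)); last first.
  by apply: eherzD => //; [exact: mgap|exact: mgap| |] => x; exact: absE_ge0.
apply: le_eherz => //.
- by apply: mgap; exact: measurable_funD.
- by apply: emeasurable_funD; exact: mgap.
- by move=> x; exact: absE_ge0.
- by move=> x; rewrite adde_ge0// absE_ge0.
apply: filterS2 (herz_eheat_ae (t_gt0 i) mf foo) (herz_eheat_ae (t_gt0 i) mg goo) => x fx gx.
exact: heat_gapD.
Qed.

Lemma eherz_absD f g : measurable_fun setT f -> measurable_fun setT g ->
  (eherz s q (absE (fun x => f x + g x)%R) <= eherz s q (absE f) + eherz s q (absE g))%E.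
Proof.
move=> mf mg; have maf := measurable_absE mf; have mag := measurable_absE mg.
apply: le_trans (eherzD _ q1 maf mag (absE_ge0 f) (absE_ge0 g)).
apply: le_eherz => //.
- by apply: measurable_absE; exact: measurable_funD.
- exact: emeasurable_funD.
- by move=> x; exact: absE_ge0.
- by move=> x; rewrite adde_ge0// absE_ge0.
- by apply: nearW => x; rewrite /absE -EFinD lee_fin ler_normD.
Qed.

Lemma herz_strongD f g : herz_strong f -> herz_strong g ->
  herz_strong (fun x => f x + g x).
Proof.
move=> [mf foo cf] [mg goo cg]; split; first exact: measurable_funD.
  by apply: le_lt_trans (eherz_absD mf mg) _; rewrite lte_add_pinfty.
apply: evsmall_le (evsmallD cf cg) => i; exact: eherz_gapD.
Qed.

Lemma herz_strongZ c f : herz_strong f -> herz_strong (fun x => c * f x).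
Proof.
move=> [mf foo cf]; have mcf : measurable_fun setT (fun x => c * f x).
  exact: measurable_funM.
have maf := measurable_absE mf.
have absZ (h : V -> R) : absE (fun x => c * h x) = fun x => (`|c|%:E * absE h x)%E.
  by apply/funext => x; rewrite /absE normrM EFinM.
split=> //.
  by rewrite absZ eherzZ//; [rewrite lte_mul_pinfty|exact: absE_ge0].
apply: evsmall_le (evsmallZ (normr_ge0 c) cf) => i.
have mgap : measurable_fun setT (heat_gap t_ f i) by exact: measurable_heat_gap.
rewrite -eherzZ//; last by move=> x; exact: absE_ge0.
apply: le_eherz => //.
- exact: measurable_heat_gap.
- exact: emeasurable_funM.
- by move=> x; exact: absE_ge0.
- by move=> x; rewrite mule_ge0// absE_ge0.
apply: filterS (herz_eheat_ae (t_gt0 i) mf foo) => x fx.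
by rewrite /heat_gap /absE heatZ ?gt_eqF// -mulrBr normrM EFinM.
Qed.

(* Off the annuli [|k| <= K] the weight is compared with the exponents
   [s + eta] and [s - eta]; on them the L^q norm is bounded by the L^1 norm. *)
Lemma herz_strong_indic m A : measurable A -> A `<=` shell m -> herz_strong (\1_A).
Proof.
move=> mA Am; have mI : measurable_fun setT (\1_A : V -> R) by exact: measurable_indic.
split; [exact: mI | exact: eherz_shell Am |].
(* Half of the distance from [s] to the ends of the admissible range, so that [s + eta] and
   [s - eta] stay inside. *)
set eta := Num.min (s + N / q) (N * (1 - q^-1) - s) / 2.
have eta0 : 0 < eta.
  by rewrite divr_gt0// lt_min subr_gt0 s_lt andbT -[N / q]opprK subr_gt0.
have eta1 : 2 * eta <= s + N / q by rewrite mulrC divfK// ge_min lexx.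
have eta2 : 2 * eta <= N * (1 - q^-1) - s by rewrite mulrC divfK// ge_min lexx orbT.
have [||Cp Cp0 HCp] := @eherz_gap_le (s + eta); [lra|lra|].
have [||Cm Cm0 HCm] := @eherz_gap_le (s - eta); [lra|lra|].
have [G G0 HG] := esum_geometric (@ltr01 R).
have [bp bpE] : exists b, (Cp%:E * eherz (s + eta) q (absE (\1_A)) = b%:E)%E.
  have : (Cp%:E * eherz (s + eta) q (absE (\1_A)) < +oo)%E.
    by rewrite lte_mul_pinfty ?lee_fin ?(ltW Cp0)//; exact: eherz_shell Am.
  move=> h; exists (fine (Cp%:E * eherz (s + eta) q (absE (\1_A)))); rewrite fineK//.
  by rewrite ge0_fin_numE// mule_ge0 ?eherz_ge0// lee_fin ltW.
have [bm bmE] : exists b, (Cm%:E * eherz (s - eta) q (absE (\1_A)) = b%:E)%E.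
  have : (Cm%:E * eherz (s - eta) q (absE (\1_A)) < +oo)%E.
    by rewrite lte_mul_pinfty ?lee_fin ?(ltW Cm0)//; exact: eherz_shell Am.
  move=> h; exists (fine (Cm%:E * eherz (s - eta) q (absE (\1_A)))); rewrite fineK//.
  by rewrite ge0_fin_numE// mule_ge0 ?eherz_ge0// lee_fin ltW.
pose I1 i := (\int[mu]_x heat_gap t_ (\1_A : V -> R) i x)%E.
have I10 i : (0 <= I1 i)%E by apply: integral_ge0 => x _; exact: absE_ge0.
have sI1 : evsmall I1.
  have : set_continuous t_ (A `&` eball (2 ^+ m)).
    by apply: measurable_set_continuous => //; rewrite exprn_ge0.
  by rewrite (_ : A `&` _ = A)//; apply/setIidPl => x /Am[].
pose J i := ((2 `^ (q - 1))%:E * I1 i)%E.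
have J0 i : (0 <= J i)%E by rewrite mule_ge0// lee_fin powR_ge0.
have q'0 : 0 < q^-1 by rewrite invr_gt0.
have sJ : evsmall (fun i => J i `^ q^-1)%E.
  by apply: evsmall_pow => //; apply: evsmallZ => //; exact: powR_ge0.
have mgap i : measurable_fun setT (heat_gap t_ (\1_A : V -> R) i).
  exact: measurable_heat_gap.
have gap2 i x : (heat_gap t_ (\1_A : V -> R) i x <= 2%:E)%E.
  apply: le_trans (heat_gap_le t_gt0 _ _ mI) _.
  rewrite (_ : 2 = 1 + 1)// EFinD; apply: leeD.
    exact: eheat_bounded (t_gt0 i) mI (indic_le1 A).
  by rewrite lee_fin indic_le1.
(* The gap is at most 2, so its power [q] is at most [2^(q-1)] times the gap itself. *)
have nJ k i : (ring_norm q k (heat_gap t_ (\1_A : V -> R) i) <= J i `^ q^-1)%E.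
  apply: le_poweR; first exact: ltW.
    by apply: integral_ge0 => x _; exact: poweR_ge0.
  rewrite /J /I1 -ge0_integralZl_EFin ?powR_ge0//; last first.
    by move=> x _; exact: absE_ge0.
  apply: (@le_trans _ _ (\int[mu]_x (heat_gap t_ (\1_A : V -> R) i x `^ q)))%E.
    apply: ge0_subset_integral => //; first exact: measurable_annulus.
      exact: (measurableT_comp (measurable_poweR q)).
    by move=> x _; exact: poweR_ge0.
  apply: ge0_le_integral => //.
  - by move=> x _; exact: poweR_ge0.
  - exact: (measurableT_comp (measurable_poweR q)).
  - exact: emeasurable_funM.
  move=> x _; have := gap2 i x; rewrite /heat_gap /absE; set z := `|_|.
  have : 0 <= z by exact: normr_ge0.
  rewrite lee_fin poweR_EFin -EFinM lee_fin => z0 z2.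
  move: z0; rewrite le_eqVlt => /predU1P[<-|z0].
    by rewrite powR0 ?mulr0// gt_eqF.
  rewrite -(powRB1_mul q z0) ler_pM2r// ge0_ler_powR ?nnegrE ?subr_ge0//.
  exact: ltW.
(* The cut-off [K] is the approximation index. For [|k| <= K] the factor [e^(K - |k|) >= 1] makes
   the sum geometric; beyond, the bound [2^(-K eta)] is uniform in [i]. *)
apply: (@evsmall_approx _ _
  (fun K i => (2 `^ (K%:R * `|s|) * expR K%:R * G)%:E * J i `^ q^-1)%E
  (fun K i => (2 `^ (- (K%:R * eta)) * (bp + bm))%:E)).
- move=> K i; set g := heat_gap t_ _ i.
  set c1 : R := 2 `^ (K%:R * `|s|) * expR K%:R; set c2 : R := 2 `^ (- (K%:R * eta)).
  have c10 : 0 <= c1 by rewrite mulr_ge0 ?powR_ge0 ?expR_ge0.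
  have c20 : 0 <= c2 by exact: powR_ge0.
  apply: (@le_trans _ _ (\esum_(k in [set: int])
      ((c1%:E * J i `^ q^-1) * (expR (- (1 * `|k%:~R - 0%:~R : R|)))%:E +
       c2%:E * ((2 `^ (k%:~R * (s + eta)))%:E * ring_norm q k g +
                (2 `^ (k%:~R * (s - eta)))%:E * ring_norm q k g)))%E).
    rewrite eherzE; apply: le_esum => k _.
    have rg0 := ring_norm_ge0 q k g.
    have A0 : (0 <= c1%:E * J i `^ q^-1 * (expR (- (1 * `|k%:~R - 0%:~R : R|)))%:E)%E.
      by rewrite !mule_ge0 ?poweR_ge0 ?lee_fin ?expR_ge0.
    have B0 a : (0 <= (2 `^ a)%:E * ring_norm q k g)%E by rewrite mule_ge0// lee_fin powR_ge0.
    have far a : k%:~R * s <= - (K%:R * eta) + a ->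
        ((2 `^ (k%:~R * s))%:E * ring_norm q k g <=
         c2%:E * ((2 `^ a)%:E * ring_norm q k g))%E.
      move=> h; rewrite muleA -EFinM -powRD_gt0//; apply: lee_wpmul2r => //.
      by rewrite lee_fin ler_powR// ler1n.
    have [kK|kK] := leP (`|k%:~R : R|) K%:R.
      apply: (@le_trans _ _ (c1%:E * J i `^ q^-1 * (expR (- (1 * `|k%:~R - 0%:~R : R|)))%:E)%E); last first.
        by rewrite leeDl// mule_ge0 ?lee_fin// adde_ge0.
      rewrite muleAC; apply: lee_pmul => //; last exact: nJ.
      rewrite -EFinM lee_fin /c1 -[leRHS]mulrA -[leLHS]mulr1; apply: ler_pM; rewrite ?powR_ge0//.
        rewrite ler_powR ?ler1n//; apply: le_trans (ler_norm _) _.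
        by rewrite normrM ler_wpM2r.
      by rewrite -expRD -[leLHS]expR0 ler_expR mul1r subr0 subr_ge0.
    apply: (@le_trans _ _ (c2%:E * ((2 `^ (k%:~R * (s + eta)))%:E * ring_norm q k g +
                (2 `^ (k%:~R * (s - eta)))%:E * ring_norm q k g))%E); last by rewrite leeDr.
    rewrite ge0_muleDr//.
    have [k0|k0] := leP 0 (k%:~R : R).
      rewrite ger0_norm// in kK.
      apply: (@le_trans _ _ (c2%:E * ((2 `^ (k%:~R * (s + eta)))%:E * ring_norm q k g))%E).
        apply: far; have : K%:R * eta <= k%:~R * eta by rewrite ler_wpM2r ?ltW//.
          lra.
      by rewrite leeDl// mule_ge0.
    rewrite ltr0_norm// in kK.
    apply: (@le_trans _ _ (c2%:E * ((2 `^ (k%:~R * (s - eta)))%:E * ring_norm q k g))%E).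
      apply: far; have : K%:R * eta <= - k%:~R * eta by rewrite ler_wpM2r ?ltW//.
        lra.
    by rewrite leeDr// mule_ge0.
  rewrite esumD; last 2 first.
  - by move=> k _; rewrite !mule_ge0 ?poweR_ge0 ?lee_fin ?expR_ge0.
  - move=> k _; rewrite mule_ge0 ?lee_fin// adde_ge0// mule_ge0 ?ring_norm_ge0 ?lee_fin ?powR_ge0//.
  apply: leeD.
    have [->|Joo] := eqVneq (J i `^ q^-1)%E +oo%E.
      by rewrite !gt0_muley ?leey ?lte_fin ?mulr_gt0 ?powR_gt0 ?expR_gt0.
    move: Joo (poweR_ge0 (J i) q^-1); case: (J i `^ q^-1)%E => [z _|//|//].
    rewrite lee_fin => z0; rewrite esum_intZl ?mulr_ge0//.
    rewrite [in leRHS]EFinM muleAC; apply: lee_wpmul2l; last exact: HG.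
    by rewrite lee_fin mulr_ge0.
  rewrite esum_intZl//; last first.
    by move=> k; rewrite adde_ge0// mule_ge0 ?ring_norm_ge0 ?lee_fin ?powR_ge0.
  rewrite EFinM; apply: lee_wpmul2l; first by rewrite lee_fin.
  rewrite esumD; last 2 first.
  - by move=> k _; exact: eherz_term_ge0.
  - by move=> k _; exact: eherz_term_ge0.
  rewrite EFinD -bpE -bmE; apply: leeD.
    by have := HCp _ i mI; rewrite [in leLHS]eherzE.
  by have := HCm _ i mI; rewrite [in leLHS]eherzE.
- move=> K; apply: evsmallZ => //.
  by rewrite !mulr_ge0 ?powR_ge0 ?expR_ge0// ltW.
- move=> e e0; have b0 : 0 <= bp + bm.
    rewrite -lee_fin EFinD -bpE -bmE adde_ge0// mule_ge0 ?eherz_ge0 ?lee_fin ?ltW//.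
  (* Since [e^x >= x], one has [2^(-K eta) <= 1 / (K eta ln 2)], which dictates [K]. *)
  have [K HK] : exists K : nat, (bp + bm) / (eta * ln 2) <= K%:R * e.
    exists (Num.trunc ((bp + bm) / (eta * ln 2) / e)).+1.
    by rewrite -ler_pdivrMr// ltW// truncnS_gt.
  exists K => i; rewrite lee_fin powR_expR// mulNr expRN.
  have L0 : 0 < ln (2 : R) by rewrite ln_gt0// ltr1n.
  rewrite mulrC ler_pdivrMr ?expR_gt0//.
  move: HK; rewrite ler_pdivrMr; last exact: mulr_gt0.
  move=> /le_trans; apply.
  rewrite mulrAC -[leLHS]mulrC ler_pM2l// mulrA.
  by apply: le_trans (expR_ge1Dx _); rewrite lerDr.
Qed.

(* Dominated convergence, on each annulus and in the sum over the annuli *)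
Lemma eherz_dominated (h : nat -> V -> \bar R) (H : V -> \bar R) :
  (forall j, measurable_fun setT (h j)) -> measurable_fun setT H ->
  (forall j x, 0 <= h j x)%E -> (forall j x, h j x <= H x)%E ->
  (forall x, x != 0 -> h j x @[j --> \oo] --> 0%E) ->
  (eherz s q H < +oo)%E -> evsmall (fun j => eherz s q (h j)).
Proof.
move=> mh mH h0 hH hc Hoo; have q'0 : 0 < q^-1 by rewrite invr_gt0.
have H0 x : (0 <= H x)%E by exact: le_trans (h0 0%N x) (hH 0%N x).
have small k : evsmall (fun j => ring_norm q k (h j)).
  apply: evsmall_pow => // [j|].
    by apply: integral_ge0 => x _; exact: poweR_ge0.
  have mA := @measurable_annulus R n k.
  have mp (g : V -> \bar R) : measurable_fun setT g -> measurable_fun (annulus k) (fun x => g x `^ q)%E.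
    by move=> mg; apply: measurable_funTS; exact: (measurableT_comp (measurable_poweR q)).
  apply: evsmall_cvg.
  have := @dominated_convergence _ _ _ mu (annulus k) mA (fun j x => h j x `^ q)%E
    (cst 0%E) (fun x => H x `^ q)%E.
  case.
  - by move=> j; exact: mp.
  - exact: measurable_cst.
  - apply: nearW => x /annulusP/andP[xk _].
    have x0 : x != 0.
      by apply/eqP => x0; move: xk; rewrite x0 enorm0 leNgt exprz_gt0.
    have /evsmall_pow := evsmall_cvg (hc x x0).
    move=> /(_ q q0 (fun j => h0 j x)) sm.
    apply/fine_cvgP; split.
      apply: filterS (sm 1 ltr01) => j hj; rewrite ge0_fin_numE ?poweR_ge0//.
      by apply: le_lt_trans hj _; exact: ltry.
    apply/cvgrPdist_le => e e0; apply: filterS (sm e e0) => j hj.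
    rewrite /= sub0r normrN ger0_norm ?fine_ge0 ?poweR_ge0//.
    rewrite -lee_fin fineK// ge0_fin_numE ?poweR_ge0//.
    by apply: le_lt_trans hj _; exact: ltry.
  - apply/integrableP; split; first exact: mp.
    under eq_integral => x _ do rewrite gee0_abs ?poweR_ge0//.
    have := ring_norm_lty k Hoo; rewrite /ring_norm.
    by apply: lty_poweRy; rewrite gt_eqF.
  - apply: nearW => x j _; rewrite gee0_abs ?poweR_ge0//.
    by apply: le_poweR => //; exact: ltW.
  by rewrite integral0 => _ _ E; exact: E.
pose a (g : V -> \bar R) i := ((2 `^ ((int_of_index i)%:~R * s))%:E *
  ring_norm q (int_of_index i) g)%E.
have a0 (g : V -> \bar R) i : (0 <= a g i)%E by exact: eherz_term_ge0.
have aE (g : V -> \bar R) : eherz s q g = (\sum_(0 <= i <oo) a g i)%E.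
  by rewrite eherzE esum_int_series// => k; exact: eherz_term_ge0.
rewrite aE in Hoo; have tail := nneseries_tail_cvg Hoo (fun i _ => a0 H i).
apply: (@evsmall_approx _ _ (fun K j => \sum_(0 <= i < K) a (h j) i)%E
  (fun K j => \sum_(K <= i <oo) a H i)%E).
- move=> K j; rewrite aE (nneseries_split 0 K); last by move=> i _; exact: a0.
  rewrite add0n; apply: leeD => //; apply: lee_nneseries => [i _ _|i _]; first exact: a0.
  apply: lee_wpmul2l; first by rewrite lee_fin powR_ge0.
  by apply: le_ring_norm => //; apply: nearW => x _; exact: hH.
- move=> K; apply: evsmall_sum => i; apply: evsmallZ; first exact: powR_ge0.
  exact: small.
- move=> e e0; have [K _ HK] := evsmall_cvg tail e0.
  by exists K => _; apply: HK => /=.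
Qed.

Lemma herz_strong0 : herz_strong (cst 0).
Proof.
have := @herz_strong_indic 0 set0 measurable0 (@sub0set _ _).
by rewrite indic0.
Qed.

(** Simple functions below [f], cut off to shells, are finite combinations of indicators. They
    converge to [f] off the origin and are dominated by [f]; the uniform bound of [eherz_gap_le]
    carries the error through the heat flow. *)
Lemma herz_strong_nneg f : measurable_fun setT f -> (forall x, 0 <= f x) ->
  (eherz s q (absE f) < +oo)%E -> herz_strong f.
Proof.
move=> mf f0 foo; split=> //.
have mEf : measurable_fun setT (EFin \o f) by exact/measurable_EFinP.
pose u j : {nnsfun V >-> R} := nnsfun_approx measurableT mEf j.
pose g j (x : V) : R := (u j : V -> R) x * \1_(shell j) x.
have mg j : measurable_fun setT (g j).
  by apply: measurable_funM => //; apply: measurable_indic; exact: measurable_shell.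
have u0 j (x : V) : 0 <= u j x by [].
have uf j (x : V) : u j x <= f x.
  rewrite -lee_fin /u nnsfun_approxE -[leRHS]/((EFin \o f) x).
  by apply: le_approx => // y _; rewrite lee_fin.
have gf j x : 0 <= g j x <= f x.
  rewrite /g indicE; case: (_ \in _); rewrite ?mulr1 ?mulr0 ?lexx ?f0//.
  by rewrite u0 uf.
have sg j : herz_strong (g j).
  pose B (y : R) := (u j @^-1` [set y]) `&` shell j.
  have mB y : measurable (B y).
    by apply: measurableI => //; exact: measurable_shell.
  have H (r : seq R) : herz_strong (fun x => \sum_(y <- r) y * \1_(B y) x).
    elim: r => [|y r IH].
      by under eq_fun do rewrite big_nil; exact: herz_strong0.
    under eq_fun do rewrite big_cons; apply: herz_strongD => //.
    by apply: herz_strongZ; apply: (@herz_strong_indic j) => // x [].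
  rewrite (_ : g j = fun x => \sum_(y <- finmap.enum_fset (fset_set (range (u j)))) y * \1_(B y) x).
    exact: H.
  apply/funext => x; rewrite /g fimfunE fsbig_finite//= mulr_suml.
  apply: eq_bigr => y _; rewrite /B -mulrA; congr (_ * _).
  by rewrite [in RHS]indicI.
have [C C0 HC] := eherz_gap_le s_gt s_lt.
pose h j : V -> \bar R := absE (fun x => f x - g j x).
have mh j : measurable_fun setT (h j).
  by apply: measurable_absE; exact: measurable_funB.
have small : evsmall (fun j => eherz s q (h j)).
  apply: (@eherz_dominated h (absE f)) => //.
  - exact: measurable_absE.
  - by move=> j x; exact: absE_ge0.
  - move=> j x; rewrite /h /absE lee_fin !ger0_norm// ?subr_ge0; last by case/andP: (gf j x).
    by rewrite gerBl; case/andP: (gf j x).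
  - move=> x x0; apply: cvg_EFin; first by apply: nearW.
    have /fine_cvgP[_ uc] := @cvg_nnsfun_approx _ _ _ _ measurableT _ mEf (fun x _ => f0 x) x I.
    have cu : f x - u j x @[j --> \oo] --> 0.
      by rewrite -(subrr (f x)); apply: cvgB; [exact: cvg_cst|exact: uc].
    have e0 : 0 < enorm x.
      rewrite lt_neqAle enorm_ge0 andbT eq_sym; apply: contra x0 => /eqP/enorm_eq0 ->.
      exact: eqxx.
    apply: cvg_trans cu; apply: near_eq_cvg.
    (* For [j >= K] the point lies in [shell j], where the cut-off equals 1. *)
    have [K HK] : exists K : nat, enorm x + (enorm x)^-1 < K%:R.
      by exists (Num.trunc (enorm x + (enorm x)^-1)).+1; rewrite truncnS_gt.
    exists K => // j /= Kj; rewrite /g indicE mem_set ?mulr1.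
      by rewrite ger0_norm// subr_ge0.
    have j2 : K%:R <= 2 ^+ j :> R.
      rewrite -natrX ler_nat; apply: leq_trans Kj _; apply: ltnW; exact: ltn_expl.
    have ex : (enorm x)^-1 < 2 ^+ j.
      by apply: lt_le_trans j2; apply: le_lt_trans HK; rewrite lerDr ltW.
    split; rewrite /eball/=.
      apply: lt_le_trans j2; apply: le_lt_trans HK.
      by rewrite lerDl invr_ge0 ltW.
    apply/negP; rewrite -leNgt -[leRHS]invrK lef_pV2 ?posrE ?exprn_gt0 ?invr_gt0//.
    exact: ltW.
apply: (@evsmall_approx _ _ (fun j i => eherz s q (heat_gap t_ (g j) i))
  (fun j i => C%:E * eherz s q (h j))%E).
- move=> j i; apply: (@le_trans _ _ (eherz s q (heat_gap t_ (g j) i) +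
      eherz s q (heat_gap t_ (fun x => f x - g j x)%R i))%E); last first.
    by apply: leeD2l; apply: HC; exact: measurable_funB.
  have [mgj gjoo _] := sg j.
  rewrite {1}(_ : f = fun x => g j x + (f x - g j x)); last first.
    by apply/funext => x; rewrite subrKC.
  apply: eherz_gapD => //; first exact: measurable_funB.
  apply: le_lt_trans foo; apply: le_eherz => //.
  + exact: mh.
  + exact: measurable_absE.
  + by move=> x; exact: absE_ge0.
  + by move=> x; exact: absE_ge0.
  + apply: nearW => x; rewrite /absE lee_fin !ger0_norm ?subr_ge0//; last by case/andP: (gf j x).
    by rewrite gerBl; case/andP: (gf j x).
- by move=> j; case: (sg j).
- move=> e e0; have [K _ HK] := evsmallZ (ltW C0) small e0.
  by exists K => _; apply: HK => /=.
Qed.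

Lemma herz_strongP f : measurable_fun setT f -> (eherz s q (absE f) < +oo)%E ->
  herz_strong f.
Proof.
move=> mf foo.
pose p (x : V) := Num.max (f x) 0; pose m (x : V) := Num.max (- f x) 0.
have mp : measurable_fun setT p by exact: measurable_maxr.
have mm : measurable_fun setT m by apply: measurable_maxr => //; exact: measurableT_comp.
have p0 x : 0 <= p x by rewrite le_max lexx orbT.
have m0 x : 0 <= m x by rewrite le_max lexx orbT.
have lty g : measurable_fun setT g -> (forall x, 0 <= g x <= `|f x|) ->
    (eherz s q (absE g) < +oo)%E.
  move=> mg gf; apply: le_lt_trans foo; apply: le_eherz.
  - exact: q0.
  - exact: measurable_absE.
  - exact: measurable_absE.
  - by move=> x; exact: absE_ge0.
  - by move=> x; exact: absE_ge0.
  - apply: nearW => x; have /andP[g0 gx] := gf x.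
    by rewrite /absE lee_fin ger0_norm.
have sp : herz_strong p.
  apply: herz_strong_nneg => //; apply: lty => // x.
  by rewrite p0 /p ge_max ler_norm normr_ge0.
have sm : herz_strong m.
  apply: herz_strong_nneg => //; apply: lty => // x.
  by rewrite m0 /m ge_max -normrN ler_norm normr_ge0.
have := herz_strongD sp (herz_strongZ (-1) sm).
rewrite (_ : (fun x => _) = f)//; apply/funext => x; rewrite /p /m mulN1r.
have [fx|fx] := leP 0 (f x).
  by rewrite max_r ?oppr_le0// oppr0 addr0.
by rewrite max_l ?oppr_ge0 ?ltW// opprK add0r.
Qed.

End fixed_parameters.
End herz_continuity.

(** * Singular integrals in time *)

Section singular_integrals.
Context {R : realType}.
Local Notation leb := (@lebesgue_measure R).
Implicit Types (a b c d t L : R).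
Local Open Scope ereal_scope.

Lemma dyadic_index L : (0 < L)%R -> exists k : int,
  (2 `^ k%:~R <= L < 2 `^ (k%:~R + 1))%R.
Proof.
move=> L0; exists (Num.floor (ln L / ln 2)).
have l2 : (0 < ln (2 : R))%R by rewrite ln_gt0// ltr1n.
rewrite !powR_expR// -[X in (_ <= X < _)%R](lnK L0) ler_expR ltr_expR.
rewrite -ler_pdivlMr// -ltr_pdivrMr// ge_floor/=.
by rewrite -(intrD _ _ 1) floorD1_gt.
Qed.

(* The layer where [f] is about [2^k] contributes at most [2^(k (1 - b))], up
   to a constant. *)
Lemma integral_dyadic_layers b : (0 <= b)%R -> (b < 1)%R -> exists2 C : R, (0 < C)%R &
  forall (D : set R) (f : R -> R) L, measurable D -> measurable_fun D f ->
  (0 < L)%R -> (forall x, D x -> (0 < f x < L)%R) ->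
  (forall k : int, leb (D `&` [set x | f x < 2 `^ k%:~R]%R) <= (2 `^ k%:~R)%:E) ->
  \int[leb]_(x in D) (f x `^ (- b))%:E <= (C * L `^ (1 - b))%:E.
Proof.
move=> b0 b1; have l2 : (0 < ln (2 : R))%R by rewrite ln_gt0// ltr1n.
have c0 : (0 < (1 - b) * ln 2 :> R)%R by rewrite mulr_gt0// subr_gt0.
have [G G0 HG] := esum_geometric c0.
exists (2 `^ b * 2 `^ (1 - b) * G)%R; first by rewrite !mulr_gt0 ?powR_gt0.
move=> D f L mD mf L0 fL Hf.
(* The layer where [f] lies between [2^(k-1)] and [2^k]; on it [f^(-b)] is at most
   [2^(-(k-1) b)]. *)
pose B (k : int) := D `&` [set x | f x \in `[2 `^ (k%:~R - 1), 2 `^ k%:~R[]%R.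
have mB k : measurable (B k) by exact: (mf mD _ (measurable_itv _)).
have B_le k : leb (B k) <= (2 `^ k%:~R)%:E.
  apply: le_trans (Hf k); apply: le_measure; rewrite ?inE//; first exact: mB.
    rewrite (_ : [set x | _] = f @^-1` [set` `]-oo, (2 `^ k%:~R)%R[]); first exact: mf.
    by apply/seteqP; split=> x /=; rewrite in_itv.
  by move=> x [Dx]; rewrite /= in_itv /= => /andP[].
have [k0 /andP[k0l k0r]] := dyadic_index L0.
(* Layers above the bound [L] are empty, so the sum over [k] stops at [k0 + 1]. *)
have B0 k : (k0%:~R + 1 < k%:~R :> R)%R -> B k = set0.
  move=> k0k; apply/seteqP; split => // x [Dx]; rewrite /= in_itv/= => /andP[fx _].
  have /andP[_ fxL] := fL x Dx.
  have := le_lt_trans fx (lt_trans fxL k0r).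
  rewrite ltNge ler_powR ?ler1n//.
  rewrite -(intrD _ _ 1) -(intrB _ _ 1) ler_int.
  by move: k0k; rewrite -(intrD _ _ 1) ltr_int; lia.
pose g k x := ((2 `^ (- ((k%:~R - 1) * b)))%:E * (\1_(B k) x)%:E : \bar R).
have g0 k x : 0 <= g k x by rewrite mule_ge0// lee_fin ?powR_ge0.
have mI k : measurable_fun setT (fun x => (\1_(B k) x : R)%:E).
  by apply/measurable_EFinP; exact: measurable_indic.
have mg k : measurable_fun setT (g k).
  by apply: emeasurable_funM; [exact: measurable_cst|exact: mI].
apply: (@le_trans _ _ (\int[leb]_(x in D) \esum_(k in [set: int]) g k x)).
  apply: ge0_le_integral => //.
  - by move=> x _; rewrite lee_fin powR_ge0.
  - by apply/measurable_EFinP; exact: (measurableT_comp (measurable_powR _)).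
  - by apply: measurable_funTS; apply: measurable_esum_int.
  move=> x Dx; have /andP[fx0 _] := fL x Dx.
  have [k /andP[kl kr]] := dyadic_index fx0.
  apply: le_trans (esum_int_ge (k + 1) (fun k => g0 k x)).
  rewrite /g indicE mem_set; last first.
    by split=> //=; rewrite in_itv/= intrD addrK kl.
  rewrite /= mule1 lee_fin intrD addrK !powRN lef_pV2 ?posrE ?powR_gt0//.
  by rewrite powRrM ge0_ler_powR ?nnegrE ?powR_ge0// ltW.
rewrite (@integral_esum_int _ _ _ leb D g mD (fun k => measurable_funTS (mg k)) (fun k x _ => g0 k x)).
(* A layer contributes at most [2^b 2^(k (1-b))]; because [b < 1] these terms decrease geometrically
   below the top index. *)
apply: (@le_trans _ _ (\esum_(k in [set: int]) ((2 `^ b * (2 * L) `^ (1 - b))%:E *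
    (expR (- ((1 - b) * ln 2 * `|k%:~R - (k0 + 1)%:~R|)))%:E))).
  apply: le_esum => k _.
  rewrite ge0_integralZl_EFin ?powR_ge0//; last first.
    exact: measurable_funTS (mI k).
  rewrite (@integral_indic _ _ _ leb D mD (B k) (mB k)) (_ : B k `&` D = B k); last first.
    by apply/setIidPl => x [].
  have [kk0|kk0] := leP (k%:~R : R) (k0%:~R + 1)%R; last first.
    by rewrite B0// measure0 mule0 mule_ge0// lee_fin ?mulr_ge0 ?powR_ge0 ?expR_ge0.
  apply: (@le_trans _ _ ((2 `^ (- ((k%:~R - 1) * b)))%:E * (2 `^ k%:~R)%:E)).
    by apply: lee_wpmul2l; [rewrite lee_fin powR_ge0|exact: B_le].
  rewrite -!EFinM lee_fin.
  rewrite [leLHS](_ : _ = 2 `^ b * (2 `^ (k0%:~R + 1) `^ (1 - b) *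
     expR (- ((1 - b) * ln 2 * `|k%:~R - (k0 + 1)%:~R|))))%R; last first.
    rewrite intrD ler0_norm ?subr_le0// -powRrM !powR_expR// -!expRD.
    by congr expR; ring.
  rewrite -[leRHS]mulrA ler_pM2l ?powR_gt0// ler_pM2r ?expR_gt0//.
  rewrite ge0_ler_powR ?nnegrE ?subr_ge0 ?powR_ge0 ?(ltW b1)//.
    by rewrite mulr_ge0// ltW.
  by rewrite powRD_gt0// powRr1// mulrC ler_pM2l.
rewrite esum_intZl; last 2 first.
- by rewrite mulr_ge0 ?powR_ge0.
- by move=> k; rewrite lee_fin expR_ge0.
apply: (@le_trans _ _ ((2 `^ b * (2 * L) `^ (1 - b))%:E * G%:E)).
  by apply: lee_wpmul2l; rewrite ?HG// lee_fin mulr_ge0 ?powR_ge0.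
rewrite -EFinM lee_fin powRM ?(ltW L0)//.
by rewrite le_eqVlt; apply/orP; left; apply/eqP; ring.
Qed.

(** The points at distance less than [2^k] from the endpoint have measure at most [2^k], as
    [integral_dyadic_layers] asks. *)
Lemma integral_left_singular b : (0 <= b)%R -> (b < 1)%R -> exists2 C : R, (0 < C)%R &
  forall c d, (c < d)%R -> \int[leb]_(x in `]c, d[) ((x - c) `^ (- b))%:E <=
    (C * (d - c) `^ (1 - b))%:E.
Proof.
move=> b0 b1; have [C C0 HC] := integral_dyadic_layers b0 b1; exists C => // c d cd.
apply: HC => //; rewrite ?subr_gt0//.
- exact: measurable_funB.
- by move=> x /=; rewrite in_itv/= => /andP[cx xd]; rewrite subr_gt0 cx ltrD2r.
- move=> k; apply: (@le_trans _ _ (leb `]c, (c + 2 `^ k%:~R)%R[%classic)).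
    apply: le_measure; rewrite ?inE//.
      apply: measurableI => //.
      rewrite (_ : [set x | _] = [set` `]-oo, (c + 2 `^ k%:~R)%R[]); first exact: measurable_itv.
      by apply/seteqP; split => x /=; rewrite in_itv/= ltrBlDl.
    move=> x [] /=; rewrite !in_itv/= => /andP[-> _].
    by rewrite ltrBlDl.
  rewrite lebesgue_measure_itv/= lte_fin ltrDl powR_gt0// -EFinD lee_fin.
  by rewrite addrAC subrr add0r.
Qed.

Lemma integral_right_singular b : (0 <= b)%R -> (b < 1)%R -> exists2 C : R, (0 < C)%R &
  forall c d, (c < d)%R -> \int[leb]_(x in `]c, d[) ((d - x) `^ (- b))%:E <=
    (C * (d - c) `^ (1 - b))%:E.
Proof.
move=> b0 b1; have [C C0 HC] := integral_dyadic_layers b0 b1; exists C => // c d cd.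
apply: HC => //; rewrite ?subr_gt0//.
- exact: measurable_funB.
- by move=> x /=; rewrite in_itv/= => /andP[cx xd]; rewrite subr_gt0 xd ltrD2l ltrN2.
- move=> k; apply: (@le_trans _ _ (leb `](d - 2 `^ k%:~R)%R, d[%classic)).
    apply: le_measure; rewrite ?inE//.
      apply: measurableI => //.
      rewrite (_ : [set x | _] = [set` `](d - 2 `^ k%:~R)%R, +oo[]); first exact: measurable_itv.
      by apply/seteqP; split => x /=; rewrite in_itv/= andbT ltrBlDr ltrBlDl.
    move=> x [] /=; rewrite !in_itv/= => /andP[_ ->].
    by rewrite andbT ltrBlDr ltrBlDl.
  rewrite lebesgue_measure_itv/= lte_fin gtrBl powR_gt0// -EFinD lee_fin.
  by rewrite opprB addrC subrK.
Qed.

Lemma measurable_singular_product a b c d (D : set R) :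
  measurable_fun D (fun x => ((d - x) `^ (- a) * (x - c) `^ (- b))%:E).
Proof.
apply/measurable_EFinP; apply: measurable_funTS; apply: measurable_funM.
  by apply: (measurableT_comp (measurable_powR _)); exact: measurable_funB.
by apply: (measurableT_comp (measurable_powR _)); exact: measurable_funB.
Qed.

(** At each point one of the two distances to the endpoints is at least half the length [h].
    Replacing that factor by a power of [h] and adding both cases leaves two one-sided integrals. *)
Lemma integral_two_singular a b : (0 <= a)%R -> (a < 1)%R -> (0 <= b)%R -> (b < 1)%R ->
  exists2 C : R, (0 < C)%R & forall c d, (c < d)%R ->
  \int[leb]_(x in `]c, d[) ((d - x) `^ (- a) * (x - c) `^ (- b))%:E <=
    (C * (d - c) `^ (1 - a - b))%:E.
Proof.
move=> a0 a1 b0 b1.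
have [Cb Cb0 HCb] := integral_left_singular b0 b1.
have [Ca Ca0 HCa] := integral_right_singular a0 a1.
exists (2 `^ a * Cb + 2 `^ b * Ca)%R; first by rewrite addr_gt0// mulr_gt0// powR_gt0.
move=> c d cd; have dc : (0 < (d - c) / 2)%R by rewrite divr_gt0// subr_gt0.
set h := ((d - c) / 2)%R in dc.
have mp (f : R -> R) (x : R) : measurable_fun setT f ->
    measurable_fun `]c, d[ (fun y : R => (f y `^ x)%:E).
  move=> mf; apply/measurable_EFinP; apply: measurable_funTS.
  exact: (measurableT_comp (measurable_powR _)).
have ml : measurable_fun setT (fun x : R => x - c)%R by exact: measurable_funB.
have mr : measurable_fun setT (fun x : R => d - x)%R by exact: measurable_funB.
apply: (@le_trans _ _ (\int[leb]_(x in `]c, d[)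
   ((h `^ (- a))%:E * ((x - c) `^ (- b))%:E + (h `^ (- b))%:E * ((d - x) `^ (- a))%:E))).
  apply: ge0_le_integral => //.
  - by move=> x _; rewrite lee_fin mulr_ge0 ?powR_ge0.
  - exact: measurable_singular_product.
  - by apply: emeasurable_funD; apply: emeasurable_funM => //; exact: mp.
  move=> x /=; rewrite in_itv/= => /andP[cx xd].
  have x1 : (0 < x - c)%R by rewrite subr_gt0.
  have x2 : (0 < d - x)%R by rewrite subr_gt0.
  rewrite -!EFinM -EFinD lee_fin.
  have key (u v : R) : (0 <= v)%R -> (h <= u)%R -> (u `^ (- v) <= h `^ (- v))%R.
    move=> v0 hu; rewrite !powRN lef_pV2 ?posrE ?powR_gt0//; last exact: lt_le_trans hu.
    by rewrite ge0_ler_powR ?nnegrE ?(ltW dc)// (le_trans (ltW dc)).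
  have [xh|xh] := leP h (d - x)%R.
    rewrite -[leLHS]addr0 lerD ?mulr_ge0 ?powR_ge0// ler_wpM2r ?powR_ge0//.
    exact: key.
  rewrite -[leLHS]add0r lerD ?mulr_ge0 ?powR_ge0// mulrC ler_wpM2r ?powR_ge0//.
  by apply: key => //; rewrite /h in xh *; lra.
rewrite ge0_integralD//; last 4 first.
- by move=> x _; rewrite mule_ge0// lee_fin powR_ge0.
- by apply: emeasurable_funM => //; exact: mp.
- by move=> x _; rewrite mule_ge0// lee_fin powR_ge0.
- by apply: emeasurable_funM => //; exact: mp.
rewrite !ge0_integralZl_EFin ?powR_ge0//; last 4 first.
- by move=> x _; rewrite lee_fin powR_ge0.
- exact: mp.
- by move=> x _; rewrite lee_fin powR_ge0.
- exact: mp.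
rewrite mulrDl EFinD; have dc0 : (0 < d - c)%R by rewrite subr_gt0.
have hE (v : R) : (h `^ (- v) = 2 `^ v * (d - c) `^ (- v))%R.
  by rewrite /h powRM ?invr_ge0 ?(ltW dc0)// -powR_inv1// -powRrM mulN1r opprK mulrC.
apply: leeD.
  apply: (@le_trans _ _ ((h `^ (- a))%:E * (Cb * (d - c) `^ (1 - b))%:E)).
    by apply: lee_wpmul2l; [rewrite lee_fin powR_ge0|exact: HCb].
  rewrite -EFinM lee_fin hE (_ : (1 - a - b = (1 - b) + - a)%R); last by ring.
  rewrite (powRD_gt0 (1 - b) (- a))//.
  by rewrite le_eqVlt; apply/orP; left; apply/eqP; ring.
apply: (@le_trans _ _ ((h `^ (- b))%:E * (Ca * (d - c) `^ (1 - a))%:E)).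
  by apply: lee_wpmul2l; [rewrite lee_fin powR_ge0|exact: HCa].
rewrite -EFinM lee_fin hE (powRD_gt0 (1 - a) (- b))//.
by rewrite le_eqVlt; apply/orP; left; apply/eqP; ring.
Qed.

End singular_integrals.

(** * Herz spaces *)

Lemma cvge0P {R : realType} {T} {F : set_system T} {FF : Filter F}
    (f : T -> \bar R) : (forall x, 0 <= f x)%E ->
  f @ F --> 0%E <-> forall e : R, 0 < e -> \forall x \near F, (f x <= e%:E)%E.
Proof.
move=> f0; split=> [/fine_cvgP[ff fc] e e0|H].
  move/cvgrPdist_le : fc => /(_ e e0) fe.
  near=> x; have fx : f x \is a fin_num by near: x.
  have : `|0 - fine (f x)| <= e by near: x.
  rewrite /= sub0r normrN ger0_norm ?fine_ge0//.
  by rewrite -lee_fin fineK.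
have fin (e : R) x : (f x <= e%:E)%E -> f x \is a fin_num.
  by move=> fe; rewrite ge0_fin_numE//; apply: le_lt_trans fe _; exact: ltry.
apply/fine_cvgP; split.
  by apply: filterS (H 1 ltr01) => x; exact: fin.
apply/cvgrPdist_le => e e0; apply: filterS (H e e0) => x fe.
by rewrite /= sub0r normrN ger0_norm ?fine_ge0// -lee_fin fineK//; exact: fin fe.
Unshelve. all: by end_near. Qed.

(** Monotonicity straight from the supremum over simple functions. It serves [herz_spaceE], where
    the indicator of a compact set enters without a measurability proof. *)
Lemma ge0_le_integral_nonmeas d (T : measurableType d) (R : realType)
    (mu : {measure set T -> \bar R}) (f g : T -> \bar R) :
  (forall x, 0 <= f x)%E -> (forall x, f x <= g x)%E ->
  (\int[mu]_x f x <= \int[mu]_x g x)%E.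
Proof.
move=> f0 fg; have g0 x : (0 <= g x)%E by exact: le_trans (f0 x) (fg x).
rewrite !ge0_integralTE//; apply: le_ereal_sup => _ [h /= hf <-].
by exists h => //= x; exact: le_trans (hf x) (fg x).
Qed.

Lemma Lnorm_indic d (T : measurableType d) (R : realType)
    (mu : {measure set T -> \bar R}) (A : set T) (p : R) (f : T -> R) : 0 < p ->
  (Lnorm mu p%:E (EFin \o (f \* \1_A)%R) =
   (\int[mu]_(x in A) (`|f x|%R%:E `^ p)) `^ p^-1)%E.
Proof.
move=> p0; rewrite unlock [in RHS]integral_mkcond; congr (_ `^ _)%E.
apply: eq_integral => x _; rewrite patchE /= indicE; case: ifPn => _.
  by rewrite mulr1.
by rewrite mulr0 normr0 powR0 ?gt_eqF.
Qed.

Section herz_space.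
Context {R : realType} {n : nat}.
Hypothesis n0 : (0 < n)%N.
Local Notation V := 'rV[R]_n.
Local Notation mu := (@lebesgue_rV R n).
Implicit Types (f g : V -> R) (s p : R).

Lemma herz_normE s p f : 0 < p ->
  herz_norm s p%:E 1%E f = eherz s p (absE f).
Proof.
move=> p0; rewrite eherzE /herz_norm invr1 poweRe1; last first.
  by apply: esum_ge0 => k _; rewrite mule_ge0 ?poweR_ge0// lee_fin powR_ge0.
apply: eq_esum => k _; rewrite mulr1 poweRe1 ?Lnorm_ge0//.
by rewrite Lnorm_indic.
Qed.

(** The squared Euclidean norm is continuous for the ambient topology, so it maps [K] to a compact
    set of reals avoiding 0: bounded, and bounded away from 0. *)
Lemma compact_shell (K : set V) : compact K -> ~ K 0 -> exists m, K `<=` shell m.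
Proof.
move=> cK K0.
pose g (x : V) : R := \sum_(i < n) x ord0 i ^+ 2.
have cg : continuous g.
  apply: (@continuous_big R _ +%R 0 xpredT); first by move=> z; exact: add_continuous.
  move=> i _ x.
  apply: (@continuous_comp V R R (fun x : V => x ord0 i) (fun t : R => t ^+ 2)).
    exact: coord_continuous.
  exact: exprn_continuous.
have cgK : compact (g @` K).
  by apply: continuous_compact => //; exact: continuous_subspaceT.
have gE x : g x = enorm x ^+ 2 by rewrite enorm_sqr.
have [M [_ HM]] := compact_bounded (V := R^o) cgK.
have clK := compact_closed (@norm_hausdorff _ R^o) cgK.
have : (~` (g @` K)) 0.
  move=> [x Kx]; rewrite gE => /eqP; rewrite expf_eq0/= => /eqP/enorm_eq0 x0.
  by rewrite x0 in Kx.
have /= opK : open (~` (g @` K)) by exact: closed_openC.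
move=> /opK /nbhs_ballP[e /= e0 He].
have [m mE] : exists m : nat, (`|M| + 1) + e^-1 + 1 < m%:R.
  by exists (Num.trunc ((`|M| + 1) + e^-1 + 1)).+1; rewrite truncnS_gt.
exists m => x Kx; have Kgx : (g @` K) (g x) by exists x.
have m2 : m%:R <= 2 ^+ m :> R by rewrite -natrX ler_nat ltnW// ltn_expl.
have i0 : 0 < e^-1 by rewrite invr_gt0.
have gM : enorm x ^+ 2 <= `|M| + 1.
  have := HM (`|M| + 1); rewrite (le_lt_trans (ler_norm M)) ?ltrDl// => /(_ isT _ Kgx).
  by rewrite /= gE ger0_norm ?sqr_ge0.
have ge : e <= enorm x ^+ 2.
  rewrite leNgt; apply/negP => gxe; apply: (He (g x)) => //.
  by rewrite /ball/= sub0r normrN gE ger0_norm ?sqr_ge0.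
have N0 := normr_ge0 M.
have P1 : 1 <= 2 ^+ m :> R by rewrite exprn_ege1// ler1n.
split; rewrite /eball/=.
  rewrite -(ltr_pXn2r (n := 2)) ?nnegrE ?enorm_ge0 ?exprn_ge0//.
  apply: (@lt_le_trans _ _ (2 ^+ m)); first lra.
  by rewrite expr2 ler_peMl// exprn_ge0.
apply/negP; rewrite -leNgt -(ler_pXn2r (n := 2)) ?nnegrE ?invr_ge0 ?enorm_ge0 ?exprn_ge0//.
apply: le_trans ge; rewrite exprVn -[leRHS]invrK lef_pV2 ?posrE ?exprn_gt0//.
apply: (@le_trans _ _ (2 ^+ m)); first lra.
by rewrite [leRHS]expr2 ler_peMl// exprn_ge0.
Qed.

(** Local integrability off the origin follows from the finite norm: a compact set that avoids the
    origin lies in a shell, which meets finitely many annuli, each of finite norm. *)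
Lemma herz_spaceE s p f : 1 <= p ->
  herz_space s p%:E 1%E f <->
  measurable_fun setT f /\ (eherz s p (absE f) < +oo)%E.
Proof.
move=> p1; have p0 : 0 < p by exact: lt_le_trans p1.
rewrite -(herz_normE s f p0); split=> [[[mf _]]//|[mf]].
move=> /[dup] fs; rewrite herz_normE// => foo; split=> //; split=> //.
move=> K cK K0; have [m Km] := compact_shell cK K0.
have [G G0 HG] := esum_geometric (@ltr01 R).
have mS := @measurable_shell R n m.
have mfp : measurable_fun setT (fun x => absE f x `^ p)%E.
  by apply: (measurableT_comp (measurable_poweR p)); exact: measurable_absE.
pose g x := (absE f x `^ p * (\1_(shell m) x)%:E)%E.
have g0 x : (0 <= g x)%E by rewrite mule_ge0 ?poweR_ge0// lee_fin.
have mg : measurable_fun setT g.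
  apply: emeasurable_funM => //.
  by apply/measurable_EFinP; exact: measurable_indic.
rewrite unlock /Lnorm; apply: poweR_lty.
apply: (@le_lt_trans _ _ (\int[mu]_x g x)%E).
  apply: ge0_le_integral_nonmeas => [x|x]; first exact: poweR_ge0.
  rewrite /= /g !indicE; have [xK|xK] := boolP (x \in K).
    rewrite (_ : x \in shell m) ?mulr1 ?mule1//.
    by apply/mem_set/Km; exact: set_mem.
  by rewrite mulr0 normr0 poweR_EFin powR0 ?gt_eqF// mule_ge0 ?poweR_ge0.
rewrite (ae_eq_integral (fun x => \esum_(j in [set: int]) rpart j g x)%E) //=.
- rewrite integral_esum_int//; last 2 first.
  + by move=> k; exact: measurable_rpart.
  + by move=> k x _; exact: rpart_ge0.
  pose A := fine (2 `^ ((m%:R + 1) * `|s|))%:E.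
  pose H := fine (eherz s p (absE f)).
  have HE : eherz s p (absE f) = H%:E by rewrite fineK// ge0_fin_numE// eherz_ge0.
  have H0 : 0 <= H by rewrite fine_ge0// eherz_ge0.
  (* As before, [e^(m + 1 - |k|) >= 1] on the annuli that meet the shell. *)
  set c : R := (2 `^ ((m%:R + 1) * `|s|) * H) `^ p * expR (m%:R + 1).
  have c0 : 0 <= c by rewrite mulr_ge0 ?powR_ge0 ?expR_ge0.
  apply: (@le_lt_trans _ _ (\esum_(k in [set: int])
      (c%:E * (expR (- (1 * `|k%:~R - 0%:~R : R|)))%:E))%E); last first.
    rewrite esum_intZl//.
    by apply: (@le_lt_trans _ _ (c%:E * G%:E)%E); [exact: lee_wpmul2l|rewrite -EFinM ltry].
  apply: le_esum => k _.
  have [km|km] := leP (`|k%:~R : R|) (m%:R + 1); last first.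
    rewrite integral0_eq ?mule_ge0 ?lee_fin ?expR_ge0// => x _.
    rewrite rpartE; case: ifPn => // /set_mem kx; rewrite /g indicE.
    case: (boolP (x \in shell m)) => [/set_mem sx|]; last by rewrite mule0.
    by have := shell_annulus n0 sx kx; rewrite leNgt km.
  apply: (@le_trans _ _ (((2 `^ ((m%:R + 1) * `|s|) * H) `^ p)%:E)).
    apply: (@le_trans _ _ (ring_norm p k (absE f) `^ p)%E); last first.
      have rk : (ring_norm p k (absE f) <= (2 `^ (- (k%:~R * s)) * H)%:E)%E.
        rewrite EFinM -HE eherzE.
        apply: (@le_trans _ _ ((2 `^ (- (k%:~R * s)))%:E *
            ((2 `^ (k%:~R * s))%:E * ring_norm p k (absE f)))%E).
          rewrite muleA -EFinM -powRD_gt0// addNr powRr0 mul1e//.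
        apply: lee_wpmul2l; first by rewrite lee_fin powR_ge0.
        by apply: (esum_int_ge k) => j; exact: eherz_term_ge0.
      rewrite -poweR_EFin; apply: le_poweR => //; [exact: ltW|exact: ring_norm_ge0|].
      apply: le_trans rk _; rewrite lee_fin ler_wpM2r// ler_powR ?ler1n//.
      apply: le_trans (ler_norm _) _; rewrite normrN normrM.
      by rewrite ler_wpM2r.
    rewrite /ring_norm -poweRrM mulVf ?gt_eqF// poweRe1; last first.
      by apply: integral_ge0 => x _; exact: poweR_ge0.
    rewrite [leRHS]integral_mkcond; apply: ge0_le_integral => //.
    + by move=> x _; exact: rpart_ge0.
    + exact: measurable_rpart.
    + apply/(measurable_restrictT _ (@measurable_annulus R n k)).
      exact: measurable_funTS.
    move=> x _; rewrite rpartE patchE; case: ifPn => // _.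
    by rewrite /g -[leRHS]mule1 lee_wpmul2l ?poweR_ge0// lee_fin indicE; case: (_ \in _).
  rewrite /c EFinM -muleA -[leLHS]mule1; apply: lee_wpmul2l; first by rewrite lee_fin powR_ge0.
  by rewrite -EFinM lee_fin -expRD -[leLHS]expR0 ler_expR mul1r subr0 subr_ge0.
- by apply: measurable_esum_int => [k|k x]; [exact: measurable_rpart|exact: rpart_ge0].
- apply: filterS (ae_neq0 n0) => x x0 _.
  by rewrite esum_rpart.
Qed.

End herz_space.

(** * The nonlinearity *)

Lemma hoelder_in d (T : measurableType d) (R : realType)
    (mu : {measure set T -> \bar R}) (A : set T) (f g : T -> R) (p q : R) :
  measurable A -> measurable_fun setT f -> measurable_fun setT g ->
  0 < p -> 0 < q -> p^-1 + q^-1 = 1 ->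
  (\int[mu]_(x in A) `|(f x * g x)%R|%R%:E <=
   (\int[mu]_(x in A) (`|f x|%R%:E `^ p)) `^ p^-1 *
   (\int[mu]_(x in A) (`|g x|%R%:E `^ q)) `^ q^-1)%E.
Proof.
move=> mA mf mg p0 q0 pq.
have mi : measurable_fun setT (\1_A : T -> R) by exact: measurable_indic.
have := hoelder mu (measurable_funM mf mi) (measurable_funM mg mi) p0 q0 pq.
rewrite !Lnorm_indic//; apply: le_trans; rewrite Lnorm1.
rewrite integral_mkcond; apply: ge0_le_integral => //.
- by move=> x _; apply: erestrict_ge0 => y _; rewrite lee_fin.
- apply/(measurable_restrictT _ mA); apply: measurable_funTS.
  by apply/measurable_EFinP; apply: measurableT_comp => //; exact: measurable_funM.
- apply: measurableT_comp => //; apply/measurable_EFinP.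
  by apply: measurable_funM; exact: measurable_funM.
move=> x _; rewrite patchE /= indicE; case: ifPn => _; last by rewrite mulr0 mul0r normr0.
by rewrite !mulr1.
Qed.

Section power_nonlinearity.
Context {R : realType}.
Implicit Types a b u v : R.

(** After division by [a^beta b] this is [1 - (b/a)^beta <= beta (a/b - 1)], from [1 + x <= e^x] and
    [ln x <= x - 1]. The factor [b] tames the singular derivative of the power when [beta < 1]. *)
Lemma powR_diff_mul (beta a b : R) : 0 < beta -> 0 <= b -> b <= a ->
  (a `^ beta - b `^ beta) * b <= beta * a `^ beta * (a - b).
Proof.
move=> beta0; rewrite le_eqVlt => /predU1P[<-|b0] ba.
  by rewrite mulr0 !mulr_ge0 ?powR_ge0 ?subr_ge0// ltW.
have a0 := lt_le_trans b0 ba.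
have : 1 - (b / a) `^ beta <= beta * (a / b - 1).
  have ab : 0 < a / b by rewrite divr_gt0.
  rewrite lerBlDr -lerBlDl powR_expR ?divr_gt0//.
  apply: le_trans (expR_ge1Dx _).
  have -> : ln (b / a) = - ln (a / b) by rewrite -lnV ?posrE// invf_div.
  have := ln_le_sub1 ab; rewrite -(ler_pM2l beta0); lra.
rewrite powRM ?invr_ge0 ?(ltW b0) ?(ltW a0)// -[a^-1]powR_inv1 ?(ltW a0)// -powRrM mulN1r.
rewrite powRN -(ler_pM2l (mulr_gt0 (powR_gt0 beta a0) b0)).
rewrite (_ : a `^ beta * b * (1 - b `^ beta / a `^ beta) = (a `^ beta - b `^ beta) * b); last first.
  by field; rewrite gt_eqF// powR_gt0.
rewrite (_ : a `^ beta * b * (beta * (a / b - 1)) = beta * a `^ beta * (a - b))//.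
by field; rewrite gt_eqF.
Qed.

(** For [|v| <= |u|], split the difference as [|u|^beta (u - v) + (|u|^beta - |v|^beta) v] and apply
    [powR_diff_mul] to the second term. *)
Lemma powR_nonlinearity_lip (beta u v : R) : 0 < beta ->
  `| `|u| `^ beta * u - `|v| `^ beta * v | <=
  (beta + 1) * (`|u| `^ beta + `|v| `^ beta) * `|u - v|.
Proof.
move=> b0; wlog vu : u v / `|v| <= `|u|.
  move=> H; have [/H //|/ltW/H] := leP `|v| `|u|.
  by rewrite distrC [X in _ <= _ * X * _]addrC (distrC v u).
have vub : `|v| `^ beta <= `|u| `^ beta.
  by rewrite ge0_ler_powR ?nnegrE// ltW.
apply: (@le_trans _ _ ((beta + 1) * `|u| `^ beta * `|u - v|)); last first.
  apply: ler_wpM2r => //; apply: ler_wpM2l; first by rewrite addr_ge0// ltW.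
  by rewrite lerDl powR_ge0.
rewrite (_ : _ - _ = `|u| `^ beta * (u - v) + (`|u| `^ beta - `|v| `^ beta) * v); last by ring.
apply: le_trans (ler_normD _ _) _; rewrite !normrM.
rewrite (ger0_norm (powR_ge0 _ _)) (@ger0_norm _ (`|u| `^ beta - `|v| `^ beta)) ?subr_ge0//.
rewrite (_ : (beta + 1) * _ * _ =
  `|u| `^ beta * `|u - v| + beta * `|u| `^ beta * `|u - v|); last by ring.
rewrite lerD2l.
apply: le_trans (powR_diff_mul b0 (normr_ge0 v) vu) _.
apply: ler_wpM2l; first by rewrite mulr_ge0 ?powR_ge0// ltW.
exact: lerB_dist.
Qed.

End power_nonlinearity.

Section nonlinear_estimate.
Context {R : realType} {n : nat}.
Hypothesis n0 : (0 < n)%N.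
Local Notation V := 'rV[R]_n.
Local Notation mu := (@lebesgue_rV R n).
Local Notation N := (n%:R : R).
Implicit Types (f g u v w : V -> R).
Variables (beta gamma kappa s : R).
Hypotheses (beta0 : 0 < beta) (gamma0 : 0 <= gamma) (kappa1 : beta + 1 <= kappa).
Local Notation p' := (kappa / (beta + 1)).
Local Notation al' := (s * (beta + 1) + gamma).

Let b1 : 0 < beta + 1. Proof. by rewrite addr_gt0. Qed.
Let kappa0 : 0 < kappa. Proof. exact: lt_le_trans kappa1. Qed.
Let p'1 : 1 <= p'. Proof. by rewrite ler_pdivlMr// mul1r. Qed.
Let p'0 : 0 < p'. Proof. exact: lt_le_trans p'1. Qed.

(** The nonlinearity with its last factor freed: [w = u] gives the nonlinearity itself, [w = u - v]
    the bound of a difference. *)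
Definition henon_weight u w (x : V) : R := enorm x `^ (- gamma) * `|u x| `^ beta * w x.

Lemma henon_termE u : henon_term gamma beta u = henon_weight u u.
Proof. by []. Qed.

Lemma measurable_henon_weight u w : measurable_fun setT u -> measurable_fun setT w ->
  measurable_fun setT (henon_weight u w).
Proof.
move=> mu_ mw; apply: measurable_funM => //; apply: measurable_funM.
  by apply: (measurableT_comp (measurable_powR _)); exact: measurable_enorm.
by apply: (measurableT_comp (measurable_powR _)); exact: measurableT_comp.
Qed.

(* Stated up to equalities so that the integrals need not be rewritten. *)
Let hoelder_exponents (a b c x y z : \bar R) : a = x -> b = y -> c = z ->
  (0 <= a -> 0 <= b -> 0 <= c ->
   a <= b `^ ((beta + 1) / beta)^-1 * c `^ (beta + 1)^-1 ->
   x `^ p'^-1 <= (y `^ kappa^-1) `^ beta * z `^ kappa^-1)%E.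
Proof.
move=> <- <- <- a0 c0 d0 H.
apply: le_trans (le_poweR _ a0 H) _; first by rewrite invr_ge0 ltW.
rewrite poweRM ?poweR_ge0// -!poweRrM.
have -> : ((beta + 1) / beta)^-1 / p' = kappa^-1 * beta by field; rewrite !gt_eqF.
by have -> : (beta + 1)^-1 / p' = kappa^-1 by field; rewrite !gt_eqF.
Qed.

(** On the annulus [|x| >= 2^(k-1)], so the singular weight is at most [2^gamma 2^(-k gamma)]; the
    rest is Hoelder's inequality. *)
Lemma ring_norm_henon k u w : measurable_fun setT u -> measurable_fun setT w ->
  (ring_norm p' k (absE (henon_weight u w)) <=
   (2 `^ gamma * 2 `^ (- (k%:~R * gamma)))%:E *
   (ring_norm kappa k (absE u) `^ beta * ring_norm kappa k (absE w)))%E.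
Proof.
move=> mu_ mw; set c : R := 2 `^ gamma * 2 `^ (- (k%:~R * gamma)).
have c0 : 0 <= c by rewrite mulr_ge0 ?powR_ge0.
pose h x := `|u x| `^ beta * w x.
have mp (r : R) f : measurable_fun setT f -> measurable_fun setT (fun x => `|f x| `^ r).
  by move=> mf; apply: (measurableT_comp (measurable_powR _)); exact: measurableT_comp.
have mh : measurable_fun setT h by apply: measurable_funM => //; exact: mp.
apply: (@le_trans _ _ (c%:E * ring_norm p' k (absE h))%E).
  rewrite -(ring_normZ k p'0 c0 (measurable_absE mh) (absE_ge0 h)).
  apply: le_ring_norm => //.
  - by apply: measurable_absE; exact: measurable_henon_weight.
  - by apply: emeasurable_funM => //; exact: measurable_absE.
  - by move=> x; exact: absE_ge0.
  - by move=> x; rewrite mule_ge0 ?absE_ge0.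
  apply: nearW => x /annulusP/andP[kx _].
  rewrite /absE -EFinM lee_fin /henon_weight /h -mulrA normrM ler_wpM2r//.
  rewrite ger0_norm ?powR_ge0// /c -powRD_gt0// !powRN.
  rewrite (_ : gamma - k%:~R * gamma = - ((k - 1)%:~R * gamma)); last by rewrite intrB; ring.
  rewrite powRN powRrM -pow2_exprz lef_pV2 ?posrE ?powR_gt0 ?exprz_gt0//; last first.
    by apply: lt_le_trans kx; rewrite exprz_gt0.
  by rewrite ge0_ler_powR ?nnegrE ?enorm_ge0 ?exprz_ge0.
apply: lee_wpmul2l => //.
have mA := @measurable_annulus R n k.
(* Hoelder with exponents [(beta + 1)/beta] and [beta + 1] for the powers [p']: both factors become
   powers [kappa], as [p' (beta + 1) = kappa]. *)
pose f x := `|u x| `^ (beta * p'); pose g x := `|w x| `^ p'.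
have pq : ((beta + 1) / beta)^-1 + (beta + 1)^-1 = 1.
  by field; rewrite !gt_eqF.
have P1 : 0 < (beta + 1) / beta by rewrite divr_gt0.
have H := @hoelder_in _ _ _ mu (annulus k) f g _ _ mA (mp _ _ mu_) (mp _ _ mw) P1 b1 pq.
have E1 : (\int[mu]_(x in annulus k) `|(f x * g x)%R|%R%:E =
    \int[mu]_(x in annulus k) (absE h x `^ p'))%E.
  apply: eq_integral => x _; rewrite /absE poweR_EFin /f /g /h ger0_norm ?mulr_ge0 ?powR_ge0//.
  by rewrite normrM (ger0_norm (powR_ge0 _ _)) powRM ?powR_ge0// -powRrM.
have E2 : (\int[mu]_(x in annulus k) (`|f x|%R%:E `^ ((beta + 1) / beta)) =
    \int[mu]_(x in annulus k) (absE u x `^ kappa))%E.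
  apply: eq_integral => x _; rewrite /absE !poweR_EFin /f (ger0_norm (powR_ge0 _ _)) -powRrM.
  by congr (_ `^ _)%:E; field; rewrite !gt_eqF.
have E3 : (\int[mu]_(x in annulus k) (`|g x|%R%:E `^ (beta + 1)) =
    \int[mu]_(x in annulus k) (absE w x `^ kappa))%E.
  apply: eq_integral => x _; rewrite /absE !poweR_EFin /g (ger0_norm (powR_ge0 _ _)) -powRrM.
  by congr (_ `^ _)%:E; field; rewrite !gt_eqF.
by apply: (hoelder_exponents E1 E2 E3 _ _ _ H); apply: integral_ge0 => x _;
  rewrite ?poweR_ge0// lee_fin.
Qed.

(** Hoelder in the summation index, [l^oo] against [l^1]: each weighted annulus norm of [u] is at
    most [M], and the sum falls on [w]. *)
Lemma eherz_henon u w (M : R) : 0 <= M -> measurable_fun setT u -> measurable_fun setT w ->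
  (eherz s kappa (absE u) <= M%:E)%E ->
  (eherz al' p' (absE (henon_weight u w)) <=
   (2 `^ gamma * M `^ beta)%:E * eherz s kappa (absE w))%E.
Proof.
move=> M0 mu_ mw uM; rewrite [in leRHS]eherzE -esum_intZl; last 2 first.
- by rewrite mulr_ge0 ?powR_ge0.
- by move=> k; exact: eherz_term_ge0.
rewrite eherzE; apply: le_esum => k _.
have rw0 := ring_norm_ge0 kappa k (absE w).
have ru : ((2 `^ (k%:~R * s))%:E * ring_norm kappa k (absE u) <= M%:E)%E.
  apply: le_trans uM; rewrite eherzE.
  by apply: (esum_int_ge k) => j; exact: eherz_term_ge0.
apply: (@le_trans _ _ ((2 `^ gamma)%:E *
    (((2 `^ (k%:~R * s))%:E * ring_norm kappa k (absE u)) `^ beta *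
     ((2 `^ (k%:~R * s))%:E * ring_norm kappa k (absE w))))%E).
  apply: (@le_trans _ _ ((2 `^ (k%:~R * al'))%:E * ((2 `^ gamma * 2 `^ (- (k%:~R * gamma)))%:E *
   (ring_norm kappa k (absE u) `^ beta * ring_norm kappa k (absE w))))%E).
    by apply: lee_wpmul2l; [rewrite lee_fin powR_ge0|exact: ring_norm_henon].
  rewrite poweRM ?ring_norm_ge0 ?lee_fin ?powR_ge0// poweR_EFin -powRrM.
  rewrite -(muleA (2 `^ (k%:~R * s * beta))%:E) (muleCA _ (2 `^ (k%:~R * s))%:E).
  rewrite !muleA -!EFinM le_eqVlt; apply/orP; left; apply/eqP.
  congr (_%:E * _ * _)%E.
  rewrite [LHS]mulrCA -[RHS]mulrA; congr (_ * _); rewrite -!powRD_gt0//.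
  by congr (_ `^ _); ring.
rewrite EFinM -muleA; apply: lee_wpmul2l; first by rewrite lee_fin powR_ge0.
apply: lee_wpmul2r; first exact: eherz_term_ge0.
rewrite -[leRHS]poweR_EFin; apply: le_poweR => //; first exact: ltW.
by rewrite mule_ge0 ?ring_norm_ge0// lee_fin powR_ge0.
Qed.

Lemma eherz_henon_diff u v (M : R) : 0 <= M ->
  measurable_fun setT u -> measurable_fun setT v ->
  (eherz s kappa (absE u) <= M%:E)%E -> (eherz s kappa (absE v) <= M%:E)%E ->
  (eherz al' p' (absE (fun x => (henon_term gamma beta u x - henon_term gamma beta v x)%R)) <=
   (2 * (beta + 1) * 2 `^ gamma * M `^ beta)%:E * eherz s kappa (absE (fun x => (u x - v x)%R)))%E.
Proof.
move=> M0 mu_ mv uM vM; pose w x := u x - v x.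
have mw : measurable_fun setT w by exact: measurable_funB.
have mh f : measurable_fun setT f -> measurable_fun setT (absE (henon_weight f w)).
  by move=> mf; apply: measurable_absE; exact: measurable_henon_weight.
pose h x := (absE (henon_weight u w) x + absE (henon_weight v w) x)%E.
have h0 x : (0 <= h x)%E by rewrite adde_ge0 ?absE_ge0.
have mh' : measurable_fun setT h by apply: emeasurable_funD; exact: mh.
apply: (@le_trans _ _ ((beta + 1)%:E * eherz al' p' h)%E).
  rewrite -eherzZ ?(ltW b1)//; apply: le_eherz => //.
  - by apply: measurable_absE; apply: measurable_funB; exact: measurable_henon_weight.
  - exact: emeasurable_funM.
  - by move=> x; exact: absE_ge0.
  - by move=> x; rewrite mule_ge0// lee_fin ltW.
  apply: nearW => x; rewrite /h /absE -EFinD -EFinM lee_fin !henon_termE /henon_weight.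
  rewrite -!mulrA -mulrBr !normrM (ger0_norm (powR_ge0 (enorm x) _)).
  rewrite !(ger0_norm (powR_ge0 `|_| _)) -mulrDr -mulrDl mulrCA.
  apply: ler_wpM2l; first exact: powR_ge0.
  by rewrite mulrA; exact: powR_nonlinearity_lip.
apply: (@le_trans _ _ ((beta + 1)%:E * ((2 `^ gamma * M `^ beta)%:E * eherz s kappa (absE w) +
   (2 `^ gamma * M `^ beta)%:E * eherz s kappa (absE w)))%E).
  apply: lee_wpmul2l; first by rewrite lee_fin ltW.
  apply: le_trans (eherzD _ p'1 (mh _ mu_) (mh _ mv) (absE_ge0 _) (absE_ge0 _)) _.
  by apply: leeD; exact: eherz_henon.
have c0 : 0 <= 2 `^ gamma * M `^ beta by rewrite mulr_ge0 ?powR_ge0.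
rewrite -ge0_muleDl ?lee_fin// muleA -EFinD -EFinM le_eqVlt; apply/orP; left; apply/eqP.
by congr (_%:E * _)%E; ring.
Qed.

(* On each annulus, Hoelder's factor [|R_k| ^ (1/q - 1/r)] is exactly the
   change of weight. *)
Lemma eherz_hoelder q r f : 1 <= q -> q <= r -> measurable_fun setT f ->
  (eherz (N * (1 - q^-1)) q (absE f) <=
   (2 `^ (N * (q^-1 - r^-1)))%:E * eherz (N * (1 - r^-1)) r (absE f))%E.
Proof.
move=> q1 qr mf; rewrite [in leRHS]eherzE -esum_intZl ?powR_ge0//; last first.
  by move=> k; exact: eherz_term_ge0.
rewrite eherzE; apply: le_esum => k _.
have rn := ring_norm_hoelder k q1 qr (measurable_absE mf) (absE_ge0 f).
apply: le_trans (lee_wpmul2l _ rn) _; first by rewrite lee_fin powR_ge0.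
rewrite !muleA -!EFinM -!powRD_gt0// le_eqVlt; apply/orP; left; apply/eqP.
by congr (((_ `^ _)%:E) * _)%E; ring.
Qed.

End nonlinear_estimate.

(** * The Duhamel integral *)

HB.lock Definition eduh {R : realType} {n : nat} (c d t : R)
    (h : R -> 'rV[R]_n -> \bar R) (x : 'rV[R]_n) : \bar R :=
  (\int[@lebesgue_measure R]_(r in `]c, d[) eheat (t - r) (h r) x)%E.
Canonical locked_eduh := Unlockable eduh.unlock.

(* The Duhamel integral over [c < r < d], evaluated at time [t >= d]; [eduh]
   is its majorant, with values in [0, +oo]. *)
HB.lock Definition duh {R : realType} {n : nat} (c d t : R)
    (g : R -> 'rV[R]_n -> R) (x : 'rV[R]_n) : R :=
  \int[@lebesgue_measure R]_(r in `]c, d[) heat (t - r) (g r) x.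
Canonical locked_duh := Unlockable duh.unlock.

Section duhamel.
Context {R : realType} {n : nat}.
Local Notation V := 'rV[R]_n.
Local Notation mu := (@lebesgue_rV R n).
Local Notation leb := (@lebesgue_measure R).
Implicit Types (g : R -> V -> R) (h : R -> V -> \bar R) (x : V) (c d m t : R).
Local Notation jmeas u := (measurable_fun setT (fun z : R * V => u z.1 z.2)).

Lemma ae_time2 (P Q S : R -> Prop) : {ae leb, forall r, P r} ->
  {ae leb, forall r, Q r} -> (forall r, P r -> Q r -> S r) -> {ae leb, forall r, S r}.
Proof.
move=> p q H; apply: filter_app q; first exact: (ae_filter_ringOfSetsType leb).
apply: filter_app p; first exact: (ae_filter_ringOfSetsType leb).
by apply: (@filterE _ _ (ae_filter_ringOfSetsType leb)) => r; exact: H.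
Qed.

Lemma eduhE c d t h x : eduh c d t h x =
  (\int[leb]_(r in `]c, d[) eheat (t - r) (h r) x)%E.
Proof. by rewrite unlock. Qed.

Lemma duhE c d t g x : duh c d t g x =
  \int[leb]_(r in `]c, d[) heat (t - r) (g r) x.
Proof. by rewrite unlock. Qed.

Definition absJ g : R -> V -> \bar R := fun t => absE (g t).

Lemma absJ_ge0 g t x : (0 <= absJ g t x)%E. Proof. exact: absE_ge0. Qed.

Lemma jmeas_absJ g : jmeas g -> jmeas (absJ g).
Proof. by move=> mg; apply/measurable_EFinP; exact: measurableT_comp. Qed.

Lemma jmeas_at g t : jmeas g -> measurable_fun setT (g t).
Proof. by move=> mg; exact: (measurableT_comp mg (pair1_measurable t)). Qed.

Lemma jmeas_swap g : jmeas g -> measurable_fun setT (fun w : V * R => g w.2 w.1).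
Proof.
move=> mg; apply: (measurableT_comp mg (g := fun w : V * R => (w.2, w.1))).
exact: measurable_fun_pair.
Qed.

Lemma ejmeas_at h t : jmeas h -> measurable_fun setT (h t).
Proof. by move=> mg; exact: (measurableT_comp mg (pair1_measurable t)). Qed.

Lemma eduh_ge0 c d t h x : (forall r y, 0 <= h r y)%E -> (0 <= eduh c d t h x)%E.
Proof. by move=> h0; rewrite eduhE; apply: integral_ge0 => r _; exact: eheat_ge0. Qed.

Lemma jmeas_eheat t h : jmeas h -> (forall r y, 0 <= h r y)%E ->
  jmeas (fun r => eheat (t - r) (h r)).
Proof.
move=> mh h0.
apply: (@measurable_eheat2 R n _ R (fun r => t - r) (fun z : R * V => h z.1 z.2)) => //.
exact: measurable_funB.
Qed.

Lemma jmeas_heat t g : jmeas g -> jmeas (fun r => heat (t - r) (g r)).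
Proof.
move=> mg.
apply: (@measurable_heat2 R n _ R (fun r => t - r) (fun z : R * V => g z.1 z.2)) => //.
exact: measurable_funB.
Qed.

Lemma measurable_eheat_time t h x : jmeas h -> (forall r y, 0 <= h r y)%E ->
  measurable_fun setT (fun r : R => eheat (t - r) (h r) x).
Proof.
move=> mh h0; exact: (measurableT_comp (jmeas_eheat t mh h0) (pair2_measurable x)).
Qed.

Lemma measurable_heat_time t g x : jmeas g ->
  measurable_fun setT (fun r : R => heat (t - r) (g r) x).
Proof. by move=> mg; exact: (measurableT_comp (jmeas_heat t mg) (pair2_measurable x)). Qed.

Lemma measurable_eduh c d t h : jmeas h -> (forall r y, 0 <= h r y)%E ->
  measurable_fun setT (eduh c d t h).
Proof.
move=> mh h0; rewrite (_ : eduh c d t h = fun x =>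
  (\int[leb]_(r in `]c, d[) eheat (t - r) (h r) x)%E); last first.
  by apply/funext => x; rewrite eduhE.
apply: (@measurable_integral_in1 _ _ _ _ _ leb `]c, d[%classic
  (fun z : R * V => eheat (t - z.1) (h z.1) z.2)) => //.
- exact: jmeas_eheat.
- by move=> z; exact: eheat_ge0.
Qed.

Lemma eduh_ae c d t h x : jmeas h -> (forall r y, 0 <= h r y)%E ->
  (eduh c d t h x < +oo)%E ->
  {ae leb, forall r, c < r < d -> (eheat (t - r) (h r) x < +oo)%E}.
Proof.
move=> mh h0; rewrite eduhE => hoo.
have : leb.-integrable `]c, d[%classic (fun r => eheat (t - r) (h r) x).
  apply/integrableP; split; first by apply: measurable_funTS; exact: measurable_eheat_time.
  by under eq_integral => r _ do rewrite gee0_abs ?eheat_ge0//.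
move/integrable_ae => /(_ (measurable_itv _)); apply: filterS => r H cd.
rewrite -ge0_fin_numE ?eheat_ge0//; apply: H.
by rewrite /= in_itv/= cd.
Qed.

Lemma duh_integrable c d t g x : d <= t -> jmeas g ->
  (eduh c d t (absJ g) x < +oo)%E ->
  leb.-integrable `]c, d[%classic (fun r => (heat (t - r) (g r) x)%:E).
Proof.
move=> dt mg goo; apply/integrableP; split.
  by apply: measurable_funTS; apply/measurable_EFinP; exact: measurable_heat_time.
apply: le_lt_trans goo; rewrite eduhE; apply: ge0_le_integral => //.
- apply: measurable_funTS; apply/measurable_EFinP.
  by apply: measurableT_comp => //; exact: measurable_heat_time.
- by apply: measurable_funTS; apply: measurable_eheat_time; [exact: jmeas_absJ|exact: absJ_ge0].
- move=> r /=; rewrite in_itv/= => /andP[_ rd].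
  apply: abs_heat_le; last exact: jmeas_at.
  by rewrite subr_eq0 gt_eqF// (lt_le_trans rd dt).
Qed.

Lemma abs_duh_le c d t g x : d <= t -> jmeas g ->
  (absE (duh c d t g) x <= eduh c d t (absJ g) x)%E.
Proof.
move=> dt mg; rewrite /absE duhE.
have := @abs_Rintegral_le _ _ _ leb `]c, d[%classic (fun r => heat (t - r) (g r) x).
move=> /(_ (measurable_itv _)) H; apply: le_trans (H _) _.
  by apply: measurable_funTS; exact: measurable_heat_time.
rewrite eduhE; apply: ge0_le_integral => //.
- apply: measurable_funTS; apply/measurable_EFinP.
  by apply: measurableT_comp => //; exact: measurable_heat_time.
- by apply: measurable_funTS; apply: measurable_eheat_time; [exact: jmeas_absJ|exact: absJ_ge0].
- move=> r /=; rewrite in_itv/= => /andP[_ rd].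
  apply: abs_heat_le; last exact: jmeas_at.
  by rewrite subr_eq0 gt_eqF// (lt_le_trans rd dt).
Qed.

Lemma measurable_duh c d t g : jmeas g -> measurable_fun setT (duh c d t g).
Proof.
move=> mg; rewrite (_ : duh c d t g = fun x =>
  \int[leb]_(r in `]c, d[) heat (t - r) (g r) x); last first.
  by apply/funext => x; rewrite duhE.
apply: (@measurable_Rintegral2 _ _ _ _ _ leb `]c, d[%classic
  (fun z : V * R => heat (t - z.2) (g z.2) z.1)) => //.
exact: (jmeas_swap (jmeas_heat t mg)).
Qed.

(** The moving endpoint is turned into a condition in the integrand, so that the domain of
    integration is fixed and [t] is a mere parameter. *)
Lemma jmeas_duh c g : jmeas g -> jmeas (fun t => duh c t t g).
Proof.
move=> mg; rewrite (_ : (fun z : R * V => _) = fun z => \int[leb]_r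
  (if (c < r) && (r < z.1) then heat (z.1 - r) (g r) z.2 else 0)); last first.
  apply/funext => -[t x] /=; rewrite duhE Rintegral_mkcond; congr Rintegral.
  apply/funext => r; rewrite patchE; case: ifPn => [/set_mem|/negP H].
    by rewrite /= in_itv/= => ->.
  case: ifPn => // cr; exfalso; apply: H.
  by apply/mem_set; rewrite /= in_itv.
apply: (@measurable_Rintegral2 _ _ _ _ _ leb setT (fun w : (R * V) * R =>
  if (c < w.2) && (w.2 < w.1.1) then heat (w.1.1 - w.2) (g w.2) w.1.2 else 0)) => //.
apply: measurable_fun_ifT => //=.
  apply: measurable_and; apply: measurable_fun_ltr => //.
  by apply: measurableT_comp => //; exact: measurable_fst.
have := @measurable_heat2 R n _ (R * R)%type (fun p => p.1 - p.2)
  (fun z : (R * R) * V => g z.1.2 z.2).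
move=> /(_ _)/(_ _) H.
have {}H := H (measurable_funB measurable_fst measurable_snd).
have mF : measurable_fun setT (fun z : (R * R) * V => g z.1.2 z.2).
  apply: (measurableT_comp mg (g := fun z : (R * R) * V => (z.1.2, z.2))).
  by apply: measurable_fun_pair => //; apply: measurableT_comp => //; exact: measurable_snd.
have {mF}H := H mF.
apply: (measurableT_comp H (g := fun w : (R * V) * R => ((w.1.1, w.2), w.1.2))).
apply: measurable_fun_pair; last by apply: measurableT_comp.
by apply: measurable_fun_pair => //; apply: measurableT_comp.
Qed.

Lemma duh_empty c d t g x : d <= c -> duh c d t g x = 0.
Proof.
move=> dc; rewrite duhE (_ : [set` `]c, d[] = set0) ?Rintegral_set0//.
by rewrite set_itv_ge ?bnd_simp// -leNgt.
Qed.

Lemma eduh_empty c d t h x : d <= c -> eduh c d t h x = 0%E.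
Proof.
move=> dc; rewrite eduhE (_ : [set` `]c, d[] = set0) ?integral_set0//.
by rewrite set_itv_ge ?bnd_simp// -leNgt.
Qed.

Lemma duhB c d t g1 g2 x : d <= t -> jmeas g1 -> jmeas g2 ->
  (eduh c d t (absJ g1) x < +oo)%E -> (eduh c d t (absJ g2) x < +oo)%E ->
  duh c d t (fun r y => g1 r y - g2 r y) x = duh c d t g1 x - duh c d t g2 x.
Proof.
move=> dt m1 m2 o1 o2; rewrite !duhE -RintegralB//; last 2 first.
- exact: duh_integrable.
- exact: duh_integrable.
rewrite /Rintegral; congr fine; apply: ae_eq_integral => //.
- apply: measurable_funTS; apply/measurable_EFinP.
  apply: (measurable_heat_time t x (g := fun r y => g1 r y - g2 r y)).
  exact: measurable_funB.
- apply: measurable_funTS; apply/measurable_EFinP.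
  by apply: measurable_funB; exact: measurable_heat_time.
have a1 := eduh_ae (jmeas_absJ m1) (@absJ_ge0 g1) o1.
have a2 := eduh_ae (jmeas_absJ m2) (@absJ_ge0 g2) o2.
apply: (ae_time2 a1 a2) => r h1 h2 /=; rewrite in_itv/= => cd; congr EFin.
apply: heatB; [|exact: jmeas_at|exact: jmeas_at|exact: h1|exact: h2].
by case/andP: cd => _ rd; rewrite subr_eq0 gt_eqF// (lt_le_trans rd dt).
Qed.

Lemma eq_duh c d t g1 g2 x : d <= t -> (forall r, measurable_fun setT (g1 r)) ->
  (forall r, measurable_fun setT (g2 r)) ->
  (forall r, c < r < d -> {ae mu, forall y, g1 r y = g2 r y}) ->
  duh c d t g1 x = duh c d t g2 x.
Proof.
move=> dt m1 m2 g12; rewrite !duhE; apply: eq_Rintegral => r /set_mem /=.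
rewrite in_itv/= => cd; apply: heat_ae => //; last exact: g12.
by case/andP: cd => _ rd; rewrite subr_eq0 gt_eqF// (lt_le_trans rd dt).
Qed.

Lemma duh_split c m d t g x : c <= m -> m <= d -> d <= t -> jmeas g ->
  (eduh c d t (absJ g) x < +oo)%E ->
  duh c d t g x = duh c m t g x + duh m d t g x.
Proof.
move=> cm md dt mg goo; have ig := duh_integrable dt mg goo.
rewrite !duhE; move: cm; rewrite le_eqVlt => /predU1P[<-|cm].
  by rewrite set_itvoo0 Rintegral_set0 add0r.
move: md; rewrite le_eqVlt => /predU1P[<-|md].
  by rewrite set_itvoo0 Rintegral_set0 addr0.
have E : `]c, d[%classic = `]c, m] `|` `]m, d[ :> set R.
  by rewrite -itv_bndbnd_setU// ?bnd_simp// ltW.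
rewrite E in ig *; rewrite Rintegral_setU//; last first.
  apply/disj_setPS => r [] /=; rewrite !in_itv/= => /andP[_ rm] /andP[mr _].
  by move: (le_lt_trans rm mr); rewrite ltxx.
congr (_ + _); rewrite -Rintegral_itv_bndo_bndc//.
apply: integrableS ig => //; first exact: measurableU.
by move=> r /=; rewrite !in_itv/= => /andP[-> rm]; left; rewrite ltW.
Qed.

(** Fubini in space and time. The domain [D] is absorbed into an indicator, and the finiteness
    assumption is the absolute convergence at [x]. *)
Lemma heat_Rintegral s (D : set R) g x : 0 < s -> measurable D -> jmeas g ->
  (\int[leb]_(r in D) eheat s (absE (g r)) x < +oo)%E ->
  heat s (fun y => \int[leb]_(r in D) g r y) x = \int[leb]_(r in D) heat s (g r) x.
Proof.
move=> s0 mD mg goo; rewrite heatE ?gt_eqF//.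
pose G r y := g r y * \1_D r.
have mI : measurable_fun setT (\1_D : R -> R) by exact: measurable_indic.
have mG : jmeas G.
  by apply: measurable_funM => //; exact: (measurableT_comp mI measurable_fst).
have GE y : \int[leb]_(r in D) g r y = \int[leb]_r G r y.
  rewrite Rintegral_mkcond; congr Rintegral; apply/funext => r.
  by rewrite patchE /G indicE; case: ifPn => _; rewrite ?mulr1 ?mulr0.
have HE r : heat s (G r) x = ((fun r => heat s (g r) x) \_ D) r.
  rewrite patchE /G indicE; case: ifPn => _.
    by under [X in heat s X]funext => y do rewrite mulr1.
  under [X in heat s X]funext => y do rewrite mulr0.
  by rewrite heatE ?gt_eqF//; under eq_Rintegral => y _ do rewrite mulr0; rewrite Rintegral_cst// mul0r.
rewrite [RHS]Rintegral_mkcond; under [RHS]eq_Rintegral => r _ do rewrite -HE.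
under eq_Rintegral => y _ do rewrite GE.
pose F (z : V * R) := heat_kernel s (x - z.1) * G z.2 z.1.
have mF : measurable_fun setT F.
  apply: measurable_funM; first by apply: measurable_heat_kernel3.
  exact: (jmeas_swap mG).
have iF : (mu \x leb)%E.-integrable setT (EFin \o F).
  apply/integrable21ltyP; first exact/measurable_EFinP.
  apply: le_lt_trans goo; rewrite [leRHS]integral_mkcond; apply: ge0_le_integral => //=.
  - by move=> r _; apply: integral_ge0.
  - have : measurable_fun setT (fun z => `|F z|%:E).
      by apply/measurable_EFinP; exact: measurableT_comp.
    by move/(measurable_integral_in1 mu measurableT); apply.
  - apply/(measurable_restrictT _ mD); apply: measurable_funTS.
    have := @measurable_eheat2 R n _ R (cst s) (fun z : R * V => absJ g z.1 z.2)
      (measurable_cst _) (jmeas_absJ mg) (fun z => absE_ge0 _ _).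
    by move=> H; exact: (measurableT_comp H (pair2_measurable x)).
  move=> r _; rewrite patchE; case: ifPn => rD.
    rewrite eheatE; apply: ge0_le_integral => //=.
    + have mFr := measurableT_comp mF (pair2_measurable r).
      by apply/measurable_EFinP; exact: (measurableT_comp _ mFr).
    + by apply: measurable_eheat_integrand; apply: measurable_absE; exact: jmeas_at.
    move=> y _; rewrite /F /G /= indicE rD mulr1 normrM (ger0_norm (heat_kernel_ge0 _ _)).
    by rewrite EFinM.
  under eq_integral => y _ do rewrite /F /G /= indicE (negbTE rD) mulr0 mulr0 normr0.
  by rewrite integral0.
have FE := Fubini iF.
transitivity (fine (\int[mu]_y \int[leb]_r (F (y, r))%:E)%E).
  rewrite /Rintegral; congr fine; apply: ae_eq_integral => //.
  - apply/measurable_EFinP; apply: measurable_heat_integrand.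
    apply: (@measurable_Rintegral2 _ _ _ _ _ leb setT (fun z : V * R => G z.2 z.1)) => //.
    exact: (jmeas_swap mG).
  - exact: (measurable_int _ (integrable_fubini_F iF)).
  have := ae_integrable1 iF; apply: filterS => y iy _.
  have k0 : heat_kernel s (x - y) != 0 by rewrite gt_eqF// heat_kernel_gt0.
  rewrite -RintegralZl//; last first.
    have := integrableZl measurableT (heat_kernel s (x - y))^-1 iy.
    by apply: eq_integrable => // r _ /=; rewrite /F /= -EFinM mulKf.
  by rewrite fineK//; apply: integral_fune_fin_num.
rewrite FE /Rintegral; congr fine.
apply: ae_eq_integral => //.
- exact: (measurable_fubini_G iF).
- apply/measurable_EFinP.
  have := @measurable_heat2 R n _ R (cst s) (fun z : R * V => G z.1 z.2) (measurable_cst _) mG.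
  by move=> H; exact: (measurableT_comp H (pair2_measurable x)).
have := ae_integrable2 iF; apply: filterS => r ir _.
by rewrite heatE ?gt_eqF// /Rintegral fineK//; apply: integral_fune_fin_num.
Qed.

(** The flow over [t - d] passes through the time integral and composes with the flow over [d - r].
    This identity is what makes restarting possible. *)
Lemma heat_duh c d t g x : d < t -> jmeas g -> (eduh c d t (absJ g) x < +oo)%E ->
  heat (t - d) (duh c d d g) x = duh c d t g x.
Proof.
move=> dt mg goo; have td : 0 < t - d by rewrite subr_gt0.
rewrite (_ : duh c d d g = fun y => \int[leb]_(r in `]c, d[) heat (d - r) (g r) y); last first.
  by apply/funext => y; rewrite duhE.
have maJ := jmeas_absJ mg.
rewrite (heat_Rintegral (g := fun r => heat (d - r) (g r)))//; last 2 first.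
- exact: jmeas_heat.
- apply: le_lt_trans goo; rewrite eduhE; apply: ge0_le_integral => //.
  + by move=> r _; apply: eheat_ge0 => y; exact: absE_ge0.
  + apply: measurable_funTS.
    have := @measurable_eheat2 R n _ R (cst (t - d))
      (fun z : R * V => absJ (fun r => heat (d - r) (g r)) z.1 z.2)
      (measurable_cst _) (jmeas_absJ (jmeas_heat d mg)) (fun z => absE_ge0 _ _).
    by move=> H; exact: (measurableT_comp H (pair2_measurable x)).
  + by apply: measurable_funTS; apply: measurable_eheat_time => // r y; exact: absE_ge0.
  move=> r /=; rewrite in_itv/= => /andP[cr rd].
  have dr : 0 < d - r by rewrite subr_gt0.
  rewrite (_ : t - r = (t - d) + (d - r)); last by ring.
  have mr := ejmeas_at r maJ.
  rewrite -(eheat_semigroup x td dr mr); last by move=> y; exact: absE_ge0.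
  apply: le_eheat.
  + by apply: measurable_absE; apply: measurable_heat; exact: jmeas_at.
  + by apply: measurable_eheat => // y; exact: absE_ge0.
  + by move=> y; exact: absE_ge0.
  + by move=> y; apply: eheat_ge0 => z; exact: absE_ge0.
  by apply: nearW => y; apply: abs_heat_le; [rewrite gt_eqF|exact: jmeas_at].
rewrite duhE /Rintegral; congr fine; apply: ae_eq_integral => //.
- apply: measurable_funTS; apply/measurable_EFinP.
  have := @measurable_heat2 R n _ R (cst (t - d))
    (fun z : R * V => heat (d - z.1) (g z.1) z.2) (measurable_cst _) (jmeas_heat d mg).
  by move=> H; exact: (measurableT_comp H (pair2_measurable x)).
- by apply: measurable_funTS; apply/measurable_EFinP; exact: measurable_heat_time.
have a1 := eduh_ae maJ (@absJ_ge0 g) goo; apply: (ae_time2 a1 a1) => r H _.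
rewrite /= in_itv/= => /andP[cr rd]; congr EFin.
have tr : t - r = (t - d) + (d - r) by ring.
have dr : 0 < d - r by rewrite subr_gt0.
rewrite (@heat_semigroup _ _ (t - d) (d - r) (g r) x td dr (jmeas_at r mg)) -tr//.
by apply: H; rewrite cr.
Qed.

Lemma eherz_eduh s r c d t h : 1 <= r -> jmeas h -> (forall r y, 0 <= h r y)%E ->
  (eherz s r (eduh c d t h) <=
   \int[leb]_(u in `]c, d[) eherz s r (eheat (t - u) (h u)))%E.
Proof.
move=> r1 mh h0; rewrite (_ : eduh c d t h = fun x =>
  (\int[leb]_(r in `]c, d[) eheat (t - r) (h r) x)%E); last first.
  by apply/funext => x; rewrite eduhE.
apply: (@eherz_int _ _ _ _ leb `]c, d[%classic (cst 1) _ _ _ _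
  (fun z : R * V => eheat (t - z.1) (h z.1) z.2)) => //.
- have -> : (\int[leb]_(u in `]c, d[) (cst 1 u)%:E = leb `]c, d[)%E.
    by rewrite -[RHS]mul1e -integral_cst.
  rewrite lebesgue_measure_itv/=.
  by case: ifPn => // _; rewrite -EFinD ltry.
- exact: jmeas_eheat.
- by move=> z; exact: eheat_ge0.
Qed.

Lemma measurable_eherz_time s p h : jmeas h -> (forall r y, 0 <= h r y)%E ->
  measurable_fun setT (fun r => eherz s p (h r)).
Proof.
by move=> mh h0; apply: (measurable_eherz (F := fun z : R * V => h z.1 z.2)) => // z.
Qed.

Lemma eherz_eduh_le s r c d t h (k : R -> R) :
  1 <= r -> d <= t -> jmeas h -> (forall r y, 0 <= h r y)%E ->
  measurable_fun `]c, d[ k -> (forall u, c < u < d -> 0 <= k u) ->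
  {ae leb, forall u, c < u < d -> (eherz s r (eheat (t - u) (h u)) <= (k u)%:E)%E} ->
  (eherz s r (eduh c d t h) <= \int[leb]_(u in `]c, d[) (k u)%:E)%E.
Proof.
move=> r1 dt mh h0 mk k0 hk; apply: le_trans (eherz_eduh _ _ _ _ r1 mh h0) _.
apply: ae_ge0_le_integral => //.
- by move=> u _; exact: eherz_ge0.
- by apply: measurable_funTS; apply: measurable_eherz_time;
    [exact: jmeas_eheat|move=> u y; exact: eheat_ge0].
- exact/measurable_EFinP.
Qed.

Lemma eheat_eduh c d t h x : d < t -> jmeas h -> (forall r y, 0 <= h r y)%E ->
  eheat (t - d) (eduh c d d h) x = eduh c d t h x.
Proof.
move=> dt mh h0; have td : 0 < t - d by rewrite subr_gt0.
rewrite (_ : eduh c d d h = fun y => (\int[leb]_(r in `]c, d[) eheat (d - r) (h r) y)%E).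
  rewrite (@eheat_int _ _ _ _ leb `]c, d[%classic
    (fun z : R * V => eheat (d - z.1) (h z.1) z.2))//.
  - rewrite eduhE; apply: eq_integral => r /set_mem /=; rewrite in_itv/= => /andP[_ rd].
    have dr : 0 < d - r by rewrite subr_gt0.
    have tr : t - r = (t - d) + (d - r) by ring.
    by rewrite (eheat_semigroup x td dr (ejmeas_at r mh) (h0 r)) -tr.
  - exact: jmeas_eheat.
  - by move=> z; exact: eheat_ge0.
by apply/funext => y; rewrite eduhE.
Qed.

End duhamel.

(** * Limits and measurable curves in Herz spaces *)

Lemma nneseries_le_bound (R : realType) (x_ : nat -> \bar R) (B : \bar R) :
  (forall i, 0 <= x_ i)%E -> (forall m, \sum_(0 <= i < m) x_ i <= B)%E ->
  (\sum_(0 <= i <oo) x_ i <= B)%E.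
Proof.
move=> x0 xB; apply: (lime_le (is_cvg_nneseries (fun i _ _ => x0 i))).
exact: nearW.
Qed.

Lemma nneseries_halves (R : realType) (c : R) : 0 <= c ->
  (\sum_(0 <= i <oo) (c * 2^-1 ^+ i)%:E <= (2 * c)%:E)%E.
Proof.
move=> c0; apply: nneseries_le_bound => [i|m].
  by rewrite lee_fin mulr_ge0// exprn_ge0.
rewrite sumEFin lee_fin (_ : \sum_(0 <= i < m) _ = 2 * c * (1 - 2^-1 ^+ m)).
  by rewrite ler_piMr ?mulr_ge0// gerBl exprn_ge0.
elim: m => [|m IH]; first by rewrite big_nil expr0 subrr mulr0.
by rewrite big_nat_recr//= IH exprS; lra.
Qed.

Section pointwise_limit.
Context {R : realType}.

Lemma summable_increments_cvg (x_ : nat -> R) :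
  (\sum_(0 <= i <oo) `|x_ i.+1 - x_ i|%:E < +oo)%E -> cvgn x_.
Proof.
set S := (X in (X < _)%E) => Soo.
have d0 i : (0%E <= `|x_ i.+1 - x_ i|%:E)%E by rewrite lee_fin.
have S0 : (0 <= S)%E by apply: nneseries_ge0.
have SE : S = (fine S)%:E by rewrite fineK// ge0_fin_numE.
rewrite (_ : x_ = fun i => x_ 0%N + series (telescope x_) i); last first.
  by apply/funext => i; exact: eq_sum_telescope.
apply: is_cvgD; first exact: is_cvg_cst.
apply: (@normed_cvg R R^o); apply: nondecreasing_is_cvgn.
  by apply/nondecreasing_seqP => m; rewrite /normed_series_of/= /series/= big_nat_recr//= lerDl.
exists (fine S) => _ [m _ <-]; rewrite -lee_fin -SE.
apply: le_trans (nneseries_lim_ge (m := 0) m (fun i _ _ => d0 i)).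
by rewrite sumEFin lee_fin /series/=.
Qed.

Lemma dist_limit_le (x_ : nat -> R) (l : R) k : x_ @ \oo --> l ->
  (`|x_ k - l|%:E <= \sum_(0 <= i <oo) `|x_ (k + i).+1 - x_ (k + i)|%:E)%E.
Proof.
move=> xl; set S := (X in (_ <= X)%E).
have d0 i : (0%E <= `|x_ (k + i).+1 - x_ (k + i)|%:E)%E by rewrite lee_fin.
have [->|Soo] := eqVneq S +oo%E; first exact: leey.
have S0 : (0 <= S)%E by apply: nneseries_ge0.
have SE : S = (fine S)%:E by rewrite fineK// ge0_fin_numE// ltey.
rewrite SE lee_fin.
have c : (fun m => `|x_ k - x_ m|) @ \oo --> `|x_ k - l|.
  by apply: cvg_norm; apply: cvgB => //; exact: cvg_cst.
apply: (cvgr_to_le c); exists k => // m /= km.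
rewrite -lee_fin -SE -(subnKC km).
apply: le_trans (nneseries_lim_ge (m := 0) (m - k) (fun i _ _ => d0 i)).
rewrite sumEFin lee_fin distrC; elim: (m - k)%N => [|j IH].
  by rewrite addn0 subrr normr0 big_nil.
rewrite big_nat_recr//= addnS.
rewrite (_ : x_ (k + j).+1 - x_ k = (x_ (k + j)%N - x_ k) + (x_ (k + j).+1 - x_ (k + j)%N)); last by ring.
by apply: le_trans (ler_normD _ _) _; rewrite lerD2r.
Qed.

End pointwise_limit.

(* Junk where the sequence diverges, but always measurable *)
Definition seq_limit {R : realType} {T} (f_ : nat -> T -> R) (x : T) : R :=
  fine (limn_esup (fun k => (f_ k x)%:E)).

Lemma seq_limit_cvg {R : realType} {T} (f_ : nat -> T -> R) x (l : R) :
  f_ ^~ x @ \oo --> l -> seq_limit f_ x = l.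
Proof.
move=> fl; rewrite /seq_limit.
have /cvg_limn_einf_sup[_ ->//] : (fun k => (f_ k x)%:E) @ \oo --> l%:E.
by apply: cvg_EFin => //; apply: nearW.
Qed.

Lemma measurable_seq_limit {R : realType} d (T : measurableType d) (f_ : nat -> T -> R) :
  (forall k, measurable_fun setT (f_ k)) -> measurable_fun setT (seq_limit f_).
Proof.
move=> mf; apply: measurableT_comp => //.
by apply: measurable_fun_limn_esup => k; exact/measurable_EFinP.
Qed.

Section herz_limit.
Context {R : realType} {n : nat}.
Hypothesis n0 : (0 < n)%N.
Local Notation V := 'rV[R]_n.
Local Notation mu := (@lebesgue_rV R n).
Variables (s p A : R) (f_ : nat -> V -> R).
Hypotheses (p1 : 1 <= p) (A0 : 0 <= A) (mf : forall k, measurable_fun setT (f_ k)).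
Hypothesis f_le : forall k,
  (eherz s p (absE (fun x => (f_ k.+1 x - f_ k x)%R)) <= (A * 2^-1 ^+ k)%:E)%E.

Let p0 : 0 < p. Proof. exact: lt_le_trans p1. Qed.

Let D k := absE (fun x => f_ k.+1 x - f_ k x).

Let mD k : measurable_fun setT (D k).
Proof. by apply: measurable_absE; exact: measurable_funB. Qed.

Let D0 k x : (0 <= D k x)%E. Proof. exact: absE_ge0. Qed.

Let tail_le k : (eherz s p (fun x => \sum_(0 <= i <oo) D (k + i) x) <=
  (2 * (A * 2^-1 ^+ k))%:E)%E.
Proof.
apply: le_trans (eherz_series _ p1 (fun i => mD (k + i)) (fun i => D0 (k + i))) _.
have c0 : 0 <= A * 2^-1 ^+ k by rewrite mulr_ge0// exprn_ge0.
apply: le_trans (nneseries_halves c0).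
apply: lee_nneseries => [i _ _|i _]; first exact: eherz_ge0.
by apply: le_trans (f_le (k + i)) _; rewrite exprD mulrA.
Qed.

Let mtail k : measurable_fun setT (fun x => \sum_(0 <= i <oo) D (k + i) x)%E.
Proof. by apply: ge0_emeasurable_sum => // i x _ _; exact: D0. Qed.

(** The series of absolute increments has finite Herz norm, hence is finite almost everywhere, and
    the sequence converges there. *)
Lemma herz_seq_cvg_ae : {ae mu, forall x, f_ ^~ x @ \oo --> seq_limit f_ x}.
Proof.
have := @eherz_lty_ae _ _ s p _ n0 p0 (mtail 0) (fun x => nneseries_ge0 (fun i _ _ => D0 _ x))
  (le_lt_trans (tail_le 0) (ltry _)).
apply: filterS => x /summable_increments_cvg /cvg_ex[l fl].
by rewrite (seq_limit_cvg fl).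
Qed.

Lemma herz_seq_limit k :
  (eherz s p (absE (fun x => (f_ k x - seq_limit f_ x)%R)) <= (2 * (A * 2^-1 ^+ k))%:E)%E.
Proof.
apply: le_trans (tail_le k); apply: le_eherz => //.
- by apply: measurable_absE; apply: measurable_funB => //; exact: measurable_seq_limit.
- by move=> x; exact: absE_ge0.
- by move=> x; apply: nneseries_ge0 => i _ _; exact: D0.
apply: filterS herz_seq_cvg_ae => x fx.
exact: (@dist_limit_le _ (f_ ^~ x) _ k fx).
Qed.

End herz_limit.

Lemma le_halves_eq0 (R : realType) (x : \bar R) (B : R) : (0 <= x)%E ->
  (forall k, x <= (B * 2^-1 ^+ k)%:E)%E -> x = 0%E.
Proof.
move=> x0 xB; apply/eqP; rewrite eq_le x0 andbT; apply/lee_addgt0Pr => e e0.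
rewrite add0e; have B1 : 0 < `|B| + 1 by rewrite ltr_pwDr.
have [k] : exists k : nat, (`|B| + 1) / e < k%:R.
  by exists (Num.trunc ((`|B| + 1) / e)).+1; rewrite truncnS_gt.
rewrite ltr_pdivrMr// => kB; apply: le_trans (xB k) _; rewrite lee_fin.
rewrite exprVn ler_pdivrMr ?exprn_gt0//.
apply: (@le_trans _ _ (`|B| + 1)); first by apply: le_trans (ler_norm _) _; rewrite lerDl.
apply: le_trans (ltW kB) _; rewrite mulrC ler_pM2l//.
by rewrite -natrX ler_nat ltnW// ltn_expl.
Qed.

Section strong_continuity_herz.
Context {R : realType} {n : nat}.
Hypothesis n0 : (0 < n)%N.
Local Notation V := 'rV[R]_n.

(** Otherwise a bad [h] below each [1/(k+1)] would form a sequence of times tending to 0 that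
    contradicts [herz_strongP]. *)
Lemma herz_heat_continuous (s q : R) (f : V -> R) : 1 <= q -> - (n%:R / q) < s ->
  s < n%:R * (1 - q^-1) -> measurable_fun setT f -> (eherz s q (absE f) < +oo)%E ->
  forall e, 0 < e -> exists2 eta, 0 < eta & forall h, 0 < h < eta ->
  (eherz s q (absE (fun x => (heat h f x - f x)%R)) <= e%:E)%E.
Proof.
move=> q1 s1 s2 mf foo e e0; apply: contrapT => H.
have /choice[t_ Ht] : forall k : nat, exists h : R, 0 < h < k.+1%:R^-1 /\
    ~ (eherz s q (absE (fun x => (heat h f x - f x)%R)) <= e%:E)%E.
  move=> k; apply: contrapT => Hk; apply: H; exists k.+1%:R^-1 => // h hk.
  by apply: contrapT => ne; apply: Hk; exists h.
have t_gt0 k : 0 < t_ k by have [/andP[]] := Ht k.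
have t_cvg : t_ @ \oo --> 0.
  apply: (@squeeze_cvgr _ _ _ _ (cst 0) (fun k => k.+1%:R^-1)).
  - by apply: nearW => k; have [/andP[/ltW -> /ltW ->]] := Ht k.
  - exact: cvg_cst.
  - exact: cvg_harmonic.
have [_ _ sm] := herz_strongP n0 q1 s1 s2 t_gt0 t_cvg mf foo.
have [k _ Hk] := sm e e0.
by have [_] := Ht k; apply; exact: (Hk k (leqnn k)).
Qed.

End strong_continuity_herz.

(* A continuous curve in the Herz space has a jointly measurable version: it
   is the limit of piecewise constant curves. *)
Section measurable_version.
Context {R : realType} {n : nat}.
Hypothesis n0 : (0 < n)%N.
Local Notation V := 'rV[R]_n.
Local Notation mu := (@lebesgue_rV R n).
Local Notation jmeas u := (measurable_fun setT (fun z : R * V => u z.1 z.2)).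
Variables (s q T : R) (u : R -> V -> R).
Hypotheses (q1 : 1 <= q) (mut : forall t, 0 <= t <= T -> measurable_fun setT (u t)).
Hypothesis cu : forall t, 0 <= t <= T -> forall e, 0 < e -> exists2 eta, 0 < eta &
  forall z, 0 <= z <= T -> `|z - t| < eta ->
    (eherz s q (absE (fun x => (u z x - u t x)%R)) <= e%:E)%E.

Let q0 : 0 < q. Proof. exact: lt_le_trans q1. Qed.

(** The first centre of the list within its radius decides the value; with a finite subcover of
    [[0, T]] this approximates [u] by a piecewise constant curve. *)
Fixpoint step_curve (eta : R -> R) (l : seq R) (t : R) : V -> R :=
  if l is c :: l' then if `|t - c| < eta c then u c else step_curve eta l' t
  else fun=> 0.

Let jmeas_step_curve eta l : {in l, forall c, 0 <= c <= T} -> jmeas (step_curve eta l).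
Proof.
elim: l => [|c l IH] cT; first exact: measurable_cst.
rewrite (_ : (fun z : R * V => _) = fun z =>
    if `|z.1 - c| < eta c then u c z.2 else step_curve eta l z.1 z.2); last first.
  by apply/funext => -[t x] /=; case: ifP.
apply: measurable_fun_ifT => /=.
- apply: measurable_fun_ltr => //; apply: measurableT_comp => //.
  by apply: measurable_funB.
- apply: (measurableT_comp (mut _)) => //; apply: cT; exact: mem_head.
- by apply: IH => c' c'l; apply: cT; rewrite in_cons c'l orbT.
Qed.

Let step_curve_at eta l t : has (fun c => `|t - c| < eta c) l ->
  exists2 c, c \in l & `|t - c| < eta c /\ step_curve eta l t = u c.
Proof.
elim: l => //= c l IH; case: ifP => [tc _|_ /= /IH[c' c'l [tc' ->]]].
  by exists c; [exact: mem_head|split].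
by exists c' => //; rewrite in_cons c'l orbT.
Qed.

Lemma measurable_version : exists v : R -> V -> R, jmeas v /\
  forall t, 0 <= t <= T -> {ae mu, forall x, v t x = u t x}.
Proof.
have H (k : nat) : exists v : R -> V -> R, jmeas v /\
    forall t, 0 <= t <= T -> (eherz s q (absE (fun x => (v t x - u t x)%R)) <= (2^-1 ^+ k)%:E)%E.
  have e0 : 0 < 2^-1 ^+ k :> R by rewrite exprn_gt0// invr_gt0.
  have /choice[eta Heta] : forall t, exists eta : R, 0 <= t <= T -> 0 < eta /\
      forall z, 0 <= z <= T -> `|z - t| < eta ->
      (eherz s q (absE (fun x => (u z x - u t x)%R)) <= (2^-1 ^+ k)%:E)%E.
    move=> t; have [tT|tT] := boolP (0 <= t <= T); last by exists 0.
    by have [eta eta0 Ht] := cu tT e0; exists eta.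
  (* Finitely many of the balls on which [u] varies by at most [2^-k] cover the interval. *)
  have : cover_compact (`[0, T]%classic : set R).
    by rewrite -compact_cover; exact: segment_compact.
  move=> /(_ R `[0, T]%classic (fun t => ball t (eta t))).
  case=> [t /= tT|t /= tT|D' DT TD].
  - by apply: ball_open; move: tT; rewrite in_itv/= => /Heta[].
  - exists t => //=; apply: ballxx.
    by move: tT; rewrite in_itv/= => /Heta[].
  exists (step_curve eta (finmap.enum_fset D')); split.
    apply: jmeas_step_curve => c cD.
    by have := DT c cD; rewrite inE/= in_itv.
  move=> t tT; have [|c cD [tc ->]] := @step_curve_at eta (finmap.enum_fset D') t.
    have tI : `[0, T]%classic t by rewrite /= in_itv.
    have [c /= cD tc] := TD t tI.
    apply/hasP; exists c => //.
    by move: tc; rewrite /ball/= distrC.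
  have cT : 0 <= c <= T by have := DT c cD; rewrite inE/= in_itv.
  have [_ Hc] := Heta c cT; apply: le_trans (Hc t tT tc).
  rewrite le_eqVlt; apply/orP; left; apply/eqP; congr (eherz s q _).
  by apply/funext => x; rewrite /absE distrC.
have /choice[v_ Hv] := H.
have mv k : jmeas (v_ k) by case: (Hv k).
have mvt k t : measurable_fun setT (v_ k t).
  exact: (measurableT_comp (mv k) (pair1_measurable t)).
pose L (t : R) : V -> R := seq_limit (fun k => v_ k t).
have mL : jmeas L.
  exact: (measurable_seq_limit (f_ := fun k (z : R * V) => v_ k z.1 z.2)).
have mLt t : measurable_fun setT (L t).
  exact: (measurableT_comp mL (pair1_measurable t)).
exists L; split => // t tT.
have vu k : (eherz s q (absE (fun x => (v_ k t x - u t x)%R)) <= (2^-1 ^+ k)%:E)%E.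
  by case: (Hv k) => _; apply.
(* Consecutive approximations are geometrically close at each time, so for each [t] they converge
   almost everywhere in space. *)
have incr k : (eherz s q (absE (fun x => (v_ k.+1 t x - v_ k t x)%R)) <= (2 * 2^-1 ^+ k)%:E)%E.
  rewrite (_ : (fun x => _) = fun x => (v_ k.+1 t x - u t x) + (u t x - v_ k t x)); last first.
    by apply/funext => x; rewrite addrA subrK.
  have m1 : measurable_fun setT (fun x => v_ k.+1 t x - u t x).
    by apply: measurable_funB => //; exact: mut.
  have m2 : measurable_fun setT (fun x => u t x - v_ k t x).
    by apply: measurable_funB => //; exact: mut.
  apply: le_trans (eherz_absD s q1 m1 m2) _.
  rewrite (_ : 2 * 2^-1 ^+ k = 2^-1 ^+ k + 2^-1 ^+ k); last by ring.
  rewrite EFinD; apply: leeD.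
    apply: le_trans (vu k.+1) _; rewrite lee_fin exprS ler_piMl ?exprn_ge0//.
    by rewrite invf_le1// ler1n.
  rewrite (_ : absE _ = absE (fun x => v_ k t x - u t x)); first exact: vu.
  by apply/funext => x; rewrite /absE distrC.
have two0 : 0 <= 2 :> R by [].
have lim := herz_seq_limit n0 q1 two0 (fun k => mvt k t) incr.
have : eherz s q (absE (fun x => L t x - u t x)) = 0%E.
  apply: (@le_halves_eq0 _ _ 5) => [|k]; first exact: eherz_ge0.
  rewrite (_ : (fun x => _) = fun x => (L t x - v_ k t x) + (v_ k t x - u t x)); last first.
    by apply/funext => x; rewrite addrA subrK.
  have m1 : measurable_fun setT (fun x => L t x - v_ k t x) by exact: measurable_funB.
  have m2 : measurable_fun setT (fun x => v_ k t x - u t x).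
    by apply: measurable_funB => //; exact: mut.
  apply: le_trans (eherz_absD s q1 m1 m2) _.
  rewrite (_ : 5 * 2^-1 ^+ k = 2 * (2 * 2^-1 ^+ k) + 2^-1 ^+ k); last by ring.
  rewrite EFinD; apply: leeD; last exact: vu.
  apply: le_trans (lim k); rewrite le_eqVlt; apply/orP; left; apply/eqP.
  by congr (eherz s q _); apply/funext => x; rewrite /absE distrC.
move/(eherz_eq0_ae n0 q0).
have mB : measurable_fun setT (absE (fun x => L t x - u t x)).
  by apply: measurable_absE; apply: measurable_funB => //; exact: mut.
move=> /(_ mB (absE_ge0 _)); apply: filterS => x.
by rewrite /absE => /eqP; rewrite eqe normr_eq0 subr_eq0 => /eqP.
Qed.

End measurable_version.

(** * Well-posedness *)

Section solutions.
Context {R : realType} {n : nat}.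
Hypothesis n0 : (0 < n)%N.
Local Notation V := 'rV[R]_n.
Local Notation mu := (@lebesgue_rV R n).
Local Notation leb := (@lebesgue_measure R).
Local Notation jmeas u := (measurable_fun setT (fun z : R * V => u z.1 z.2)).
Implicit Types (u v w : R -> V -> R) (f g phi : V -> R) (t K M : R).

Variables (a beta gamma s q kappa sigma delta C : R).
Local Notation F := (@henon_term R n gamma beta).
Local Notation NX f := (eherz s q (absE f)).
Local Notation NY f := (eherz s kappa (absE f)).

(* [NX] is the norm of the solution space and [NY] that of the auxiliary space;
   [sigma] and [delta] are the singularities of the heat flow from the former
   to the latter, and from the range of the nonlinearity to the latter. *)
Definition nonlin_smoothing (r e : R) := forall t (f g : V -> R) M, 0 < t -> 0 <= M ->
  measurable_fun setT f -> measurable_fun setT g ->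
  (NY f <= M%:E)%E -> (NY g <= M%:E)%E ->
  (eherz s r (eheat t (absE (fun x => (F f x - F g x)%R))) <=
   (C * M `^ beta * t `^ (- e))%:E * NY (fun x => (f x - g x)%R))%E.

Hypotheses (beta0 : 0 < beta) (q1 : 1 <= q) (kappa1 : 1 <= kappa) (C0 : 0 <= C).
Hypotheses (sigma0 : 0 < sigma) (sigma_delta : sigma < delta) (delta1 : delta < 1)
  (b1 : sigma * (beta + 1) < 1) (theta0 : 0 < 1 - delta - sigma * beta).
Hypothesis HXX : forall t (f : V -> \bar R), 0 < t -> measurable_fun setT f ->
  (forall x, 0 <= f x)%E -> (eherz s q (eheat t f) <= C%:E * eherz s q f)%E.
Hypothesis HXY : forall t (f : V -> \bar R), 0 < t -> measurable_fun setT f ->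
  (forall x, 0 <= f x)%E ->
  (eherz s kappa (eheat t f) <= (C * t `^ (- sigma))%:E * eherz s q f)%E.
Hypotheses (HX : nonlin_smoothing q (delta - sigma)) (HY : nonlin_smoothing kappa delta).
Hypothesis strong : forall f, measurable_fun setT f -> (NX f < +oo)%E ->
  forall e, 0 < e -> exists2 eta, 0 < eta & forall h, 0 < h < eta ->
  (NX (fun x => (heat h f x - f x)%R) <= e%:E)%E.

Local Notation theta := (1 - delta - sigma * beta).

Definition duhamel_map (t0 : R) (phi : V -> R) u : R -> V -> R := fun t x =>
  heat (t - t0) phi x + a * duh t0 t t (fun r => F (u r)) x.

(** The working notion, started at [t0]. Joint measurability stands in for continuity, and the
    weighted bound holds at every time after [t0]. Finiteness and continuity of [NX] are
    consequences, for data of finite norm. *)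
Definition solution (t0 T : R) (phi : V -> R) u := [/\ jmeas u,
  exists2 M : R, 0 <= M & forall t, t0 < t <= T ->
    (NY (u t) <= (M * (t - t0) `^ (- sigma))%:E)%E &
  forall t, t0 <= t <= T -> {ae mu, forall x, u t x = duhamel_map t0 phi u t x}].

Let q0 : 0 < q. Proof. exact: lt_le_trans q1. Qed.
Let kappa0 : 0 < kappa. Proof. exact: lt_le_trans kappa1. Qed.
Let delta0 : 0 < delta. Proof. exact: lt_trans sigma_delta. Qed.
Let b0 : 0 < sigma * (beta + 1). Proof. by rewrite mulr_gt0// addr_gt0. Qed.

Lemma henon_term0 (f : V -> R) x : f x = 0 -> F f x = 0.
Proof. by move=> fx; rewrite /henon_term fx mulr0. Qed.

Lemma jmeas_henon u : jmeas u -> jmeas (fun t => F (u t)).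
Proof.
move=> mu_; apply: measurable_funM => //; apply: measurable_funM.
  apply: (measurableT_comp (measurable_powR _)).
  exact: (measurableT_comp (@measurable_enorm R n) measurable_snd).
by apply: (measurableT_comp (measurable_powR _)); exact: measurableT_comp.
Qed.

Lemma measurable_henon f : measurable_fun setT f -> measurable_fun setT (F f).
Proof. by move=> mf; exact: measurable_henon_weight. Qed.

Lemma jmeasB u v : jmeas u -> jmeas v -> jmeas (fun t x => u t x - v t x).
Proof. by move=> mu_ mv; exact: measurable_funB. Qed.

(** The reference curve: [F] vanishes on it, so a bound on one curve is a bound on a difference, and
    the Duhamel map sends it to the free heat flow. *)
Let zero : R -> V -> R := fun _ _ => 0.

Lemma jmeas_zero : jmeas zero. Proof. exact: measurable_cst. Qed.

Lemma eherz_abs_zero p t : 0 < p -> eherz s p (absE (zero t)) = 0%E.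
Proof.
move=> p0; rewrite (_ : absE _ = cst 0%E) ?eherz0//.
by apply/funext => x; rewrite /absE normr0.
Qed.

Lemma jmeas_duhamel_map t0 phi u : measurable_fun setT phi -> jmeas u ->
  jmeas (duhamel_map t0 phi u).
Proof.
move=> m0 mu_; apply: measurable_funD.
  apply: (@measurable_heat2 R n _ R (fun t => t - t0) (fun z : R * V => phi z.2)).
    exact: measurable_funB.
  exact: (measurableT_comp m0 measurable_snd).
apply: measurable_funM => //; apply: jmeas_duh; exact: jmeas_henon.
Qed.

Lemma eherz_abs_triangle p f g : 1 <= p -> measurable_fun setT f -> measurable_fun setT g ->
  (eherz s p (absE f) <= eherz s p (absE (fun x => (f x - g x)%R)) + eherz s p (absE g))%E.
Proof.
move=> p1 mf mg; rewrite [in leLHS](_ : f = fun x => (f x - g x) + g x); last first.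
  by apply/funext => x; rewrite subrK.
by apply: eherz_absD => //; exact: measurable_funB.
Qed.

Lemma eq_eherz_abs p f g : 0 < p -> measurable_fun setT f -> measurable_fun setT g ->
  {ae mu, forall x, f x = g x} -> eherz s p (absE f) = eherz s p (absE g).
Proof.
move=> p0 mf mg fg; apply: eq_eherz => //.
- exact: measurable_absE.
- exact: measurable_absE.
- by move=> x; exact: absE_ge0.
- by move=> x; exact: absE_ge0.
- by apply: filterS fg => x fgx; rewrite /absE fgx.
Qed.

Lemma eherz_abs_mono p (f : V -> R) (g : V -> \bar R) : 0 < p ->
  measurable_fun setT f -> measurable_fun setT g -> (forall x, 0 <= g x)%E ->
  {ae mu, forall x, (absE f x <= g x)%E} -> (eherz s p (absE f) <= eherz s p g)%E.
Proof.
move=> p0 mf mg g0 fg; apply: le_eherz => //; first exact: measurable_absE.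
by move=> x; exact: absE_ge0.
Qed.

(** * Estimates of the Duhamel term in both norms *)

Section estimates.
Variables (r e : R).
Hypotheses (r1 : 1 <= r) (e0 : 0 <= e) (e1 : e < 1) (Hre : nonlin_smoothing r e).

(** The pair [(r, e)] stands for [(q, delta - sigma)] and [(kappa, delta)]. The majorant [k] of the
    difference is arbitrary, so that the same estimate serves the Picard iteration and the weighted
    norm of the uniqueness proof. *)
Lemma eherz_eduh_diff c d t t0 u v M (k : R -> R) : t0 <= c -> d <= t -> 0 <= M ->
  jmeas u -> jmeas v -> measurable_fun setT k -> (forall z, c < z < d -> 0 <= k z) ->
  {ae leb, forall z, c < z < d -> (NY (u z) <= (M * (z - t0) `^ (- sigma))%:E)%E} ->
  {ae leb, forall z, c < z < d -> (NY (v z) <= (M * (z - t0) `^ (- sigma))%:E)%E} ->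
  {ae leb, forall z, c < z < d -> (NY (fun x => (u z x - v z x)%R) <= (k z)%:E)%E} ->
  (eherz s r (eduh c d t (absJ (fun z x => (F (u z) x - F (v z) x)%R))) <=
   (C * M `^ beta)%:E * \int[leb]_(z in `]c, d[)
     ((t - z) `^ (- e) * (z - t0) `^ (- (sigma * beta)) * k z)%:E)%E.
Proof.
move=> tc dt M0 mu_ mv mk k0 uM vM uvk.
have mJ := jmeasB (jmeas_henon mu_) (jmeas_henon mv).
have mpow (g : R -> R) y : measurable_fun setT g -> measurable_fun setT (fun z : R => g z `^ y).
  by move=> mg; exact: (measurableT_comp (measurable_powR _) mg).
have mP : measurable_fun setT
    (fun z : R => (t - z) `^ (- e) * (z - t0) `^ (- (sigma * beta)) * k z).
  apply: measurable_funM => //; apply: measurable_funM; apply: mpow; exact: measurable_funB.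
have P0 z : c < z < d -> 0 <= (t - z) `^ (- e) * (z - t0) `^ (- (sigma * beta)) * k z.
  by move=> zd; rewrite !mulr_ge0 ?powR_ge0// k0.
have CM0 : 0 <= C * M `^ beta by rewrite mulr_ge0 ?powR_ge0.
rewrite -ge0_integralZl_EFin//; last by apply/measurable_EFinP; exact: measurable_funTS.
apply: (eherz_eduh_le (k := fun z => C * M `^ beta *
   ((t - z) `^ (- e) * (z - t0) `^ (- (sigma * beta)) * k z))) => //.
- exact: jmeas_absJ.
- by move=> z y; exact: absE_ge0.
- by apply: measurable_funTS; exact: measurable_funM.
- by move=> z zd; rewrite mulr_ge0 ?P0// mulr_ge0 ?powR_ge0.
have uv := ae_time2 uM vM (fun z p q => conj p q).
apply: (ae_time2 uv uvk) => z uvz {}uvk zd; have [/(_ zd) uz /(_ zd) vz] := uvz.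
have /andP[cz zd'] := zd.
have tz : 0 < t - z by rewrite subr_gt0 (lt_le_trans zd' dt).
have z0 : 0 < z - t0 by rewrite subr_gt0 (le_lt_trans tc cz).
have Mz : 0 <= M * (z - t0) `^ (- sigma) by rewrite mulr_ge0 ?powR_ge0.
apply: le_trans (Hre tz Mz (jmeas_at z mu_) (jmeas_at z mv) uz vz) _.
rewrite powRM ?powR_ge0// -powRrM mulNr.
apply: (@le_trans _ _ ((C * (M `^ beta * (z - t0) `^ (- (sigma * beta))) *
    (t - z) `^ (- e))%:E * (k z)%:E)%E).
  apply: lee_wpmul2l; last exact: uvk.
  by rewrite lee_fin !mulr_ge0 ?powR_ge0.
by rewrite -EFinM lee_fin le_eqVlt; apply/orP; left; apply/eqP; ring.
Qed.

Lemma henon_diff_zero u : (fun z x => F (u z) x - F (zero z) x) = (fun z => F (u z)).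
Proof.
by apply/funext => z; apply/funext => x; rewrite [X in _ - X]henon_term0// subr0.
Qed.

Lemma eherz_eduh_henon c d t t0 u M : t0 <= c -> d <= t -> 0 <= M ->
  jmeas u ->
  {ae leb, forall z, c < z < d -> (NY (u z) <= (M * (z - t0) `^ (- sigma))%:E)%E} ->
  (eherz s r (eduh c d t (absJ (fun z => F (u z)))) <=
   (C * M `^ beta * M)%:E * \int[leb]_(z in `]c, d[)
     ((t - z) `^ (- e) * (z - t0) `^ (- (sigma * (beta + 1))))%:E)%E.
Proof.
move=> tc dt M0 mu_ uM; rewrite -henon_diff_zero.
have mp : measurable_fun setT (fun z : R => M * (z - t0) `^ (- sigma)).
  apply: measurable_funM => //; apply: (measurableT_comp (measurable_powR _)).
  exact: measurable_funB.
apply: le_trans (@eherz_eduh_diff c d t t0 u zero M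
  (fun z => M * (z - t0) `^ (- sigma)) tc dt M0 mu_ jmeas_zero mp _ uM _ _) _.
- by move=> z _; rewrite mulr_ge0 ?powR_ge0.
- apply: (ae_time2 uM uM) => z _ _ _; rewrite eherz_abs_zero//.
  by rewrite lee_fin mulr_ge0 ?powR_ge0.
- apply: (ae_time2 uM uM) => z uz _ zd.
  by under [X in absE X]funext => x do rewrite subr0; exact: uz.
rewrite [in leRHS]EFinM -muleA; apply: lee_wpmul2l.
  by rewrite lee_fin mulr_ge0 ?powR_ge0.
have mq : measurable_fun `]c, d[ (fun z : R =>
    ((t - z) `^ (- e) * (z - t0) `^ (- (sigma * (beta + 1))))%:E).
  exact: measurable_singular_product.
rewrite -ge0_integralZl_EFin//; last by move=> z _; rewrite lee_fin mulr_ge0 ?powR_ge0.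
rewrite le_eqVlt; apply/orP; left; apply/eqP; apply: eq_integral => z /set_mem /=.
rewrite in_itv/= => /andP[cz _]; rewrite -EFinM.
have z0 : 0 < z - t0 by rewrite subr_gt0 (le_lt_trans tc cz).
rewrite mulrDr mulr1 opprD powRD_gt0//; congr EFin; ring.
Qed.

(** An integral of beta type: the singularity is [e] at the final time and [sigma (beta + 1)] at the
    initial one, both below 1. *)
Lemma eduh_henon_bound : exists2 A : R, 0 <= A & forall t0 t u M, t0 < t -> 0 <= M ->
  jmeas u ->
  {ae leb, forall z, t0 < z < t -> (NY (u z) <= (M * (z - t0) `^ (- sigma))%:E)%E} ->
  (eherz s r (eduh t0 t t (absJ (fun z => F (u z)))) <=
   (A * M `^ beta * M * (t - t0) `^ (1 - e - sigma * (beta + 1)))%:E)%E.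
Proof.
have [B B0 HB] := integral_two_singular e0 e1 (ltW b0) b1.
exists (C * B) => [|t0 t u M tt M0 mu_ uM]; first by rewrite mulr_ge0// ltW.
apply: le_trans (@eherz_eduh_henon t0 t t t0 u M (lexx _) (lexx _) M0 mu_ uM) _.
apply: (@le_trans _ _ ((C * M `^ beta * M)%:E *
    (B * (t - t0) `^ (1 - e - sigma * (beta + 1)))%:E)%E).
  by apply: lee_wpmul2l; [rewrite lee_fin !mulr_ge0 ?powR_ge0|exact: HB].
by rewrite -EFinM lee_fin le_eqVlt; apply/orP; left; apply/eqP; ring.
Qed.

(* Away from the initial time the singularity of [u] is harmless. *)
Lemma eduh_henon_tail : exists2 A : R, 0 <= A & forall t0 c t u M, t0 < c -> c < t ->
  0 <= M -> jmeas u ->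
  {ae leb, forall z, t0 < z < t -> (NY (u z) <= (M * (z - t0) `^ (- sigma))%:E)%E} ->
  (eherz s r (eduh c t t (absJ (fun z => F (u z)))) <=
   (A * M `^ beta * M * (c - t0) `^ (- (sigma * (beta + 1))) * (t - c) `^ (1 - e))%:E)%E.
Proof.
have [B B0 HB] := integral_right_singular e0 e1.
exists (C * B) => [|t0 c t u M tc ct M0 mu_ uM]; first by rewrite mulr_ge0// ltW.
have uM' : {ae leb, forall z, c < z < t -> (NY (u z) <= (M * (z - t0) `^ (- sigma))%:E)%E}.
  apply: (ae_time2 uM uM) => z uz _ /andP[cz zt]; apply: uz.
  by rewrite zt (lt_trans tc cz).
apply: le_trans (@eherz_eduh_henon c t t t0 u M (ltW tc) (lexx _) M0 mu_ uM') _.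
set bb := sigma * (beta + 1); have ct0 : 0 < c - t0 by rewrite subr_gt0.
have mr : measurable_fun `]c, t[ (fun z : R => ((t - z) `^ (- e))%:E).
  apply: measurable_funTS; apply/measurable_EFinP.
  by apply: (measurableT_comp (measurable_powR _)); exact: measurable_funB.
apply: (@le_trans _ _ ((C * M `^ beta * M)%:E *
    (((c - t0) `^ (- bb))%:E * (B * (t - c) `^ (1 - e))%:E))%E); last first.
  by rewrite -!EFinM lee_fin le_eqVlt; apply/orP; left; apply/eqP; ring.
apply: lee_wpmul2l; first by rewrite lee_fin !mulr_ge0 ?powR_ge0.
apply: le_trans (lee_wpmul2l _ (HB _ _ ct)); last by rewrite lee_fin powR_ge0.
rewrite -ge0_integralZl_EFin ?powR_ge0//; last by move=> z _; rewrite lee_fin powR_ge0.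
apply: ge0_le_integral => //.
- by move=> z _; rewrite lee_fin mulr_ge0 ?powR_ge0.
- exact: measurable_singular_product.
- exact: emeasurable_funM.
move=> z /=; rewrite in_itv/= => /andP[cz _]; rewrite -EFinM lee_fin mulrC.
apply: ler_wpM2r; first exact: powR_ge0.
have z0 : 0 < z - t0 by rewrite subr_gt0 (lt_trans tc cz).
rewrite !powRN lef_pV2 ?posrE ?powR_gt0// ge0_ler_powR ?nnegrE ?(ltW b0) ?(ltW ct0) ?(ltW z0)//.
by rewrite lerD2r ltW.
Qed.

Lemma eduh_henon_ae t0 t u M : t0 < t -> 0 <= M -> jmeas u ->
  {ae leb, forall z, t0 < z < t -> (NY (u z) <= (M * (z - t0) `^ (- sigma))%:E)%E} ->
  {ae mu, forall x, (eduh t0 t t (absJ (fun z => F (u z))) x < +oo)%E}.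
Proof.
move=> tt M0 mu_ uM; have [A A0 HA] := eduh_henon_bound.
have mJ := jmeas_absJ (jmeas_henon mu_).
apply: (@eherz_lty_ae _ _ s r) => //.
- exact: lt_le_trans r1.
- by apply: measurable_eduh => // z y; exact: absE_ge0.
- by move=> x; apply: eduh_ge0 => z y; exact: absE_ge0.
- by apply: le_lt_trans (HA _ _ _ _ tt M0 mu_ uM) _; exact: ltry.
Qed.

(** The free parts cancel. The two Duhamel integrals are finite almost everywhere by
    [eduh_henon_ae], which permits subtracting them. *)
Lemma duhamel_map_diff t0 t phi u v M (k : R -> R) : t0 < t -> 0 <= M ->
  measurable_fun setT phi -> jmeas u -> jmeas v ->
  measurable_fun setT k -> (forall z, t0 < z < t -> 0 <= k z) ->
  {ae leb, forall z, t0 < z < t -> (NY (u z) <= (M * (z - t0) `^ (- sigma))%:E)%E} ->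
  {ae leb, forall z, t0 < z < t -> (NY (v z) <= (M * (z - t0) `^ (- sigma))%:E)%E} ->
  {ae leb, forall z, t0 < z < t -> (NY (fun x => (u z x - v z x)%R) <= (k z)%:E)%E} ->
  (eherz s r (absE (fun x => (duhamel_map t0 phi u t x - duhamel_map t0 phi v t x)%R)) <=
   (`|a| * (C * M `^ beta))%:E * \int[leb]_(z in `]t0, t[)
     ((t - z) `^ (- e) * (z - t0) `^ (- (sigma * beta)) * k z)%:E)%E.
Proof.
move=> tt M0 mphi mu_ mv mk k0 uM vM uvk.
have mJ := jmeasB (jmeas_henon mu_) (jmeas_henon mv).
have mE : measurable_fun setT
    (eduh t0 t t (absJ (fun z x => (F (u z) x - F (v z) x)%R))).
  by apply: measurable_eduh => [|z y]; [exact: jmeas_absJ|exact: absE_ge0].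
have E0 x : (0 <= eduh t0 t t (absJ (fun z x => (F (u z) x - F (v z) x)%R)) x)%E.
  by apply: eduh_ge0 => z y; exact: absE_ge0.
have r0 : 0 < r by exact: lt_le_trans r1.
apply: (@le_trans _ _ (eherz s r (fun x => `|a|%:E *
    eduh t0 t t (absJ (fun z x => (F (u z) x - F (v z) x)%R)) x)%E)).
  apply: eherz_abs_mono => //.
  - by apply: measurable_funB; apply: jmeas_at; exact: jmeas_duhamel_map.
  - exact: emeasurable_funM.
  - by move=> x; rewrite mule_ge0.
  have := eduh_henon_ae tt M0 mu_ uM; have := eduh_henon_ae tt M0 mv vM.
  apply: filterS2 => x vx ux; rewrite /absE /duhamel_map.
  rewrite opprD addrACA subrr add0r -mulrBr -duhB//; last 2 first.
  + exact: jmeas_henon.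
  + exact: jmeas_henon.
  by rewrite normrM EFinM; apply: lee_wpmul2l => //; exact: abs_duh_le.
rewrite eherzZ// EFinM -muleA; apply: lee_wpmul2l => //.
exact: eherz_eduh_diff.
Qed.

Lemma duhamel_map_lipschitz : exists2 A : R, 0 <= A & forall t0 t phi u v M K,
  t0 < t -> 0 <= M -> 0 <= K -> measurable_fun setT phi -> jmeas u -> jmeas v ->
  {ae leb, forall z, t0 < z < t -> (NY (u z) <= (M * (z - t0) `^ (- sigma))%:E)%E} ->
  {ae leb, forall z, t0 < z < t -> (NY (v z) <= (M * (z - t0) `^ (- sigma))%:E)%E} ->
  {ae leb, forall z, t0 < z < t ->
    (NY (fun x => (u z x - v z x)%R) <= (K * (z - t0) `^ (- sigma))%:E)%E} ->
  (eherz s r (absE (fun x => (duhamel_map t0 phi u t x - duhamel_map t0 phi v t x)%R)) <=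
   (A * M `^ beta * K * (t - t0) `^ (1 - e - sigma * (beta + 1)))%:E)%E.
Proof.
have [B B0 HB] := integral_two_singular e0 e1 (ltW b0) b1.
exists (`|a| * C * B) => [|t0 t phi u v M K tt M0 K0 mphi mu_ mv uM vM uvK].
  by rewrite !mulr_ge0// ltW.
have mk : measurable_fun setT (fun z : R => K * (z - t0) `^ (- sigma)).
  apply: measurable_funM => //; apply: (measurableT_comp (measurable_powR _)).
  exact: measurable_funB.
have k0 z : t0 < z < t -> 0 <= K * (z - t0) `^ (- sigma) by rewrite mulr_ge0 ?powR_ge0.
apply: le_trans (duhamel_map_diff tt M0 mphi mu_ mv mk k0 uM vM uvK) _.
have -> : (\int[leb]_(z in `]t0, t[)
     ((t - z) `^ (- e) * (z - t0) `^ (- (sigma * beta)) * (K * (z - t0) `^ (- sigma)))%:E =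
   \int[leb]_(z in `]t0, t[) (K%:E *
   ((t - z) `^ (- e) * (z - t0) `^ (- (sigma * (beta + 1))))%:E))%E.
  apply: eq_integral => z /set_mem /=; rewrite in_itv/= => /andP[tz _]; rewrite -EFinM.
  by rewrite mulrDr mulr1 opprD powRD_gt0 ?subr_gt0//; congr EFin; ring.
rewrite ge0_integralZl_EFin//; last 2 first.
- by move=> z _; rewrite lee_fin mulr_ge0 ?powR_ge0.
- exact: measurable_singular_product.
apply: (@le_trans _ _ ((`|a| * (C * M `^ beta))%:E * (K%:E *
    (B * (t - t0) `^ (1 - e - sigma * (beta + 1)))%:E))%E).
  apply: lee_wpmul2l; first by rewrite lee_fin !mulr_ge0 ?powR_ge0.
  by apply: lee_wpmul2l => //; exact: HB.
by rewrite -!EFinM lee_fin le_eqVlt; apply/orP; left; apply/eqP; ring.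
Qed.

End estimates.

(** * Local existence by Picard iteration *)

Lemma eherz_abs_subC p f g :
  eherz s p (absE (fun x => (f x - g x)%R)) = eherz s p (absE (fun x => (g x - f x)%R)).
Proof. by congr (eherz s p _); apply/funext => x; rewrite /absE distrC. Qed.

Lemma duh_henon_zero c d t x : duh c d t (fun r => F (zero r)) x = 0.
Proof.
rewrite duhE; transitivity (\int[leb]_(z in `]c, d[) (0 : R)); last first.
  by rewrite /Rintegral integral0.
apply: eq_Rintegral => z _.
rewrite (_ : F (zero z) = fun=> 0); last by apply/funext => y; exact: henon_term0.
rewrite /heat; case: ifP => // _.
by under eq_Rintegral => y _ do rewrite mulr0; rewrite /Rintegral integral0.
Qed.

Lemma duhamel_map_zero t0 phi t x : duhamel_map t0 phi zero t x = heat (t - t0) phi x.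
Proof. by rewrite /duhamel_map duh_henon_zero mulr0 addr0. Qed.

Lemma NY_heat_le m t phi : 0 < t -> measurable_fun setT phi -> (NX phi <= m%:E)%E ->
  (NY (heat t phi) <= (C * m * t `^ (- sigma))%:E)%E.
Proof.
move=> t0 mphi phim; have maf := measurable_absE mphi.
apply: (@le_trans _ _ (eherz s kappa (eheat t (absE phi)))).
  apply: eherz_abs_mono => //.
  - exact: measurable_heat.
  - by apply: measurable_eheat => // x; exact: absE_ge0.
  - by move=> x; apply: eheat_ge0 => y; exact: absE_ge0.
  - by apply: nearW => x; apply: abs_heat_le => //; rewrite gt_eqF.
apply: le_trans (HXY t0 maf (absE_ge0 phi)) _.
apply: (@le_trans _ _ ((C * t `^ (- sigma))%:E * m%:E)%E).
  by apply: lee_wpmul2l => //; rewrite lee_fin mulr_ge0 ?powR_ge0.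
by rewrite -EFinM lee_fin mulrAC.
Qed.

Lemma NX_heat_le t phi : 0 < t -> measurable_fun setT phi ->
  (NX (heat t phi) <= C%:E * NX phi)%E.
Proof.
move=> t0 mphi; have maf := measurable_absE mphi.
apply: (@le_trans _ _ (eherz s q (eheat t (absE phi)))).
  apply: eherz_abs_mono => //.
  - exact: measurable_heat.
  - by apply: measurable_eheat => // x; exact: absE_ge0.
  - by move=> x; apply: eheat_ge0 => y; exact: absE_ge0.
  - by apply: nearW => x; apply: abs_heat_le => //; rewrite gt_eqF.
exact: HXX (absE_ge0 phi).
Qed.

Lemma ae_interval (c d : R) (P : R -> Prop) : (forall z, c < z < d -> P z) ->
  {ae leb, forall z, c < z < d -> P z}.
Proof. by move=> H; apply: aeW. Qed.

(** The Duhamel map gains a factor [T^theta] in the norm with weight [(t - t0)^sigma]. The constants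
    involve the datum only through [m], hence so does [T]. *)
Lemma local_existence m : 0 <= m -> exists2 T, 0 < T & forall t0 phi,
  measurable_fun setT phi -> (NX phi <= m%:E)%E -> exists u, solution t0 (t0 + T) phi u.
Proof.
move=> m0.
have [A A0 HA] := duhamel_map_lipschitz kappa1 (ltW delta0) delta1 HY.
(* The first iterate, the free heat flow, is bounded by [K0]. The radius [M = 2 K0] is preserved
   because the remaining part contributes at most [M / 2]. *)
set K0 := C * m + 1; have K00 : 0 <= K0 by rewrite addr_ge0 ?mulr_ge0.
set M := 2 * K0; have M0 : 0 <= M by rewrite mulr_ge0.
set D := 2 * (A * M `^ beta + 1).
have D0 : 0 < D by rewrite mulr_gt0// ltr_wpDl// mulr_ge0 ?powR_ge0.
(* Solves [T^theta = 1 / D], which makes the Lipschitz factor [A M^beta T^theta] at most one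
   half. *)
set T := D^-1 `^ theta^-1.
have T0 : 0 < T by rewrite powR_gt0// invr_gt0.
have TE : T `^ theta = D^-1.
  by rewrite -powRrM mulVf ?gt_eqF// powRr1// invr_ge0 ltW.
have AT : A * M `^ beta * T `^ theta <= 2^-1.
  rewrite TE ler_pdivrMr// /D mulrA mulVf// mul1r lerDl//.
exists T => // t0 phi mphi phim; pose Psi := duhamel_map t0 phi.
have scale t M1 K : t0 < t <= t0 + T -> 0 <= K ->
    A * M1 `^ beta * K * (t - t0) `^ (1 - delta - sigma * (beta + 1)) <=
    A * M1 `^ beta * T `^ theta * K * (t - t0) `^ (- sigma).
  move=> /andP[tt tT] K1; have t1 : 0 < t - t0 by rewrite subr_gt0.
  rewrite (_ : 1 - delta - sigma * (beta + 1) = theta + - sigma); last by ring.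
  rewrite powRD_gt0// mulrA; apply: ler_wpM2r; first exact: powR_ge0.
  rewrite mulrAC; apply: ler_wpM2r => //; apply: ler_wpM2l.
    by rewrite mulr_ge0 ?powR_ge0.
  by rewrite ge0_ler_powR ?nnegrE ?(ltW theta0) ?(ltW t1) ?(ltW T0)// lerBlDl.
pose u_ k := iter k Psi zero.
have mu_ k : jmeas (u_ k).
  elim: k => [|k IH]; first exact: jmeas_zero.
  exact: jmeas_duhamel_map.
have base t : t0 < t <= t0 + T -> (NY (u_ 1%N t) <= (K0 * (t - t0) `^ (- sigma))%:E)%E.
  move=> /andP[tt tT]; rewrite (_ : u_ 1%N t = heat (t - t0) phi); last first.
    by apply/funext => x; exact: duhamel_map_zero.
  apply: le_trans (NY_heat_le _ mphi phim) _; first by rewrite subr_gt0.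
  by rewrite lee_fin; apply: ler_wpM2r; rewrite ?powR_ge0// lerDl.
have mut k t : measurable_fun setT (u_ k t) by exact: jmeas_at.
have bound k t : t0 < t <= t0 + T -> (NY (u_ k t) <= (M * (t - t0) `^ (- sigma))%:E)%E.
  elim: k t => [|k IH] t tT.
    by rewrite eherz_abs_zero// lee_fin mulr_ge0 ?powR_ge0.
  have /andP[tt tT'] := tT.
  have below (z : R) : t0 < z < t -> t0 < z <= t0 + T.
    by move=> /andP[-> zt]; rewrite (ltW (lt_le_trans zt tT')).
  apply: le_trans (eherz_abs_triangle kappa1 (mut k.+1 t) (mut 1%N t)) _.
  rewrite (_ : M = K0 + K0); last by rewrite /M; ring.
  rewrite mulrDl EFinD; apply: leeD; last exact: base.
  apply: le_trans (HA t0 t phi (u_ k) zero M M tt M0 M0 mphi (mu_ k) jmeas_zero _ _ _) _.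
  - by apply: ae_interval => z zt; apply: IH; exact: below.
  - by apply: ae_interval => z zt; rewrite eherz_abs_zero// lee_fin mulr_ge0 ?powR_ge0.
  - apply: ae_interval => z zt; under [X in absE X]funext => x do rewrite subr0.
    by apply: IH; exact: below.
  rewrite lee_fin; apply: le_trans (scale t M M tT M0) _.
  apply: ler_wpM2r; first exact: powR_ge0.
  apply: le_trans (ler_wpM2r M0 AT) _.
  by rewrite /M mulrA mulVf// mul1r.
have incr k t : t0 < t <= t0 + T ->
    (NY (fun x => (u_ k.+1 t x - u_ k t x)%R) <= (M * (t - t0) `^ (- sigma) * 2^-1 ^+ k)%:E)%E.
  elim: k t => [|k IH] t tT.
    under [X in absE X]funext => x do rewrite subr0.
    by rewrite expr0 mulr1; exact: bound.
  have /andP[tt tT'] := tT.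
  have below (z : R) : t0 < z < t -> t0 < z <= t0 + T.
    by move=> /andP[-> zt]; rewrite (ltW (lt_le_trans zt tT')).
  have Mk : 0 <= M * 2^-1 ^+ k by rewrite mulr_ge0// exprn_ge0.
  apply: le_trans (HA t0 t phi (u_ k.+1) (u_ k) M (M * 2^-1 ^+ k) tt M0 Mk mphi
    (mu_ k.+1) (mu_ k) _ _ _) _.
  - by apply: ae_interval => z zt; apply: bound; exact: below.
  - by apply: ae_interval => z zt; apply: bound; exact: below.
  - by apply: ae_interval => z zt; rewrite mulrAC; apply: IH; exact: below.
  rewrite lee_fin; apply: le_trans (scale t M _ tT Mk) _.
  rewrite [leRHS]mulrAC; apply: ler_wpM2r; first exact: powR_ge0.
  rewrite [leRHS](_ : _ = 2^-1 * (M * 2^-1 ^+ k)); last by rewrite exprS; ring.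
  exact: ler_wpM2r.
pose L (t : R) : V -> R := seq_limit (fun k => u_ k t).
have mL : jmeas L.
  exact: (measurable_seq_limit (f_ := fun k (z : R * V) => u_ k z.1 z.2)).
have LB t : 0 <= M * (t - t0) `^ (- sigma) by rewrite mulr_ge0 ?powR_ge0.
have lim k t (tT : t0 < t <= t0 + T) :
    (NY (fun x => (u_ k t x - L t x)%R) <= (2 * (M * (t - t0) `^ (- sigma) * 2^-1 ^+ k))%:E)%E.
  apply: (herz_seq_limit n0 kappa1 (LB t) (fun k => mut k t)) => j.
  exact: incr.
(* The limit is within [2 M] of the zeroth iterate, which is zero. *)
set M1 := 2 * M; have M10 : 0 <= M1 by rewrite mulr_ge0.
have boundL t : t0 < t <= t0 + T -> (NY (L t) <= (M1 * (t - t0) `^ (- sigma))%:E)%E.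
  move=> tT; have := lim 0%N t tT; rewrite expr0 mulr1 mulrA.
  by rewrite eherz_abs_subC; under [X in absE X]funext => x do rewrite subr0.
have mPL := jmeas_duhamel_map t0 mphi mL.
have fix_ t : t0 < t <= t0 + T -> {ae mu, forall x, Psi L t x = L t x}.
  move=> tT; have /andP[tt tT'] := tT.
  have below (z : R) : t0 < z < t -> t0 < z <= t0 + T.
    by move=> /andP[-> zt]; rewrite (ltW (lt_le_trans zt tT')).
  (* Both [Psi L] and [L] are geometrically close to the iterate of index [k + 1], for every [k]. *)
  have : NY (fun x => (Psi L t x - L t x)%R) = 0%E.
    apply: (@le_halves_eq0 _ _ ((A * M1 `^ beta * T `^ theta * (2 * M) + M) * (t - t0) `^ (- sigma))).
      exact: eherz_ge0.
    move=> k; apply: (@le_trans _ _ (NY (fun x => (Psi L t x - u_ k.+1 t x)%R) +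
        NY (fun x => (u_ k.+1 t x - L t x)%R))%E).
      rewrite (_ : (fun x => Psi L t x - L t x) =
        fun x => (Psi L t x - u_ k.+1 t x) + (u_ k.+1 t x - L t x)); last first.
        by apply/funext => x; rewrite addrA subrK.
      apply: eherz_absD => //; apply: measurable_funB => //; exact: jmeas_at.
    rewrite mulrDl mulrDl EFinD; apply: leeD; last first.
      apply: le_trans (lim k.+1 t tT) _; rewrite lee_fin exprS.
      by rewrite le_eqVlt; apply/orP; left; apply/eqP; field.
    have Kk : 0 <= 2 * M * 2^-1 ^+ k by rewrite mulr_ge0// exprn_ge0.
    apply: le_trans (HA t0 t phi L (u_ k) M1 (2 * M * 2^-1 ^+ k) tt M10 Kk mphi mL (mu_ k) _ _ _) _.
    - by apply: ae_interval => z zt; apply: boundL; exact: below.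
    - apply: ae_interval => z zt; apply: le_trans (bound k z (below z zt)) _.
      by rewrite lee_fin; apply: ler_wpM2r; rewrite ?powR_ge0// /M1; lra.
    - apply: ae_interval => z zt; rewrite eherz_abs_subC.
      apply: le_trans (lim k z (below z zt)) _.
      by rewrite lee_fin le_eqVlt; apply/orP; left; apply/eqP; ring.
    rewrite lee_fin; apply: le_trans (scale t M1 _ tT Kk) _.
    by rewrite le_eqVlt; apply/orP; left; apply/eqP; ring.
  move/(eherz_eq0_ae n0 kappa0).
  have mB : measurable_fun setT (absE (fun x => Psi L t x - L t x)).
    by apply: measurable_absE; apply: measurable_funB; exact: jmeas_at.
  move=> /(_ mB (absE_ge0 _)); apply: filterS => x.
  by rewrite /absE => /eqP; rewrite eqe normr_eq0 subr_eq0 => /eqP.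
(* The identity of [L] and [Psi L] is known only after [t0]; taking [Psi L] as the solution secures
   the equation at [t0] as well. *)
exists (Psi L); split => //.
  exists M1 => // t tT; rewrite (@eq_eherz_abs _ _ (L t)) ?boundL//.
  - exact: jmeas_at.
  - exact: jmeas_at.
  - exact: fix_.
move=> t /andP[tt tT]; apply: nearW => x; rewrite {1}/Psi /duhamel_map.
congr (_ + _ * _); apply: eq_duh => //.
- by move=> z; apply: measurable_henon; exact: jmeas_at.
- by move=> z; apply: measurable_henon; exact: jmeas_at.
move=> z /andP[tz zt].
have : t0 < z <= t0 + T by rewrite tz (le_trans (ltW zt)).
move/fix_; apply: filterS => y yE.
by rewrite /henon_term yE.
Qed.

(** * Uniqueness on arbitrary intervals *)

Lemma eherz_absB p f g : 1 <= p -> measurable_fun setT f -> measurable_fun setT g ->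
  (eherz s p (absE (fun x => (f x - g x)%R)) <= eherz s p (absE f) + eherz s p (absE g))%E.
Proof.
move=> p1 mf mg; have mNg : measurable_fun setT (fun x => - g x) by exact: measurableT_comp.
apply: le_trans (eherz_absD s p1 mf mNg) _.
by rewrite (_ : absE (fun x => - g x) = absE g)//; apply/funext => x; rewrite /absE normrN.
Qed.

(** Exchanges the exponential weight for a negative power of [lambda], at the price of a slightly
    stronger singularity in time. *)
Lemma expR_le_powRN (eps y : R) : 0 < eps -> eps <= 1 -> 0 < y ->
  expR (- y) <= y `^ (- eps).
Proof.
move=> eps0 eps1 y0; rewrite powR_expR// ler_expR mulNr lerN2.
have [l0|l0] := leP (ln y) 0.
  by apply: (@le_trans _ _ 0); [rewrite mulr_ge0_le0// ltW|exact: ltW].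
apply: (@le_trans _ _ (ln y)); first by rewrite ger_pMl.
by apply: le_trans (ln_le_sub1 y0) _; rewrite gerBl.
Qed.

(* Bielecki's weight [expR (lambda * (t - t0))] makes the Duhamel map a
   contraction on the whole interval. *)
Lemma solution_unique t0 T phi u v : measurable_fun setT phi ->
  solution t0 T phi u -> solution t0 T phi v ->
  forall t, t0 <= t <= T -> {ae mu, forall x, u t x = v t x}.
Proof.
move=> mphi [mu_ [Mu Mu0 uM] uE] [mv [Mv Mv0 vM] vE] t1 /andP[tt1 t1T].
move: tt1; rewrite le_eqVlt => /predU1P[t01|tt1].
  have tT : t0 <= t1 <= T by rewrite -{1}t01 lexx.
  apply: filterS2 (uE _ tT) (vE _ tT) => x -> ->.
  by rewrite /duhamel_map !duh_empty// -t01.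
set M := Mu + Mv; have M0 : 0 <= M by rewrite addr_ge0.
have {}uM t : t0 < t <= T -> (NY (u t) <= (M * (t - t0) `^ (- sigma))%:E)%E.
  move=> tT; apply: le_trans (uM t tT) _.
  by rewrite lee_fin ler_wpM2r ?powR_ge0// lerDl.
have {}vM t : t0 < t <= T -> (NY (v t) <= (M * (t - t0) `^ (- sigma))%:E)%E.
  move=> tT; apply: le_trans (vM t tT) _.
  by rewrite lee_fin ler_wpM2r ?powR_ge0// lerDr.
(* The extra singularity must fit: [delta + eps < 1] keeps the integral finite, and
   [theta - eps >= 0] keeps the power of the length bounded. *)
set eps := Num.min theta (1 - delta) / 2.
have eps0 : 0 < eps by rewrite divr_gt0// lt_min theta0 subr_gt0.
have eps2 : 2 * eps <= 1 - delta by rewrite mulrC divfK// ge_min lexx orbT.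
have eps3 : 2 * eps <= theta by rewrite mulrC divfK// ge_min lexx.
have eps1 : eps <= 1 by move: eps2 delta0; lra.
have de0 : 0 <= delta + eps by rewrite addr_ge0// ltW.
have de1 : delta + eps < 1 by move: eps2 eps0; lra.
have [B B0 HB] := integral_two_singular de0 de1 (ltW b0) b1.
have W0 : 0 < T - t0 by rewrite subr_gt0 (lt_le_trans tt1).
set D := `|a| * (C * M `^ beta) * (B * (T - t0) `^ (theta - eps)).
have D0 : 0 <= D by rewrite !mulr_ge0 ?powR_ge0// ltW.
have D1 : 0 < 2 * (D + 1) by rewrite mulr_gt0// ltr_wpDl.
(* Makes the contraction factor [D lambda^(-eps)] at most one half. *)
set lambda := (2 * (D + 1)) `^ eps^-1.
have lambda0 : 0 < lambda by rewrite powR_gt0.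
have lambdaE : lambda `^ (- eps) = (2 * (D + 1))^-1.
  by rewrite powRN /lambda -powRrM mulVf ?gt_eqF// powRr1// ltW.
have DL : D * lambda `^ (- eps) <= 2^-1.
  by rewrite lambdaE ler_pdivrMr// mulrA mulVf// mul1r lerDl.
(* The bound after [j] applications of the map: in the weighted norm the difference halves at each
   of them. *)
pose k (j : nat) (t : R) := 2 * M * 2^-1 ^+ j * (expR (lambda * (t - t0)) * (t - t0) `^ (- sigma)).
have k0 j t : 0 <= k j t by rewrite !mulr_ge0 ?exprn_ge0 ?expR_ge0 ?powR_ge0.
have mk j : measurable_fun setT (k j).
  apply: measurable_funM => //; apply: measurable_funM.
    apply: measurableT_comp => //; apply: measurable_funM => //.
    exact: measurable_funB.
  by apply: (measurableT_comp (measurable_powR _)); exact: measurable_funB.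
have mut t : measurable_fun setT (u t) by exact: jmeas_at.
have mvt t : measurable_fun setT (v t) by exact: jmeas_at.
have H j t : t0 < t <= T -> (NY (fun x => (u t x - v t x)%R) <= (k j t)%:E)%E.
  elim: j t => [|j IH] t tT; have /andP[tt tT'] := tT.
    apply: le_trans (eherz_absB kappa1 (mut t) (mvt t)) _.
    apply: le_trans (leeD (uM t tT) (vM t tT)) _.
    rewrite -EFinD lee_fin /k expr0 mulr1 -mulrDl (_ : M + M = 2 * M); last by ring.
    apply: ler_wpM2l; first by rewrite mulr_ge0.
    rewrite ler_peMl ?powR_ge0// -expR0 ler_expR mulr_ge0 ?(ltW lambda0)//.
    by rewrite subr_ge0 ltW.
  have below (z : R) : t0 < z < t -> t0 < z <= T.
    by move=> /andP[-> zt]; rewrite (ltW (lt_le_trans zt tT')).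
  have tT0 : t0 <= t <= T by rewrite tT' ltW.
  rewrite (@eq_eherz_abs _ _ (fun x => duhamel_map t0 phi u t x - duhamel_map t0 phi v t x))//; last 3 first.
  - by apply: measurable_funB.
  - by apply: measurable_funB; apply: jmeas_at; exact: jmeas_duhamel_map.
  - by apply: filterS2 (uE _ tT0) (vE _ tT0) => x -> ->.
  apply: le_trans (duhamel_map_diff kappa1 (ltW delta0) delta1 HY tt M0 mphi mu_ mv (mk j)
    (fun z _ => k0 j z) _ _ _) _.
  - by apply: ae_interval => z zt; apply: uM; exact: below.
  - by apply: ae_interval => z zt; apply: vM; exact: below.
  - by apply: ae_interval => z zt; apply: IH; exact: below.
  have tt0 : 0 < t - t0 by rewrite subr_gt0.
  set K := 2 * M * 2^-1 ^+ j * (expR (lambda * (t - t0)) * lambda `^ (- eps)).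
  have K0 : 0 <= K by rewrite !mulr_ge0 ?exprn_ge0 ?expR_ge0 ?powR_ge0.
  apply: (@le_trans _ _ ((`|a| * (C * M `^ beta))%:E * (K%:E *
      (B * (t - t0) `^ (1 - (delta + eps) - sigma * (beta + 1)))%:E))%E).
    apply: lee_wpmul2l; first by rewrite lee_fin !mulr_ge0 ?powR_ge0.
    apply: le_trans (lee_wpmul2l _ (HB _ _ tt)) => //.
    rewrite -ge0_integralZl_EFin//; last 2 first.
    - by move=> z _; rewrite lee_fin mulr_ge0 ?powR_ge0.
    - exact: measurable_singular_product.
    apply: ge0_le_integral => //.
    - by move=> z _; rewrite lee_fin !mulr_ge0 ?powR_ge0.
    - apply: measurable_funTS; apply/measurable_EFinP.
      apply: measurable_funM; last exact: mk.
      by apply/measurable_EFinP; exact: measurable_singular_product.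
    - by apply: emeasurable_funM => //; exact: measurable_singular_product.
    move=> z /=; rewrite in_itv/= => /andP[tz zt].
    have z0 : 0 < z - t0 by rewrite subr_gt0.
    have tz0 : 0 < t - z by rewrite subr_gt0.
    (* The loss [e^(-lambda (t - z))] is at most [(lambda (t - z))^(-eps)]. *)
    have ez : expR (lambda * (z - t0)) <=
        expR (lambda * (t - t0)) * (lambda `^ (- eps) * (t - z) `^ (- eps)).
      rewrite -powRM ?(ltW lambda0) ?(ltW tz0)//.
      rewrite (_ : lambda * (z - t0) = lambda * (t - t0) - lambda * (t - z)); last by ring.
      rewrite expRD ler_pM2l ?expR_gt0//; apply: expR_le_powRN => //.
      exact: mulr_gt0.
    rewrite -EFinM lee_fin /k /K.
    rewrite (opprD delta) (powRD_gt0 _ _ tz0).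
    rewrite (_ : - (sigma * (beta + 1)) = - (sigma * beta) + - sigma); last by ring.
    rewrite (powRD_gt0 _ _ z0).
    rewrite [leLHS](_ : _ = 2 * M * 2^-1 ^+ j * ((t - z) `^ (- delta) *
      ((z - t0) `^ (- (sigma * beta)) * (z - t0) `^ (- sigma))) *
      expR (lambda * (z - t0))); last by ring.
    rewrite [leRHS](_ : _ = 2 * M * 2^-1 ^+ j * ((t - z) `^ (- delta) *
      ((z - t0) `^ (- (sigma * beta)) * (z - t0) `^ (- sigma))) *
      (expR (lambda * (t - t0)) * (lambda `^ (- eps) * (t - z) `^ (- eps)))); last by ring.
    by apply: ler_wpM2l => //; rewrite !mulr_ge0 ?exprn_ge0 ?powR_ge0.
  rewrite -!EFinM lee_fin /K /k exprS.
  rewrite (_ : 1 - (delta + eps) - sigma * (beta + 1) = (theta - eps) + - sigma); last by ring.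
  rewrite powRD_gt0//.
  have P : (t - t0) `^ (theta - eps) <= (T - t0) `^ (theta - eps).
    rewrite ge0_ler_powR ?nnegrE ?(ltW W0) ?(ltW tt0)//; last by rewrite lerD2r.
    by rewrite subr_ge0; move: eps3 eps0; lra.
  set E := expR _; set X := (t - t0) `^ (- sigma); set Y := _ `^ (theta - eps) in P *.
  rewrite [leLHS](_ : _ = 2 * M * 2^-1 ^+ j * (E * X) *
     (`|a| * (C * M `^ beta) * (B * Y) * lambda `^ (- eps))); last by ring.
  rewrite [leRHS](_ : _ = 2 * M * 2^-1 ^+ j * (E * X) * 2^-1); last by ring.
  apply: ler_wpM2l; first by rewrite !mulr_ge0 ?exprn_ge0 ?expR_ge0 ?powR_ge0.
  apply: le_trans DL; apply: ler_wpM2r; first exact: powR_ge0.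
  apply: ler_wpM2l; first by rewrite !mulr_ge0 ?powR_ge0.
  by apply: ler_wpM2l => //; exact: ltW.
have tT : t0 < t1 <= T by rewrite tt1.
have : NY (fun x => (u t1 x - v t1 x)%R) = 0%E.
  apply: (@le_halves_eq0 _ _ (2 * M * (expR (lambda * (t1 - t0)) * (t1 - t0) `^ (- sigma)))).
    exact: eherz_ge0.
  by move=> j; apply: le_trans (H j t1 tT) _; rewrite lee_fin /k mulrAC.
move/(eherz_eq0_ae n0 kappa0).
have mB : measurable_fun setT (absE (fun x => u t1 x - v t1 x)).
  by apply: measurable_absE; exact: measurable_funB.
move=> /(_ mB (absE_ge0 _)); apply: filterS => x.
by rewrite /absE => /eqP; rewrite eqe normr_eq0 subr_eq0 => /eqP.
Qed.

(** * Restarting, finiteness and continuity in time *)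

Lemma eheat_lty_ae t phi : 0 < t -> measurable_fun setT phi -> (NX phi < +oo)%E ->
  {ae mu, forall x, (eheat t (absE phi) x < +oo)%E}.
Proof.
move=> t0 mphi phioo; have maf := measurable_absE mphi.
apply: (eherz_lty_ae (s := s) n0 q0).
- by apply: measurable_eheat => // x; exact: absE_ge0.
- by move=> x; apply: eheat_ge0 => y; exact: absE_ge0.
apply: le_lt_trans (HXX t0 maf (absE_ge0 phi)) _.
by rewrite lte_mul_pinfty// lee_fin.
Qed.

Let ds0 : 0 <= delta - sigma. Proof. by rewrite subr_ge0 ltW. Qed.
Let ds1 : delta - sigma < 1.
Proof. by apply: le_lt_trans delta1; rewrite gerBl ltW. Qed.

Lemma solution_ae_bound t0 T phi u : solution t0 T phi u -> exists2 M, 0 <= M &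
  forall t, t <= T ->
  {ae leb, forall z, t0 < z < t -> (NY (u z) <= (M * (z - t0) `^ (- sigma))%:E)%E}.
Proof.
move=> [_ [M M0 uM] _]; exists M => // t tT; apply: ae_interval => z /andP[tz zt].
by apply: uM; rewrite tz (le_trans (ltW zt)).
Qed.

Lemma solution_start t0 T phi u : t0 <= T -> solution t0 T phi u ->
  {ae mu, forall x, u t0 x = phi x}.
Proof.
move=> tT [_ _ /(_ t0)]; rewrite lexx tT => /(_ isT); apply: filterS => x ->.
by rewrite /duhamel_map duh_empty// mulr0 addr0 subrr heat0.
Qed.

(** At [t = t1] this is the Duhamel bound; for later [t] the heat flow, bounded for the norm with
    parameters [s] and [q], is applied to the integral taken at [t1]. *)
Lemma eduh_solution_ae t0 T phi u t1 t : solution t0 T phi u ->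
  t0 <= t1 -> t1 <= T -> t1 <= t ->
  {ae mu, forall x, (eduh t0 t1 t (absJ (fun r => F (u r))) x < +oo)%E}.
Proof.
move=> usol; rewrite le_eqVlt => /predU1P[<- _ _|tt1 t1T].
  by apply: nearW => x; rewrite eduh_empty.
have [M M0 uM] := solution_ae_bound usol; have [mu_ _ _] := usol.
rewrite le_eqVlt => /predU1P[<-|t1t].
  exact: (eduh_henon_ae q1 ds0 ds1 HX tt1 M0 mu_ (uM _ t1T)).
have mJ := jmeas_absJ (jmeas_henon mu_).
have mE : measurable_fun setT (eduh t0 t1 t1 (absJ (fun r => F (u r)))).
  by apply: measurable_eduh => // z y; exact: absE_ge0.
have E0 x : (0 <= eduh t0 t1 t1 (absJ (fun r => F (u r))) x)%E.
  by apply: eduh_ge0 => z y; exact: absE_ge0.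
have t0' : 0 < t - t1 by rewrite subr_gt0.
have : {ae mu, forall x, (eheat (t - t1) (eduh t0 t1 t1 (absJ (fun r => F (u r)))) x < +oo)%E}.
  apply: (eherz_lty_ae (s := s) n0 q0).
  - exact: measurable_eheat.
  - by move=> x; exact: eheat_ge0.
  apply: le_lt_trans (HXX t0' mE E0) _.
  have [A A0 HA] := eduh_henon_bound q1 ds0 ds1 HX.
  rewrite lte_mul_pinfty// ?lee_fin//.
  by apply: le_lt_trans (HA _ _ _ _ tt1 M0 mu_ (uM _ t1T)) _; exact: ltry.
apply: filterS => x; rewrite eheat_eduh// => z y; exact: absE_ge0.
Qed.

(** The evaluation time [t] may lie beyond [T]; the gluing of solutions relies on this. *)
Lemma solution_restart t0 T phi u t1 t : measurable_fun setT phi -> (NX phi < +oo)%E ->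
  solution t0 T phi u -> t0 <= t1 -> t1 <= T -> t1 < t ->
  {ae mu, forall x, heat (t - t1) (u t1) x =
    heat (t - t0) phi x + a * duh t0 t1 t (fun r => F (u r)) x}.
Proof.
move=> mphi phioo usol tt1 t1T t1t; have [mu_ _ uE] := usol.
have t1t0 : 0 < t - t1 by rewrite subr_gt0.
have mut : measurable_fun setT (u t1) by exact: jmeas_at.
have mF := jmeas_henon mu_.
have mJ : jmeas (absJ (fun r => F (u r))) by exact: jmeas_absJ mF.
have [tt1'|tt1'] := leP t1 t0.
  have -> : t1 = t0 by apply/eqP; rewrite eq_le tt1'.
  apply: nearW => x; rewrite duh_empty// mulr0 addr0; apply: heat_ae => //.
  - by rewrite subr_eq0 gt_eqF// (le_lt_trans tt1).
  - exact: jmeas_at.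
  - by apply: solution_start usol; exact: le_trans t1T.
have tt0 : 0 < t - t0 by rewrite subr_gt0 (lt_trans tt1').
have s10 : 0 < t1 - t0 by rewrite subr_gt0.
have tE : t - t0 = (t - t1) + (t1 - t0) by ring.
have := eheat_lty_ae tt0 mphi phioo; have := eduh_solution_ae usol tt1 t1T (ltW t1t).
have mh := measurable_heat (t1 - t0) mphi.
have md : measurable_fun setT (duh t0 t1 t1 (fun r => F (u r))) by exact: measurable_duh.
apply: filterS2 => x dx hx.
have hx' : (eheat (t - t1) (absE (heat (t1 - t0) phi)) x < +oo)%E.
  apply: le_lt_trans hx; rewrite tE.
  rewrite -(eheat_semigroup x t1t0 s10 (measurable_absE mphi) (absE_ge0 _)).
  apply: le_eheat.
  - exact: measurable_absE.
  - by apply: measurable_eheat; [exact: measurable_absE|exact: absE_ge0].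
  - exact: absE_ge0.
  - by move=> y; apply: eheat_ge0 => z; exact: absE_ge0.
  - by apply: nearW => y; apply: abs_heat_le => //; rewrite gt_eqF.
have dx' : (eheat (t - t1) (absE (duh t0 t1 t1 (fun r => F (u r)))) x < +oo)%E.
  apply: le_lt_trans dx; rewrite -eheat_eduh//; last by move=> z y; exact: absE_ge0.
  apply: le_eheat.
  - exact: measurable_absE.
  - by apply: measurable_eduh => // z y; exact: absE_ge0.
  - exact: absE_ge0.
  - by move=> y; apply: eduh_ge0 => z w; exact: absE_ge0.
  - by apply: nearW => y; exact: abs_duh_le.
have dx'' : (eduh t0 t1 t (absJ (fun r => F (u r))) x < +oo)%E by exact: dx.
have tn0 : t - t1 != 0 by rewrite gt_eqF.
have mad : measurable_fun setT (fun y => a * duh t0 t1 t1 (fun r => F (u r)) y).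
  exact: measurable_funM.
have t1T' : t0 <= t1 <= T by rewrite tt1.
rewrite (@heat_ae _ _ (t - t1) (u t1) (fun y => heat (t1 - t0) phi y +
    a * duh t0 t1 t1 (fun r => F (u r)) y) x tn0 mut (measurable_funD mh mad) (uE _ t1T')).
rewrite heatD//; last first.
  rewrite (_ : absE _ = fun y => (`|a|%:E * absE (duh t0 t1 t1 (fun r => F (u r))) y)%E); last first.
    by apply/funext => y; rewrite /absE normrM EFinM.
  rewrite eheatZ//; [by rewrite lte_mul_pinfty|exact: measurable_absE|exact: absE_ge0].
rewrite heatZ// (heat_duh t1t mF dx'') tE heat_semigroup// -?tE//.
Qed.

Lemma solution_step t0 T phi u t1 t : measurable_fun setT phi -> (NX phi < +oo)%E ->
  solution t0 T phi u -> t0 <= t1 -> t1 <= t -> t <= T ->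
  {ae mu, forall x, u t x = heat (t - t1) (u t1) x + a * duh t1 t t (fun r => F (u r)) x}.
Proof.
move=> mphi phioo usol tt1 t1t tT; have [mu_ _ uE] := usol.
move: t1t; rewrite le_eqVlt => /predU1P[<-|t1t].
  by apply: nearW => x; rewrite subrr heat0 duh_empty// mulr0 addr0.
have tT' : t0 <= t <= T by rewrite tT (le_trans tt1 (ltW t1t)).
have t1T : t1 <= T by exact: le_trans (ltW t1t) tT.
have := solution_restart mphi phioo usol tt1 t1T t1t.
have := eduh_solution_ae usol (le_trans tt1 (ltW t1t)) tT (lexx t).
have := uE t tT'; apply: filterS3 => x -> dx ->.
rewrite /duhamel_map (duh_split tt1 (ltW t1t) (lexx t) (jmeas_henon mu_) dx).
by rewrite mulrDr addrA.
Qed.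

Lemma solution_step_NX t0 T phi u t1 t : measurable_fun setT phi -> (NX phi < +oo)%E ->
  solution t0 T phi u -> t0 <= t1 -> t1 <= t -> t <= T ->
  (NX (fun x => (u t x - heat (t - t1) (u t1) x)%R) <=
   `|a|%:E * eherz s q (eduh t1 t t (absJ (fun r => F (u r)))))%E.
Proof.
move=> mphi phioo usol tt1 t1t tT; have [mu_ _ _] := usol.
have mF := jmeas_henon mu_.
have mut z : measurable_fun setT (u z) by exact: jmeas_at.
have mE : measurable_fun setT (eduh t1 t t (absJ (fun r => F (u r)))).
  by apply: measurable_eduh => [|z y]; [exact: jmeas_absJ|exact: absE_ge0].
have E0 x : (0 <= eduh t1 t t (absJ (fun r => F (u r))) x)%E.
  by apply: eduh_ge0 => z y; exact: absE_ge0.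
rewrite -eherzZ//; apply: eherz_abs_mono => //.
- by apply: measurable_funB => //; exact: measurable_heat.
- exact: emeasurable_funM.
- by move=> x; rewrite mule_ge0.
apply: filterS (solution_step mphi phioo usol tt1 t1t tT) => x ux.
rewrite /absE ux addrC addKr normrM EFinM; apply: lee_wpmul2l => //.
exact: abs_duh_le.
Qed.

Lemma solution_NX_lty t0 T phi u t : measurable_fun setT phi -> (NX phi < +oo)%E ->
  solution t0 T phi u -> t0 <= t <= T -> (NX (u t) < +oo)%E.
Proof.
move=> mphi phioo usol /andP[tt tT]; have [mu_ _ _] := usol.
have mut z : measurable_fun setT (u z) by exact: jmeas_at.
have u0oo : (NX (u t0) < +oo)%E.
  rewrite (eq_eherz_abs q0 (mut t0) mphi)//.
  by apply: solution_start usol; exact: le_trans tT.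
move: (tt); rewrite le_eqVlt => /predU1P[<-//|tt'].
have mh := measurable_heat (t - t0) (mut t0).
apply: le_lt_trans (eherz_abs_triangle q1 (mut t) mh) _.
have st := solution_step_NX mphi phioo usol (lexx t0) tt tT.
apply: lte_add_pinfty.
  apply: le_lt_trans st _; rewrite lte_mul_pinfty//.
  have [M M0 uM] := solution_ae_bound usol.
  have [A A0 HA] := eduh_henon_bound q1 ds0 ds1 HX.
  by apply: le_lt_trans (HA _ _ _ _ tt' M0 mu_ (uM _ tT)) _; exact: ltry.
apply: le_lt_trans (NX_heat_le _ (mut t0)) _; first by rewrite subr_gt0.
by rewrite lte_mul_pinfty// lee_fin.
Qed.

Lemma powR_small (B e' y : R) : 0 <= B -> 0 < e' -> 0 < y -> exists2 eta, 0 < eta &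
  forall z, 0 <= z -> z <= eta -> B * z `^ e' <= y.
Proof.
move=> B0 e0 y0; have B1 : 0 < B + 1 by rewrite ltr_wpDl.
have yB : 0 < y / (B + 1) by rewrite divr_gt0.
exists ((y / (B + 1)) `^ e'^-1) => [|z z0 zE]; first exact: powR_gt0.
apply: (@le_trans _ _ (B * (y / (B + 1)))).
  apply: ler_wpM2l => //.
  have E : ((y / (B + 1)) `^ e'^-1) `^ e' = y / (B + 1).
    by rewrite -powRrM mulVf ?gt_eqF// powRr1// ltW.
  by rewrite -[leRHS]E ge0_ler_powR ?nnegrE ?powR_ge0// ltW.
by rewrite mulrCA ler_piMr ?(ltW y0)// ler_pdivrMr// mul1r lerDl.
Qed.

(** The difference is the flow over [p] applied to the gap at time [h]; the constant [C + 1] also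
    covers [p = 0]. *)
Lemma heat_gap_time p h phi : 0 <= p -> 0 < h -> measurable_fun setT phi ->
  (NX phi < +oo)%E ->
  (NX (fun x => (heat (p + h) phi x - heat p phi x)%R) <=
   (C + 1)%:E * NX (fun x => (heat h phi x - phi x)%R))%E.
Proof.
move=> p0 h0 mphi phioo; have mh := measurable_heat h mphi.
have md : measurable_fun setT (fun x => heat h phi x - phi x) by exact: measurable_funB.
have NX0 := eherz_ge0 s q (absE (fun x => heat h phi x - phi x)).
have key (c : R) : c <= C + 1 -> (c%:E * NX (fun x => (heat h phi x - phi x)%R) <=
   (C + 1)%:E * NX (fun x => (heat h phi x - phi x)%R))%E.
  by move=> cC; apply: lee_wpmul2r.
move: p0; rewrite le_eqVlt => /predU1P[<-|p0].
  rewrite add0r; under [X in absE X]funext => x do rewrite heat0.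
  by rewrite -[leLHS]mul1e; apply: key; rewrite lerDr.
apply: (@le_trans _ _ (C%:E * NX (fun x => (heat h phi x - phi x)%R))%E); last first.
  by apply: key; rewrite lerDl.
apply: le_trans (NX_heat_le p0 md); rewrite le_eqVlt; apply/orP; left; apply/eqP.
apply: eq_eherz_abs => //.
- by apply: measurable_funB; exact: measurable_heat.
- exact: measurable_heat.
have ph0 : 0 < p + h by rewrite addr_gt0.
apply: filterS2 (eheat_lty_ae ph0 mphi phioo) (eheat_lty_ae p0 mphi phioo) => x hx px.
rewrite heatB ?gt_eqF//; first by rewrite heat_semigroup.
apply: le_lt_trans hx.
rewrite -(eheat_semigroup x p0 h0 (measurable_absE mphi) (absE_ge0 _)).
apply: le_eheat.
- exact: measurable_absE.
- by apply: measurable_eheat; [exact: measurable_absE|exact: absE_ge0].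
- exact: absE_ge0.
- by move=> y; apply: eheat_ge0 => z; exact: absE_ge0.
- by apply: nearW => y; apply: abs_heat_le => //; rewrite gt_eqF.
Qed.

(** One restart time serves all [z] close to [t]. At [t = t0] it is [t0] itself, because the whole
    Duhamel term is of order [(z - t0)^theta]; otherwise it lies slightly before [t], away from the
    singularity at [t0]. *)
Lemma duhamel_tail_small t0 T phi u t e : solution t0 T phi u -> t0 <= t -> 0 < e ->
  exists t1, [/\ t0 <= t1, t1 <= t & exists2 eta, 0 < eta & forall z, t0 <= z <= T ->
    `|z - t| < eta -> t1 <= z /\
    (`|a|%:E * eherz s q (eduh t1 z z (absJ (fun r => F (u r)))) <= e%:E)%E].
Proof.
move=> usol tt e0; have [M M0 uM] := solution_ae_bound usol; have [mu_ _ _] := usol.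
have empty t1 z : z <= t1 ->
    (`|a|%:E * eherz s q (eduh t1 z z (absJ (fun r => F (u r)))) <= e%:E)%E.
  move=> zt; rewrite (_ : eduh t1 z z _ = cst 0%E); last first.
    by apply/funext => x; rewrite eduh_empty.
  by rewrite eherz0// mule0 lee_fin ltW.
move: tt; rewrite le_eqVlt => /predU1P[<-|tt].
  exists t0; split => //.
  have [A A0 HA] := eduh_henon_bound q1 ds0 ds1 HX.
  have B0 : 0 <= `|a| * (A * M `^ beta * M) by rewrite !mulr_ge0 ?powR_ge0.
  have ex0 : 0 < 1 - (delta - sigma) - sigma * (beta + 1).
    by rewrite (_ : 1 - (delta - sigma) - sigma * (beta + 1) = theta)//; ring.
  have [eta eta0 Heta] := powR_small B0 ex0 e0.
  exists eta => // z /andP[tz zT] zeta; split => //.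
  move: (tz); rewrite le_eqVlt => /predU1P[<-|tz']; first exact: empty.
  apply: le_trans (lee_wpmul2l _ (HA _ _ _ _ tz' M0 mu_ (uM _ zT))) _ => //.
  rewrite -EFinM lee_fin mulrA; apply: Heta; first by rewrite subr_ge0.
  by apply: ltW; apply: le_lt_trans zeta; exact: ler_norm.
have [A A0 HA] := eduh_henon_tail q1 ds0 ds1 HX.
(* The restart time stays at least [h] after [t0], which bounds the singular factor. *)
set h := (t - t0) / 2; have h0 : 0 < h by rewrite divr_gt0// subr_gt0.
set B := `|a| * (A * M `^ beta * M * h `^ (- (sigma * (beta + 1)))).
have B0 : 0 <= B by rewrite !mulr_ge0 ?powR_ge0.
have ex0 : 0 < 1 - (delta - sigma) by rewrite subr_gt0.
have [eta eta0 Heta] := powR_small B0 ex0 e0.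
(* The tail runs from [t - rho] to [z < t + rho], a length below [2 rho <= eta]. *)
set rho := Num.min h (eta / 2).
have rho0 : 0 < rho by rewrite lt_min h0 divr_gt0.
have rhoh : rho <= h by rewrite ge_min lexx.
have rhoe : 2 * rho <= eta by rewrite mulrC -ler_pdivlMr// ge_min lexx orbT.
exists (t - rho); split; first by rewrite /h in rhoh *; move: rhoh tt; lra.
  by rewrite gerBl ltW.
exists rho => // z /andP[tz zT]; rewrite ltr_distl => /andP[z1 z2]; split; first exact: ltW.
have tr : t0 < t - rho by move: rhoh tt; rewrite /h; lra.
apply: le_trans (lee_wpmul2l _ (HA _ _ _ _ _ tr z1 M0 mu_ (uM _ zT))) _ => //.
rewrite -EFinM lee_fin; apply: le_trans (Heta (z - (t - rho)) _ _).
- rewrite /B mulrA mulrA; apply: ler_wpM2r; first exact: powR_ge0.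
  rewrite [leRHS]mulrA; apply: ler_wpM2l; first by rewrite !mulr_ge0 ?powR_ge0.
  rewrite !powRN lef_pV2 ?posrE ?powR_gt0//; last by rewrite subr_gt0.
  rewrite ge0_ler_powR ?nnegrE ?(ltW b0) ?(ltW h0)//; first by rewrite subr_ge0 ltW.
  by move: rhoh; rewrite /h; lra.
- by rewrite subr_ge0 ltW.
- by move: z2 rhoe; lra.
Qed.

(** Both [u z] and [u t] are compared with the heat flow of the same earlier state [u t1]. The
    Duhamel tails are small, and what remains is strong continuity at that state; left and right
    continuity come together. *)
Lemma solution_continuous t0 T phi u t e : measurable_fun setT phi -> (NX phi < +oo)%E ->
  solution t0 T phi u -> t0 <= t <= T -> 0 < e -> exists2 eta, 0 < eta &
  forall z, t0 <= z <= T -> `|z - t| < eta ->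
    (NX (fun x => (u z x - u t x)%R) <= e%:E)%E.
Proof.
move=> mphi phioo usol tT e0; have [mu_ _ _] := usol; have /andP[tt tT'] := tT.
have mut z : measurable_fun setT (u z) by exact: jmeas_at.
have e3 : 0 < e / 3 by rewrite divr_gt0.
have [t1 [tt1 t1t [eta1 eta10 H1]]] := duhamel_tail_small usol tt e3.
have t1T : t0 <= t1 <= T by rewrite tt1 (le_trans t1t).
have woo := solution_NX_lty mphi phioo usol t1T.
have C1 : 0 < C + 1 by rewrite ltr_wpDl.
have eC : 0 < e / 3 / (C + 1) by rewrite divr_gt0.
have [eta2 eta20 H2] := strong (mut t1) woo eC.
exists (Num.min eta1 eta2) => [|z zT]; first by rewrite lt_min eta10.
rewrite lt_min => /andP[z1 z2]; have /andP[tz zT'] := zT.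
have [t1z sz] := H1 z zT z1.
have tt1' : `|t - t| < eta1 by rewrite subrr normr0.
have [_ st] := H1 t tT tt1'.
have mh p : measurable_fun setT (heat p (u t1)) by exact: measurable_heat.
have gap p p' : 0 <= p -> p < p' -> p' - p < eta2 ->
    (NX (fun x => (heat p' (u t1) x - heat p (u t1) x)%R) <= (e / 3)%:E)%E.
  move=> p0 pp pe; have h0 : 0 < p' - p by rewrite subr_gt0.
  have := heat_gap_time p0 h0 (mut t1) woo; rewrite subrKC => H; apply: le_trans H _.
  apply: (@le_trans _ _ ((C + 1)%:E * (e / 3 / (C + 1))%:E)%E).
    by apply: lee_wpmul2l; [rewrite lee_fin ltW|apply: H2; rewrite h0].
  by rewrite -EFinM lee_fin mulrC divfK// gt_eqF.
have mid : (NX (fun x => (heat (z - t1) (u t1) x - heat (t - t1) (u t1) x)%R) <= (e / 3)%:E)%E.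
  have [zt|tz'|<-] := ltgtP z t.
  - rewrite eherz_abs_subC; apply: gap; rewrite ?subr_ge0 ?ltrD2r//.
    by apply: le_lt_trans z2; rewrite distrC; apply: le_trans (ler_norm _); lra.
  - apply: gap; rewrite ?subr_ge0 ?ltrD2r//.
    by apply: le_lt_trans z2; apply: le_trans (ler_norm _); lra.
  - rewrite (_ : absE _ = cst 0%E) ?eherz0// ?lee_fin ?(ltW e3)//.
    by apply/funext => x; rewrite /absE subrr normr0.
pose f1 x := u z x - heat (z - t1) (u t1) x.
pose f2 x := heat (z - t1) (u t1) x - heat (t - t1) (u t1) x.
pose f3 x := heat (t - t1) (u t1) x - u t x.
have m1 : measurable_fun setT f1 by exact: measurable_funB.
have m2 : measurable_fun setT f2 by exact: measurable_funB.
have m3 : measurable_fun setT f3 by exact: measurable_funB.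
have b1' : (NX f1 <= (e / 3)%:E)%E.
  by apply: le_trans sz; exact: (solution_step_NX mphi phioo usol).
have b3' : (NX f3 <= (e / 3)%:E)%E.
  rewrite eherz_abs_subC; apply: le_trans st.
  exact: (solution_step_NX mphi phioo usol).
have b2' : (NX f2 <= (e / 3)%:E)%E by exact: mid.
have -> : (fun x => u z x - u t x) = fun x => f1 x + (f2 x + f3 x).
  apply/funext => x; rewrite /f1 /f2 /f3.
  by move: (u z x) (u t x) (heat _ _ _) (heat _ _ _) => *; ring.
clear mid; clearbody f1 f2 f3.
have H23 := eherz_absD s q1 m2 m3; have m23 := measurable_funD m2 m3.
have H123 := eherz_absD s q1 m1 m23.
have -> : e = e / 3 + (e / 3 + e / 3) by field.
apply: le_trans H123 _; rewrite EFinD; apply: leeD => //.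
by apply: le_trans H23 _; rewrite EFinD; exact: leeD.
Qed.

(** * Restriction, shift and gluing of solutions *)

Lemma solution_restrict t0 T T' phi u : T' <= T -> solution t0 T phi u ->
  solution t0 T' phi u.
Proof.
move=> TT [mu_ [M M0 uM] uE]; split => //.
  by exists M => // t /andP[tt tT]; apply: uM; rewrite tt (le_trans tT).
by move=> t /andP[tt tT]; apply: uE; rewrite tt (le_trans tT).
Qed.

Lemma powRN_anti (x y : R) : 0 < x -> x <= y -> y `^ (- sigma) <= x `^ (- sigma).
Proof.
move=> x0 xy; have y0 := lt_le_trans x0 xy.
rewrite !powRN lef_pV2 ?posrE ?powR_gt0//.
by rewrite ge0_ler_powR ?nnegrE// ltW.
Qed.

Lemma solution_shift t0 T phi u t1 : measurable_fun setT phi -> (NX phi < +oo)%E ->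
  solution t0 T phi u -> t0 <= t1 -> solution t1 T (u t1) u.
Proof.
move=> mphi phioo usol tt; have [mu_ [M M0 uM] uE] := usol; split => //.
  exists M => // t /andP[tt1 tT]; apply: le_trans (uM t _) _.
    by rewrite (le_lt_trans tt tt1).
  rewrite lee_fin; apply: ler_wpM2l => //; apply: powRN_anti; first by rewrite subr_gt0.
  by rewrite lerD2l lerN2.
by move=> t /andP[tt1 tT]; exact: (solution_step mphi phioo usol).
Qed.

(** The overlap from [t1] to [T1] serves twice: uniqueness identifies [u] and [w] there, and past
    [T1] the weight [(t - t1)^(-sigma)] in the bound of [w] is no longer singular. *)
Lemma solution_glue t0 T1 T2 phi u t1 w : measurable_fun setT phi -> (NX phi < +oo)%E ->
  solution t0 T1 phi u -> t0 <= t1 -> t1 < T1 -> T1 < T2 -> solution t1 T2 (u t1) w ->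
  solution t0 T2 phi (fun t x => if t <= T1 then u t x else w t x).
Proof.
move=> mphi phioo usol tt1 tT1 T12 wsol; set z := fun t x => _.
have [mu_ [Mu Mu0 uM] uE] := usol; have [mw [Mw Mw0 wM] wE] := wsol.
have mut t : measurable_fun setT (u t) by exact: jmeas_at.
have mwt t : measurable_fun setT (w t) by exact: jmeas_at.
have mz : jmeas z.
  apply: measurable_fun_ifT => //=.
  by apply: measurable_fun_ler => //; exact: measurable_fst.
have mzt t : measurable_fun setT (z t) by exact: jmeas_at.
have zu t : t <= T1 -> z t = u t by move=> tT; apply/funext => x; rewrite /z tT.
have zw t : T1 < t -> z t = w t by move=> tT; apply/funext => x; rewrite /z leNgt tT.
have uw t : t1 <= t <= T1 -> {ae mu, forall x, u t x = w t x}.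
  apply: (solution_unique (mut t1) (solution_shift mphi phioo usol tt1)).
  exact: solution_restrict (ltW T12) wsol.
(* For [T1 < t <= T2]: [(t - t1)^(-sigma) <= (T1 - t1)^(-sigma)] and
   [1 <= (T2 - t0)^sigma (t - t0)^(-sigma)]. *)
set M := Mu + Mw * ((T1 - t1) `^ (- sigma) * (T2 - t0) `^ sigma).
have M2 : 0 <= Mw * ((T1 - t1) `^ (- sigma) * (T2 - t0) `^ sigma).
  by rewrite !mulr_ge0 ?powR_ge0.
have M0 : 0 <= M by rewrite addr_ge0.
have bound t : t0 < t <= T2 -> (NY (z t) <= (M * (t - t0) `^ (- sigma))%:E)%E.
  move=> /andP[tt tT]; have [tT1'|tT1'] := leP t T1.
    rewrite zu//; apply: le_trans (uM t _) _; first by rewrite tt.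
    by rewrite lee_fin; apply: ler_wpM2r; rewrite ?powR_ge0// lerDl.
  rewrite zw//; have t1t : t1 < t by exact: lt_trans tT1'.
  apply: le_trans (wM t _) _; first by rewrite t1t.
  rewrite lee_fin /M mulrDl; apply: ler_wpDl; first by rewrite mulr_ge0 ?powR_ge0.
  rewrite -mulrA; apply: ler_wpM2l => //; rewrite -mulrA.
  apply: (@le_trans _ _ ((T1 - t1) `^ (- sigma))).
    by apply: powRN_anti; rewrite ?subr_gt0// lerD2r ltW.
  rewrite ler_peMr ?powR_ge0// powRN -ler_pdivrMl ?powR_gt0 ?subr_gt0//; last first.
    by apply: lt_le_trans tT.
  rewrite mulr1 lef_pV2 ?posrE ?powR_gt0 ?subr_gt0//; last by apply: lt_le_trans tT.
  rewrite ge0_ler_powR ?nnegrE ?(ltW sigma0) ?subr_ge0 ?(ltW tt)//.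
    by rewrite ltW// (lt_le_trans tt).
  by rewrite lerD2r.
split => //; first by exists M.
move=> t /andP[tt tT]; have [tT1'|tT1'] := leP t T1.
  have tT0 : t0 <= t <= T1 by rewrite tt.
  apply: filterS (uE t tT0) => x ux; rewrite zu// ux /duhamel_map.
  congr (_ + _ * _); apply: eq_duh => //.
  - by move=> r; exact: measurable_henon.
  - by move=> r; exact: measurable_henon.
  move=> r /andP[_ rt]; apply: nearW => y.
  by rewrite zu// (le_trans (ltW rt)).
have t1t : t1 < t by exact: lt_trans tT1'.
have tt' : t0 < t by exact: le_lt_trans t1t.
have tT2 : t1 <= t <= T2 by rewrite ltW.
have zfin : {ae mu, forall x, (eduh t0 t t (absJ (fun r => F (z r))) x < +oo)%E}.
  apply: (eduh_henon_ae q1 ds0 ds1 HX tt' M0 mz).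
  apply: ae_interval => r /andP[tr rt]; apply: bound.
  by rewrite tr (le_trans (ltW rt)).
have res := solution_restart mphi phioo usol tt1 (ltW tT1) t1t.
move: res zfin (wE t tT2); apply: filterS3 => x res zfin wx.
rewrite zw// wx /duhamel_map res.
rewrite (duh_split tt1 (ltW t1t) (lexx t) (jmeas_henon mz) zfin) mulrDr addrA.
congr (_ + _ * _ + _ * _).
- apply: eq_duh; first exact: ltW.
  + by move=> r; exact: measurable_henon.
  + by move=> r; exact: measurable_henon.
  move=> r /andP[_ rt]; apply: nearW => y.
  by rewrite zu// (le_trans (ltW rt))// ltW.
- apply: eq_duh => //.
  + by move=> r; exact: measurable_henon.
  + by move=> r; exact: measurable_henon.
  move=> r /andP[tr rt]; have [rT|rT] := leP r T1; last by apply: nearW => y; rewrite zw.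
  have : t1 <= r <= T1 by rewrite rT ltW.
  by move/uw; apply: filterS => y uwy; rewrite zu// /henon_term uwy.
Qed.

(** * Passage between solutions and the mild formulation *)

Definition mild_curve T phi u : Prop :=
  [/\ herz_continuous s q%:E 1%E `[0, T] u,
      herz_weighted_bounded sigma s kappa%:E 1%E T u &
      forall t, 0 <= t <= T -> mild_eq a gamma beta phi u t].

(** The curve [u] is any version of [v] with measurable slices: the slices of the maximal solution
    are chosen one time at a time and need not be jointly measurable. *)
Lemma solution_mild_curve T phi u v : measurable_fun setT phi -> (NX phi < +oo)%E ->
  solution 0 T phi v -> (forall t, 0 <= t <= T -> measurable_fun setT (u t)) ->
  (forall t, 0 <= t <= T -> {ae mu, forall x, u t x = v t x}) -> mild_curve T phi u.
Proof.
move=> mphi phioo vsol mut uv; have [mv [M M0 vM] vE] := vsol.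
have mvt t : measurable_fun setT (v t) by exact: jmeas_at.
have itvP t : `[0, T]%classic t -> 0 <= t <= T by rewrite /= in_itv.
split.
- split=> t /itvP tT.
    apply/(herz_spaceE n0 s _ q1); split; first exact: mut.
    rewrite (eq_eherz_abs q0 (mut t tT) (mvt t) (uv t tT)).
    exact: solution_NX_lty vsol tT.
  apply/cvge0P => [z|e e0]; first by rewrite herz_normE// eherz_ge0.
  have [eta eta0 Heta] := solution_continuous mphi phioo vsol tT e0.
  rewrite near_withinE; apply/nbhs_ballP; exists eta => // z.
  move=> zb /itvP zT; rewrite herz_normE//.
  have zt : `|z - t| < eta by move: zb; rewrite /ball/= distrC.
  apply: le_trans (Heta z zT zt); rewrite le_eqVlt; apply/orP; left; apply/eqP.
  apply: eq_eherz_abs => //.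
  + by apply: measurable_funB; exact: mut.
  + by apply: measurable_funB.
  + by apply: filterS2 (uv t tT) (uv z zT) => x ut uz; rewrite /= ut uz.
- have E t : 0 < t <= T -> herz_norm s kappa%:E 1%E (u t) = NY (v t).
    move=> /andP[t0 tT]; have tT' : 0 <= t <= T by rewrite ltW.
    by rewrite herz_normE// (eq_eherz_abs kappa0 (mut t tT') (mvt t) (uv t tT')).
  split.
    apply: (eq_measurable_fun (fun t => (t `^ sigma)%:E * NY (v t))%E).
      by move=> t /set_mem tI; rewrite E//; move: tI; rewrite /= in_itv.
    apply: measurable_funTS; apply: emeasurable_funM.
      by apply/measurable_EFinP; exact: measurable_powR.
    apply: (measurable_eherz_time s kappa (h := absJ v)); first exact: jmeas_absJ.
    by move=> r y; exact: absE_ge0.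
  exists M; apply: aeW => t tT; rewrite E//; have /andP[t0 _] := tT.
  apply: le_trans (lee_wpmul2l _ (vM t tT)) _; first by rewrite lee_fin powR_ge0.
  by rewrite subr0 -EFinM lee_fin mulrCA powRN mulfV ?mulr1// gt_eqF// powR_gt0.
move=> t tT; have /andP[t0 tT'] := tT.
have below r : 0 < r < t -> 0 <= r <= T.
  by move=> /andP[r0 rt]; rewrite (ltW r0) (le_trans (ltW rt)).
have mF := jmeas_henon mv.
have FE r : 0 < r < t -> {ae mu, forall x, F (u r) x = F (v r) x}.
  by move/below => rT; apply: filterS (uv r rT) => x uvx; rewrite /henon_term uvx.
have mFu r : 0 < r < t -> measurable_fun setT (F (u r)).
  by move/below => rT; apply: measurable_henon; exact: mut.
have tr0 r : 0 < r < t -> t - r != 0 by move=> /andP[_ rt]; rewrite subr_eq0 gt_eqF.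
have heatE' r x : 0 < r < t -> heat (t - r) (F (u r)) x = heat (t - r) (F (v r)) x.
  move=> rt; apply: heat_ae; [exact: tr0|exact: mFu| |exact: FE].
  exact: measurable_henon.
have h0 : {ae mu, forall x, heat_defined t phi x}.
  have [t00|t00] := eqVneq t 0; first by apply: nearW => x; rewrite /heat_defined t00 eqxx.
  have t0' : 0 < t by rewrite lt_neqAle eq_sym t00.
  apply: filterS (eheat_lty_ae t0' mphi phioo) => x hx _.
  exact: heat_integrable.
have := eduh_solution_ae vsol t0 tT' (lexx t).
apply: filterS3 h0 (filterI (uv t tT) (vE t tT)) => x h0x [uvx vx] ex.
have intv := duh_integrable (lexx t) mF ex.
split => //.
- have := eduh_ae (jmeas_absJ mF) (fun r y => absE_ge0 _ _) ex => ex'.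
  apply: (ae_time2 ex' ex') => r Hr _ rt _.
  apply: heat_integrable; first exact: mFu.
  apply: le_lt_trans (Hr rt); apply: le_eheat.
  + by apply: measurable_absE; exact: mFu.
  + by apply: measurable_absE; exact: measurable_henon.
  + exact: absE_ge0.
  + exact: absE_ge0.
  + by apply: filterS (FE r rt) => y Fy; rewrite /absJ /absE Fy.
- apply: eq_integrable intv => // r /set_mem; rewrite /= in_itv/= => rt.
  by rewrite heatE'.
rewrite uvx vx /duhamel_map subr0 duhE; congr (_ + _ * _).
apply: eq_Rintegral => r /set_mem; rewrite /= in_itv/= => rt.
by rewrite heatE'.
Qed.

Lemma mild_curve_measurable T phi u t : mild_curve T phi u -> 0 <= t <= T ->
  measurable_fun setT (u t).
Proof.
move=> [[+ _] _ _] tT => /(_ t); rewrite /= in_itv/= => /(_ tT).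
by move/(herz_spaceE n0 s _ q1) => [].
Qed.

(** Norm continuity provides the measurable version. Its weighted bound holds at almost every time,
    which is all that the time integral sees; the Duhamel formula then returns a bound at every
    time. *)
Lemma mild_curve_solution T phi u : 0 < T -> measurable_fun setT phi -> (NX phi < +oo)%E ->
  mild_curve T phi u -> exists v, solution 0 T phi v /\
    forall t, 0 <= t <= T -> {ae mu, forall x, u t x = v t x}.
Proof.
move=> T0 mphi phioo ucur; have mut t := mild_curve_measurable (t := t) ucur.
have [[uS uc] [_ [M uM]] uE] := ucur.
have cu t : 0 <= t <= T -> forall e, 0 < e -> exists2 eta, 0 < eta &
    forall z, 0 <= z <= T -> `|z - t| < eta ->
    (NX (fun x => (u z x - u t x)%R) <= e%:E)%E.
  move=> tT e e0; have tI : `[0, T]%classic t by rewrite /= in_itv.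
  have H : \forall z \near within `[0, T] (nbhs t),
      (herz_norm s q%:E 1%E (u z \- u t)%R <= e%:E)%E.
    move: (uc t tI) => /cvge0P; apply => // z.
    by rewrite herz_normE// eherz_ge0.
  move: H; rewrite near_withinE => /nbhs_ballP[eta /= eta0 Heta]; exists eta => // z zT zt.
  have zb : ball t eta z by rewrite /ball/= distrC.
  have zI : `[0, T]%classic z by rewrite /= in_itv.
  have H : (herz_norm s q%:E 1%E (u z \- u t)%R <= e%:E)%E := Heta z zb zI.
  by rewrite herz_normE in H.
have [v [mv vu]] := measurable_version n0 q1 mut cu.
have uv t : 0 <= t <= T -> {ae mu, forall x, u t x = v t x}.
  by move/vu; apply: filterS => x ->.
have mvt t : measurable_fun setT (v t) by exact: jmeas_at.
have vM : {ae leb, forall z, 0 < z <= T -> (NY (v z) <= (`|M| * (z - 0) `^ (- sigma))%:E)%E}.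
  apply: (ae_time2 uM uM) => z zM _ zT; have /andP[z0 zT'] := zT.
  have zT0 : 0 <= z <= T by rewrite ltW.
  have := zM zT; rewrite herz_normE// (eq_eherz_abs kappa0 (mut z zT0) (mvt z) (uv z zT0)) => H.
  rewrite subr0; apply: (@le_trans _ _ ((z `^ (- sigma))%:E * ((z `^ sigma)%:E * NY (v z)))%E).
    by rewrite muleA -EFinM -powRD_gt0// addNr powRr0 mul1e.
  rewrite mulrC EFinM; apply: lee_wpmul2l; first by rewrite lee_fin powR_ge0.
  by apply: le_trans H _; rewrite lee_fin ler_norm.
have vM' t : 0 < t <= T -> {ae leb, forall z, 0 < z < t ->
    (NY (v z) <= (`|M| * (z - 0) `^ (- sigma))%:E)%E}.
  move=> /andP[_ tT]; apply: (ae_time2 vM vM) => z Hz _ /andP[z0 zt].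
  by apply: Hz; rewrite z0 (le_trans (ltW zt)).
have vE t : 0 <= t <= T -> {ae mu, forall x, v t x = duhamel_map 0 phi v t x}.
  move=> tT; apply: filterS2 (vu t tT) (uE t tT) => x -> [_ _ _ ->].
  rewrite /duhamel_map subr0 duhE; congr (_ + _ * _).
  apply: eq_Rintegral => r /set_mem; rewrite /= in_itv/= => /andP[r0 rt].
  have rT : 0 <= r <= T by have /andP[_ tT'] := tT; rewrite (ltW r0) (le_trans (ltW rt)).
  apply: heat_ae.
  - by rewrite subr_eq0 gt_eqF.
  - by apply: measurable_henon; exact: mut.
  - exact: measurable_henon.
  - by apply: filterS (uv r rT) => y uvy; rewrite /henon_term uvy.
exists v; split => //; split => //.
have [A A0 HA] := duhamel_map_lipschitz kappa1 (ltW delta0) delta1 HY.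
pose m := fine (NX phi).
have mE : (NX phi <= m%:E)%E by rewrite fineK// ge0_fin_numE// eherz_ge0.
have m0 : 0 <= m by rewrite fine_ge0// eherz_ge0.
(* The nonlinear part, measured against the image of the zero curve, plus the free part. *)
exists (A * `|M| `^ beta * `|M| * T `^ theta + C * m).
  by rewrite addr_ge0 ?mulr_ge0 ?powR_ge0.
move=> t tT; have /andP[t0 tT'] := tT; have tT0 : 0 <= t <= T by rewrite ltW.
have mD w : jmeas w -> measurable_fun setT (duhamel_map 0 phi w t).
  by move=> mw; apply: jmeas_at; exact: jmeas_duhamel_map.
rewrite (eq_eherz_abs kappa0 (mvt t) (mD _ mv) (vE t tT0)).
apply: le_trans (eherz_abs_triangle kappa1 (mD _ mv) (mD _ jmeas_zero)) _.
rewrite mulrDl EFinD; apply: leeD.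
  apply: le_trans (HA 0 t phi v zero `|M| `|M| t0 _ _ mphi mv jmeas_zero (vM' t tT) _ _) _ => //.
  - by apply: (ae_time2 vM vM) => z _ _ zt; rewrite eherz_abs_zero// lee_fin mulr_ge0 ?powR_ge0.
  - have := vM' t tT => vMt; apply: (ae_time2 vMt vMt) => z Hz _ zt.
    by under [X in absE X]funext => x do rewrite subr0; exact: Hz.
  rewrite lee_fin subr0 (_ : 1 - delta - sigma * (beta + 1) = theta + - sigma); last by ring.
  rewrite powRD_gt0// mulrA; apply: ler_wpM2r; first exact: powR_ge0.
  apply: ler_wpM2l; first by rewrite !mulr_ge0 ?powR_ge0.
  by rewrite ge0_ler_powR ?nnegrE ?(ltW theta0) ?(ltW t0) ?(ltW T0).
rewrite (_ : duhamel_map 0 phi zero t = heat t phi); last first.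
  by apply/funext => x; rewrite duhamel_map_zero subr0.
by rewrite subr0; exact: NY_heat_le.
Qed.

(** * The maximal solution and blow-up *)

Lemma existence_time : exists Texist : R -> R, forall m, 0 <= m -> 0 < Texist m /\
  forall t0 phi, measurable_fun setT phi -> (NX phi <= m%:E)%E ->
  exists u, solution t0 (t0 + Texist m) phi u.
Proof.
have /choice[Texist H] : forall m, exists T, 0 <= m -> 0 < T /\
    forall t0 phi, measurable_fun setT phi -> (NX phi <= m%:E)%E ->
    exists u, solution t0 (t0 + T) phi u.
  move=> m; have [m0|m0] := leP 0 m; last by exists 0.
  by have [T T0 H] := local_existence m0; exists T.
by exists Texist.
Qed.

Section maximal_solution.
Variable Texist : R -> R.
Hypothesis Texist_gt0 : forall m, 0 <= m -> 0 < Texist m.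
Hypothesis TexistP : forall m, 0 <= m -> forall t0 phi, measurable_fun setT phi ->
  (NX phi <= m%:E)%E -> exists u, solution t0 (t0 + Texist m) phi u.
Variable phi : V -> R.
Hypotheses (mphi : measurable_fun setT phi) (phioo : (NX phi < +oo)%E).

(** The form in which the uniform existence time enters both [solution_longer] and the blow-up
    alternative. *)
Lemma solution_extend T1 u t1 m : solution 0 T1 phi u -> 0 <= t1 -> t1 < T1 -> 0 <= m ->
  (NX (u t1) <= m%:E)%E -> exists w, solution 0 (t1 + Texist m) phi w.
Proof.
move=> usol t10 t1T m0 um; have [T2|T2] := leP (t1 + Texist m) T1.
  by exists u; exact: solution_restrict usol.
have [mu_ _ _] := usol; have [w wsol] := TexistP m0 t1 (jmeas_at t1 mu_) um.
by eexists; apply: (solution_glue mphi phioo usol t10 t1T T2 wsol).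
Qed.

Lemma solution_longer T1 u : 0 < T1 -> solution 0 T1 phi u ->
  exists2 T2, T1 < T2 & exists w, solution 0 T2 phi w.
Proof.
move=> T10 usol; have [mu_ _ _] := usol.
have mut t : measurable_fun setT (u t) by exact: jmeas_at.
have T1T : 0 <= T1 <= T1 by rewrite lexx ltW.
have uoo := solution_NX_lty mphi phioo usol T1T.
have [eta eta0 Heta] := solution_continuous mphi phioo usol T1T ltr01.
(* The restart must take place strictly before [T1]; by continuity the norm there exceeds that at
   [T1] by at most 1. *)
set m := fine (NX (u T1)) + 1.
have mE : (NX (u T1))%E = (fine (NX (u T1)))%:E by rewrite fineK// ge0_fin_numE// eherz_ge0.
have m0 : 0 <= m by rewrite addr_ge0// fine_ge0// eherz_ge0.
have tau0 := Texist_gt0 m0.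
(* With these halves [T1 - d] is positive, within [eta] of [T1], and closer to [T1] than
   [Texist m]. *)
set d := Num.min (T1 / 2) (Num.min (eta / 2) (Texist m / 2)).
have d0 : 0 < d by rewrite !lt_min !divr_gt0.
have d1 : d <= T1 / 2 by rewrite ge_min lexx.
have d2 : d <= eta / 2 by rewrite !ge_min lexx orbT.
have d3 : d <= Texist m / 2 by rewrite !ge_min lexx !orbT.
have t1T : 0 <= T1 - d <= T1 by apply/andP; split; move: d1 d0; lra.
have um : (NX (u (T1 - d)%R) <= m%:E)%E.
  apply: le_trans (eherz_abs_triangle q1 (mut _) (mut T1)) _.
  rewrite mE /m EFinD [leLHS]addeC; apply: leeD => //; apply: Heta => //.
  by rewrite addrAC subrr add0r normrN gtr0_norm//; move: d2 eta0; lra.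
have t10 : 0 <= T1 - d by case/andP: t1T.
have t1T' : T1 - d < T1 by rewrite gtrBl.
have [w wsol] := solution_extend usol t10 t1T' m0 um.
by exists (T1 - d + Texist m); [move: d3 tau0; lra|exists w].
Qed.

(** [Tmax] is the supremum of the existence times and exceeds each of them by [solution_longer]. At
    each time [U] is a slice of some solution; by uniqueness different choices differ on a null set
    only. *)
Lemma maximal_solution : exists (Tmax : \bar R) (U : R -> V -> R),
  [/\ forall T u, 0 < T -> solution 0 T phi u -> (T%:E < Tmax)%E /\
        forall t, 0 <= t <= T -> {ae mu, forall x, U t x = u t x},
      forall T', 0 < T' -> (T'%:E < Tmax)%E -> mild_curve T' phi U,
      forall T' v, (0 < Tmax)%E -> (Tmax <= T'%:E)%E -> ~ mild_curve T' phi v &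
      (0 < Tmax)%E -> Tmax = +oo%E \/ exists2 Tm : R, Tmax = Tm%:E &
        herz_norm s q%:E 1%E (U t) @[t --> Tm^'-] --> +oo%E].
Proof.
pose E := [set T : R | 0 < T /\ exists u, solution 0 T phi u].
pose Tmax := ereal_sup (EFin @` E).
have lt_Tmax T u : 0 < T -> solution 0 T phi u -> (T%:E < Tmax)%E.
  move=> T0 usol; have [T2 T12 [w wsol]] := solution_longer T0 usol.
  apply: (@lt_le_trans _ _ T2%:E); first by rewrite lte_fin.
  apply: ereal_sup_ubound; exists T2 => //; split; last by exists w.
  exact: lt_trans T12.
have below t : (t%:E < Tmax)%E -> exists T, [/\ 0 < T, t < T & exists u, solution 0 T phi u].
  by move=> /ereal_sup_gt[_ [T [T0 Tu] <-]]; rewrite lte_fin => tT; exists T.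
have /choice[U HU] : forall t, exists f, (t%:E < Tmax)%E ->
    exists T u, [/\ 0 < T, t < T, solution 0 T phi u & f = u t].
  move=> t; have [tT|tT] := boolP (t%:E < Tmax)%E; last by exists phi.
  by have [T [T0 tT' [u usol]]] := below t tT; exists (u t) => _; exists T, u.
have agree T u t : 0 < T -> solution 0 T phi u -> 0 <= t <= T ->
    {ae mu, forall x, U t x = u t x}.
  move=> T0 usol /andP[t0 tT].
  have tmax : (t%:E < Tmax)%E.
    by apply: le_lt_trans (lt_Tmax T u T0 usol); rewrite lee_fin.
  have [T2 [w [T20 tT2 wsol ->]]] := HU t tmax.
  have tm : 0 <= t <= Num.min T T2 by rewrite t0 le_min tT ltW.
  apply: (solution_unique mphi (solution_restrict _ wsol) (solution_restrict _ usol) tm).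
    by rewrite ge_min lexx orbT.
  by rewrite ge_min lexx.
have Umild T' : 0 < T' -> (T'%:E < Tmax)%E -> mild_curve T' phi U.
  move=> T'0 T'm; have [T [T0 T'T [u usol]]] := below T' T'm.
  have usol' := solution_restrict (ltW T'T) usol.
  apply: (solution_mild_curve mphi phioo usol') => t tT.
    have tm : (t%:E < Tmax)%E.
      by apply: le_lt_trans T'm; rewrite lee_fin; case/andP: tT.
    have [T2 [w [_ _ [mw _ _] ->]]] := HU t tm; exact: jmeas_at.
  exact: agree usol' tT.
exists Tmax, U; split => //.
- by move=> T u T0 usol; split => [|t tT]; [exact: lt_Tmax usol|exact: agree usol tT].
- move=> T' v Tm0 TmT vcur.
  have T'0 : 0 < T' by rewrite -lte_fin; exact: lt_le_trans TmT.
  have [w [wsol _]] := mild_curve_solution T'0 mphi phioo vcur.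
  by have := lt_le_trans (lt_Tmax T' w T'0 wsol) TmT; rewrite ltxx.
move=> Tm0; have : Tmax != -oo%E by rewrite gt_eqF// (lt_trans _ Tm0)// ltNyr.
case TmE : Tmax => [Tm| |] // _; last by left.
(* If the norm were below [A] at a time closer to [Tm] than the existence time of [|A|], a restart
   there would lead past [Tm]. *)
right; exists Tm => //; apply/cvgeyPger => A _.
rewrite TmE lte_fin in Tm0.
have tau0 : 0 < Texist `|A| by exact: Texist_gt0.
near=> t; rewrite leNgt; apply/negP => UA.
have tTm : t < Tm by near: t; exact: nbhs_left_lt.
have t0 : 0 < t by near: t; exact: nbhs_left_gt.
have ttau : Tm - Texist `|A| < t by near: t; apply: nbhs_left_gt; rewrite gtrBl.
have tmax : (t%:E < Tmax)%E by rewrite TmE lte_fin.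
have [T [T0 tT [u usol]]] := below t tmax; have [mu_ _ _] := usol.
have tT0 : 0 <= t <= T by rewrite !ltW.
have mU : measurable_fun setT (U t).
  by have [T2 [w [_ _ [mw _ _] ->]]] := HU t tmax; exact: jmeas_at.
have uA : (NX (u t) <= `|A|%:E)%E.
  rewrite -(eq_eherz_abs q0 mU (jmeas_at t mu_) (agree T u t T0 usol tT0)).
  rewrite herz_normE// in UA; apply: le_trans (ltW UA) _.
  by rewrite lee_fin ler_norm.
have [w wsol] := solution_extend usol (ltW t0) tT (normr_ge0 A) uA.
have T20 : 0 < t + Texist `|A| by rewrite addr_gt0.
have := lt_Tmax _ w T20 wsol; rewrite TmE lte_fin; move: ttau; lra.
Unshelve. all: by end_near. Qed.

End maximal_solution.

End solutions.

(** * The exponents *)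

Section parameters.
Context {R : realType} {n : nat}.
Hypothesis n0 : (0 < n)%N.
Local Notation V := 'rV[R]_n.
Local Notation N := (n%:R : R).
Variables (beta gamma s q kappa sigma delta : R).
Hypotheses (beta0 : 0 < beta) (gamma0 : 0 <= gamma) (q1 : 1 <= q)
  (kappa_ge : q * (beta + 1) <= kappa).
Hypotheses (s_q : - (N / q) < s) (s_kappa : - (N / kappa) < s)
  (s_le : s <= N * (1 - q^-1)) (s_al : s <= s * (beta + 1) + gamma)
  (alE : s * (beta + 1) + gamma = N * (1 - (kappa / (beta + 1))^-1))
  (sigmaE : sigma = (N / q - N / kappa) / 2) (deltaE : delta = (N - N / kappa - s) / 2).

(** Four instances of [heat_herz]: from X to X, from X to Y, and for the nonlinearity from the
    endpoint weights to X and to Y. For the third, [eherz_hoelder] first lowers the integrability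
    from [p] to [q], moving the weight from one endpoint to the other. *)
Lemma smoothing_constants : exists2 C : R, 0 <= C &
  [/\ forall t (f : V -> \bar R), 0 < t -> measurable_fun setT f ->
        (forall x, 0 <= f x)%E -> (eherz s q (eheat t f) <= C%:E * eherz s q f)%E,
      forall t (f : V -> \bar R), 0 < t -> measurable_fun setT f ->
        (forall x, 0 <= f x)%E ->
        (eherz s kappa (eheat t f) <= (C * t `^ (- sigma))%:E * eherz s q f)%E,
      @nonlin_smoothing R n beta gamma s kappa C q (delta - sigma) &
      @nonlin_smoothing R n beta gamma s kappa C kappa delta].
Proof.
have b1 : 0 < beta + 1 by rewrite addr_gt0.
have q0 : 0 < q by exact: lt_le_trans q1.
have kappa1 : beta + 1 <= kappa.
  by apply: le_trans kappa_ge; rewrite ler_peMl// ltW.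
have qkappa : q <= kappa.
  by apply: le_trans kappa_ge; rewrite ler_peMr ?(ltW q0)// lerDr ltW.
have kappa0 : 0 < kappa by exact: lt_le_trans qkappa.
set p := kappa / (beta + 1); have qp : q <= p by rewrite ler_pdivlMr.
have p1 : 1 <= p by exact: le_trans qp.
have p0 : 0 < p by exact: lt_le_trans p1.
have pk : p <= kappa by rewrite ler_pdivrMr// ler_peMr ?(ltW kappa0)// lerDr ltW.
have [C1 C10 H1] := heat_herz n0 q1 (lexx q) s_q (lexx s) s_le.
have [C2 C20 H2] := heat_herz n0 q1 qkappa s_kappa (lexx s) s_le.
have [C3 C30 H3] := heat_herz n0 q1 (lexx q) s_q s_le (lexx _).
have sp : s <= N * (1 - p^-1) by rewrite -alE.
have [C4 C40 H4] := heat_herz n0 p1 pk s_kappa sp (lexx _).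
(* The constant [c3] includes the loss of [eherz_hoelder], and [c] is the Lipschitz constant of
   [eherz_henon_diff]. *)
set c3 := C3 * 2 `^ (N * (q^-1 - p^-1)); set c := 2 * (beta + 1) * 2 `^ gamma.
have c30 : 0 <= c3 by rewrite mulr_ge0 ?powR_ge0// ltW.
have c0 : 0 <= c by rewrite !mulr_ge0 ?powR_ge0// ltW.
have nonlin (r e C' C : R) : 0 <= C' -> C' * c <= C ->
    (forall t (f : V -> R), 0 < t -> measurable_fun setT f ->
     (eherz s r (eheat t (absE f)) <=
      (C' * t `^ (- e))%:E * eherz (s * (beta + 1) + gamma) p (absE f))%E) ->
    @nonlin_smoothing R n beta gamma s kappa C r e.
  move=> C'0 CC H t f g M t0 M0 mf mg fM gM.
  have md : measurable_fun setT (fun x => henon_term gamma beta f x - henon_term gamma beta g x).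
    by apply: measurable_funB; exact: measurable_henon_weight.
  apply: le_trans (H t _ t0 md) _.
  have h := @eherz_henon_diff _ _ beta gamma kappa s beta0 gamma0 kappa1 f g M M0 mf mg fM gM.
  apply: le_trans (lee_wpmul2l _ h) _; first by rewrite lee_fin mulr_ge0 ?powR_ge0.
  rewrite muleA -EFinM; apply: lee_wpmul2r; first exact: eherz_ge0.
  rewrite lee_fin (_ : C' * t `^ (- e) * _ = C' * c * (M `^ beta * t `^ (- e))); last first.
    by rewrite /c; ring.
  by rewrite -[leRHS]mulrA; apply: ler_wpM2r => //; rewrite mulr_ge0 ?powR_ge0.
have k3 : 0 <= c3 * c by rewrite mulr_ge0.
have k4 : 0 <= C4 * c by rewrite mulr_ge0// ltW.
exists (C1 + C2 + c3 * c + C4 * c); first by rewrite !addr_ge0// ltW.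
split.
- move=> t f t0 mf f0; apply: le_trans (H1 t f t0 mf f0) _.
  apply: lee_wpmul2r; first exact: eherz_ge0.
  rewrite lee_fin (_ : (N / q - N / q + s - s) / 2 = 0); last by ring.
  by rewrite oppr0 powRr0 mulr1; move: C20 k3 k4; lra.
- move=> t f t0 mf f0; apply: le_trans (H2 t f t0 mf f0) _.
  apply: lee_wpmul2r; first exact: eherz_ge0.
  rewrite lee_fin (_ : (N / q - N / kappa + s - s) / 2 = sigma); last first.
    by rewrite sigmaE; ring.
  by apply: ler_wpM2r; [exact: powR_ge0|move: C10 k3 k4; lra].
- apply: (@nonlin q (delta - sigma) c3) => //; first by move: C10 C20 k4; lra.
  move=> t f t0 mf; have maf := measurable_absE mf.
  apply: le_trans (H3 t _ t0 maf (absE_ge0 f)) _.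
  have h := eherz_hoelder q1 qp mf.
  apply: le_trans (lee_wpmul2l _ h) _.
    by rewrite lee_fin mulr_ge0 ?powR_ge0// ltW.
  rewrite muleA -EFinM alE -/p; apply: lee_wpmul2r; first exact: eherz_ge0.
  rewrite lee_fin (_ : (N / q - N / q + N * (1 - q^-1) - s) / 2 = delta - sigma); last first.
    by rewrite deltaE sigmaE; field; rewrite !gt_eqF.
  by rewrite /c3 le_eqVlt; apply/orP; left; apply/eqP; ring.
- apply: (@nonlin kappa delta C4); [exact: ltW|by move: C10 C20 k3; lra|].
  move=> t f t0 mf; have maf := measurable_absE mf.
  apply: le_trans (H4 t _ t0 maf (absE_ge0 f)) _.
  rewrite alE -/p; apply: lee_wpmul2r; first exact: eherz_ge0.
  rewrite lee_fin (_ : (N / p - N / kappa + N * (1 - p^-1) - s) / 2 = delta)//.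
  by rewrite deltaE; field; rewrite !gt_eqF.
Qed.

End parameters.

(** * Verification of the conditions on the exponents *)

Section exponents.
Context {R : realType}.
Variables (N q beta gamma kappa : R).
Hypotheses (N1 : 1 <= N) (q_gt1 : 1 < q) (beta_gt0 : 0 < beta)
  (gamma_bounds : 0 < gamma < Num.min (Num.min 2 N) (N - (N - 2) * (beta + 1)))
  (kappa_ge : q * (beta + 1) <= kappa)
  (kappa_lower :
    Num.max
      (Num.max ((N - gamma) / (N * (beta + 1)) + 1 / q - 1)
        ((N - gamma) / (N * (beta + 1)) + 1 / q + (gamma - 2) / (N * beta)))
      (1 / q - 2 / (N * (beta + 1)))
    < 1 / kappa)
  (kappa_upper :
    1 / kappa <
    Num.min ((N - gamma) / (N * (beta + 1)) + 1 / q)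
      (1 / beta - (N - gamma) / (N * beta * (beta + 1)))).

Let s := (N - gamma) / (beta + 1) - N / kappa.
Let sigma := N / (2 * q) - N / (2 * kappa).
Let delta := (N * beta + gamma) / (2 * (beta + 1)).

(** Each inequality is a positive multiple of an assumption. The upper bounds on [1/kappa] give
    [- N/q < s] and [s <= s (beta + 1) + gamma]. The first lower bound gives both [s < N (1 - 1/q)]
    and [sigma < delta], the second [delta + sigma beta < 1], the third [sigma (beta + 1) < 1]. The
    bounds on [gamma] give [- N/kappa < s] and [delta < 1], and [0 < sigma] is [q < kappa]. *)
Lemma herz_exponents :
  [/\ [/\ - (N / q) < s, - (N / kappa) < s, s < N * (1 - q^-1),
          s <= s * (beta + 1) + gamma &
          s * (beta + 1) + gamma = N * (1 - (kappa / (beta + 1))^-1)],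
      [/\ sigma = (N / q - N / kappa) / 2 & delta = (N - N / kappa - s) / 2] &
      [/\ 0 < sigma, sigma < delta, delta < 1, sigma * (beta + 1) < 1 &
          0 < 1 - delta - sigma * beta]].
Proof.
have N0 : 0 < N by exact: lt_le_trans N1.
have q0 : 0 < q by exact: lt_trans q_gt1.
have b1 : 0 < beta + 1 by rewrite addr_gt0.
have qk : q < kappa by apply: lt_le_trans kappa_ge; rewrite ltr_pMr// ltrDr.
have k0 : 0 < kappa by exact: lt_trans qk.
have N_neq0 : N != 0 by rewrite gt_eqF.
have q_neq0 : q != 0 by rewrite gt_eqF.
have b_neq0 : beta != 0 by rewrite gt_eqF.
have b1_neq0 : beta + 1 != 0 by rewrite gt_eqF.
have k_neq0 : kappa != 0 by rewrite gt_eqF.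
move: gamma_bounds; rewrite !lt_min => /andP[g0 /andP[/andP[g2 gN] gb]].
move: kappa_lower; rewrite !gt_max => /andP[/andP[L1 L2] L3].
move: kappa_upper; rewrite lt_min => /andP[U1 U2].
have sE : s * (beta + 1) + gamma = N - N * (beta + 1) / kappa.
  by rewrite /s; field; rewrite b1_neq0 k_neq0.
split.
- split.
  + rewrite -subr_gt0 (_ : s - - (N / q) = N * ((N - gamma) / (N * (beta + 1)) + 1 / q - 1 / kappa)).
      by rewrite mulr_gt0// subr_gt0.
    by rewrite /s; field; rewrite N_neq0 q_neq0 b1_neq0 k_neq0.
  + by rewrite /s ltrDr divr_gt0// subr_gt0.
  + rewrite -subr_gt0 (_ : N * (1 - q^-1) - s =
      N * (1 / kappa - ((N - gamma) / (N * (beta + 1)) + 1 / q - 1))).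
      by rewrite mulr_gt0// subr_gt0.
    by rewrite /s; field; rewrite N_neq0 q_neq0 b1_neq0 k_neq0.
  + rewrite -subr_ge0 (_ : s * (beta + 1) + gamma - s =
      N * beta * (1 / beta - (N - gamma) / (N * beta * (beta + 1)) - 1 / kappa)).
      by rewrite !mulr_ge0 ?(ltW N0) ?(ltW beta_gt0)// subr_ge0 ltW.
    by rewrite /s; field; rewrite N_neq0 b_neq0 b1_neq0 k_neq0.
  + by rewrite sE; field; rewrite k_neq0 b1_neq0.
- split; rewrite /sigma /delta /s; field; rewrite ?q_neq0 ?k_neq0 ?b1_neq0//.
split.
- rewrite /sigma subr_gt0 ltr_pM2l// ltf_pV2 ?posrE ?mulr_gt0//.
  by rewrite ltr_pM2l.
- rewrite -subr_gt0 (_ : delta - sigma =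
    N / 2 * (1 / kappa - ((N - gamma) / (N * (beta + 1)) + 1 / q - 1))).
    by rewrite mulr_gt0 ?divr_gt0// subr_gt0.
  by rewrite /delta /sigma; field; rewrite N_neq0 q_neq0 b1_neq0 k_neq0.
- rewrite /delta ltr_pdivrMr ?mulr_gt0// mul1r -subr_gt0.
  by rewrite (_ : _ - _ = N - (N - 2) * (beta + 1) - gamma) ?subr_gt0//; ring.
- rewrite -subr_gt0 (_ : 1 - sigma * (beta + 1) =
    N * (beta + 1) / 2 * (1 / kappa - (1 / q - 2 / (N * (beta + 1))))).
    by rewrite mulr_gt0 ?subr_gt0// divr_gt0// mulr_gt0.
  by rewrite /sigma; field; rewrite N_neq0 q_neq0 b1_neq0 k_neq0.
- rewrite (_ : 1 - delta - sigma * beta = N * beta / 2 * (1 / kappa -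
    ((N - gamma) / (N * (beta + 1)) + 1 / q + (gamma - 2) / (N * beta)))).
    by rewrite mulr_gt0 ?subr_gt0// divr_gt0// mulr_gt0.
  by rewrite /delta /sigma; field; rewrite N_neq0 q_neq0 b_neq0 b1_neq0 k_neq0.
Qed.

End exponents.

Theorem theorem3p23 (R : realType) (a : R) (n : nat) (q r beta gamma kappa : R)
    (n_ge1 : (1 <= n)%N) (q_gt1 : 1 < q) (r_ge1 : 1 <= r) (beta_gt0 : 0 < beta)
    (gamma_bounds : 0 < gamma <
      Num.min (Num.min 2 n%:R) (n%:R - (n%:R - 2) * (beta + 1)))
    (kappa_ge : q * (beta + 1) <= kappa)
    (kappa_lower :
      Num.max
        (Num.max ((n%:R - gamma) / (n%:R * (beta + 1)) + 1 / q - 1)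
          ((n%:R - gamma) / (n%:R * (beta + 1)) + 1 / q
            + (gamma - 2) / (n%:R * beta)))
        (1 / q - 2 / (n%:R * (beta + 1)))
      < 1 / kappa)
    (kappa_upper :
      1 / kappa <
      Num.min ((n%:R - gamma) / (n%:R * (beta + 1)) + 1 / q)
        (1 / beta - (n%:R - gamma) / (n%:R * beta * (beta + 1)))) :
  let s := (n%:R - gamma) / (beta + 1) - n%:R / kappa in
  (* the existence time, as a function of the norm of the initial datum *)
  exists2 Texist : R -> R, forall M, 0 <= M -> 0 < Texist M &
  forall u0 : 'rV[R]_n -> R, herz_space s q%:E 1%E u0 ->
  let T := Texist (fine (herz_norm s q%:E 1%E u0)) in
  exists u : R -> 'rV[R]_n -> R,
    [/\ mild_solution a gamma beta q kappa u0 T u,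
        forall v, mild_solution a gamma beta q kappa u0 T v ->
          forall t, 0 <= t <= T -> v t = u t %[ae lebesgue_rV n] &
        exists (Tmax : \bar R) (U : R -> 'rV[R]_n -> R),
          [/\ (T%:E < Tmax)%E,
              forall t, 0 <= t <= T -> U t = u t %[ae lebesgue_rV n],
              forall T', 0 < T' -> (T'%:E < Tmax)%E ->
                mild_solution a gamma beta q kappa u0 T' U,
              ~ (exists T' v, [/\ (Tmax <= T'%:E)%E,
                   mild_solution a gamma beta q kappa u0 T' v &
                   forall t, 0 <= t -> (t%:E < Tmax)%E ->
                     v t = U t %[ae lebesgue_rV n]]) &
              Tmax = +oo%E \/
              exists2 Tm : R, Tmax = Tm%:E &
                herz_norm s q%:E 1%E (U t) @[t --> Tm^'-] --> +oo%E]].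
Proof.
move=> s.
have n0 : (0 < n)%N by [].
have N1 : 1 <= n%:R :> R by rewrite ler1n.
have q1 := ltW q_gt1.
have [[s1 s2 s3 s4 s5] [sigmaE deltaE] [c1 c2 c3 c4 c5]] :=
  herz_exponents N1 q_gt1 beta_gt0 gamma_bounds kappa_ge kappa_lower kappa_upper.
have gamma0 : 0 <= gamma by case/andP: gamma_bounds => /ltW.
have [C C0 [HXX HXY HX HY]] := smoothing_constants n0 beta_gt0 gamma0 q1 kappa_ge
  s1 s2 (ltW s3) s4 s5 sigmaE deltaE.
have kappa1 : 1 <= kappa.
  apply: le_trans kappa_ge; apply: (le_trans q1).
  by rewrite ler_peMr ?(le_trans ler01)// lerDr ltW.
have strong (f : 'rV[R]_n -> R) mf foo := herz_heat_continuous n0 q1 s1 s3 (f := f) mf foo.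
(* The existence time is fixed before any datum is introduced, as a function of a bound on the
   norm. *)
have [Texist HT] := existence_time n0 a beta_gt0 kappa1 C0 c1 c2 c3 c4 c5 HXY HY.
have q0 : 0 < q by exact: lt_trans q_gt1.
exists Texist => [M M0|phi]; first by have [] := HT M M0.
rewrite (herz_spaceE n0 _ _ q1) (herz_normE _ _ q0) => -[mphi phioo] T.
set m := fine _ in T *.
have phi_ge0 : (0 <= eherz s q (absE phi))%E by exact: eherz_ge0.
have m0 : 0 <= m by exact: fine_ge0.
have phiE : eherz s q (absE phi) = m%:E by rewrite fineK// ge0_fin_numE.
have [T0 HTm] := HT m m0.
have [|u] := HTm 0 phi mphi; first by rewrite phiE.
rewrite add0r -/T => solu.
exists u; split.
- apply: (solution_mild_curve n0 beta_gt0 q1 kappa1 C0 c1 c2 c3 c4 c5 HXX HX strong mphi phioo solu) => t tT.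
    by case: solu => mu_ _ _; exact: (jmeas_at t mu_).
  by apply: aeW.
- move=> v mv t tT.
  have [w [solw vw]] := mild_curve_solution n0 beta_gt0 q1 kappa1 C0 c1 c2 c3 c4 c5
    HXY HY T0 mphi phioo mv.
  have wu := solution_unique n0 beta_gt0 kappa1 C0 c1 c2 c3 c4 c5 HY mphi solw solu tT.
  by apply: filterS2 (vw t tT) wu => x -> -> _.
have HT1 M (M0 : 0 <= M) : 0 < Texist M by have [] := HT M M0.
have HT2 M (M0 : 0 <= M) := (HT M M0).2.
have [Tmax [U [U1 U2 U3 U4]]] := maximal_solution n0 beta_gt0 q1 kappa1 C0 c1 c2 c3 c4 c5
  HXX HXY HX HY strong HT1 HT2 mphi phioo.
have [TTmax Uu] := U1 T u T0 solu.
have Tmax0 : (0 < Tmax)%E by apply: lt_trans TTmax; rewrite lte_fin.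
exists Tmax, U; split => //.
- by move=> t /Uu; apply: filterS => x -> _.
- by move=> [T' [v [/(U3 _ v Tmax0)]]].
- exact: U4.
Qed.
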